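(* Let $N\ge 1$ be an integer and let $f$ be a newform for $\Gamma_1(N)$ which is either a holomorphic cusp form of weight $k\ge 1$, or a Maass cusp form of weight $k\in\{0,1\}$ with Laplace eigenvalue $\lambda$. Let $\chi$ be the nebentypus character of $f$ and let $M$ be the conductor of $\chi$ (so $M\mid N$). Write $N=\prod_p p^{n_p}$ and $M=\prod_p p^{m_p}$. Then for every $\varepsilon>0$, $$\frac{\|f\|_\infty}{\|f\|_2} \gg_{\lambda/k,\varepsilon} N^{-\varepsilon}\prod_{p}\max\left(p^{\frac12 \lfloor \frac{3m_p}{2} \rfloor - \frac{n_p}2},\, 1\right).$$ In particular, if $M$ is a perfect square and $N^2$ divides $M^3$, then $$\frac{\|f\|_\infty}{\|f\|_2} \gg_{\lambda/k, \varepsilon} N^{-\varepsilon} \frac{M^{3/4}}{N^{1/2}}.$$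
   Context: For $z=x+iy$ in the upper half-plane $\mathbb H$, put $F(z)=y^{k/2}|f(z)|$; this is a $\Gamma_0(N)$-invariant function. Define $\|f\|_\infty=\sup_{z\in\Gamma_0(N)\backslash\mathbb H}F(z)$ and $\|f\|_2=\left(\operatorname{vol}(\Gamma_0(N)\backslash\mathbb H)^{-1}\int_{\Gamma_0(N)\backslash \mathbb H}F(z)^2\,dz\right)^{1/2}$, with $dz$ the invariant hyperbolic measure. The subscript $\lambda/k$ means the implied constant depends only on $\lambda$ (in the Maass case) or on $k$ (in the holomorphic case), together with $\varepsilon$. *)

(* Defs.v *)
From HB Require Import structures.
From mathcomp Require Import all_boot all_order all_algebra.
From mathcomp Require Import all_classical all_reals all_analysis.
From mathcomp Require Import complex.

Set Implicit Arguments.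
Unset Strict Implicit.
Unset Printing Implicit Defensive.
Import Order.TTheory GRing.Theory Num.Theory.
Import numFieldNormedType.Exports.
Local Open Scope classical_set_scope.
Local Open Scope ring_scope.
Local Open Scope complex_scope.
Local Notation Re := complex.Re.
Local Notation Im := complex.Im.
Local Notation normc := Normc.normc.

Section Characters.
Context {R : realType}.
Implicit Types (chi : int -> R[i]) (N M : nat).

Definition dirichlet_char N chi :=
  [/\ forall a, chi (a + N%:Z) = chi a,
      forall a b, chi (a * b) = chi a * chi b
    & forall a, (chi a != 0) = coprimez a N%:Z].

Definition factors_through N chi M :=
  forall a b : int, coprimez a N%:Z -> coprimez b N%:Z ->
    (a = b %[mod M%:Z])%Z -> chi a = chi b.

Definition is_conductor N chi M :=
  [/\ (M %| N)%N, factors_through N chi M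
    & forall M', (M' %| N)%N -> factors_through N chi M' -> (M <= M')%N].

End Characters.

Section Groups.

Definition SL2Z : set 'M[int]_2 := [set g | \det g = 1].

Definition Gamma0 (N : nat) : set 'M[int]_2 :=
  [set g | SL2Z g /\ (N%:Z %| g 1%R 0%R)%Z].

Definition Gamma1 (N : nat) : set 'M[int]_2 :=
  [set g | [/\ SL2Z g, (N%:Z %| g 1%R 0%R)%Z,
               (g 0%R 0%R = 1 %[mod N%:Z])%Z & (g 1%R 1%R = 1 %[mod N%:Z])%Z]].

End Groups.

Section UpperHalfPlane.
Context {R : realType}.
Implicit Types (z : R[i]) (g : 'M[int]_2) (f : R[i] -> R[i]) (k : nat).

Definition uhp : set R[i] := [set z | 0 < Im z].

Definition autj g z : R[i] := (g 1 0)%:~R * z + (g 1 1)%:~R.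

Definition moebius g z : R[i] := ((g 0 0)%:~R * z + (g 0 1)%:~R) / autj g z.

Definition slash k g f z : R[i] := autj g z ^- k * f (moebius g z).

(* A strict fundamental domain (exactly one point of each orbit) for a subgroup
   G of SL_2(Z) of finite index containing z |-> z + 1: the representative has
   maximal imaginary part in its orbit and, among the orbit points of that
   height, the least nonnegative real part.  *)
Definition fund_dom (G : set 'M[int]_2) : set R[i] :=
  [set z | [/\ uhp z, 0 <= Re z &
     forall g, G g -> Im (moebius g z) <= Im z /\
       (Im (moebius g z) = Im z -> 0 <= Re (moebius g z) ->
          Re z <= Re (moebius g z))]].

(* Integral over G\H, against dx dy / y^2, of a G-invariant function. *)
Definition quot_int (G : set 'M[int]_2) (h : R[i] -> R) : R :=
  \int[(@lebesgue_measure R \x @lebesgue_measure R)%E]_(p in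
      [set p : R * R | fund_dom G (p.1 +i* p.2)])
    (h (p.1 +i* p.2) / p.2 ^+ 2).

Definition quot_vol (G : set 'M[int]_2) : R := quot_int G (fun=> 1).

Definition height k f z : R := Im z `^ (k%:R / 2) * normc (f z).

Definition sup_norm k f : R := sup [set height k f z | z in uhp].

Definition l2_norm N k f : R :=
  Num.sqrt ((quot_vol (Gamma0 N))^-1 *
            quot_int (Gamma0 N) (fun z => height k f z ^+ 2)).

Definition petersson N k f1 f2 : R[i] :=
  let h z := (Im z ^+ k)%:C * (f1 z * ((f2 z)^*)%C) in
  quot_int (Gamma1 N) (fun z => Re (h z)) +i*
  quot_int (Gamma1 N) (fun z => Im (h z)).

Definition weakly_modular N k f :=
  forall g z, Gamma1 N g -> uhp z -> f (moebius g z) = autj g z ^+ k * f z.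

(* Differentiability is over the field R[i], i.e. complex differentiability. *)
Definition holomorphic_uhp f :=
  forall z, uhp z -> derivable (f : R[i]^o -> R[i]^o) z 1.

Definition vanishes_at_cusps k f :=
  forall g, SL2Z g -> forall e : R, 0 < e ->
    exists Y : R, forall z, uhp z -> Y < Im z -> normc (slash k g f z) < e.

Definition hol_cusp_form k N f :=
  [/\ holomorphic_uhp f, weakly_modular N k f & vanishes_at_cusps k f].

Definition plane_fun f (p : R * R) : R[i] := f (p.1 +i* p.2).

Definition partial (v : R * R) (u : R * R -> R[i]) (p : R * R) : R[i] :=
  ('D_v (fun q => Re (u q)) p) +i* ('D_v (fun q => Im (u q)) p).

Definition partialx := partial (1, 0).
Definition partialy := partial (0, 1).

Fixpoint Cn_uhp (n : nat) (u : R * R -> R[i]) : Prop :=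
  (forall p, 0 < p.2 -> {for p, continuous (fun q => Re (u q))} /\
                        {for p, continuous (fun q => Im (u q))}) /\
  (if n is n'.+1 then
     [/\ forall p v, 0 < p.2 -> derivable (fun q => Re (u q)) p v /\
                                derivable (fun q => Im (u q)) p v,
         Cn_uhp n' (partialx u) & Cn_uhp n' (partialy u)]
   else True).

Definition smooth_uhp u := forall n, Cn_uhp n u.

Definition laplacian k (u : R * R -> R[i]) (p : R * R) : R[i] :=
  (p.2 ^+ 2)%:C * (partialx (partialx u) p + partialy (partialy u) p)
  - ('i)%C * (k%:R * p.2)%:C * partialx u p.

Definition moderate_growth k f :=
  forall g, SL2Z g -> exists (C : R) (A : nat), forall z, 1 <= Im z ->
    normc (slash k g f z) <= C * Im z ^+ A.

(* The width of every cusp of Gamma_1(N) divides N, so the constant term may be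
   computed by integrating over a segment of length N. *)
Definition cuspidal N k f :=
  forall g, SL2Z g -> forall y : R, 0 < y ->
    \int[lebesgue_measure]_(x in `[0, N%:R]) Re (slash k g f (x +i* y)) = 0 /\
    \int[lebesgue_measure]_(x in `[0, N%:R]) Im (slash k g f (x +i* y)) = 0.

(* Maass forms are normalized so that, as for holomorphic forms, the automorphy
   factor is (cz+d)^k and y^(k/2) |f| is invariant; the usual normalization with
   factor ((cz+d)/|cz+d|)^k, on which the Laplacian acts, is y^(k/2) f. *)
Definition maass_cusp_form (lambda : R) k N f :=
  let u := plane_fun (fun z => (Im z `^ (k%:R / 2))%:C * f z) in
  [/\ smooth_uhp u,
      forall p, 0 < p.2 -> laplacian k u p + lambda%:C * u p = 0,
      weakly_modular N k f, moderate_growth k f & cuspidal N k f].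

Definition nebentypus N k (chi : int -> R[i]) f :=
  forall g z, Gamma0 N g -> uhp z ->
    f (moebius g z) = chi (g 1 1) * autj g z ^+ k * f z.

(* T_n f (z) = n^(k-1) sum_(a d = n) chi(a) d^-k sum_(b mod d) f((a z + b)/d) *)
Definition hecke k (chi : int -> R[i]) n f z : R[i] :=
  n%:R ^+ k / n%:R *
  \sum_(d <- divisors n) (chi (n %/ d)%N%:Z / d%:R ^+ k *
     \sum_(b < d) f (((n %/ d)%N%:R * z + b%:R) / d%:R)).

(* Only n prime to the level: together with orthogonality to the oldforms this
   already pins down a newform up to a scalar. *)
Definition hecke_eigenform N k chi f :=
  forall n, (0 < n)%N -> coprime n N ->
    exists a : R[i], forall z, uhp z -> hecke k chi n f z = a * f z.

(* [cusp_form N] is the space of cusp forms for Gamma_1(N). *)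
Definition orthogonal_to_oldforms (cusp_form : nat -> (R[i] -> R[i]) -> Prop)
    N k f :=
  forall (N' d : nat) (h : R[i] -> R[i]),
    (N' < N)%N -> (d * N' %| N)%N -> cusp_form N' h ->
    petersson N k f (fun z => h (d%:R * z)) = 0.

(* No normalization of the first Fourier coefficient is imposed. *)
Definition newform (cusp_form : nat -> (R[i] -> R[i]) -> Prop)
    N k (chi : int -> R[i]) f :=
  [/\ cusp_form N f, exists2 z, uhp z & f z != 0,
      dirichlet_char N chi /\ nebentypus N k chi f,
      orthogonal_to_oldforms cusp_form N k f
    & hecke_eigenform N k chi f].

Definition hol_newform k := newform (hol_cusp_form k) ^~ k.
Definition maass_newform lambda k := newform (maass_cusp_form lambda k) ^~ k.

End UpperHalfPlane.

Definition local_product (R : realType) (N M : nat) : R :=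
  \prod_(p <- primes N)
    Num.max (p%:R `^ ((3 * logn p M)./2%:R / 2 - (logn p N)%:R / 2)) 1.

(* Main.v *)
(** Let c be the product of the p^ceil(n_p/2) and q = M / gcd(M, c); the product over
    p in the theorem, and M^(3/4)/N^(1/2) in the special case, are at most q^(1/2).
    The forms f_b = f|(1 0; bc 1), b mod N/c, satisfy f_b(z+1) = psi(b) f_b(z) for an
    additive character psi of Z/(N/c) whose kernel has index at least q, so a given
    frequency occurs in at most N/(cq) of the f_b, and the sum over b of the squares
    of the corresponding Fourier coefficients is at most N/(cq) times the square of
    the sup norm.  The Hecke relations at integers n prime to N tie the frequency nd
    to d; iterating Hoelder's inequality along the multiplicativity of the Hecke
    eigenvalues, this bound survives, up to N^eps, for the sum over all frequencies:
    the integral of the sum of the F_b^2 over 0 <= x <= 1, y >= Y is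
    << N^eps (N/(cq)) sup^2 / Y for every Y >= N^-A.  Conversely, counting pairs
    (u, w) with c | u, (w, N) = 1 and |uz + w|^2 <= Im z / Y shows that the
    Gamma0(c)-translates of almost all of a fundamental domain of Gamma0(N) cover such
    strips about phi(N)/(NcY) times, so that the same integral is
    >> phi(N)/(NcY) times the integral of F^2 over the domain, whose volume is >> N.
    Comparing the two gives sup^2 >> q N^-eps (L2-norm)^2.
    Only the Hecke eigenvalue equation at integers prime to N, the nebentypus and the
    exponential decay at the cusps are used; the latter comes, in the holomorphic and in
    the Maass case, from an ODE for the Fourier coefficients in y. *)
Require Import Defs.
From HB Require Import structures.
From mathcomp Require Import all_boot all_order all_algebra.
From mathcomp Require Import all_classical all_reals all_analysis.
From mathcomp Require Import measurable_realfun complex.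
From mathcomp Require Import ring lra zify.
From mathcomp Require cyclic.

Set Implicit Arguments.
Unset Strict Implicit.
Unset Printing Implicit Defensive.
Import Order.TTheory GRing.Theory Num.Theory.
Import numFieldNormedType.Exports.
Local Open Scope classical_set_scope.
Local Open Scope ring_scope.
Local Open Scope complex_scope.
Local Notation Re := complex.Re.
Local Notation Im := complex.Im.
Local Notation normc := Normc.normc.
Local Notation mfunT := (measurable_fun setT).
Local Notation plane R := (measurableTypeR R * measurableTypeR R)%type.

(** At a single frequency the mass is smaller by the factor q than Bessel's inequality says, but
    there are many frequencies and no pointwise bound on the Hecke eigenvalues is at hand. The way
    out: the Hecke weights satisfy (sum up to X)^(2^s) << X^eps (sum up to X^(2^s)). Bessel's
    inequality bounds the long sum, with a loss of q that becomes q^(1/2^s), hence N^eps, after the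
    2^s-th root. The Hecke relations do not reach the part of a frequency composed of primes of N,
    but up to a power of N there are only N^eps such parts. The number c is the least one with N |
    c^2. This makes b -> 1 + bc multiplicative modulo N, so that psi is additive, and with T = (1 1;
    0 1) it puts (1 0; bc 1) T (1 0; -bc 1) into Gamma0(N). The count of translates needs 16 N^2 Y
    <= Im z <= 1 / (4 c^2 Y). On the fundamental domain this holds for Y a large negative power of
    N, unless some SL2(Z)-translate of z is higher than N^4. That cuspidal rest has volume O(1), and
    there F is bounded by its supremum. Fixed powers of N are harmless in Y and in the number of
    frequencies, since these enter the final bound only through N^eps. *)

Lemma eq_ler d (T : porderType d) (x y : T) : x = y -> (x <= y)%O.
Proof. by move=> ->. Qed.

(** * The hyperbolic measure *)

Section OneDim.
Context {R : realType}.
Local Notation mu := (@lebesgue_measure R).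
Implicit Types h : R -> \bar R.
Local Open Scope ereal_scope.

Section Affine.
Variables (phi : R -> R).
Hypothesis mphi : measurable_fun (setT : set (measurableTypeR R)) (phi : _ -> measurableTypeR R).
Variable c : {nonneg R}.
Hypothesis phiE : forall a b : R,
  mu `]a, b] = c%:num%:E * mu (phi @^-1` `]a, b]%classic).

(** Lebesgue measure is determined by its values on half-open intervals, so the substitution only
    has to be checked on those. *)
Lemma integral_affine h : mfunT h ->
  (forall x, 0 <= h x) -> c%:num%:E * \int[mu]_x h (phi x) = \int[mu]_x h x.
Proof.
move=> mh h0.
have <- : \int[pushforward mu (phi : _ -> measurableTypeR R)]_y h y = \int[mu]_x h (phi x).
  by apply: (ge0_integral_pushforward mphi _ measurableT mh) => x _.
rewrite -ge0_integral_mscale//.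
apply: eq_measure_integral => A mA _; apply/esym.
by apply: lebesgue_measure_unique mA => _ [[a b] _ <-] /=; exact: phiE.
Qed.
End Affine.

Lemma integral_translate h (c : R) : mfunT h ->
  (forall x, 0 <= h x) -> \int[mu]_x h (x + c)%R = \int[mu]_x h x.
Proof.
move=> mh h0; rewrite -[RHS](@integral_affine (fun x => x + c)%R _ (NngNum (@ler01 R))) ?mul1e//.
- exact: measurable_funD.
- move=> a b; rewrite mul1e.
  rewrite (_ : _ @^-1` _ = `](a - c)%R, (b - c)%R]%classic); last first.
    by apply/seteqP; split => x /=; rewrite !in_itv/= => /andP[? ?]; apply/andP; split; lra.
  rewrite !lebesgue_measure_itv/= !lte_fin ltrD2r; case: ifPn => // _.
  by rewrite -!EFinD; congr EFin; lra.
Qed.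

Lemma integral_scale h (c : R) : (0 < c)%R -> mfunT h ->
  (forall x, 0 <= h x) -> c%:E * \int[mu]_x h (c * x)%R = \int[mu]_x h x.
Proof.
move=> c0 mh h0; rewrite -[RHS](@integral_affine (fun x => c * x)%R _ (NngNum (ltW c0)))//.
- exact: measurable_funM.
- move=> a b /=.
  rewrite (_ : _ @^-1` _ = `](a / c)%R, (b / c)%R]%classic); last first.
    apply/seteqP; split => x /=; rewrite !in_itv/=;
    by rewrite ltr_pdivrMr// ler_pdivlMr// ![(x * c)%R]mulrC.
  rewrite !lebesgue_measure_itv/= !lte_fin ltr_pM2r ?invr_gt0//.
  case: ifPn => // _; last by rewrite mule0.
  by rewrite -!EFinD -EFinM; congr EFin; field; rewrite gt_eqF.
Qed.

Lemma integral_opp h : mfunT h ->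
  (forall x, 0 <= h x) -> \int[mu]_x h (- x)%R = \int[mu]_x h x.
Proof.
move=> mh h0; rewrite -[RHS](@integral_affine -%R _ (NngNum (@ler01 R))) ?mul1e//.
move=> a b; rewrite mul1e opp_preimage_itvbndbnd/= !lebesgue_measure_itv/=.
by rewrite !lte_fin ltrN2 opprK addrC.
Qed.

(** The value 0 for y <= 0 lets integrals over the upper half-plane be taken over the whole
    plane. *)
Definition invpos (y : R) : R := if (0 < y)%R then y^-1%R else 0%R.

Lemma invpos_ge0 y : (0 <= invpos y)%R.
Proof. by rewrite /invpos; case: ifP => // /ltW; rewrite invr_ge0. Qed.

Lemma measurable_invpos : mfunT invpos.
Proof.
rewrite (_ : invpos = (fun y => \1_(`]0%R, +oo[%classic : set (measurableTypeR R)) y * expR (- ln y))%R).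
  apply: measurable_funM; first exact: measurable_indic.
  by apply: measurableT_comp => //; apply: measurable_funN; exact: measurable_ln.
apply/funext => y; rewrite /invpos indicE mem_setE /= in_itv/= andbT.
by case: ifPn => y0; rewrite ?mul0r// mul1r expRN lnK.
Qed.

(* Both sides are scaling invariant integrals on the positive reals; the constant
   (which is 1) cancels in the only application. *)
Lemma integral_expR : exists2 c : \bar R, 0 <= c & forall h, mfunT h -> (forall x, 0 <= h x) ->
  \int[mu]_y (h y * (invpos y)%:E) = c * \int[mu]_x h (expR x).
Proof.
pose phi (s : R) : \bar R := (\1_(`]0%R, 1%R] : set (measurableTypeR R)) s)%:E.
have mphi : mfunT phi by apply/measurable_EFinP; exact: measurable_indic.
have phi0 s : 0 <= phi s by rewrite lee_fin.
have phi1 : \int[mu]_s phi s = 1.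
  transitivity (mu [set` `]0%R, 1%R]]).
    by rewrite integral_indic ?setIT//; exact: measurable_itv.
  by rewrite lebesgue_measure_itv /= lte_fin ltr01 sube0.
have scale g s : mfunT g -> (forall x, 0 <= g x) ->
    \int[mu]_y (g (expR s * y)%R * (invpos y)%:E) = \int[mu]_y (g y * (invpos y)%:E).
  move=> mg g0; have mgi : mfunT (fun y => g y * (invpos y)%:E).
    by apply: emeasurable_funM => //; apply/measurable_EFinP; exact: measurable_invpos.
  have gi0 y : 0 <= g y * (invpos y)%:E by rewrite mule_ge0// lee_fin invpos_ge0.
  rewrite -(integral_scale (expR_gt0 s) mgi gi0) -ge0_integralZl//; last first.
    by apply: (measurableT_comp mgi); exact: measurable_funM.
  apply: eq_integral => y _; rewrite muleCA -EFinM /invpos pmulr_rgt0 ?expR_gt0//.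
  by case: ifP => y0; rewrite ?mulr0//; congr (_ * _%:E); field; rewrite !gt_eqF ?expR_gt0.
exists (\int[mu]_y (phi (- ln y)%R * (invpos y)%:E)) => [|h mh h0].
  by apply: integral_ge0 => y _; rewrite mule_ge0// lee_fin invpos_ge0.
have me : mfunT (fun p : R * R => expR p.1).
  by apply: measurableT_comp => //; exact: measurable_fst.
have mi : mfunT (fun p : R * R => (invpos p.2)%:E).
  by apply/measurable_EFinP; apply: (measurableT_comp measurable_invpos); exact: measurable_snd.
have ml : mfunT (fun p : R * R => (p.1 - ln p.2)%R).
  by apply: measurable_funB; [exact: measurable_fst|apply: measurableT_comp; [exact: measurable_ln|exact: measurable_snd]].
(* As for the uniqueness of Haar measure: integrating over s, against [phi], the s-dilate of either
   integral does not change it, and after exchanging the integrals the shift of s by ln y turns [F1]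
   into [F2]. *)
pose F1 (p : R * R) := phi p.1 * (h (expR p.1 * p.2)%R * (invpos p.2)%:E).
pose F2 (p : R * R) := h (expR p.1) * (phi (p.1 - ln p.2)%R * (invpos p.2)%:E).
have mF1 : mfunT F1.
  apply: emeasurable_funM; first exact: (measurableT_comp mphi measurable_fst).
  by apply: emeasurable_funM => //; apply: (measurableT_comp mh); apply: measurable_funM => //; exact: measurable_snd.
have mF2 : mfunT F2.
  apply: emeasurable_funM; first exact: (measurableT_comp mh me).
  by apply: emeasurable_funM => //; exact: (measurableT_comp mphi ml).
have F10 p : 0 <= F1 p by rewrite !mule_ge0// lee_fin invpos_ge0.
have F20 p : 0 <= F2 p by rewrite !mule_ge0// lee_fin invpos_ge0.
have mgi g : mfunT g -> mfunT (fun y => g y * (invpos y)%:E).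
  by move=> mg; apply: emeasurable_funM => //; apply/measurable_EFinP; exact: measurable_invpos.
have L : \int[mu]_s \int[mu]_y F1 (s, y) = \int[mu]_y (h y * (invpos y)%:E).
  rewrite -[RHS]mul1e -phi1 -ge0_integralZr//; last by apply: integral_ge0 => y _; rewrite mule_ge0// lee_fin invpos_ge0.
  apply: eq_integral => s _; rewrite -(scale h s)// /F1 /= ge0_integralZl//.
    by apply: mgi; apply: (measurableT_comp mh); exact: measurable_funM.
  by move=> y _; rewrite mule_ge0// lee_fin invpos_ge0.
have Rr : \int[mu]_s \int[mu]_y F2 (s, y) =
    (\int[mu]_y (phi (- ln y)%R * (invpos y)%:E)) * \int[mu]_x h (expR x).
  rewrite muleC -ge0_integralZr//; last 2 first.
  - exact: (measurableT_comp mh).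
  - by apply: integral_ge0 => y _; rewrite mule_ge0// lee_fin invpos_ge0.
  apply: eq_integral => s _; have mps : mfunT (fun y : R => phi (s - ln y)%R).
    by apply: (measurableT_comp mphi); apply: measurable_funB => //; exact: measurable_ln.
  rewrite /F2 /= ge0_integralZl//; first last.
  - by move=> y _; rewrite mule_ge0// lee_fin invpos_ge0.
  - exact: mgi.
  congr (_ * _); rewrite -(scale _ s mps)//; apply: eq_integral => y _; rewrite /invpos.
  case: ifPn => y0; last by rewrite !mule0.
  by congr (phi _ * _); rewrite lnM ?posrE ?expR_gt0// expRK; lra.
rewrite -L -Rr.
have -> : \int[mu]_s \int[mu]_y F1 (s, y) = \int[mu]_y \int[mu]_s F1 (s, y).
  by rewrite -fubini_tonelli1// fubini_tonelli2.
have -> : \int[mu]_s \int[mu]_y F2 (s, y) = \int[mu]_y \int[mu]_s F2 (s, y).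
  by rewrite -fubini_tonelli1// fubini_tonelli2.
apply: eq_integral => y _; have [y0|y0] := ltP 0%R y; last first.
  by rewrite !integral0_eq// => s _; rewrite /F1 /F2 /= /invpos ltNge y0 !mule0.
rewrite -[RHS](integral_translate (ln y) (measurableT_comp mF2 (measurable_pair2 y)) (fun=> F20 _)).
apply: eq_integral => s _; rewrite /F1 /F2 /= addrK expRD lnK ?posrE// muleCA muleA.
by rewrite muleAC.
Qed.
End OneDim.

Section Hyperbolic.
Context {R : realType}.
Local Notation mu := (@lebesgue_measure R).
Local Notation mu2 := (@lebesgue_measure R \x @lebesgue_measure R)%E.
Implicit Types h : R * R -> \bar R.
Local Open Scope ereal_scope.

(** The density 1/y^2 of the invariant measure, extended by 0 to y <= 0. *)
Definition hyp_weight (y : R) : R := (invpos y ^+ 2)%R.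

Definition hyp h : \bar R := \int[mu2]_p (h p * (hyp_weight p.2)%:E).

Lemma measurable_hyp_weight : mfunT hyp_weight.
Proof. by apply: measurable_funX; exact: measurable_invpos. Qed.

Lemma hyp_weight_ge0 y : (0 <= hyp_weight y)%R.
Proof. exact: sqr_ge0. Qed.

Lemma eq_hyp h1 h2 : (forall p, (0 < p.2)%R -> h1 p = h2 p) -> hyp h1 = hyp h2.
Proof.
move=> e; apply: eq_integral => p _; rewrite /hyp_weight /invpos.
by case: ifPn => [/e -> //|_]; rewrite expr0n !mule0.
Qed.

Lemma measurable_hyp_integrand h : mfunT h ->
  mfunT (fun p => h p * (hyp_weight p.2)%:E).
Proof.
move=> mh; apply: emeasurable_funM => //; apply/measurable_EFinP.
by apply: (measurableT_comp measurable_hyp_weight); exact: measurable_snd.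
Qed.

Lemma hyp_tonelli h : mfunT h -> (forall p, 0 <= h p) ->
  hyp h = \int[mu]_y ((\int[mu]_x h (x, y)) * (hyp_weight y)%:E).
Proof.
move=> mh h0; rewrite /hyp fubini_tonelli2//.
- apply: eq_integral => y _; rewrite /fubini_G /= ge0_integralZr//.
  + exact: (measurableT_comp mh).
  + by rewrite lee_fin hyp_weight_ge0.
- exact: measurable_hyp_integrand.
- by move=> p; rewrite mule_ge0// lee_fin hyp_weight_ge0.
Qed.

Let msec2 h : mfunT h -> forall y, mfunT (fun x : R => h (x, y)).
Proof. by move=> mh y; exact: (measurableT_comp mh). Qed.

Let msec1 h : mfunT h -> forall x, mfunT (fun y : R => h (x, y)).
Proof. by move=> mh y; exact: (measurableT_comp mh). Qed.

Lemma measurable_translate (c : R) : mfunT (fun p : R * R => ((p.1 + c)%R, p.2)).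
Proof.
apply/measurable_fun_pairP; split; last exact: measurable_snd.
by apply: measurable_funD => //; exact: measurable_fst.
Qed.

Lemma hyp_translate h (c : R) : mfunT h -> (forall p, 0 <= h p) ->
  hyp (fun p => h (p.1 + c, p.2)%R) = hyp h.
Proof.
move=> mh h0; rewrite (hyp_tonelli mh h0).
have mhc : mfunT (fun p : R * R => h (p.1 + c, p.2)%R).
  exact: (measurableT_comp mh (measurable_translate c)).
rewrite (hyp_tonelli mhc (fun=> h0 _)).
by apply: eq_integral => y _ /=; rewrite (integral_translate c (msec2 mh y)).
Qed.

(** Coordinates t = x/y and e = ln |z|, where ln |z| = ln y + [cc] t. In them the measure is a
    constant times dt de, and z -> -1/z becomes (t, e) -> (-t, -e). *)
Let cc (t : R) : R := (ln (1 + t ^+ 2) / 2)%R.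
Let psi (q : R * R) : R * R :=
  (expR (q.2 - cc q.1) * q.1, expR (q.2 - cc q.1))%R.

Let mcc : mfunT cc.
Proof.
apply: measurable_funM => //; apply: measurableT_comp; first exact: measurable_ln.
by apply: measurable_funD => //; exact: measurable_funX.
Qed.

Let me1 : mfunT (fun q : R * R => expR (q.2 - cc q.1)%R).
Proof.
apply: measurableT_comp; first exact: measurable_expR.
apply: measurable_funB; first exact: measurable_snd.
by apply: measurableT_comp => //; exact: measurable_fst.
Qed.

Let mpsi : mfunT psi.
Proof.
apply/measurable_fun_pairP; split => //.
by apply: measurable_funM => //; exact: measurable_fst.
Qed.

Let hyp_psi : exists c : \bar R, forall h, mfunT h -> (forall p, 0 <= h p) ->
  hyp h = c * \int[mu]_t \int[mu]_e h (psi (t, e)).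
Proof.
have [c c0 hc] := @integral_expR R; exists c => h mh h0; rewrite hyp_tonelli//.
have mh1 : mfunT (fun p : R * R => h (p.2 * p.1, p.2)%R).
  apply: (measurableT_comp mh); apply/measurable_fun_pairP; split.
    by apply: measurable_funM; [exact: measurable_snd|exact: measurable_fst].
  exact: measurable_snd.
have mh2 : mfunT
    (fun p : R * R => h (p.2 * p.1, p.2)%R * (invpos p.2)%:E).
  apply: emeasurable_funM => //; apply/measurable_EFinP.
  by apply: (measurableT_comp measurable_invpos); exact: measurable_snd.
transitivity (\int[mu]_y \int[mu]_t (h (y * t, y)%R * (invpos y)%:E)).
  apply: eq_integral => y _; rewrite ge0_integralZr//; last 2 first.
    exact: (msec2 mh1).
    by rewrite lee_fin invpos_ge0.
  rewrite /hyp_weight /invpos; case: ifPn => y0; last by rewrite expr0n !mule0.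
  rewrite -[in LHS](integral_scale y0 (msec2 mh y))//.
  rewrite [X in X * _]muleC -muleA -EFinM; congr (_ * _%:E).
  by field; rewrite gt_eqF.
have mh20 (p : R * R) : 0 <= h (p.2 * p.1, p.2)%R * (invpos p.2)%:E.
  by rewrite mule_ge0// lee_fin invpos_ge0.
transitivity (\int[mu]_t \int[mu]_y (h (y * t, y)%R * (invpos y)%:E)).
  transitivity (\int[mu2]_p (h (p.2 * p.1, p.2)%R * (invpos p.2)%:E)).
    by rewrite fubini_tonelli2.
  by rewrite fubini_tonelli1.
have mhp : mfunT (fun q : R * R => h (psi q)) by exact: measurableT_comp.
rewrite -ge0_integralZl//; last 2 first.
- exact: (@measurable_fun_fubini_tonelli_F _ _ _ _ _ mu (fun q : R * R => h (psi q))).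
- by move=> t _; exact: integral_ge0.
apply: eq_integral => t _ /=.
rewrite (hc (fun y : R => h (y * t, y)%R) (msec1 mh1 t) (fun=> h0 _)).
rewrite -(@integral_translate R _ (- cc t)) //.
apply: (measurableT_comp (msec1 mh1 t)); exact: measurable_expR.
Qed.

(** The map z -> -1/z, written with [invpos] so that it is measurable on the whole plane. *)
Definition SP (p : R * R) : R * R :=
  (- p.1 * invpos (p.1 ^+ 2 + p.2 ^+ 2), p.2 * invpos (p.1 ^+ 2 + p.2 ^+ 2))%R.

Lemma measurable_SP : mfunT SP.
Proof.
have mi : mfunT (fun p : R * R => invpos (p.1 ^+ 2 + p.2 ^+ 2)).
  apply: (measurableT_comp measurable_invpos).
  apply: measurable_funD; apply: measurable_funX; [exact: measurable_fst|exact: measurable_snd].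
apply/measurable_fun_pairP; split; apply: measurable_funM => //.
by apply: measurable_funN; exact: measurable_fst.
Qed.

Lemma hyp_inversion h : mfunT h -> (forall p, 0 <= h p) ->
  hyp (h \o SP) = hyp h.
Proof.
move=> mh h0; have [c hc] := hyp_psi; rewrite (hc _ mh h0) (hc _ (measurableT_comp mh measurable_SP) (fun=> h0 _)); congr (_ * _).
have mhp : mfunT (fun q : R * R => h (psi q)) by exact: measurableT_comp.
rewrite -[RHS]integral_opp; last 2 first.
- exact: (@measurable_fun_fubini_tonelli_F _ _ _ _ _ mu (fun q : R * R => h (psi q))).
- by move=> t; exact: integral_ge0.
apply: eq_integral => t _.
rewrite -[RHS]integral_opp//; last exact: (msec1 mhp).
apply: eq_integral => e _ /=; congr h; rewrite /SP /psi /=.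
have t0 : (0 < 1 + t ^+ 2)%R by rewrite ltr_wpDr ?sqr_ge0.
have ccN : cc (- t) = cc t by rewrite /cc sqrrN.
have -> : ((expR (e - cc t) * t) ^+ 2 + expR (e - cc t) ^+ 2 = expR (e + e))%R.
  rewrite exprMn -{2}[(expR (e - cc t) ^+ 2)%R]mulr1 -mulrDr [(t ^+ 2 + 1)%R]addrC.
  rewrite -[X in (_ * X)%R = _](lnK t0) expr2 -!expRD; congr expR.
  by rewrite /cc; lra.
rewrite /invpos expR_gt0 ccN -expRN.
have -> : (- e - cc t = (e - cc t) + - (e + e))%R by lra.
by rewrite [in RHS]expRD; congr pair; ring.
Qed.
End Hyperbolic.

(** * Integral matrices and their action on the upper half-plane *)

Definition mat2 (a b c d : int) : 'M[int]_2 :=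
  \matrix_(i < 2, j < 2) (if i == 0 then if j == 0 then a else b
                          else if j == 0 then c else d).

Lemma mat2E a b c d :
  (mat2 a b c d 0 0 = a) * (mat2 a b c d 0 1 = b) *
  (mat2 a b c d 1 0 = c) * (mat2 a b c d 1 1 = d).
Proof. by rewrite !mxE. Qed.

Lemma ord2P (i : 'I_2) : i = 0 \/ i = 1.
Proof. by case: i => [[|[|i]] hi] //; [left|right]; apply/val_inj. Qed.

Lemma mat2_eta (g : 'M[int]_2) : g = mat2 (g 0 0) (g 0 1) (g 1 0) (g 1 1).
Proof.
apply/matrixP => i j; rewrite mxE.
by case: (ord2P i) => ->; case: (ord2P j) => ->.
Qed.

Lemma mulmx2E (g h : 'M[int]_2) i j :
  (g *m h) i j = g i 0 * h 0 j + g i 1 * h 1 j.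
Proof. by rewrite mxE big_ord_recl big_ord1; congr (_ + _ * _); congr (_ _ _); apply/val_inj. Qed.

Lemma det2E (g : 'M[int]_2) : \det g = g 0 0 * g 1 1 - g 0 1 * g 1 0.
Proof. rewrite (expand_det_row _ 0) !big_ord_recl big_ord0 /cofactor !det_mx11 !mxE /=.
rewrite addr0 expr0 mul1r expr1 mulN1r mulrN; congr (_ * _ - _ * _);
by congr (g _ _); apply/val_inj. Qed.

Section SL2Int.
Implicit Types (g h : 'M[int]_2).

Lemma SL2Z_det g : SL2Z g -> g 0 0 * g 1 1 - g 0 1 * g 1 0 = 1.
Proof. by rewrite /SL2Z /= det2E. Qed.

Lemma SL2Z_mul g h : SL2Z g -> SL2Z h -> SL2Z (g *m h).
Proof. by rewrite /SL2Z /= det_mulmx => -> ->; rewrite mulr1. Qed.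

Definition inv2 g : 'M[int]_2 := mat2 (g 1 1) (- g 0 1) (- g 1 0) (g 0 0).

Lemma mulmxK2 g : SL2Z g -> g *m inv2 g = 1%:M.
Proof.
move=> /SL2Z_det dg; rewrite [LHS]mat2_eta [RHS]mat2_eta !mulmx2E !mat2E.
congr mat2; rewrite !mxE/=; lia.
Qed.

Lemma mulVmx2 g : SL2Z g -> inv2 g *m g = 1%:M.
Proof.
move=> /SL2Z_det dg; rewrite [LHS]mat2_eta [RHS]mat2_eta !mulmx2E !mat2E.
congr mat2; rewrite !mxE/=; lia.
Qed.

Lemma SL2Z_inv g : SL2Z g -> SL2Z (inv2 g).
Proof. by move=> /SL2Z_det dg; rewrite /SL2Z /= det2E !mat2E; lia. Qed.

Lemma SL2Z1 : SL2Z 1%:M. Proof. by rewrite /SL2Z /= det1. Qed.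

Definition Smat : 'M[int]_2 := mat2 0 (-1) 1 0.
Definition Tmat (n : int) : 'M[int]_2 := mat2 1 n 0 1.

Lemma SL2Z_S : SL2Z Smat. Proof. by rewrite /SL2Z /= det2E !mat2E. Qed.
Lemma SL2Z_T n : SL2Z (Tmat n).
Proof. by rewrite /SL2Z /= det2E !mat2E; lia. Qed.

(** Euclid's algorithm on the bottom row. Only right multiplications occur, because the invariance
    of [hyp] is proved by splitting off the map that acts first. *)
Lemma SL2Z_ind (P : 'M[int]_2 -> Prop) :
  (forall n, P (Tmat n)) ->
  (forall g, SL2Z g -> P g -> P (g *m Smat)) ->
  (forall g n, SL2Z g -> P g -> P (g *m Tmat n)) ->
  forall g, SL2Z g -> P g.
Proof.
move=> HT HS HgT.
suff H (n : nat) g : SL2Z g -> `|g 1%R 0%R|%N = n -> P g by move=> g dg; exact: (H _ g dg erefl).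
elim/ltn_ind: n g => n IH g dg gn.
have dg1 := SL2Z_det dg.
have [c0|c0] := eqVneq (g 1 0) 0.
  have ad : g 0 0 * g 1 1 = 1 by move: dg1; rewrite c0 mulr0 subr0.
  have [[a1 d1]|[a1 d1]] : (g 0 0 = 1 /\ g 1 1 = 1) \/ (g 0 0 = -1 /\ g 1 1 = -1).
    have : (`|g 0%R 0%R| * `|g 1%R 1%R|)%N == 1%N by rewrite -abszM ad.
    rewrite muln_eq1 => /andP[/eqP a1 /eqP d1].
    move: ad; case: (intP (g 0 0)) a1 => // a; case: (intP (g 1 1)) d1 => // d; lia.
  - have -> : g = Tmat (g 0 1) by rewrite {1}(mat2_eta g) a1 d1 c0.
    exact: HT.
  - have -> : g = ((Tmat (- g 0 1) *m Smat) *m Smat).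
      rewrite [LHS]mat2_eta [RHS]mat2_eta !mulmx2E !mat2E a1 d1 c0.
      by congr mat2; lia.
    by apply: (HS); [apply: SL2Z_mul; [exact: SL2Z_T|exact: SL2Z_S]|apply: (HS); [exact: SL2Z_T|exact: HT]].
pose q := (g 1%R 1%R %/ g 1%R 0%R)%Z.
pose h := (g *m Tmat (- q)) *m Smat.
have dh : SL2Z h.
  by apply: SL2Z_mul; [apply: SL2Z_mul => //; exact: SL2Z_T|exact: SL2Z_S].
have h10 : h 1 0 = (g 1%R 1%R %% g 1%R 0%R)%Z.
  rewrite !mulmx2E !mat2E; have := divz_eq (g 1 1) (g 1 0); rewrite -/q; lia.
have Ph : P h.
  apply: (IH `|h 1%R 0%R|%N) => //; rewrite h10 -gn.
  have := ltz_mod (g 1 1) c0; have := modz_ge0 (g 1 1) c0; lia.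
(* The fourth power of [Smat] is 1, so three more factors undo the one in [h]. *)
have -> : g = ((h *m Smat) *m Smat *m Smat) *m Tmat q.
  rewrite [LHS]mat2_eta [RHS]mat2_eta !mulmx2E !mat2E.
  by congr mat2; lia.
have dS := SL2Z_S.
have d1 := SL2Z_mul dh dS; have d2 := SL2Z_mul d1 dS; have d3 := SL2Z_mul d2 dS.
exact: (HgT _ _ d3 (HS _ d2 (HS _ d1 (HS _ dh Ph)))).
Qed.

End SL2Int.

Section SL2.
Context {R : realType}.
Implicit Types (z : R[i]) (g h : 'M[int]_2).

Definition nsq (z : R[i]) : R := Re z ^+ 2 + Im z ^+ 2.

Lemma nsq_gt0 z : z != 0 -> 0 < nsq z.
Proof.
case: z => x y; rewrite /nsq eq_complex/= negb_and => /orP[] h.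
  by rewrite ltr_pwDl ?sqr_ge0// lt_def sqr_ge0 sqrf_eq0 h.
by rewrite ltr_wpDl ?sqr_ge0// lt_def sqr_ge0 sqrf_eq0 h.
Qed.

Lemma normc_nsq z : normc z ^+ 2 = nsq z.
Proof. by case: z => x y; rewrite /nsq /= sqr_sqrtr// addr_ge0 ?sqr_ge0. Qed.

Lemma intc (m : int) : (m%:~R : R[i]) = (m%:~R : R) +i* 0.
Proof. by rewrite -[RHS]/((m%:~R : R)%:C) rmorph_int. Qed.

Lemma autjE g x y : autj g (x +i* y) =
  ((g 1 0)%:~R * x + (g 1 1)%:~R) +i* ((g 1 0)%:~R * y) :> R[i].
Proof. by rewrite /autj !intc; simpc. Qed.

Lemma autj_neq0 g z : SL2Z g -> uhp z -> autj g z != 0.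
Proof.
case: z => x y /SL2Z_det dg; rewrite /uhp /= => y0; rewrite autjE eq_complex/=.
apply/negP => /andP[/eqP e1 /eqP e2]; move: e2 e1.
move/eqP; rewrite mulf_eq0 (gt_eqF y0) orbF intr_eq0 => /eqP c0.
rewrite c0 mul0r add0r => /eqP; rewrite intr_eq0 => /eqP d0.
by move: dg; rewrite c0 d0; lia.
Qed.

Lemma moebiusE g x y : SL2Z g ->
  moebius g (x +i* y) =
  ((((g 0 0)%:~R * x + (g 0 1)%:~R) * ((g 1 0)%:~R * x + (g 1 1)%:~R)
    + (g 0 0)%:~R * (g 1 0)%:~R * y ^+ 2) / nsq (autj g (x +i* y)))
  +i* (y / nsq (autj g (x +i* y))) :> R[i].
Proof.
move=> /SL2Z_det dg; rewrite /moebius autjE /nsq /= !intc; simpc.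
have dR : (g 0 0)%:~R * (g 1 1)%:~R - (g 0 1)%:~R * (g 1 0)%:~R = 1 :> R.
  by rewrite -!intrM -intrB dg.
congr (_ +i* _); first by ring.
set D := (_ ^+ 2 + _)^-1.
transitivity (((g 0 0)%:~R * (g 1 1)%:~R - (g 0 1)%:~R * (g 1 0)%:~R) * (y * D) : R).
  by ring.
by rewrite dR mul1r.
Qed.

Lemma Im_moebius g z : SL2Z g -> Im (moebius g z) = Im z / nsq (autj g z).
Proof. by case: z => x y dg; rewrite moebiusE. Qed.

Lemma uhp_moebius g z : SL2Z g -> uhp z -> uhp (moebius g z).
Proof.
move=> dg uz; rewrite /uhp /= Im_moebius// divr_gt0//.
by apply: nsq_gt0; exact: autj_neq0.
Qed.

Lemma autj_mul g h z : SL2Z h -> uhp z ->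
  autj (g *m h) z = autj g (moebius h z) * autj h z.
Proof.
move=> dh uz; have := autj_neq0 dh uz; rewrite /moebius.
rewrite {1 2 5}/autj => h0; rewrite !mulmx2E !rmorphD !rmorphM /=.
by rewrite /autj; field.
Qed.

Lemma moebius_mul g h z : SL2Z g -> SL2Z h -> uhp z ->
  moebius (g *m h) z = moebius g (moebius h z).
Proof.
move=> dg dh uz.
have h0 := autj_neq0 dh uz.
have g0 := autj_neq0 dg (uhp_moebius dh uz).
have gh0 := autj_neq0 (SL2Z_mul dg dh) uz.
rewrite /moebius autj_mul// -/(moebius h z).
rewrite !mulmx2E !rmorphD !rmorphM /= invfM mulrA.
have e : ((g 0 0)%:~R * moebius h z + (g 0 1)%:~R) * autj h z =
  ((g 0 0)%:~R * (h 0 0)%:~R + (g 0 1)%:~R * (h 1 0)%:~R) * z +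
   ((g 0 0)%:~R * (h 0 1)%:~R + (g 0 1)%:~R * (h 1 1)%:~R).
  by rewrite /moebius; move: h0; rewrite /autj => h0; field.
rewrite -e; field; exact/andP.
Qed.

Lemma moebius1 z : moebius 1%:M z = z.
Proof. by rewrite /moebius /autj !mxE /=; rewrite mul1r mul0r add0r addr0 divr1. Qed.

Lemma autj1 z : autj 1%:M z = 1.
Proof. by rewrite /autj !mxE /= mul0r add0r. Qed.

Lemma moebiusK g z : SL2Z g -> uhp z -> moebius (inv2 g) (moebius g z) = z.
Proof.
by move=> dg uz; rewrite -moebius_mul ?mulVmx2 ?moebius1//; exact: SL2Z_inv.
Qed.

Lemma moebius_T n z : moebius (Tmat n) z = z + n%:~R.
Proof. by rewrite /moebius /autj !mat2E mul0r add0r mul1r divr1. Qed.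

Lemma autj_T n z : autj (Tmat n) z = 1.
Proof. by rewrite /autj !mat2E mul0r add0r. Qed.

Lemma nsq_autj g (x y : R) : nsq (autj g (x +i* y)) =
  ((g 1 0)%:~R * x + (g 1 1)%:~R) ^+ 2 + ((g 1 0)%:~R * y) ^+ 2.
Proof. by rewrite autjE. Qed.
End SL2.

Section HypInvariance.
Context {R : realType}.
Local Open Scope ereal_scope.
Implicit Types h : R * R -> \bar R.

Definition toC (p : R * R) : R[i] := p.1 +i* p.2.
Definition ofC (z : R[i]) : R * R := (Re z, Im z).
Lemma toCK p : ofC (toC p) = p. Proof. by case: p. Qed.
Lemma ofCK z : toC (ofC z) = z. Proof. by case: z. Qed.

Definition mobp (g : 'M[int]_2) (p : R * R) : R * R := ofC (moebius g (toC p)).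

Lemma mobp_mul g g' p : SL2Z g -> SL2Z g' -> (0 < p.2)%R ->
  mobp (g *m g') p = mobp g (mobp g' p).
Proof. by move=> dg dg' p0; rewrite /mobp ofCK moebius_mul. Qed.

Lemma mobp_gt0 g p : SL2Z g -> (0 < p.2)%R -> (0 < (mobp g p).2)%R.
Proof. by move=> dg p0; rewrite /mobp; exact: uhp_moebius. Qed.

Lemma mobpE g p : SL2Z g -> mobp g p =
  ((((g 0 0)%:~R * p.1 + (g 0 1)%:~R) * ((g 1 0)%:~R * p.1 + (g 1 1)%:~R)
    + (g 0 0)%:~R * (g 1 0)%:~R * p.2 ^+ 2)
    * invpos (((g 1 0)%:~R * p.1 + (g 1 1)%:~R) ^+ 2 + ((g 1 0)%:~R * p.2) ^+ 2),
   p.2 * invpos (((g 1 0)%:~R * p.1 + (g 1 1)%:~R) ^+ 2 + ((g 1 0)%:~R * p.2) ^+ 2))%R.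
Proof.
move=> dg; rewrite /mobp /toC moebiusE// nsq_autj /ofC /=.
set D := (_ ^+ 2 + _)%R; have -> // : (D^-1 = invpos D)%R.
rewrite /invpos; case: ifPn => //; rewrite -leNgt => D0.
have -> : D = 0%R; last by rewrite invr0.
by apply/eqP; rewrite eq_le D0 addr_ge0// sqr_ge0.
Qed.

Lemma measurable_mobp g : SL2Z g -> mfunT (mobp g).
Proof.
move=> dg; rewrite (funext (fun p => mobpE p dg)).
have m1 := @measurable_fst _ _ (measurableTypeR R) (measurableTypeR R).
have m2 := @measurable_snd _ _ (measurableTypeR R) (measurableTypeR R).
have ma (a b : R) : mfunT (fun p : R * R => a * p.1 + b)%R.
  by apply: measurable_funD => //; apply: measurable_funM.
have md : mfunT (fun p : R * R =>
   invpos (((g 1%R 0%R)%:~R * p.1 + (g 1%R 1%R)%:~R) ^+ 2 + ((g 1%R 0%R)%:~R * p.2) ^+ 2)).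
  apply: (measurableT_comp measurable_invpos); apply: measurable_funD; apply: measurable_funX => //.
  by apply: measurable_funM.
apply/measurable_fun_pairP; split; apply: measurable_funM => //=.
by apply: measurable_funD; [apply: measurable_funM|apply: measurable_funM => //; apply: measurable_funX].
Qed.

Lemma hyp_mobp g h : SL2Z g -> mfunT h -> (forall p, 0 <= h p) ->
  hyp (h \o mobp g) = hyp h.
Proof.
move=> dg; move: h.
pose P g := forall h, mfunT h -> (forall p, 0 <= h p) -> hyp (h \o mobp g) = hyp h.
suff: P g by []; move: g dg; apply: SL2Z_ind => [n|g dg IH|g n dg IH] h mh h0.
- rewrite -[RHS](hyp_translate n%:~R mh h0); apply: eq_hyp => p p0 /=; congr h.
  by rewrite /mobp moebius_T /ofC /toC intc /= addr0.
- rewrite -(IH _ mh h0).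
  have mhg : mfunT (h \o mobp g) by exact: measurableT_comp mh (measurable_mobp dg).
  rewrite -[RHS](hyp_inversion mhg)//; last by move=> p; exact: h0.
  apply: eq_hyp => p p0 /=; rewrite mobp_mul//; last exact: SL2Z_S.
  congr (h (mobp g _)); rewrite (mobpE p SL2Z_S) /SP !mat2E; congr (_, _).
    by rewrite !(mul0r, mul1r, add0r, addr0, mulN1r, mulrN1, rmorphN1).
  by rewrite !(mul1r, addr0).
- rewrite -(IH _ mh h0).
  have mhg : mfunT (h \o mobp g) by exact: measurableT_comp mh (measurable_mobp dg).
  rewrite -[RHS](hyp_translate n%:~R mhg)//; last by move=> p; exact: h0.
  apply: eq_hyp => p p0 /=; rewrite mobp_mul//; last exact: SL2Z_T.
  congr (h (mobp g _)).
  by rewrite /mobp moebius_T /ofC /toC intc /= addr0.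
Qed.
End HypInvariance.

(** * Fourier series *)

Section RealIntegral.
Context {R : realType}.
Local Notation mu := (@lebesgue_measure R).
Implicit Types (f g F : R -> R) (a b c x k N : R).

Definition rint a b f : R := \int[mu]_(x in `[a, b]) f x.

Lemma rint_integrable a b f : continuous f -> mu.-integrable `[a, b] (EFin \o f).
Proof.
move=> cf; apply: continuous_compact_integrable; first exact: segment_compact.
by apply: continuous_subspaceT.
Qed.

Lemma rint_EFin a b f : continuous f ->
  (\int[mu]_(x in `[a, b]) (f x)%:E = (rint a b f)%:E)%E.
Proof.
move=> cf; rewrite /rint /Rintegral fineK//.
by apply: integrable_fin_num => //; exact: rint_integrable.
Qed.

Lemma rint_FTC a b f F : continuous f -> a <= b ->
  (forall x, a <= x <= b -> is_derive x 1 F (f x)) -> rint a b f = F b - F a.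
Proof.
move=> cf; rewrite le_eqVlt => /predU1P[->|ab] dF.
  by rewrite subrr /rint set_itv1 Rintegral_set1.
have cF x : a <= x <= b -> {for x, continuous F}.
  by move=> /dF d; apply/differentiable_continuous/derivable1_diffP; apply: ex_derive.
rewrite /rint /Rintegral (@continuous_FTC2 _ f F)//.
- exact: continuous_subspaceT.
- split.
  + by move=> x; rewrite in_itv/= => /andP[/ltW h1 /ltW h2]; apply: ex_derive; apply: dF; rewrite h1.
  + by apply: cvg_at_right_filter; apply: cF; rewrite lexx ltW.
  + by apply: cvg_at_left_filter; apply: cF; rewrite lexx ltW.
- move=> x; rewrite in_itv/= => /andP[/ltW h1 /ltW h2]; rewrite derive1E.
  by have /@derive_val : is_derive x 1 F (f x) by apply: dF; rewrite h1.
Qed.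

(** Starting the primitive at some A to the left of the interval gives two-sided derivatives at its
    endpoints as well. *)
Lemma rint_prim f A : continuous f ->
  exists F, forall x, A < x -> is_derive x 1 F (f x).
Proof.
move=> cf; exists (fun x => \int[mu]_(t in `[A, x]) f t) => x Ax.
have xu : x < x + 1 by rewrite ltrDl.
have [d e] := continuous_FTC1_closed xu (rint_integrable A (x + 1) cf) Ax (cf x).
by move: e; rewrite derive1E; exact: DeriveDef d.
Qed.

Lemma rint_prims f g A : continuous f -> continuous g -> exists F G,
  (forall x, A < x -> is_derive x 1 F (f x)) /\ (forall x, A < x -> is_derive x 1 G (g x)).
Proof.
by move=> /(rint_prim A)[F dF] /(rint_prim A)[G dG]; exists F, G.
Qed.

Lemma rintD a b f g : continuous f -> continuous g ->
  rint a b (fun x => f x + g x) = rint a b f + rint a b g.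
Proof. by move=> cf cg; rewrite /rint RintegralD//; exact: rint_integrable. Qed.

Lemma rintZ a b k f : continuous f ->
  rint a b (fun x => k * f x) = k * rint a b f.
Proof. by move=> cf; rewrite /rint RintegralZl//; exact: rint_integrable. Qed.

Lemma rintN a b f : continuous f -> rint a b (fun x => - f x) = - rint a b f.
Proof.
move=> cf; rewrite -mulN1r -rintZ//; congr rint.
by apply/funext => x; rewrite mulN1r.
Qed.

Lemma rint_le a b f g : continuous f -> continuous g ->
  (forall x, a <= x <= b -> f x <= g x) -> rint a b f <= rint a b g.
Proof.
move=> cf cg fg; apply: le_Rintegral => //; try exact: rint_integrable.
all: by move=> x /=; rewrite in_itv/=; exact: fg.
Qed.

Lemma rint_cst a b k : a <= b -> rint a b (fun=> k) = k * (b - a).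
Proof.
move=> ab; rewrite mulrBr; apply: (@rint_FTC _ _ _ (fun x => k * x)) => //.
  by move=> x; exact: cvg_cst.
move=> x _; apply: (is_derive_eq (is_deriveM (f := fun=> k) (is_derive_cst _ _ _) (is_derive_id _ _))).
by rewrite /= scaler0 addr0 /GRing.scale/= mulr1.
Qed.

Lemma rint_ge0 a b f : (forall x, a <= x <= b -> 0 <= f x) -> 0 <= rint a b f.
Proof.
by move=> f0; apply: Rintegral_ge0 => x /=; rewrite in_itv/=; exact: f0.
Qed.

Lemma rint_split a b c f : continuous f -> a <= b -> b <= c ->
  rint a c f = rint a b f + rint b c f.
Proof.
move=> cf ab bc; have [F dF] := rint_prim (a - 1) cf.
have P x : a <= x -> is_derive x 1 F (f x) by move=> ax; apply: dF; lra.
have E u v : a <= u -> u <= v -> rint u v f = F v - F u.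
  move=> au uv; apply: rint_FTC => // x /andP[h _]; apply: P; exact: le_trans h.
by rewrite !E ?(le_trans ab bc)//; ring.
Qed.

Lemma rint_affine a b k c f : continuous f -> a <= b -> 0 < k ->
  k * rint a b (fun x => f (k * x + c)) = rint (k * a + c) (k * b + c) f.
Proof.
move=> cf ab k0; have [F dF] := rint_prim (k * a + c - 1) cf.
have P x : k * a + c <= x -> is_derive x 1 F (f x) by move=> ax; apply: dF; lra.
have kab : k * a + c <= k * b + c by rewrite lerD2r ler_pM2l.
have cfk : continuous (fun x => f (k * x + c)).
  move=> x; apply: (@continuous_comp _ _ _ (fun x => k * x + c) f); last exact: cf.
  by apply: cvgD; [apply: cvgM; [exact: cvg_cst|exact: cvg_id]|exact: cvg_cst].
have E : rint (k * a + c) (k * b + c) f = F (k * b + c) - F (k * a + c).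
  by apply: rint_FTC => // x /andP[h _]; exact: P.
rewrite -rintZ// E.
apply: (@rint_FTC _ _ _ (fun x => F (k * x + c))) => //.
  by move=> x; apply: cvgM; [exact: cvg_cst|exact: cfk].
move=> x /andP[ax _].
have d1 : is_derive x 1 (fun x => k * x + c) k.
  apply: (is_derive_eq (is_deriveD (is_deriveM (f := fun=> k) (is_derive_cst _ _ _) (is_derive_id _ _)) (is_derive_cst c _ _))).
  by rewrite /= scaler0 !addr0 /GRing.scale/= mulr1.
have d2 : is_derive (k * x + c) 1 F (f (k * x + c)).
  by apply: P; rewrite lerD2r ler_pM2l.
by rewrite mulrC; exact: (is_derive1_comp (f := F) (g := fun x => k * x + c) d2 d1).
Qed.

Lemma rint_shift a b c f : continuous f -> a <= b ->
  rint a b (fun x => f (x + c)) = rint (a + c) (b + c) f.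
Proof.
move=> cf ab; have := rint_affine c cf ab ltr01; rewrite !mul1r => <-.
by congr rint; apply/funext => x; rewrite mul1r.
Qed.

Lemma rint_periodic N c f : 0 <= N -> continuous f -> (forall x, f (x + N) = f x) ->
  rint c (c + N) f = rint 0 N f.
Proof.
move=> N0 cf pf.
wlog c0 : c / 0 <= c => [H|].
  have [c0|c0] := leP 0 c; first exact: H.
  have pn (n : nat) x : f (x + N *+ n) = f x.
    by elim: n => [|n IH]; rewrite ?mulr0n ?addr0// mulrSr addrA pf.
  have [N1|N1] := eqVneq N 0; first by rewrite N1 addr0 /rint !set_itv1 !Rintegral_set1.
  have Np : 0 < N by rewrite lt_def N1.
  pose n := (Num.truncn (- c / N)).+1.
  have cn : 0 <= c + N *+ n.
    have : - c / N < n%:R by rewrite /n; apply: truncnS_gt.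
    by rewrite ltr_pdivrMr// -mulr_natl; lra.
  rewrite -(H _ cn) addrAC -rint_shift//; last by rewrite lerDl.
  by congr rint; apply/funext => x; rewrite pn.
have e : rint 0 (c + N) f = rint 0 c f + rint c (c + N) f by rewrite (@rint_split _ c)// lerDl.
have e2 : rint 0 (c + N) f = rint 0 N f + rint N (c + N) f by rewrite (@rint_split _ N)// lerDr.
have e3 : rint N (c + N) f = rint 0 c f.
  rewrite -{1}[N]add0r -rint_shift//; congr rint; exact/funext.
by move: e; rewrite e2 e3 addrC => /addrI.
Qed.
End RealIntegral.

Section ComplexIntegral.
Context {R : realType}.
Implicit Types (f g : R -> R[i]) (a b c x k N : R) (w z : R[i]).

Definition ccont f := continuous (fun x => Re (f x)) /\ continuous (fun x => Im (f x)).

Definition cint a b f : R[i] :=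
  rint a b (fun x => Re (f x)) +i* rint a b (fun x => Im (f x)).

Lemma ccont_cst w : ccont (fun=> w).
Proof. by split => x; exact: cvg_cst. Qed.

Lemma ccontD f g : ccont f -> ccont g -> ccont (fun x => f x + g x).
Proof.
move=> [f1 f2] [g1 g2]; split.
  rewrite (_ : (fun x => _) = (fun x => Re (f x) + Re (g x))); last first.
    by apply/funext => x; rewrite raddfD.
  by move=> x; apply: cvgD; [exact: f1|exact: g1].
rewrite (_ : (fun x => _) = (fun x => Im (f x) + Im (g x))); last first.
  by apply/funext => x; rewrite raddfD.
by move=> x; apply: cvgD; [exact: f2|exact: g2].
Qed.

Lemma cReM w z : Re (w * z) = Re w * Re z - Im w * Im z.
Proof. by case: w; case: z. Qed.
Lemma cImM w z : Im (w * z) = Re w * Im z + Im w * Re z.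
Proof. by case: w; case: z. Qed.

Lemma ccontM f g : ccont f -> ccont g -> ccont (fun x => f x * g x).
Proof.
move=> [f1 f2] [g1 g2]; split.
  rewrite (_ : (fun x => _) = (fun x => Re (f x) * Re (g x) - Im (f x) * Im (g x))); last first.
    by apply/funext => x; rewrite cReM.
  move=> x; apply: cvgB; apply: cvgM; try exact: f1; try exact: g1; try exact: f2; exact: g2.
rewrite (_ : (fun x => _) = (fun x => Re (f x) * Im (g x) + Im (f x) * Re (g x))); last first.
  by apply/funext => x; rewrite cImM.
move=> x; apply: cvgD; apply: cvgM; try exact: f1; try exact: g1; try exact: f2; exact: g2.
Qed.

Lemma ccontZ w f : ccont f -> ccont (fun x => w * f x).
Proof. by move=> cf; apply: ccontM => //; exact: ccont_cst. Qed.

Lemma ccontN f : ccont f -> ccont (fun x => - f x).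
Proof.
move=> cf; rewrite (_ : (fun x => _) = (fun x => -1 * f x)); first exact: ccontZ.
by apply/funext => x; rewrite mulN1r.
Qed.

Lemma ccontB f g : ccont f -> ccont g -> ccont (fun x => f x - g x).
Proof. by move=> cf cg; apply: ccontD => //; exact: ccontN. Qed.

Lemma ccont_sum (I : Type) (r : seq I) (P : pred I) (f : I -> R -> R[i]) :
  (forall i, ccont (f i)) -> ccont (fun x => \sum_(i <- r | P i) f i x).
Proof.
move=> cf; elim: r => [|i r IH].
  rewrite (_ : (fun x => _) = (fun=> 0)); first exact: ccont_cst.
  by apply/funext => x; rewrite big_nil.
rewrite (_ : (fun x => _) = (fun x => (if P i then f i x else 0) + \sum_(j <- r | P j) f j x)).
  by apply: ccontD => //; case: (P i) => //; exact: ccont_cst.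
by apply/funext => x; rewrite big_cons; case: ifP; rewrite ?add0r.
Qed.

Lemma ccont_comp f (g : R -> R) : ccont f -> continuous g -> ccont (fun x => f (g x)).
Proof.
move=> [f1 f2] cg; split=> x.
  by apply: (@continuous_comp _ _ _ g (fun x => Re (f x))); [exact: cg|exact: f1].
by apply: (@continuous_comp _ _ _ g (fun x => Im (f x))); [exact: cg|exact: f2].
Qed.

Lemma continuous_affine k c : continuous (fun x : R => k * x + c).
Proof.
by move=> x; apply: cvgD; [apply: cvgM; [exact: cvg_cst|exact: cvg_id]|exact: cvg_cst].
Qed.

Lemma continuous_shift c : continuous (fun x : R => x + c).
Proof. by move=> x; apply: cvgD; [exact: cvg_id|exact: cvg_cst]. Qed.

Lemma eq_cint a b f g : f =1 g -> cint a b f = cint a b g.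
Proof. by move=> e; congr cint; apply/funext. Qed.

Lemma cintD a b f g : ccont f -> ccont g ->
  cint a b (fun x => f x + g x) = cint a b f + cint a b g.
Proof.
move=> [f1 f2] [g1 g2]; rewrite /cint; simpc.
by congr (_ +i* _); rewrite -rintD//; congr rint; apply/funext => x; rewrite raddfD.
Qed.

Lemma cintZ a b w f : ccont f -> cint a b (fun x => w * f x) = w * cint a b f.
Proof.
move=> [f1 f2]; case: w => u v; rewrite /cint; simpc.
have cm k (h : R -> R) : continuous h -> continuous (fun x => k * h x).
  by move=> ch x; apply: cvgM; [exact: cvg_cst|exact: ch].
congr (_ +i* _).
  rewrite -!rintZ// -rintN; last exact: cm.
  rewrite -rintD//; [|exact: cm|by move=> x; apply: cvgN; exact: cm].
  by congr rint; apply/funext => x; rewrite cReM.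
rewrite -!rintZ// -rintD//; [|exact: cm..].
by congr rint; apply/funext => x; rewrite cImM.
Qed.

Lemma cintN a b f : ccont f -> cint a b (fun x => - f x) = - cint a b f.
Proof. by move=> cf; rewrite -mulN1r -cintZ//; apply: eq_cint => x; rewrite mulN1r. Qed.

Lemma cintB a b f g : ccont f -> ccont g ->
  cint a b (fun x => f x - g x) = cint a b f - cint a b g.
Proof. by move=> cf cg; rewrite cintD ?cintN//; exact: ccontN. Qed.

Lemma cint0 a b : cint a b (fun=> 0) = 0.
Proof.
rewrite -[RHS](mul0r (cint a b (fun=> 0))) -cintZ; last exact: ccont_cst.
by apply: eq_cint => x; rewrite mul0r.
Qed.

Lemma cint_sum a b (I : Type) (r : seq I) (P : pred I) (f : I -> R -> R[i]) :
  (forall i, ccont (f i)) ->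
  cint a b (fun x => \sum_(i <- r | P i) f i x) = \sum_(i <- r | P i) cint a b (f i).
Proof.
move=> cf; elim: r => [|i r IH].
  by rewrite big_nil -[RHS](cint0 a b); apply: eq_cint => x; rewrite big_nil.
rewrite big_cons; case: ifP => Pi.
  rewrite -IH -cintD//; last exact: ccont_sum.
  by apply: eq_cint => x; rewrite big_cons Pi.
by rewrite -IH; apply: eq_cint => x; rewrite big_cons Pi.
Qed.

Lemma cint_cst a b w : a <= b -> cint a b (fun=> w) = w * (b - a)%:C.
Proof. by move=> ab; rewrite /cint !rint_cst//; case: w => u v; simpc. Qed.

Lemma cint_split a b c f : ccont f -> a <= b -> b <= c ->
  cint a c f = cint a b f + cint b c f.
Proof.
by move=> [f1 f2] ab bc; rewrite /cint (rint_split f1 ab bc) (rint_split f2 ab bc); simpc.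
Qed.

Lemma cint_affine a b k c f : ccont f -> a <= b -> 0 < k ->
  k%:C * cint a b (fun x => f (k * x + c)) = cint (k * a + c) (k * b + c) f.
Proof.
move=> [f1 f2] ab k0; rewrite /cint -(rint_affine c f1 ab k0) -(rint_affine c f2 ab k0).
by simpc.
Qed.

Lemma cint_shift a b c f : ccont f -> a <= b ->
  cint a b (fun x => f (x + c)) = cint (a + c) (b + c) f.
Proof.
move=> [f1 f2] ab; rewrite /cint.
by rewrite (rint_shift c f1 ab) (rint_shift c f2 ab).
Qed.

Lemma cint_periodic N c f : 0 <= N -> ccont f -> (forall x, f (x + N) = f x) ->
  cint c (c + N) f = cint 0 N f.
Proof. by move=> N0 [f1 f2] pf; rewrite /cint !rint_periodic// => x; rewrite pf. Qed.

Lemma cint_FTC a b f (F G : R -> R) : ccont f -> a <= b ->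
  (forall x, a <= x <= b -> is_derive x 1 F (Re (f x))) ->
  (forall x, a <= x <= b -> is_derive x 1 G (Im (f x))) ->
  cint a b f = (F b - F a) +i* (G b - G a).
Proof.
by move=> [f1 f2] ab dF dG; rewrite /cint (rint_FTC f1 ab dF) (rint_FTC f2 ab dG).
Qed.

Lemma normc_Re w : Re w <= normc w.
Proof.
case: w => u v /=; apply: (le_trans (ler_norm _)).
by rewrite -sqrtr_sqr ler_wsqrtr// lerDl sqr_ge0.
Qed.

Lemma normc_ge0 w : 0 <= normc w. Proof. by case: w => u v; exact: sqrtr_ge0. Qed.

Lemma normc_le_ReIm w : normc w <= `|Re w| + `|Im w|.
Proof.
case: w => u v /=; rewrite -[leRHS]ger0_norm ?addr_ge0// -sqrtr_sqr ler_wsqrtr//.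
by rewrite sqrrD !real_normK ?num_real// addrAC lerDl mulrn_wge0// mulr_ge0.
Qed.

Lemma normc_ge_Re w : `|Re w| <= normc w.
Proof. by case: w => u v /=; rewrite -sqrtr_sqr ler_wsqrtr// lerDl sqr_ge0. Qed.

Lemma normc_ge_Im w : `|Im w| <= normc w.
Proof. by case: w => u v /=; rewrite -sqrtr_sqr ler_wsqrtr// lerDr sqr_ge0. Qed.

Lemma normcD w z : normc (w + z) <= normc w + normc z.
Proof. exact: (@le_normcD R w z). Qed.

Lemma normcM w z : normc (w * z) = normc w * normc z.
Proof. exact: Normc.normcM. Qed.

Lemma normc_conj w : normc (w^*)%C = normc w.
Proof. by case: w => u v /=; rewrite sqrrN. Qed.

Lemma normc_real (u : R) : normc (u%:C) = `|u|.
Proof. by rewrite /= expr0n /= addr0 sqrtr_sqr. Qed.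

Lemma mul_conj w : w * (w^*)%C = ((normc w) ^+ 2)%:C.
Proof.
case: w => u v; rewrite [LHS]/= [normc _]/= sqr_sqrtr ?addr_ge0 ?sqr_ge0//.
by simpc; congr (_ +i* _); ring.
Qed.

Lemma normc_cint_le a b f (M : R -> R) : ccont f -> continuous M ->
  (forall x, a <= x <= b -> normc (f x) <= M x) -> normc (cint a b f) <= rint a b M.
Proof.
move=> cf cM fM; set I := cint a b f.
have M0 : 0 <= rint a b M.
  by apply: rint_ge0 => x /fM; apply: le_trans; exact: normc_ge0.
have [->|I0] := eqVneq (normc I) 0; first by [].
have Ip : 0 < normc I by rewrite lt_def I0 normc_ge0.
(* Multiplying by the conjugate of the integral makes the integral real and nonnegative, so that
   only real parts have to be compared. *)
pose w := (I^*)%C.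
have : Re (cint a b (fun x => w * f x)) <= rint a b (fun x => normc I * M x).
  have cwf := ccontZ w cf; apply: rint_le; first exact: cwf.1.
    by move=> x; apply: cvgM; [exact: cvg_cst|exact: cM].
  move=> x /fM fx; apply: (le_trans (normc_Re _)).
  by rewrite normcM normc_conj ler_pM2l.
by rewrite cintZ// -/I mulrC mul_conj /= rintZ// expr2 ler_pM2l.
Qed.

Lemma normc_cint_cst a b f (M : R) : ccont f -> a <= b ->
  (forall x, a <= x <= b -> normc (f x) <= M) -> normc (cint a b f) <= M * (b - a).
Proof.
move=> cf ab fM; rewrite -(rint_cst M ab); apply: normc_cint_le => //.
by move=> x; exact: cvg_cst.
Qed.
End ComplexIntegral.

Section Characters.
Context {R : realType}.
Implicit Types (t x k c N : R) (z w : R[i]).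

Definition ee t : R[i] := cos (2 * pi * t) +i* sin (2 * pi * t).

Lemma ee0 : ee 0 = 1. Proof. by rewrite /ee mulr0 cos0 sin0. Qed.

Lemma eeD t x : ee (t + x) = ee t * ee x.
Proof. by rewrite /ee mulrDr cosD sinD; simpc; congr (_ +i* _); ring. Qed.

Lemma eeN t : ee (- t) = (ee t)^*%C.
Proof. by rewrite /ee mulrN cosN sinN. Qed.

Lemma normc_ee t : normc (ee t) = 1.
Proof. by rewrite /= cos2Dsin2 sqrtr1. Qed.

Lemma eeNK t : ee t * ee (- t) = 1.
Proof. by rewrite -eeD subrr ee0. Qed.

Lemma ee1 : ee 1 = 1.
Proof. by rewrite /ee mulr1 mulr_natl cos2pi sin2pi. Qed.

Lemma ee_nat (n : nat) : ee n%:R = 1.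
Proof. by elim: n => [|n IH]; rewrite ?ee0// -addn1 natrD eeD IH ee1 mulr1. Qed.

Lemma ee_int (n : int) : ee n%:~R = 1.
Proof.
case: (intP n) => [|m|m]; rewrite ?ee0//; first exact: ee_nat.
by rewrite rmorphN /= eeN ee_nat rmorph1.
Qed.

Lemma ee_half : ee (1 / 2) = -1.
Proof. by rewrite /ee (_ : 2 * pi * (1 / 2) = pi) ?cospi ?sinpi; [simpc|field]. Qed.

Lemma ccont_ee k c : ccont (fun x => ee (k * x + c)).
Proof.
split=> x.
  apply: (@continuous_comp _ _ _ (fun x => 2 * pi * (k * x + c)) cos); last exact: continuous_cos.
  by apply: cvgM; [exact: cvg_cst|exact: continuous_affine].
apply: (@continuous_comp _ _ _ (fun x => 2 * pi * (k * x + c)) sin); last exact: continuous_sin.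
by apply: cvgM; [exact: cvg_cst|exact: continuous_affine].
Qed.
End Characters.
Arguments ee : simpl never.

Section Fourier.
Context {R : realType}.
Variable N : R.
Hypothesis N0 : 0 < N.
Implicit Types (f g h : R -> R[i]) (x : R) (j k : int) (w : R[i]).

Definition ech j x : R[i] := ee (j%:~R / N * x).
Arguments ech : simpl never.

Lemma ccont_ech j : ccont (ech j).
Proof.
have := ccont_ee (j%:~R / N) 0; rewrite (_ : (fun x => _) = ech j)//.
by apply/funext => x; rewrite addr0.
Qed.

Lemma echD j k x : ech (j + k) x = ech j x * ech k x.
Proof. by rewrite /ech -eeD; congr ee; rewrite rmorphD /=; ring. Qed.

Lemma echN j x : ech (- j) x = (ech j x)^*%C.
Proof. by rewrite /ech -eeN; congr ee; rewrite rmorphN /=; ring. Qed.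

Lemma ech0 x : ech 0 x = 1. Proof. by rewrite /ech mul0r mul0r ee0. Qed.

Lemma ech_addx j x y : ech j (x + y) = ech j x * ech j y.
Proof. by rewrite /ech mulrDr eeD. Qed.

Lemma normc_ech j x : normc (ech j x) = 1. Proof. exact: normc_ee. Qed.

Lemma ech_period j x : ech j (x + N) = ech j x.
Proof. by rewrite ech_addx {2}/ech mulfVK ?gt_eqF// ee_int mulr1. Qed.

Definition inp f g : R[i] := (N^-1)%:C * cint 0 N (fun x => f x * (g x)^*%C).

Definition fc f j : R[i] := inp f (ech j).

Lemma ccont_conj f : ccont f -> ccont (fun x => (f x)^*%C).
Proof.
move=> [f1 f2]; split.
  by rewrite (_ : (fun x => _) = (fun x => Re (f x)))//; apply/funext => x; case: (f x).
rewrite (_ : (fun x => _) = (fun x => - Im (f x))); last by apply/funext => x; case: (f x).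
by move=> x; apply: cvgN; exact: f2.
Qed.

Lemma ccont_inp f g : ccont f -> ccont g -> ccont (fun x => f x * (g x)^*%C).
Proof. by move=> cf cg; apply: ccontM => //; exact: ccont_conj. Qed.

Lemma inpBl f g h : ccont f -> ccont g -> ccont h ->
  inp (fun x => f x - g x) h = inp f h - inp g h.
Proof.
move=> cf cg ch; rewrite /inp -mulrBr -cintB; try exact: ccont_inp.
by congr (_ * _); apply: eq_cint => x; rewrite mulrBl.
Qed.

Lemma inpBr f g h : ccont f -> ccont g -> ccont h ->
  inp h (fun x => f x - g x) = inp h f - inp h g.
Proof.
move=> cf cg ch; rewrite /inp -mulrBr -cintB; try exact: ccont_inp.
by congr (_ * _); apply: eq_cint => x; rewrite rmorphB mulrBr.
Qed.

Lemma inpZl w f h : ccont f -> ccont h -> inp (fun x => w * f x) h = w * inp f h.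
Proof.
move=> cf ch; rewrite /inp mulrCA -(cintZ _ _ _ (ccont_inp cf ch)).
by congr (_ * _); apply: eq_cint => x; rewrite mulrA.
Qed.

Lemma inp_conj f g : ccont f -> ccont g -> (inp f g)^*%C = inp g f.
Proof.
move=> cf cg; rewrite /inp rmorphM /=; congr (_ * _).
  by rewrite oppr0.
rewrite /cint /= -rintN; last exact: (ccont_inp cf cg).2.
congr (_ +i* _); congr rint; apply/funext => x.
  by case: (f x) => a b; case: (g x) => c d /=; ring.
by case: (f x) => a b; case: (g x) => c d /=; ring.
Qed.

Lemma inp_suml (r : seq int) (c : int -> R[i]) (e : int -> R -> R[i]) h :
  (forall j, ccont (e j)) -> ccont h ->
  inp (fun x => \sum_(j <- r) c j * e j x) h = \sum_(j <- r) c j * inp (e j) h.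
Proof.
move=> ce ch; rewrite /inp (@eq_cint _ _ _ _ (fun x => \sum_(j <- r) c j * (e j x * (h x)^*%C))).
  rewrite cint_sum; last by move=> j; apply: ccontZ; exact: ccont_inp.
  rewrite big_distrr /=; apply: eq_bigr => j _; rewrite cintZ; last exact: ccont_inp.
  by rewrite mulrCA.
by move=> x; rewrite big_distrl /=; apply: eq_bigr => j _; rewrite mulrA.
Qed.

Lemma inp_ge0 f : ccont f ->
  inp f f = (N^-1 * rint 0 N (fun x => normc (f x) ^+ 2))%:C.
Proof.
move=> cf; rewrite /inp.
have -> : cint 0 N (fun x => f x * (f x)^*%C) = (rint 0 N (fun x => normc (f x) ^+ 2))%:C.
  rewrite /cint; congr (_ +i* _).
    by congr rint; apply/funext => x; rewrite mul_conj.
  rewrite -[RHS](mul0r (N - 0)) -rint_cst ?ltW//; congr rint; apply/funext => x.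
  by rewrite mul_conj.
by simpc.
Qed.

(** Shifting by half a period of the character changes its sign but not its integral over [0, N]. *)
Lemma cint_ech j : j != 0 -> cint 0 N (ech j) = 0.
Proof.
move=> j0; pose c := N / (2 * j%:~R).
have jR : (j%:~R : R) != 0 by rewrite intr_eq0.
have : cint 0 N (fun x => ech j (x + c)) = cint 0 N (ech j).
  rewrite cint_shift; [|exact: ccont_ech|exact: ltW].
  rewrite add0r addrC cint_periodic//; [exact: ltW|exact: ccont_ech|exact: ech_period].
rewrite (@eq_cint _ _ _ _ (fun x => ech j c * ech j x)); last by move=> x; rewrite ech_addx mulrC.
rewrite cintZ; last exact: ccont_ech.
have -> : ech j c = -1.
  rewrite -ee_half /ech /c; congr ee; field.
  by rewrite jR gt_eqF.
move=> /eqP; rewrite mulN1r -subr_eq0 -opprD oppr_eq0 -mulr2n mulrn_eq0 /=.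
by move/eqP.
Qed.

Lemma inp_ech j k : inp (ech j) (ech k) = (j == k)%:R.
Proof.
rewrite /inp (@eq_cint _ _ _ _ (ech (j - k))); last by move=> x; rewrite echD echN.
have [->|jk] := eqVneq j k; last by rewrite cint_ech ?mulr0// subr_eq0.
rewrite subrr (@eq_cint _ _ _ _ (fun=> 1)); last by move=> x; rewrite ech0.
rewrite cint_cst ?ltW// mul1r subr0 -rmorphM /= mulVf ?gt_eqF//.
Qed.

Definition psum (r : seq int) f x : R[i] := \sum_(j <- r) fc f j * ech j x.

Lemma ccont_psum r f : ccont (psum r f).
Proof. by apply: ccont_sum => j; apply: ccontZ; exact: ccont_ech. Qed.

Lemma fc_psum r f k : uniq r -> fc (psum r f) k = if k \in r then fc f k else 0.
Proof.
move=> ur; rewrite /fc inp_suml; [|exact: ccont_ech|exact: ccont_ech].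
rewrite (eq_bigr (fun j => if j == k then fc f j else 0)); last first.
  by move=> j _; rewrite inp_ech; case: eqP => _; rewrite ?mulr1 ?mulr0.
rewrite -big_mkcond /=; case: ifPn => kr.
  by rewrite -big_filter filter_pred1_uniq// big_seq1.
rewrite big_seq_cond big1// => j /andP[jr /eqP jk]; by rewrite -jk jr in kr.
Qed.

Lemma inp_psum r f g : ccont f -> ccont g ->
  inp (psum r f) g = \sum_(j <- r) fc f j * (fc g j)^*%C.
Proof.
move=> cf cg; rewrite inp_suml//; last exact: ccont_ech.
by apply: eq_bigr => j _; rewrite /fc inp_conj//; exact: ccont_ech.
Qed.

Lemma bessel r f : uniq r -> ccont f ->
  \sum_(j <- r) normc (fc f j) ^+ 2 <= N^-1 * rint 0 N (fun x => normc (f x) ^+ 2).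
Proof.
move=> ur cf; have cS := ccont_psum r f.
have ch := ccontB cf cS.
have h0 : inp (fun x => f x - psum r f x) (psum r f) = 0.
  rewrite -inp_conj// inp_psum//.
  rewrite big_seq big1 ?rmorph0// => j jr.
  rewrite /fc inpBl//; last exact: ccont_ech.
  by rewrite -!/(fc _ j) fc_psum// jr subrr rmorph0 mulr0.
have : inp (fun x => f x - psum r f x) (fun x => f x - psum r f x) =
   inp f f - \sum_(j <- r) (normc (fc f j) ^+ 2)%:C.
  rewrite inpBr// h0 subr0.
  rewrite inpBl// inp_psum//; congr (_ - _).
  by apply: eq_bigr => j _; rewrite mul_conj.
rewrite !inp_ge0// -rmorph_sum -rmorphB /= => -[e].
rewrite -subr_ge0 -e mulr_ge0//; first by rewrite invr_ge0 ltW.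
by apply: rint_ge0 => x _; exact: sqr_ge0.
Qed.

Lemma bin_center_step (n m : nat) : (m < n)%N -> ('C(n.*2, m) <= 'C(n.*2, m.+1))%N.
Proof.
move=> mn; rewrite -(leq_pmul2l (ltn0Sn m)) mul_bin_left leq_mul2r; apply/orP; right.
by rewrite -addnn; lia.
Qed.

Lemma bin_center_le (n m : nat) : ('C(n.*2, m) <= 'C(n.*2, n))%N.
Proof.
have H (k : nat) : (k <= n)%N -> ('C(n.*2, n - k) <= 'C(n.*2, n))%N.
  elim: k => [|k IH] kn; first by rewrite subn0.
  apply: leq_trans (IH (ltnW kn)).
  by rewrite -(subnSK kn); apply: bin_center_step; lia.
have [mn|nm] := leqP m n; first by rewrite -(subKn mn); apply: H; exact: leq_subr.
have [m2|m2] := leqP m n.*2; last by rewrite bin_small.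
rewrite -bin_sub//; have -> : (n.*2 - m = n - (m - n))%N by rewrite -addnn; lia.
by apply: H; rewrite -addnn in m2 *; lia.
Qed.

(* The powers of [Tk] are a nonnegative approximate identity. *)
Definition Tk t : R := (1 + cos (2 * pi * t)) / 2.

Lemma Tk_ge0 t : 0 <= Tk t.
Proof. by rewrite /Tk; have := cos_geN1 (2 * pi * t); lra. Qed.

Lemma Tk_ee t : (Tk t)%:C = (1 + ee t) ^+ 2 * ee (- t) / 4 :> R[i].
Proof.
have -> : (1 + ee t) ^+ 2 * ee (- t) = ee t + ee (- t) + 2.
  have e := eeNK t.
  have -> : (1 + ee t) ^+ 2 * ee (- t) = ee (- t) + 2 * (ee t * ee (- t)) + ee t * (ee t * ee (- t)) by ring.
  by rewrite e; ring.
apply: (mulIf (x := (4 : R)%:C)); first by rewrite eq_complex /= eqxx andbT pnatr_eq0.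
have e4 : (4 : R)%:C = 4 :> R[i] by rewrite rmorph_nat.
have e2 : (2 : R[i]) = 2%:C by rewrite rmorph_nat.
rewrite {2}e4 divfK; last by rewrite pnatr_eq0.
rewrite e2 eeN /ee /Tk; simpc; congr (_ +i* _); last by lra.
Qed.

Lemma Tk_pow n t : ((Tk t) ^+ n)%:C =
  \sum_(m < n.*2.+1) (('C(n.*2, m)%:R / 4 ^+ n)%:C) * ee ((m%:R - n%:R) * t) :> R[i].
Proof.
have -> : (Tk t ^+ n)%:C = ((Tk t)%:C) ^+ n by rewrite rmorphXn.
rewrite Tk_ee 2!exprMn -exprM mul2n exprDn.
rewrite big_distrl big_distrl /=; apply: eq_bigr => m _.
rewrite expr1n mul1r.
have eX (k : nat) s : ee s ^+ k = ee (k%:R * s) :> R[i].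
  by elim: k => [|k IH]; rewrite ?expr0 ?mul0r ?ee0// exprS IH -eeD; congr ee; rewrite -natr1; ring.
rewrite !eX mulrBl eeD.
have -> : ee (n%:R * - t) = ee (- (n%:R * t)) :> R[i] by rewrite mulrN.
rewrite rmorphM /= rmorph_nat fmorphV rmorphXn /= rmorph_nat.
by rewrite -[_ *+ 'C(_, _)]mulr_natr exprVn; ring.
Qed.

Lemma Tk_sum n t x0 : ((Tk ((t - x0) / N)) ^+ n)%:C =
  \sum_(m < n.*2.+1) ('C(n.*2, m)%:R / 4 ^+ n)%:C * ech (n%:Z - m%:Z) x0 * (ech (n%:Z - m%:Z) t)^*%C.
Proof.
rewrite Tk_pow; apply: eq_bigr => m _; rewrite -mulrA; congr (_ * _).
rewrite -echN opprB /ech -eeD; congr ee.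
by rewrite !rmorphB /=; ring.
Qed.

Lemma continuous_Tk n x0 : continuous (fun x => Tk ((x - x0) / N) ^+ n).
Proof.
move=> x; apply: (@continuous_comp _ _ _ (fun x => Tk ((x - x0) / N)) (fun y => y ^+ n)); last exact: exprn_continuous.
apply: cvgM; last exact: cvg_cst.
apply: cvgD; first exact: cvg_cst.
apply: (@continuous_comp _ _ _ (fun x => 2 * pi * ((x - x0) / N)) cos); last exact: continuous_cos.
apply: cvgM; first exact: cvg_cst.
by apply: cvgM; [apply: cvgB; [exact: cvg_id|exact: cvg_cst]|exact: cvg_cst].
Qed.

Definition Tmean n : R := 'C(n.*2, n)%:R / 4 ^+ n.

Lemma Tmean_gt0 n : 0 < Tmean n.
Proof. by rewrite divr_gt0 ?exprn_gt0// ltr0n bin_gt0 -addnn leq_addr. Qed.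

(** The central binomial coefficient is the largest of the 2n + 1 coefficients whose sum is 4^n. So
    the mean of the kernel decays only polynomially in n, while away from [x0] the kernel decays
    exponentially. *)
Lemma Tmean_ge n : 1 <= Tmean n * (n.*2.+1)%:R.
Proof.
rewrite /Tmean mulrAC ler_pdivlMr ?exprn_gt0// mul1r -natrM -[4]/(4%:R) -natrX ler_nat.
rewrite -[4%N]/(2 ^ 2)%N -expnM mul2n -[2%N]/(1 + 1)%N expnDn.
apply: (@leq_trans (\sum_(i < n.*2.+1) 'C(n.*2, n))).
  by apply: leq_sum => i _; rewrite !exp1n !muln1; exact: bin_center_le.
by rewrite sum_nat_const card_ord mulnC.
Qed.

Lemma inp_Tk n f x0 : ccont f ->
  (N^-1)%:C * cint 0 N (fun t => f t * ((Tk ((t - x0) / N)) ^+ n)%:C) =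
  \sum_(m < n.*2.+1) ('C(n.*2, m)%:R / 4 ^+ n)%:C * ech (n%:Z - m%:Z) x0 * fc f (n%:Z - m%:Z).
Proof.
move=> cf.
rewrite (@eq_cint _ _ _ _ (fun t => \sum_(m < n.*2.+1) ('C(n.*2, m)%:R / 4 ^+ n)%:C *
    ech (n%:Z - m%:Z) x0 * (f t * (ech (n%:Z - m%:Z) t)^*%C))); last first.
  move=> t; rewrite Tk_sum big_distrr /=; apply: eq_bigr => m _; exact: mulrCA.
rewrite cint_sum; last by move=> m; apply: ccontZ; apply: ccont_inp => //; exact: ccont_ech.
rewrite big_distrr /=; apply: eq_bigr => m _.
by rewrite (cintZ _ _ _ (ccont_inp cf (ccont_ech _))) mulrCA.
Qed.

Lemma rint_Tk n x0 : rint 0 N (fun t => Tk ((t - x0) / N) ^+ n) = N * Tmean n.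
Proof.
have e1 : (fun=> 1) = ech 0 by apply/funext => x; exact/esym/ech0.
have := @inp_Tk n (fun=> 1) x0 (ccont_cst 1).
rewrite (@eq_cint _ _ _ _ (fun t => ((Tk ((t - x0) / N)) ^+ n)%:C)); last by move=> t; rewrite mul1r.
have nn : (n < n.*2.+1)%N by rewrite ltnS -addnn leq_addr.
rewrite (bigD1 (Ordinal nn)) //= subrr ech0 mulr1 big1 ?addr0; last first.
  move=> m mn; have nm : n%:Z - m%:Z != 0.
    apply: contra mn; rewrite subr_eq0 => /eqP[e]; exact/eqP/val_inj.
  have -> : fc (fun=> 1) (n%:Z - m%:Z) = inp (ech 0) (ech (n%:Z - m%:Z)).
    by rewrite /fc e1.
  by rewrite inp_ech eq_sym (negbTE nm) mulr0.
have -> : fc (fun=> 1) 0 = 1.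
  by rewrite /fc e1 inp_ech eqxx.
rewrite mulr1 => e.
have ce : cint 0 N (fun t => (Tk ((t - x0) / N) ^+ n)%:C) = (rint 0 N (fun t => Tk ((t - x0) / N) ^+ n))%:C.
  by rewrite /cint; congr (_ +i* _); rewrite (rint_cst 0 (ltW N0)) mul0r.
move: e; rewrite ce => -[+ _]; rewrite mul0r subr0 -/(Tmean n) => <-.
by rewrite mulrA divff ?mul1r//; exact: lt0r_neq0.
Qed.

Lemma ccont_near f x0 (e : R) : ccont f -> 0 < e ->
  exists2 d : R, 0 < d & forall x, `|x - x0| < d -> normc (f x - f x0) <= e.
Proof.
move=> [c1 c2] e0; have e2 : 0 < e / 2 by rewrite divr_gt0.
have /cvgrPdist_lt/(_ _ e2)/nbhs_ballP[d1 /= d10 h1] := c1 x0.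
have /cvgrPdist_lt/(_ _ e2)/nbhs_ballP[d2 /= d20 h2] := c2 x0.
exists (Num.min d1 d2); first by rewrite lt_min d10.
move=> x; rewrite lt_min distrC => /andP[/h1 h1x /h2 h2x].
apply: le_trans (normc_le_ReIm _) _; rewrite !raddfB /=.
by rewrite ![`|_ - _ (f x0)|]distrC; lra.
Qed.

Lemma ccont_bounded f a b : ccont f -> a <= b ->
  exists M : R, forall x, a <= x <= b -> normc (f x) <= M.
Proof.
move=> [c1 c2] ab.
have cg : continuous (fun x => `|Re (f x)| + `|Im (f x)|).
  move=> x; apply: cvgD; apply: cvg_norm; [exact: c1|exact: c2].
have [c _ cM] := @EVT_max R _ a b ab (continuous_subspaceT cg).
exists (`|Re (f c)| + `|Im (f c)|) => x xab; apply: le_trans (cM x _); last by rewrite in_itv.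
exact: normc_le_ReIm.
Qed.

Definition zr (K : nat) : seq int := [seq K%:Z - m%:Z | m <- iota 0 K.*2.+1].

Lemma uniq_zr K : uniq (zr K).
Proof.
rewrite map_inj_uniq ?iota_uniq// => m n /addrI /oppr_inj; by case.
Qed.

Lemma mem_zr K j : (j \in zr K) = (`|j| <= K)%N.
Proof.
apply/mapP/idP => [[m]|jK]; first by rewrite mem_iota -addnn => h ->; lia.
exists (`|K%:Z - j|)%N; first by rewrite mem_iota -addnn; lia.
lia.
Qed.

Lemma big_zr (V : nmodType) K (G : int -> V) :
  \sum_(j <- zr K) G j = \sum_(m < K.*2.+1) G (K%:Z - m%:Z).
Proof. by rewrite /zr big_map -[iota 0 _]/(index_iota 0 K.*2.+1) big_mkord. Qed.

Lemma sum_zr K (G : nat -> R) :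
  \sum_(j <- zr K) G `|j|%N = G 0 + 2 * \sum_(i < K) G i.+1.
Proof.
rewrite big_zr -(big_mkord xpredT (fun m => G (`|K%:Z - m%:Z|%N))).
rewrite (big_cat_nat _ (n := K)) //=; last by rewrite -addnn; lia.
rewrite [X in _ + X]big_nat_recl//; last by rewrite -addnn; lia.
have -> : \sum_(0 <= i < K) G `|K%:Z - i%:Z|%N = \sum_(i < K) G i.+1.
  rewrite big_nat_rev /= add0n big_mkord; apply: eq_bigr => i _.
  by have := ltn_ord i => iK; apply: (congr1 G); lia.
have -> : \sum_(K <= i < K.*2) G `|K%:Z - i.+1%:Z|%N = \sum_(i < K) G i.+1.
  rewrite -{1}[K]add0n big_addn (_ : (K.*2 - K = K)%N); last by rewrite -addnn; lia.
  by rewrite big_mkord; apply: eq_bigr => i _; apply: (congr1 G); lia.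
rewrite subrr absz0; ring.
Qed.

Lemma inv_sq_tail (J K : nat) : (0 < J)%N ->
  \sum_(J <= i < K) ((i.+1%:R : R) ^+ 2)^-1 <= (J%:R)^-1.
Proof.
move=> J0; have [KJ|JK] := leqP K J; first by rewrite big_geq// invr_ge0.
suff : \sum_(J <= i < K) ((i.+1%:R : R) ^+ 2)^-1 <= (J%:R)^-1 - (K%:R)^-1.
  move/le_trans; apply; by rewrite gerBl invr_ge0.
elim: K JK => // K IH; rewrite ltnS leq_eqVlt => /predU1P[<-|JK].
  rewrite big_nat1 -subr_ge0.
  have -> : (J%:R)^-1 - (J.+1%:R)^-1 - (J.+1%:R ^+ 2)^-1 = (J%:R * J.+1%:R ^+2)^-1 :> R.
    rewrite -natr1; field; rewrite natr1 !pnatr_eq0 /=; lia.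
  by rewrite invr_ge0 mulr_ge0// sqr_ge0.
rewrite big_nat_recr/=; last exact: ltnW.
have := IH JK; move: (\sum_(_ <= _ < _) _) => s hs.
have : 0 <= (K%:R)^-1 - (K.+1%:R)^-1 - (K.+1%:R ^+ 2)^-1 :> R.
  have -> : (K%:R)^-1 - (K.+1%:R)^-1 - (K.+1%:R ^+ 2)^-1 = (K%:R * K.+1%:R ^+2)^-1 :> R.
    rewrite -natr1; field; rewrite natr1 !pnatr_eq0 /=; lia.
  by rewrite invr_ge0 mulr_ge0// sqr_ge0.
move: hs; move: (J%:R^-1) (K%:R^-1) (K.+1%:R^-1) (K.+1%:R ^- 2) => u v w t; lra.
Qed.

Lemma sum_zr_tail (J K : nat) : (0 < J)%N ->
  \sum_(j <- zr K | (J < `|j|)%N) ((`|j|%N%:R : R) ^+ 2)^-1 <= 2 / J%:R.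
Proof.
move=> J0; rewrite big_mkcond.
have := sum_zr K (fun i => if (J < i)%N then ((i%:R : R) ^+ 2)^-1 else 0).
move=> ->; rewrite ltn0 add0r ler_pM2l// -(big_mkord xpredT (fun i => if (J < i.+1)%N then ((i.+1%:R : R) ^+ 2)^-1 else 0)).
have [KJ|JK] := leqP K J.
  rewrite big_nat_cond big1 ?invr_ge0// => i /andP[/andP[_ iK] _]; case: ifP => //; lia.
rewrite (big_cat_nat _ (n := J)) //=; last exact: ltnW.
rewrite big_nat_cond big1 ?add0r; last by move=> i /andP[/andP[_ iK] _]; case: ifP => //; lia.
apply: le_trans (inv_sq_tail K J0).
rewrite big_nat_cond [leRHS]big_nat_cond; apply: ler_sum => i /andP[/andP[Ji _] _].
by rewrite ltnS Ji.
Qed.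

(** With s the square root of r, one factor s^n keeps n s^n bounded (compare with the geometric sum)
    and the other one tends to 0. *)
Lemma pow_small (r e : R) : 0 <= r -> r < 1 -> 0 < e -> exists n : nat, (n.*2.+1)%:R * r ^+ n <= e.
Proof.
move=> r0 r1 e0; pose s := Num.sqrt r.
have s0 : 0 <= s by exact: sqrtr_ge0.
have s1 : s < 1 by rewrite -sqrtr1 ltr_sqrt.
have ss : s ^+ 2 = r by rewrite sqr_sqrtr.
have hs : 0 < 1 - s by rewrite subr_gt0.
have nb n : n%:R * s ^+ n <= (1 - s)^-1.
  have e1 : (1 - s) * \sum_(i < n) s ^+ i = 1 - s ^+ n.
    by rewrite -{2}(expr1n _ n) subrXX; congr (_ * _); apply: eq_bigr => i _; rewrite expr1n mul1r.
  have e2 : n%:R * s ^+ n <= \sum_(i < n) s ^+ i.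
    have -> : n%:R * s ^+ n = \sum_(i < n) s ^+ n by rewrite sumr_const card_ord mulr_natl.
    apply: ler_sum => i _.
    exact: (ler_wiXn2l s0 (ltW s1) (ltnW (ltn_ord i))).
  apply: le_trans e2 _; rewrite -[leRHS]mul1r ler_pdivlMr// mulrC e1.
  by rewrite gerBl exprn_ge0.
pose A := 2 * (1 - s)^-1 + 1.
have A0 : 0 < A by rewrite ltr_wpDl// mulr_ge0// invr_ge0 ltW.
have : \forall n \near \oo, s ^+ n < e / A.
  have /cvgr0Pnorm_lt/(_ (e / A)) : s ^+ n @[n --> \oo] --> 0.
    by apply: cvg_expr; rewrite ger0_norm.
  rewrite divr_gt0// => /(_ isT); apply: filterS => n.
  by rewrite ger0_norm// exprn_ge0.
case=> n _ /(_ n (leqnn n)) /= sn; exists n.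
have -> : r ^+ n = s ^+ n * s ^+ n by rewrite -ss expr2 exprMn.
rewrite mulrA.
apply: (@le_trans _ _ (A * s ^+ n)); last by rewrite mulrC -ler_pdivlMr// ltW.
apply: ler_wpM2r; first exact: exprn_ge0.
rewrite -natr1 mulrDl mul1r /A -muln2 natrM -mulrA [X in X + _ <= _](_ : _ = 2 * (n%:R * s ^+ n)); last by ring.
by apply: lerD; [rewrite ler_pM2l|rewrite exprn_ile1// ltW].
Qed.

Lemma normc_sum (I : Type) (r : seq I) (P : pred I) (F : I -> R[i]) :
  normc (\sum_(i <- r | P i) F i) <= \sum_(i <- r | P i) normc (F i).
Proof.
elim/big_rec2 : _ => [|i x y _ h]; first by rewrite Normc.normc0.
by apply: le_trans (normcD _ _) _; rewrite lerD2l.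
Qed.

Lemma Tk_far x0 (d : R) : 0 < d -> d < N / 2 -> exists2 r : R, 0 <= r < 1 &
  forall x, d <= `|x - x0| <= N / 2 -> Tk ((x - x0) / N) <= r.
Proof.
move=> d0 dN; have p0 := @pi_gt0 R; pose th := 2 * pi * (d / N).
have dN0 : 0 < d / N by rewrite divr_gt0.
have dN2 : d / N < 1 / 2 by rewrite ltr_pdivrMr//; lra.
have th0 : 0 < th by rewrite /th; do 2 apply: mulr_gt0 => //.
have thp : th < pi by rewrite /th; nra.
exists (Tk (d / N)).
  rewrite Tk_ge0 /=; have : cos th < 1.
    by rewrite -(@cos0 R) ltr_cos ?in_itv /= ?lexx ?(ltW th0) ?(ltW thp) ?(ltW p0).
  by rewrite /Tk -/th; lra.
move=> x /andP[dx xN]; rewrite /Tk ler_pM2r ?invr_gt0// lerD2l.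
rewrite -(cos_norm (2 * pi * ((x - x0) / N))).
have -> : `|2 * pi * ((x - x0) / N)| = 2 * pi * (`|x - x0| / N).
  rewrite !normrM normfV (gtr0_norm N0) (gtr0_norm p0) ger0_norm//.
have h1 : d / N <= `|x - x0| / N by rewrite ler_pM2r ?invr_gt0.
have h2 : `|x - x0| / N <= 1 / 2 by rewrite ler_pdivrMr//; lra.
rewrite leNgt ltr_cos -?leNgt ?in_itv /=.
- by rewrite !ler_pM2l ?mulr_gt0.
- by apply/andP; split; nra.
- by rewrite -/th (ltW th0) (ltW thp).
Qed.

(* Averaging [f] against the kernel recovers [f x0]; only the frequencies
   outside the window contribute, each with weight at most that of frequency 0. *)
Lemma kernel_bound f x0 (J : nat) (B : R) : (0 < J)%N -> ccont f ->
  (forall x, f (x + N) = f x) ->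
  (forall j : int, (`|j| <= J)%N -> fc f j = 0) ->
  (forall j : int, j != 0 -> normc (fc f j) <= B / (`|j|%N%:R) ^+ 2) ->
  normc (f x0) <= 2 * B / J%:R.
Proof.
move=> J0 cf pf fc0 fcB; apply/ler_addgt0Pl => e e0.
have e2 : 0 < e / 2 by rewrite divr_gt0.
have [d0 d00 near_x0] := ccont_near x0 cf e2.
pose d := Num.min d0 (N / 4).
have dp : 0 < d by rewrite lt_min d00 divr_gt0.
have dN : d < N / 2 by rewrite gt_min; apply/orP; right; have := N0; lra.
have [r /andP[r0 r1] far] := Tk_far x0 dp dN.
(* The period is centred at [x0], so that [Tk_far] covers everything at distance at least [d]. *)
pose c := x0 - N / 2.
have cN : c <= c + N by rewrite lerDl ltW.
have cdf : ccont (fun t => f x0 - f t) by apply: ccontB => //; exact: ccont_cst.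
have [M0 hM0] := ccont_bounded cdf cN.
pose M := Num.max M0 0; have M00 : 0 <= M by rewrite le_max lexx orbT.
have hM x : c <= x <= c + N -> normc (f x0 - f x) <= M.
  by move=> /hM0 h; rewrite le_max h.
have e2N : 0 < e / 2 / (M + 1) by rewrite divr_gt0// ltr_wpDl.
(* The factor 2n + 1 pays for dividing by the mean of the kernel, through [Tmean_ge]. *)
have [n hn] := pow_small r0 r1 e2N.
have B0 : 0 <= B.
  have := fcB 1 isT; rewrite absz1 expr1n divr1; apply: le_trans; exact: normc_ge0.
pose K t := Tk ((t - x0) / N) ^+ n.
have K0 t : 0 <= K t by rewrite exprn_ge0// Tk_ge0.
have cK : continuous K by exact: continuous_Tk.
have cKc : ccont (fun t => (K t)%:C).
  by split => //= x; exact: cvg_cst.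
have pK t : K (t + N) = K t.
  rewrite /K; congr (_ ^+ n); rewrite /Tk; congr ((1 + _) / 2).
  have -> : 2 * pi * ((t + N - x0) / N) = 2 * pi * ((t - x0) / N) + pi *+ 2.
    by rewrite mulr2n; field; exact: lt0r_neq0.
  exact: cosD2pi.
have main : normc (cint c (c + N) (fun t => f t * (K t)%:C)) <= N * Tmean n * (2 * B / J%:R).
  rewrite (cint_periodic c (ltW N0) (ccontM cf cKc)); last by move=> t; rewrite pf pK.
  have := @inp_Tk n f x0 cf; rewrite -/(K _) => e1.
  have {e1}-> : cint 0 N (fun t => f t * (K t)%:C) = N%:C * (\sum_(m < n.*2.+1)
     ('C(n.*2, m)%:R / 4 ^+ n)%:C * ech (n%:Z - m%:Z) x0 * fc f (n%:Z - m%:Z)).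
    rewrite -e1 mulrA -rmorphM /= divff ?mul1r//; exact: lt0r_neq0.
  rewrite normcM normc_real (gtr0_norm N0) -mulrA ler_pM2l//.
  apply: le_trans (normc_sum _ _ _) _.
  apply: (@le_trans _ _ (\sum_(m < n.*2.+1) Tmean n * (if (J < `|n%:Z - m%:Z|)%N then B / (`|n%:Z - m%:Z|%N%:R) ^+ 2 else 0))).
    apply: ler_sum => m _; rewrite 2!normcM normc_ech mulr1 normc_real.
    have C0 : 0 <= ('C(n.*2, m)%:R / 4 ^+ n : R) by rewrite divr_ge0// exprn_ge0.
    rewrite (ger0_norm C0); case: ifPn => hJ; last first.
      by rewrite fc0 ?Normc.normc0 ?mulr0// leqNgt.
    apply: ler_pM => //; first exact: normc_ge0.
      by rewrite ler_pM2r ?invr_gt0 ?exprn_gt0// ler_nat bin_center_le.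
    by apply: fcB; apply: contraTneq hJ => ->.
  rewrite -big_distrr /= ler_pM2l ?Tmean_gt0//.
  rewrite -(big_zr n (fun j => if (J < `|j|)%N then B / (`|j|%N%:R) ^+ 2 else 0)).
  rewrite -big_mkcond /= -big_distrr /= [2 * B]mulrC -mulrA ler_wpM2l//.
  exact: sum_zr_tail.
have rest : normc (cint c (c + N) (fun t => (f x0 - f t) * (K t)%:C)) <=
    e / 2 * (N * Tmean n) + M * r ^+ n * N.
  have rK : rint c (c + N) K = N * Tmean n.
    by rewrite (rint_periodic c (ltW N0) cK pK); exact: rint_Tk.
  have ck1 : continuous (fun t => e / 2 * K t) by move=> t; apply: cvgM; [exact: cvg_cst|exact: cK].
  have ck2 : continuous (fun _ : R => M * r ^+ n) by move=> t; exact: cvg_cst.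
  have -> : e / 2 * (N * Tmean n) + M * r ^+ n * N = rint c (c + N) (fun t => e / 2 * K t + M * r ^+ n).
    by rewrite rintD// rintZ// rK rint_cst//; congr (_ + _ * _); ring.
  apply: normc_cint_le; first exact: ccontM.
    by move=> t; apply: cvgD; [exact: ck1|exact: cvg_cst].
  move=> t tc; rewrite normcM normc_real (ger0_norm (K0 t)).
  have [td|td] := ltP `|t - x0| d.
    apply: ler_wpDr; first by rewrite mulr_ge0// exprn_ge0.
    apply: ler_wpM2r => //; rewrite -normcN opprB; apply: near_x0.
    by apply: (lt_le_trans td); rewrite ge_min lexx.
  apply: ler_wpDl; first by rewrite mulr_ge0// ltW.
  apply: ler_pM => //; [exact: normc_ge0|exact: hM|].
  apply: lerXn2r; rewrite ?nnegrE ?Tk_ge0//; apply: far; rewrite td /=.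
  by move: tc; rewrite /c ler_norml => /andP[h1 h2]; apply/andP; split; lra.
have NT : 0 < N * Tmean n by rewrite mulr_gt0 ?Tmean_gt0.
have whole : normc (f x0) * (N * Tmean n) = normc (cint c (c + N) (fun t => f x0 * (K t)%:C)).
  rewrite (cintZ _ _ _ cKc) normcM; congr (_ * _).
  have -> : cint c (c + N) (fun t => (K t)%:C) = (N * Tmean n)%:C.
    rewrite /cint (rint_periodic c (ltW N0) cK pK) rint_Tk; congr (_ +i* _).
    by rewrite (rint_cst 0 cN) mul0r.
  by rewrite normc_real gtr0_norm.
have : normc (f x0) * (N * Tmean n) <= N * Tmean n * (2 * B / J%:R) + (e / 2 * (N * Tmean n) + M * r ^+ n * N).
  rewrite whole.
  rewrite (@eq_cint _ _ _ _ (fun t => f t * (K t)%:C + (f x0 - f t) * (K t)%:C)); last first.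
    by move=> t; rewrite mulrBl addrC subrK.
  rewrite cintD; [|exact: ccontM|exact: ccontM].
  by apply: le_trans (normcD _ _) _; exact: lerD.
have small : M * r ^+ n * N <= e / 2 * (N * Tmean n).
  rewrite [leRHS]mulrCA [leLHS]mulrC ler_pM2l//.
  have T1 := Tmean_ge n.
  have : M * r ^+ n <= (M + 1) * (r ^+ n * (Tmean n * (n.*2.+1)%:R)).
    apply: ler_pM => //; rewrite ?exprn_ge0// ?lerDl//.
    by rewrite -{1}[r ^+ n]mulr1 ler_wpM2l// exprn_ge0.
  move/le_trans; apply; move: hn; rewrite ler_pdivlMr ?ltr_wpDl// => hn.
  rewrite (_ : (M + 1) * _ = (n.*2.+1%:R * r ^+ n * (M + 1)) * Tmean n); last by ring.
  by rewrite ler_wpM2r// ltW// Tmean_gt0.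
move=> h; rewrite -(ler_pM2r NT); apply: (le_trans h).
by rewrite mulrDl; move: small; nra.
Qed.

Section Decay.
Variables (f : R -> R[i]) (B : R).
Hypothesis cf : ccont f.
Hypothesis pf : forall x, f (x + N) = f x.
Hypothesis fcB : forall j : int, j != 0 -> normc (fc f j) <= B / (`|j|%N%:R) ^+ 2.

(** The remainder has the coefficients of [f] beyond J and none up to J, which is the situation of
    [kernel_bound]. *)
Lemma fourier_approx (J : nat) x : (0 < J)%N ->
  normc (f x - psum (zr J) f x) <= 2 * B / J%:R.
Proof.
move=> J0; have cS := ccont_psum (zr J) f.
have B0 : 0 <= B.
  have := fcB (isT : (1 : int) != 0); rewrite absz1 expr1n divr1; apply: le_trans; exact: normc_ge0.
have fcd j : fc (fun x => f x - psum (zr J) f x) j = if (`|j| <= J)%N then 0 else fc f j.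
  rewrite /fc inpBl//; last exact: ccont_ech.
  rewrite -!/(fc _ j) fc_psum ?uniq_zr// mem_zr; case: ifP => _; first by rewrite subrr.
  by rewrite subr0.
apply: (@kernel_bound (fun x => f x - psum (zr J) f x) x J B J0).
- exact: ccontB.
- move=> y; rewrite pf; congr (_ - _); apply: eq_bigr => j _; by rewrite ech_period.
- by move=> j jJ; rewrite fcd jJ.
- move=> j j0; rewrite fcd; case: ifP => _; last exact: fcB.
  by rewrite Normc.normc0 divr_ge0// sqr_ge0.
Qed.

Lemma fourier_sup x : fc f 0 = 0 -> normc (f x) <= 4 * B.
Proof.
move=> f0; have h := fourier_approx x (ltn0Sn 0).
have -> : f x = (f x - psum (zr 1) f x) + psum (zr 1) f x by rewrite subrK.
apply: le_trans (normcD _ _) _.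
have : normc (psum (zr 1) f x) <= 2 * B.
  rewrite /psum /zr /= !big_cons big_nil.
  have e0 : 1%:Z - 1%:Z = 0 by [].
  have e2 : 1%:Z - 2%:Z = -1 by [].
  rewrite e0 e2 f0 mul0r add0r.
  rewrite [X in _ + X]addr0; apply: le_trans (normcD _ _) _; rewrite (normcM (fc f 1)) (normcM (fc f (-1))) !normc_ech !mulr1.
  have := fcB (isT : (1 : int) != 0); have := fcB (isT : (-1 : int) != 0).
  by rewrite abszN absz1 expr1n divr1; lra.
by move: h; rewrite divr1; lra.
Qed.

(** Replacing one factor of |f|^2 by the partial sum costs at most sup |f| times the error of
    [fourier_approx]. The opposite inequality is [bessel]. *)
Lemma parseval_le (J : nat) (M : R) : (0 < J)%N -> (forall x, normc (f x) <= M) ->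
  N^-1 * rint 0 N (fun x => normc (f x) ^+ 2) <=
  \sum_(j <- zr J) normc (fc f j) ^+ 2 + M * (2 * B / J%:R).
Proof.
move=> J0 fM; have cS := ccont_psum (zr J) f.
have e : inp f f = inp (psum (zr J) f) f + inp (fun x => f x - psum (zr J) f x) f.
  by rewrite inpBl// addrC subrK.
move: e; rewrite inp_ge0// inp_psum// => e.
have h : normc (inp (fun x => f x - psum (zr J) f x) f) <= M * (2 * B / J%:R).
  rewrite /inp normcM normc_real gtr0_norm ?invr_gt0// ler_pdivrMl// mulrC -[X in _ * X](subr0 N).
  apply: normc_cint_cst; [|exact: ltW|].
    by apply: ccont_inp => //; exact: ccontB.
  move=> x _; rewrite normcM normc_conj mulrC.
  apply: ler_pM; rewrite ?normc_ge0//; exact: fourier_approx.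
have -> : N^-1 * rint 0 N (fun x => normc (f x) ^+ 2) =
    \sum_(j <- zr J) normc (fc f j) ^+ 2 + Re (inp (fun x => f x - psum (zr J) f x) f).
  have -> : \sum_(j <- zr J) normc (fc f j) ^+ 2 = Re (\sum_(j <- zr J) fc f j * (fc f j)^*%C).
    rewrite (eq_bigr (fun j => (normc (fc f j) ^+ 2)%:C)); last by move=> j _; rewrite mul_conj.
    by rewrite raddf_sum.
  by rewrite -raddfD /= -e.
by rewrite lerD2l; apply: le_trans h; exact: normc_Re.
Qed.
End Decay.
End Fourier.

(** * Wirtinger derivatives and the Cauchy-Pompeiu formula *)

Section ComplexDiff.
Context {R : realType}.
Implicit Types (F G : R[i] -> R[i]) (z w A B : R[i]) (e d : R).

Lemma normCE w : `|w| = (normc w)%:C.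
Proof. by rewrite normc_def; case: w. Qed.

(* Real differentiability in Wirtinger form: [A] is the derivative with respect
   to z and [B] the derivative with respect to the conjugate of z. *)
Definition rdiff F z A B := forall e, 0 < e -> exists2 d, 0 < d &
  forall h, normc h < d -> normc (F (z + h) - F z - (A * h + B * conjc h)) <= e * normc h.

Definition ccat F z := forall e, 0 < e -> exists2 d, 0 < d &
  forall h, normc h < d -> normc (F (z + h) - F z) <= e.

Lemma derivable_cdiff F z : derivable (F : R[i]^o -> R[i]^o) z 1 -> exists A, rdiff F z A 0.
Proof.
move=> dF; exists ('D_(1 : R[i]^o) (F : R[i]^o -> R[i]^o) z) => e e0; set A := 'D_ _ _ _.
have e0C : 0 < e%:C :> R[i] by rewrite ltcR.
have := dF => /cvgrPdist_lt/(_ _ e0C); rewrite -/A.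
case/nbhs_ballP => d /= d0 H.
have [dI dR] : Im d = 0 /\ 0 < Re d by move: d0; case: (d) => u v; rewrite ltcE /= => /andP[/eqP-> ->].
exists (Re d) => // h hd; rewrite mul0r addr0.
have [->|h0] := eqVneq h 0; first by rewrite addr0 subrr mulr0 subr0 Normc.normc0 mulr0.
have /H : ball (0 : (R[i])^o) d h.
  rewrite -ball_normE /= sub0r normrN normCE; move: hd dI; case: (d) => u v /= hd ->.
  by rewrite ltcR.
move=> /(_ h0); rewrite normCE ltcR => /ltW h1.
have hp : 0 < normc h.
  rewrite lt_def normc_ge0 andbT; apply: contra h0 => /eqP/Normc.eq0_normc ->; exact: eqxx.
have -> : F (z + h) - F z - A * h = - (h * (A - h^-1 *: (F (h *: 1 + z) - F z))).
  rewrite mulrBr -[h^-1 *: _]/(h^-1 * _) mulVKf// -[h *: 1]/(h * 1) mulr1 [h + z]addrC.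
  by ring.
by rewrite normcN normcM mulrC ler_wpM2r// normc_ge0.
Qed.

Lemma normc_lin A B h : normc (A * h + B * conjc h) <= (normc A + normc B) * normc h.
Proof. by rewrite mulrDl; apply: le_trans (normcD _ _) _; rewrite !normcM normc_conj. Qed.

Lemma rdiff_ccat F z A B : rdiff F z A B -> ccat F z.
Proof.
move=> dF e e0; have [d d0 H] := dF 1 ltr01.
have n0 := addr_ge0 (normc_ge0 A) (normc_ge0 B).
have A1 : 0 < normc A + normc B + 1 by rewrite ltr_wpDl.
exists (Num.min d (e / (normc A + normc B + 1))); first by rewrite lt_min d0 divr_gt0.
move=> h; rewrite lt_min => /andP[/H hd]; rewrite ltr_pdivlMr// => he.
rewrite -[F (z + h) - F z](subrK (A * h + B * conjc h)); apply: le_trans (normcD _ _) _.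
apply: le_trans (lerD hd (normc_lin A B h)) _.
by apply: le_trans (ltW he); rewrite mul1r mulrDr mulr1 addrC [normc h * _]mulrC.
Qed.

Lemma rdiff_eq F z A B A' B' : rdiff F z A B -> A = A' -> B = B' -> rdiff F z A' B'.
Proof. by move=> + <- <-. Qed.

Lemma rdiff_affine F z A B : (forall h, F (z + h) - F z = A * h + B * conjc h) -> rdiff F z A B.
Proof.
move=> H e e0; exists 1 => // h _; rewrite H subrr Normc.normc0.
by rewrite mulr_ge0 ?normc_ge0// ltW.
Qed.

Lemma rdiff_cst w z : rdiff (fun=> w) z 0 0.
Proof. by apply: rdiff_affine => h; rewrite subrr !mul0r addr0. Qed.

Lemma rdiff_uhp F G z A B : (forall w, uhp w -> F w = G w) -> uhp z -> rdiff F z A B -> rdiff G z A B.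
Proof.
move=> FG uz dF e e0; have [d d0 H] := dF e e0.
exists (Num.min d (Im z)); first by rewrite lt_min d0.
move=> h; rewrite lt_min => /andP[hd hz]; rewrite -!FG//; first exact: H.
rewrite /uhp /= raddfD /=; have := le_lt_trans (normc_ge_Im h) hz.
by rewrite ltr_norml => /andP[? _]; lra.
Qed.

Lemma rdiffD F G z A B A' B' : rdiff F z A B -> rdiff G z A' B' ->
  rdiff (fun w => F w + G w) z (A + A') (B + B').
Proof.
move=> dF dG e e0; have e2 : 0 < e / 2 by rewrite divr_gt0.
have [d1 d10 H1] := dF _ e2; have [d2 d20 H2] := dG _ e2.
exists (Num.min d1 d2); first by rewrite lt_min d10.
move=> h; rewrite lt_min => /andP[/H1 h1 /H2 h2].
rewrite (_ : _ - _ = (F (z + h) - F z - (A * h + B * conjc h)) + (G (z + h) - G z - (A' * h + B' * conjc h))); last by ring.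
apply: le_trans (normcD _ _) _; apply: le_trans (lerD h1 h2) _.
by rewrite -mulrDl -splitr.
Qed.

Lemma rdiffM F G z A B A' B' : rdiff F z A B -> rdiff G z A' B' ->
  rdiff (fun w => F w * G w) z (A * G z + F z * A') (B * G z + F z * B').
Proof.
move=> dF dG e e0; pose b := normc A' + normc B'.
have b0 : 0 <= b by rewrite addr_ge0// normc_ge0.
have G1 : 0 < normc (G z) + 1 by rewrite ltr_wpDl// normc_ge0.
have F1 : 0 < normc (F z) + 1 by rewrite ltr_wpDl// normc_ge0.
have B1 : 0 < b + 1 by rewrite ltr_wpDl.
have e3 : 0 < e / 3 by rewrite divr_gt0.
have [d1 d10 H1] := dF _ (divr_gt0 e3 G1).
have [d2 d20 H2] := dG _ (divr_gt0 e3 F1).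
have [d3 d30 H3] := rdiff_ccat dF (divr_gt0 e3 B1).
have [d4 d40 H4] := rdiff_ccat dF ltr01.
pose d := Num.min (Num.min d1 d2) (Num.min d3 d4).
exists d; first by rewrite 3!lt_min d10 d20 d30 d40.
move=> h; rewrite 3!lt_min => /andP[/andP[/H1 h1 /H2 h2] /andP[/H3 h3 /H4 h4]].
set l := A * h + B * conjc h in h1; set l' := A' * h + B' * conjc h in h2.
have -> : F (z + h) * G (z + h) - F z * G z -
    ((A * G z + F z * A') * h + (B * G z + F z * B') * conjc h) =
   (F (z + h) - F z - l) * G z + (F (z + h)) * (G (z + h) - G z - l')
   + (F (z + h) - F z) * l' by rewrite /l /l'; ring.
have nFz : normc (F (z + h)) <= normc (F z) + 1.
  rewrite -[F (z + h)](subrK (F z)); apply: le_trans (normcD _ _) _; lra.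
have nh := normc_ge0 h.
have b1 : normc ((F (z + h) - F z - l) * G z) <= e / 3 * normc h.
  rewrite normcM; apply: (@le_trans _ _ (e / 3 / (normc (G z) + 1) * normc h * (normc (G z) + 1))).
    by apply: ler_pM => //; rewrite ?normc_ge0// lerDl.
  by rewrite mulrAC divfK// gt_eqF.
have b2 : normc (F (z + h) * (G (z + h) - G z - l')) <= e / 3 * normc h.
  rewrite normcM; apply: (@le_trans _ _ ((normc (F z) + 1) * (e / 3 / (normc (F z) + 1) * normc h))).
    by apply: ler_pM => //; rewrite ?normc_ge0.
  by rewrite mulrA mulrCA divff ?mulr1// gt_eqF.
have b3 : normc ((F (z + h) - F z) * l') <= e / 3 * normc h.
  rewrite normcM.
  apply: (@le_trans _ _ (e / 3 / (b + 1) * ((b + 1) * normc h))).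
    apply: ler_pM => //; rewrite ?normc_ge0//; apply: le_trans (normc_lin _ _ _) _.
    by rewrite ler_wpM2r// lerDl.
  by rewrite mulrA divfK// gt_eqF.
apply: le_trans (normcD _ _) _; apply: le_trans (lerD (le_trans (normcD _ _) (lerD b1 b2)) b3) _.
by rewrite -!mulrDl ler_wpM2r//; lra.
Qed.

Lemma rdiffZ w F z A B : rdiff F z A B -> rdiff (fun x => w * F x) z (w * A) (w * B).
Proof.
by move=> dF; apply: (rdiff_eq (rdiffM (rdiff_cst w z) dF)); ring.
Qed.

Lemma rdiffX n F z A : rdiff F z A 0 -> rdiff (fun x => F x ^+ n) z (n%:R * F z ^+ n.-1 * A) 0.
Proof.
move=> dF; elim: n => [|n IH].
  by apply: (rdiff_eq (rdiff_cst 1 z)); ring.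
rewrite (_ : (fun x => _) = (fun x => F x * F x ^+ n)); last by apply/funext => x; rewrite exprS.
apply: (rdiff_eq (rdiffM dF IH)); last by ring.
case: n {IH} => [|n] /=; first by rewrite expr0; ring.
by rewrite -[n.+2%:R]natr1 exprS; ring.
Qed.

Lemma rdiff_conj F z A B : rdiff F z A B -> rdiff (fun w => conjc (F w)) z (conjc B) (conjc A).
Proof.
move=> dF e e0; have [d d0 H] := dF e e0; exists d => // h /H.
rewrite -normc_conj (_ : conjc _ = conjc (F (z + h)) - conjc (F z) - (conjc B * h + conjc A * conjc h))//.
by rewrite !rmorphB rmorphD !rmorphM /= conjcK [_ + conjc B * _]addrC.
Qed.

Lemma rdiff_comp F G z A B D : rdiff F (G z) A B -> rdiff G z D 0 ->
  rdiff (fun w => F (G w)) z (A * D) (B * conjc D).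
Proof.
move=> dF dG e e0; pose b := normc A + normc B.
have b0 : 0 <= b by rewrite addr_ge0// normc_ge0.
have D1 : 0 < normc D + 1 by rewrite ltr_wpDl// normc_ge0.
have B1 : 0 < b + 1 by rewrite ltr_wpDl.
have e2 : 0 < e / 2 by rewrite divr_gt0.
have [d1 d10 H1] := dF _ (divr_gt0 e2 D1).
have [d2 d20 H2] := dG _ (divr_gt0 e2 B1).
have [d3 d30 H3] := dG _ ltr01.
have [d4 d40 H4] := rdiff_ccat dG (divr_gt0 d10 (ltr0Sn _ 1)).
exists (Num.min d2 (Num.min d3 d4)); first by rewrite 2!lt_min d20 d30 d40.
move=> h; rewrite 2!lt_min => /andP[/H2 h2 /andP[/H3 h3 /H4 h4]].
move: h2 h3; rewrite !mul0r !addr0 mul1r => h2 h3.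
set w := G (z + h) - G z in h2 h3 h4.
have wd : normc w < d1 by apply: le_lt_trans h4 _; lra.
have nw : normc w <= (normc D + 1) * normc h.
  rewrite -[w](subrK (D * h)); apply: le_trans (normcD _ _) _.
  by rewrite normcM mulrDl mul1r addrC lerD2l.
have := H1 w wd; rewrite (_ : G z + w = G (z + h)); last by rewrite /w addrC subrK.
move=> h1.
rewrite (_ : _ - _ = (F (G (z + h)) - F (G z) - (A * w + B * conjc w)) +
   (A * (w - D * h) + B * conjc (w - D * h))); last first.
  have -> : conjc (w - D * h) = conjc w - conjc D * conjc h by move: (w) => w'; rewrite rmorphB rmorphM.
  by ring.
have nh := normc_ge0 h.
apply: le_trans (normcD _ _) _; rewrite [leRHS](_ : _ = e / 2 * normc h + e / 2 * normc h); last by field.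
apply: lerD.
  apply: (le_trans h1); apply: (@le_trans _ _ (e / 2 / (normc D + 1) * ((normc D + 1) * normc h))).
    by rewrite ler_wpM2l// divr_ge0 ?ltW.
  by rewrite mulrA divfK// gt_eqF.
apply: le_trans (normc_lin _ _ _) _.
apply: (@le_trans _ _ ((b + 1) * (e / 2 / (b + 1) * normc h))).
  by apply: ler_pM => //; rewrite ?normc_ge0// lerDl.
by rewrite mulrA mulrCA divff ?mulr1// gt_eqF.
Qed.

Lemma rdiff_inv z : z != 0 -> rdiff (fun w => w^-1) z (- z^-1 ^+ 2) 0.
Proof.
move=> z0 e e0; have nz : 0 < normc z.
  by rewrite lt_def normc_ge0 andbT; apply: contra z0 => /eqP/Normc.eq0_normc ->.
pose m := e * normc z ^+ 3 / 2.
have m0 : 0 < m by rewrite divr_gt0// mulr_gt0// exprn_gt0.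
exists (Num.min (normc z / 2) m); first by rewrite lt_min m0 divr_gt0.
move=> h; rewrite lt_min mul0r addr0 => /andP[hz hm].
have zh : normc z / 2 <= normc (z + h).
  have := normcD (z + h) (- h); rewrite addrK normcN; lra.
have zh0 : z + h != 0.
  by apply/eqP => e1; move: zh; rewrite e1 Normc.normc0; lra.
have -> : (z + h)^-1 - z^-1 - - z^-1 ^+ 2 * h = h * h * (z^-1 ^+ 2 * (z + h)^-1).
  by field; rewrite ?z0 ?zh0.
have nV (x : R[i]) : x != 0 -> normc x^-1 = (normc x)^-1.
  move=> x0; have nx : normc x != 0 by apply: contra x0 => /eqP/Normc.eq0_normc ->.
  by apply: (mulfI nx); rewrite -normcM !divff// /= expr1n expr0n /= addr0 sqrtr1.
rewrite [z^-1 ^+ 2]expr2 !normcM !nV// mulrAC ler_wpM2r ?normc_ge0//.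
have zh1 : 0 < normc (z + h) by apply: lt_le_trans zh; rewrite divr_gt0.
rewrite mulrA ler_pdivrMr// mulrA ler_pdivrMr// ler_pdivrMr//.
apply: (le_trans (ltW hm)); rewrite /m.
rewrite (_ : e * normc z ^+ 3 / 2 = e * (normc z / 2) * normc z * normc z); last by field.
by rewrite !ler_wpM2r ?(ltW nz)// ler_wpM2l// ltW.
Qed.

Lemma deriv_o (g : R -> R) (l : R) : is_derive (0 : R) (1 : R) g l -> forall e, 0 < e ->
  exists2 d, 0 < d & forall u : R, `|u| < d -> `|g u - g 0 - l * u| <= e * `|u|.
Proof.
move=> [dg <-] e e0; set A := 'D_ _ _ _.
have := dg => /cvgrPdist_lt/(_ _ e0); rewrite -/A.
case/nbhs_ballP => d /= d0 H; exists d => // u ud.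
have [->|u0] := eqVneq u 0; first by rewrite subrr mulr0 subr0 !normr0 mulr0.
have /H : ball (0 : R) d u by rewrite -ball_normE /= sub0r normrN.
move=> /(_ u0) /ltW h1.
have -> : g u - g 0 - A * u = - (u * (A - u^-1 *: (g (u *: 1 + 0) - g 0))).
  rewrite mulrBr -[u^-1 *: _]/(u^-1 * _) mulVKf// -[u *: 1]/(u * 1) mulr1 addr0.
  by ring.
by rewrite normrN normrM mulrC ler_wpM2r.
Qed.

(* [cexp k z = exp (- i k z)] *)
Definition cexp (k : R) z : R[i] := (expR (k * Im z))%:C * (cos (k * Re z) -i* sin (k * Re z)).

Lemma cexpD k z w : cexp k (z + w) = cexp k z * cexp k w.
Proof.
rewrite /cexp !raddfD !mulrDr expRD cosD sinD rmorphM /=.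
move: (expR _) (expR _) (cos _) (cos _) (sin _) (sin _) => a b c c' s s'.
by simpc; congr (_ +i* _); ring.
Qed.

Lemma rdiff_cexp0 k : rdiff (cexp k) 0 (- 'i * k%:C) 0.
Proof.
wlog k0 : / k != 0 => [H|].
  have [k0|/H//] := eqVneq k 0; rewrite k0 => e e0; exists 1 => // h _.
  rewrite /cexp !mul0r expR0 cos0 sin0 /=.
  rewrite (_ : _ - _ - _ = 0); first by rewrite Normc.normc0 mulr_ge0 ?normc_ge0// ltW.
  by rewrite subrr mulr0 !mul0r addr0 subr0.
move=> e e0; have kp : 0 < `|k| by rewrite normr_gt0.
pose e1 := Num.min (e / (9 * `|k|)) 1.
have e10 : 0 < e1 by rewrite lt_min ltr01 andbT divr_gt0// mulr_gt0.
have e11 : e1 <= 1 by rewrite ge_min lexx orbT.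
have e18 : 9 * `|k| * e1 <= e.
  by rewrite -ler_pdivlMl ?mulr_gt0// mulrC ge_min lexx.
have de : is_derive (0 : R) (1 : R) expR 1 by have := is_derive_expR (0 : R); rewrite expR0.
have dc : is_derive (0 : R) (1 : R) cos 0 by have := is_derive_cos (0 : R); rewrite sin0 oppr0.
have ds : is_derive (0 : R) (1 : R) sin 1 by have := is_derive_sin (0 : R); rewrite cos0.
have [d1 d10 H1] := deriv_o de e10.
have [d2 d20 H2] := deriv_o dc e10.
have [d3 d30 H3] := deriv_o ds e10.
pose d := Num.min (Num.min d1 d2) (Num.min d3 e1).
have d0 : 0 < d by rewrite 3!lt_min d10 d20 d30 e10.
exists (d / `|k|); first by rewrite divr_gt0.
case=> s t hd; rewrite add0r mul0r addr0; set h := s +i* t in hd *.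
have hs : `|s| <= normc h := normc_ge_Re h.
have ht : `|t| <= normc h := normc_ge_Im h.
move: hd; rewrite ltr_pdivlMr// => hd.
have us : `|k * s| < d by rewrite normrM mulrC (le_lt_trans _ hd)// ler_pM2r.
have ut : `|k * t| < d by rewrite normrM mulrC (le_lt_trans _ hd)// ler_pM2r.
have lt' x : x < d -> [/\ x < d1, x < d2, x < d3 & x < e1].
  by rewrite 3!lt_min => /andP[/andP[-> ->] /andP[-> ->]].
have [us1 us2 us3 us4] := lt' _ us; have [ut1 _ _ ut4] := lt' _ ut.
have := H1 _ ut1; have := H2 _ us2; have := H3 _ us3.
rewrite sin0 cos0 expR0 subr0 mul0r subr0 !mul1r => hS hC hE.
have -> : cexp k h - cexp k 0 - (- 'i * k%:C) * h =
   (expR (k * t) * cos (k * s) - 1 - k * t) +i* (- (expR (k * t) * sin (k * s) - k * s)).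
  rewrite /cexp /= !mulr0 expR0 cos0 sin0; simpc; congr (_ +i* _); ring.
apply: le_trans (normc_le_ReIm _) _; rewrite /= normrN.
move: hS hC hE; move: (expR (k * t)) (cos (k * s)) (sin (k * s)) => E C S hS hC hE.
set u := k * t in hE ut4 *; set v := k * s in hS hC us4 *.
have nu : `|u| <= `|k| * normc h by rewrite normrM ler_pM2l.
have nv : `|v| <= `|k| * normc h by rewrite normrM ler_pM2l.
have E3 : `|E| <= 3.
  have -> : E = (E - 1 - u) + u + 1 by ring.
  apply: le_trans (ler_normD _ _) _; rewrite normr1.
  apply: le_trans (_ : (e1 * `|u| + `|u|) + 1 <= _); last by nra.
  by rewrite lerD2r; apply: le_trans (ler_normD _ _) _; rewrite lerD2r.
have E1 : `|E - 1| <= 2 * e1.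
  have -> : E - 1 = (E - 1 - u) + u by ring.
  by apply: le_trans (ler_normD _ _) _; nra.
have a1 : `|E * C - 1 - u| <= 3 * (e1 * `|v|) + e1 * `|u|.
  have -> : E * C - 1 - u = E * (C - 1) + (E - 1 - u) by ring.
  apply: le_trans (ler_normD _ _) _; apply: lerD => //; rewrite normrM.
  by apply: ler_pM.
have a2 : `|E * S - v| <= 3 * (e1 * `|v|) + 2 * e1 * `|v|.
  have -> : E * S - v = E * (S - v) + (E - 1) * v by ring.
  apply: le_trans (ler_normD _ _) _; apply: lerD; rewrite normrM.
    by apply: ler_pM.
  by rewrite ler_wpM2r.
apply: le_trans (lerD a1 a2) _.
have nh := normc_ge0 h.
apply: (@le_trans _ _ (9 * `|k| * e1 * normc h)); last by rewrite ler_wpM2r.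
by nra.
Qed.

Lemma rdiff_cexp k z : exists A, rdiff (cexp k) z A 0.
Proof.
exists (cexp k z * (- 'i * k%:C)) => e e0.
have E1 : 0 < normc (cexp k z) + 1 by rewrite ltr_wpDl// normc_ge0.
have [d d0 H] := rdiff_cexp0 k (divr_gt0 e0 E1).
exists d => // h /H; rewrite add0r mul0r !addr0 => hh.
have c0 : cexp k 0 = 1 by rewrite /cexp /= !mulr0 expR0 cos0 sin0; simpc.
rewrite cexpD (_ : _ - _ - _ = cexp k z * (cexp k h - cexp k 0 - (- 'i * k%:C) * h)); last first.
  by rewrite c0; ring.
rewrite normcM; apply: (@le_trans _ _ ((normc (cexp k z) + 1) * (e / (normc (cexp k z) + 1) * normc h))).
  by apply: ler_pM => //; rewrite ?normc_ge0// lerDl.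
by rewrite mulrA mulrCA divff ?mulr1// gt_eqF.
Qed.
End ComplexDiff.

Lemma four_max (R : realType) (s a b c d : R) : s <= a + b + (c + d) ->
  [\/ s <= 4 * a, s <= 4 * b, s <= 4 * c | s <= 4 * d].
Proof.
move=> h; have [ha|ha] := leP s (4 * a); first exact: Or41.
have [hb|hb] := leP s (4 * b); first exact: Or42.
have [hc|hc] := leP s (4 * c); first exact: Or43.
by apply: Or44; lra.
Qed.

Lemma eq_cint_in (R : realType) (a b : R) (f g : R -> R[i]) : (forall x, a <= x <= b -> f x = g x) ->
  cint a b f = cint a b g.
Proof.
move=> e; rewrite /cint /rint; congr (_ +i* _); apply: eq_Rintegral => x;
by rewrite mem_setE in_itv => /e ->.
Qed.

Section Contour.
Context {R : realType}.
Implicit Types (F G : R[i] -> R[i]) (y : R).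

Definition ccatb y0 F := forall z, y0 <= Im z -> ccat F z.

Definition hline F (c : R) := fun x : R => F (x +i* c).
(** Clamping the height at [y0] gives a continuous function on the whole line without changing it on
    the contours used. *)
Definition vline F y0 (a : R) := fun y : R => F (a +i* Num.max y y0).
Definition sline G y0 (a b : R) := fun y : R => cint a b (hline G (Num.max y y0)).

Lemma ccat_near F (z : R[i]) (e : R) : ccat F z -> 0 < e -> exists2 d, 0 < d &
  forall x y, `|x - Re z| < d -> `|y - Im z| < d -> normc (F (x +i* y) - F z) <= e.
Proof.
move=> cF e0; have [d d0 H] := cF e e0; exists (d / 2) => [|x y hx hy]; first by rewrite divr_gt0.
have -> : x +i* y = z + ((x - Re z) +i* (y - Im z)).
  by case: (z) => u v /=; simpc; rewrite ![_ + (_ - _)]addrC !subrK.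
apply: H; apply: le_lt_trans (normc_le_ReIm _) _; rewrite /=; lra.
Qed.

Lemma ccont_ccatb F y0 (g : R -> R[i]) : ccatb y0 F -> ccont g -> (forall x, y0 <= Im (g x)) -> ccont (fun x => F (g x)).
Proof.
move=> dF [g1 g2] gy.
have near_x (x e : R) : 0 < e -> \forall t \near x, normc (F (g t) - F (g x)) <= e.
  move=> e0; have [d d0 H] := dF _ (gy x) _ e0.
  have d2 : 0 < d / 2 by rewrite divr_gt0.
  have /cvgrPdist_lt/(_ _ d2) n1 := g1 x; have /cvgrPdist_lt/(_ _ d2) n2 := g2 x.
  near=> t; rewrite -[g t](subrK (g x)) [g t - g x + _]addrC; apply: H.
  apply: le_lt_trans (normc_le_ReIm _) _; rewrite !raddfB /=.
  rewrite ![`|_ - _ (g x)|]distrC (_ : d = d / 2 + d / 2); last by field.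
  by apply: ltrD; near: t.
split=> x; apply/cvgrPdist_le => e e0; near=> t; rewrite distrC -raddfB.
  by apply: le_trans (normc_ge_Re _) _; near: t; exact: near_x.
by apply: le_trans (normc_ge_Im _) _; near: t; exact: near_x.
Unshelve. all: by end_near. Qed.

Lemma ccont_hline F y0 c : ccatb y0 F -> y0 <= c -> ccont (hline F c).
Proof.
move=> dF yc; apply: (ccont_ccatb dF) => //; split => x; [exact: cvg_id|exact: cvg_cst].
Qed.

Lemma ccont_vline F y0 a : ccatb y0 F -> ccont (vline F y0 a).
Proof.
move=> dF; apply: (ccont_ccatb dF) => [|y]; last by rewrite /= le_max lexx orbT.
split => y; first exact: cvg_cst.
by apply: (@continuous_max _ _ id (fun=> y0)); [exact: cvg_id|exact: cvg_cst].
Qed.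

Lemma ccont_sline G y0 a b : a <= b -> ccatb y0 G -> ccont (sline G y0 a b).
Proof.
move=> ab cG.
have ym (y : R) : y0 <= Num.max y y0 by rewrite le_max lexx orbT.
have cm : continuous (fun y : R => Num.max y y0).
  by move=> y; apply: (@continuous_max _ _ id (fun=> y0)); [exact: cvg_id|exact: cvg_cst].
have main (y e : R) : 0 < e -> \forall t \near y, normc (sline G y0 a b t - sline G y0 a b y) <= e * (b - a).
  move=> e0; have /compact_near_coveringP cab := @segment_compact R a b.
  have := cab R (nbhs y) (fun t x => normc (G (x +i* Num.max t y0) - G (x +i* Num.max y y0)) <= e) _.
  have h : forall x, `[a, b]%classic x ->
      \forall x' \near x & i \near y, normc (G (x' +i* Num.max i y0) - G (x' +i* Num.max y y0)) <= e.
    move=> x _; have e2 : 0 < e / 2 by rewrite divr_gt0.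
    have [d d0 H] := ccat_near (cG (x +i* Num.max y y0) (ym y)) e2.
    have n1 : \forall x' \near x, `|x' - x| < d.
      by have /cvgrPdist_lt/(_ _ d0) := @cvg_id _ (nbhs x); apply: filterS => u; rewrite distrC.
    have n2 : \forall t \near y, `|Num.max t y0 - Num.max y y0| < d.
      by have /cvgrPdist_lt/(_ _ d0) := cm y; apply: filterS => u; rewrite distrC.
    exists ([set x' | `|x' - x| < d], [set t | `|Num.max t y0 - Num.max y y0| < d]) => //= -[x' t] /= [h1 h2].
    rewrite (_ : _ - _ = (G (x' +i* Num.max t y0) - G (x +i* Num.max y y0)) -
       (G (x' +i* Num.max y y0) - G (x +i* Num.max y y0))); last by ring.
    apply: le_trans (normcD _ _) _; rewrite normcN [leRHS](splitr e).
    by apply: lerD; apply: H; rewrite //= subrr normr0.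
  move=> /(_ _ h); apply: filterS => t ht.
  have -> : sline G y0 a b t - sline G y0 a b y =
     cint a b (fun x => hline G (Num.max t y0) x - hline G (Num.max y y0) x).
    by rewrite cintB//; exact: (ccont_hline cG (ym _)).
  apply: normc_cint_cst => //; first by apply: ccontB; exact: (ccont_hline cG (ym _)).
have ba : 0 < b - a + 1 by rewrite ltr_wpDl// subr_ge0.
split=> y; apply/cvgrPdist_le => e e0; have e1 : 0 < e / (b - a + 1) by rewrite divr_gt0.
  near=> t; rewrite distrC -raddfB; apply: le_trans (normc_ge_Re _) _.
  apply: (@le_trans _ _ (e / (b - a + 1) * (b - a))); first by near: t; exact: main.
  by rewrite mulrAC ler_pdivrMr// ler_wpM2l ?ltW// ltrDl.
near=> t; rewrite distrC -raddfB; apply: le_trans (normc_ge_Im _) _.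
apply: (@le_trans _ _ (e / (b - a + 1) * (b - a))); first by near: t; exact: main.
by rewrite mulrAC ler_pdivrMr// ler_wpM2l ?ltW// ltrDl.
Unshelve. all: by end_near. Qed.

Definition contour F y0 a b c d : R[i] :=
  cint a b (hline F c) - cint a b (hline F d) + 'i * (cint c d (vline F y0 b) - cint c d (vline F y0 a)).

(* The Cauchy-Pompeiu defect, which vanishes when [G] is the derivative of [F]
   with respect to the conjugate variable. *)
Definition pompeiu F G y0 a b c d : R[i] :=
  contour F y0 a b c d - 2 * 'i * cint c d (sline G y0 a b).

Lemma defect_hsplit (i a b c d u v w s t : R[i]) :
  (a + b) - (c + d) + i * (u - v) - 2 * i * (s + t) =
  (a - c + i * (w - v) - 2 * i * s) + (b - d + i * (u - w) - 2 * i * t).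
Proof. by ring. Qed.

Lemma defect_vsplit (i a b d u u' v v' s t : R[i]) :
  a - b + i * ((u + u') - (v + v')) - 2 * i * (s + t) =
  (a - d + i * (u - v) - 2 * i * s) + (d - b + i * (u' - v') - 2 * i * t).
Proof. by ring. Qed.

Lemma defectB (i a b c d u u' v v' s t : R[i]) :
  (a - b) - (c - d) + i * ((u - u') - (v - v')) - 2 * i * (s - t) =
  (a - c + i * (u - v) - 2 * i * s) - (b - d + i * (u' - v') - 2 * i * t).
Proof. by ring. Qed.

Lemma defect_affine (i a b c d u A B p q : R[i]) : i * i = -1 ->
  (u + (A - B) * (i * c)) * (b - a) + (A + B) * p - ((u + (A - B) * (i * d)) * (b - a) + (A + B) * p) +
  i * ((u + (A + B) * b) * (d - c) + (A - B) * i * q - ((u + (A + B) * a) * (d - c) + (A - B) * i * q)) -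
  2 * i * (B * (b - a) * (d - c)) = 0.
Proof. by move=> i2; ring: i2. Qed.

Lemma pompeiu_hsplit F G y0 a m b c d : ccatb y0 F -> ccatb y0 G ->
  y0 <= c -> c <= d -> a <= m -> m <= b ->
  pompeiu F G y0 a b c d = pompeiu F G y0 a m c d + pompeiu F G y0 m b c d.
Proof.
move=> cF cG yc cd am mb; rewrite /pompeiu /contour.
have c1 := ccont_hline cF yc; have c2 := ccont_hline cF (le_trans yc cd).
rewrite (cint_split c1 am mb) (cint_split c2 am mb).
rewrite (_ : cint c d (sline G y0 a b) = cint c d (sline G y0 a m) + cint c d (sline G y0 m b)); first exact: defect_hsplit.
rewrite -cintD; [|exact: ccont_sline..]; apply: eq_cint => y; rewrite /sline -cint_split//.
by apply: (ccont_hline cG); rewrite le_max lexx orbT.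
Qed.

Lemma pompeiu_vsplit F G y0 a b c m d : ccatb y0 F -> ccatb y0 G -> a <= b ->
  c <= m -> m <= d ->
  pompeiu F G y0 a b c d = pompeiu F G y0 a b c m + pompeiu F G y0 a b m d.
Proof.
move=> cF cG ab cm md; rewrite /pompeiu /contour.
have c1 := ccont_vline a cF; have c2 := ccont_vline b cF; have c3 := ccont_sline ab cG.
by rewrite (cint_split c1 cm md) (cint_split c2 cm md) (cint_split c3 cm md); exact: defect_vsplit.
Qed.

(** Goursat's bisection: the defect is additive over the four quarters, so one of them carries at
    least a quarter of it. *)
Lemma pompeiu_quad F G y0 a c (l1 l2 : R) : ccatb y0 F -> ccatb y0 G ->
  y0 <= c -> 0 <= l1 -> 0 <= l2 ->
  exists p : R * R, [/\ (a <= p.1 <= a + l1), (c <= p.2 <= c + l2) &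
   normc (pompeiu F G y0 a (a + 2 * l1) c (c + 2 * l2)) <=
   4 * normc (pompeiu F G y0 p.1 (p.1 + l1) p.2 (p.2 + l2))].
Proof.
move=> cF cG yc l10 l20.
have h1 : a <= a + l1 by rewrite lerDl.
have h2 : c <= c + l2 by rewrite lerDl.
have e1 : a + 2 * l1 = a + l1 + l1 by ring.
have e2 : c + 2 * l2 = c + l2 + l2 by ring.
have h3 : a + l1 <= a + l1 + l1 by rewrite lerDl.
have h4 : c + l2 <= c + l2 + l2 by rewrite lerDl.
rewrite e1 e2 (pompeiu_hsplit cF cG yc (le_trans h2 h4) h1 h3).
rewrite (pompeiu_vsplit cF cG h1 h2 h4) (pompeiu_vsplit cF cG h3 h2 h4).
set A := pompeiu _ _ _ a _ c _; set B := pompeiu _ _ _ a _ _ _.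
set C := pompeiu _ _ _ _ _ c _; set D := pompeiu _ _ _ _ _ (c + l2) _.
have hs : normc (A + B + (C + D)) <= normc A + normc B + (normc C + normc D).
  by apply: le_trans (normcD _ _) _; apply: lerD; exact: normcD.
have [h|h|h|h] := four_max hs.
- by exists (a, c); split; rewrite /= ?lexx ?h1 ?h2.
- by exists (a, c + l2); split; rewrite /= ?lexx ?h1 ?h2.
- by exists (a + l1, c); split; rewrite /= ?lexx ?h1 ?h2.
- by exists (a + l1, c + l2); split; rewrite /= ?lexx ?h1 ?h2.
Qed.

Lemma cint_id (a b : R) : a <= b -> cint a b (fun x => x%:C) = ((b ^+ 2 - a ^+ 2) / 2)%:C.
Proof.
move=> ab.
have -> : ((b ^+ 2 - a ^+ 2) / 2)%:C = (b ^+ 2 / 2 - a ^+ 2 / 2) +i* (0 - 0) :> R[i].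
  by rewrite subrr mulrBl.
rewrite /cint; congr (_ +i* _).
  rewrite !expr2; apply: (@rint_FTC _ a b (fun x => x) (fun x => x * x / 2)) => //.
  - by move=> x; exact: cvg_id.
  - move=> x _; apply: (is_derive_eq (is_deriveM (f := fun y : R => y * y) (g := fun=> 2^-1)
      (is_deriveM (f := fun y : R => y) (g := fun y : R => y) (is_derive_id x 1) (is_derive_id x 1)) (is_derive_cst _ _ _))).
    by rewrite /= scaler0 add0r /GRing.scale/= mulr1; field.
rewrite subrr; transitivity (rint a b (fun=> 0 : R)); first by [].
by rewrite rint_cst// mul0r.
Qed.

(** For affine functions the formula is exact. This allows the affine approximation of a
    differentiable function to be subtracted at no cost. *)
Lemma pompeiu_affine (y0 a b c d : R) (u A B : R[i]) : y0 <= c -> a <= b -> c <= d ->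
  pompeiu (fun w => u + A * w + B * conjc w) (fun=> B) y0 a b c d = 0.
Proof.
move=> yc ab cd; rewrite /pompeiu /contour.
have ci : ccont (fun x : R => x%:C) by split => x; [exact: cvg_id|exact: cvg_cst].
have H t : cint a b (hline (fun w => u + A * w + B * conjc w) t) =
    (u + (A - B) * ('i * t%:C)) * (b - a)%:C + (A + B) * ((b ^+ 2 - a ^+ 2) / 2)%:C.
  rewrite (@eq_cint _ _ _ _ (fun x => (u + (A - B) * ('i * t%:C)) + (A + B) * x%:C)); last first.
    move=> x; rewrite /hline (_ : conjc _ = x%:C - 'i * t%:C); last by simpc.
    by rewrite (_ : x +i* t = 'i * t%:C + x%:C); [ring|simpc].
  by rewrite cintD ?cintZ// ?cint_id ?cint_cst//; [exact: ccont_cst|exact: ccontZ].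
have V t : cint c d (vline (fun w => u + A * w + B * conjc w) y0 t) =
    (u + (A + B) * t%:C) * (d - c)%:C + (A - B) * 'i * ((d ^+ 2 - c ^+ 2) / 2)%:C.
  rewrite (@eq_cint_in _ _ _ _ (fun x => (u + (A + B) * t%:C) + ((A - B) * 'i) * x%:C)); last first.
    move=> x /andP[cx _]; rewrite /vline max_l ?(le_trans yc cx)//.
    rewrite (_ : conjc _ = t%:C - 'i * x%:C); last by simpc.
    by rewrite (_ : t +i* x = 'i * x%:C + t%:C); [ring|simpc].
  by rewrite cintD ?cintZ// ?cint_id ?cint_cst//; [exact: ccont_cst|exact: ccontZ].
have SL : cint c d (sline (fun=> B) y0 a b) = B * (b - a)%:C * (d - c)%:C.
  rewrite (@eq_cint _ _ _ _ (fun=> B * (b - a)%:C)); last by move=> x; rewrite /sline /hline cint_cst.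
  by rewrite cint_cst.
have i2 : 'i * 'i = -1 :> R[i] by rewrite -expr2 sqr_i.
have e (x y : R) : (x - y)%:C = x%:C - y%:C :> R[i] by rewrite rmorphB.
rewrite !H !V SL !e; move: (a%:C) (b%:C) (c%:C) (d%:C) i2 (((b ^+ 2 - a ^+ 2) / 2)%:C) (((d ^+ 2 - c ^+ 2) / 2)%:C).
move=> a' b' c' d' i2' p q; exact: defect_affine.
Qed.

Lemma pompeiuB F P G Q (y0 a b c d : R) :
  ccatb y0 F -> ccatb y0 P -> ccatb y0 G -> ccatb y0 Q ->
  y0 <= c -> a <= b -> c <= d ->
  pompeiu (fun w => F w - P w) (fun w => G w - Q w) y0 a b c d =
  pompeiu F G y0 a b c d - pompeiu P Q y0 a b c d.
Proof.
move=> hF hP hG hQ yc ab cd; have yd := le_trans yc cd; rewrite /pompeiu /contour.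
have eh U V t : ccatb y0 U -> ccatb y0 V -> y0 <= t -> cint a b (hline (fun w => U w - V w) t) = cint a b (hline U t) - cint a b (hline V t).
  by move=> hU hV yt; rewrite -cintB//; [exact: (ccont_hline hU yt)|exact: (ccont_hline hV yt)].
have ev t : cint c d (vline (fun w => F w - P w) y0 t) = cint c d (vline F y0 t) - cint c d (vline P y0 t).
  by rewrite -cintB//; [exact: ccont_vline|exact: ccont_vline].
have es : cint c d (sline (fun w => G w - Q w) y0 a b) = cint c d (sline G y0 a b) - cint c d (sline Q y0 a b).
  rewrite -cintB//; [|exact: ccont_sline..]; apply: eq_cint => x; rewrite /sline eh//.
  by rewrite le_max lexx orbT.
by rewrite !eh// !ev es; exact: defectB.
Qed.

Lemma pompeiu_le F G (y0 a b c d M K : R) : ccatb y0 F -> ccatb y0 G ->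
  y0 <= c -> a <= b -> c <= d ->
  (forall x y, a <= x <= b -> c <= y <= d -> normc (F (x +i* y)) <= M) ->
  (forall x y, a <= x <= b -> c <= y <= d -> normc (G (x +i* y)) <= K) ->
  normc (pompeiu F G y0 a b c d) <= 2 * M * ((b - a) + (d - c)) + 2 * K * ((b - a) * (d - c)).
Proof.
move=> cF cG yc ab cd FM GK; have yd := le_trans yc cd; rewrite /pompeiu /contour.
have b1 : normc (cint a b (hline F c)) <= M * (b - a).
  by apply: normc_cint_cst => //; [exact: ccont_hline cF yc|move=> x xab; apply: FM; rewrite // lexx].
have b2 : normc (cint a b (hline F d)) <= M * (b - a).
  by apply: normc_cint_cst => //; [exact: ccont_hline cF yd|move=> x xab; apply: FM; rewrite // lexx cd].
have bv t : a <= t <= b -> normc (cint c d (vline F y0 t)) <= M * (d - c).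
  move=> tab; apply: normc_cint_cst => //; first exact: ccont_vline.
  move=> y /andP[cy yd'].
  by rewrite /vline max_l ?(le_trans yc cy)//; apply: FM => //; rewrite cy.
have b3 : normc (cint c d (vline F y0 b)) <= M * (d - c) by apply: bv; rewrite lexx ab.
have b4 : normc (cint c d (vline F y0 a)) <= M * (d - c) by apply: bv; rewrite lexx ab.
have b5 : normc (cint c d (sline G y0 a b)) <= K * (b - a) * (d - c).
  apply: normc_cint_cst => //; first exact: ccont_sline.
  move=> y /andP[cy yd']; apply: normc_cint_cst => //.
    by apply: (ccont_hline cG); rewrite le_max lexx orbT.
  by move=> x xab; rewrite /hline max_l ?(le_trans yc cy)//; apply: GK => //; rewrite cy.
have i1 : normc ('i : R[i]) = 1 by rewrite /= expr0n expr1n add0r sqrtr1.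
apply: le_trans (normcD _ _) _; apply: lerD.
  apply: le_trans (normcD _ _) _.
  rewrite normcM i1 mul1r.
  apply: le_trans (lerD (normcD _ _) (normcD _ _)) _; rewrite !normcN.
  apply: le_trans (lerD (lerD b1 b2) (lerD b3 b4)) _.
  by apply: eq_ler; ring.
have -> : (2 : R[i]) = (2 : R)%:C by rewrite rmorph_nat.
rewrite normcN !normcM i1 mulr1 normc_real normr_nat -mulrA ler_pM2l// mulrA; exact: b5.
Qed.
End Contour.

Lemma pow2_small (R : realType) (D d : R) : 0 <= D -> 0 < d -> exists n, D / 2 ^+ n < d.
Proof.
move=> D0 dl0; have : \forall n \near \oo, (2^-1 : R) ^+ n < d / (D + 1).
  have /cvgr0Pnorm_lt/(_ (d / (D + 1))) : (2^-1 : R) ^+ n @[n --> \oo] --> 0.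
    by apply: cvg_expr; rewrite ger0_norm ?invr_ge0// invf_lt1// ltr1n.
  rewrite divr_gt0 ?ltr_wpDl// => /(_ isT); apply: filterS => n.
  by rewrite ger0_norm// exprn_ge0// invr_ge0.
case=> n _ /(_ n (leqnn n)) /= hn; exists n.
move: hn; rewrite ltr_pdivlMr ?ltr_wpDl// exprVn => hn.
apply: le_lt_trans hn; rewrite mulrC ler_wpM2l ?invr_ge0 ?exprn_ge0//; lra.
Qed.

(** Iterated bisection. The nested rectangles meet in the point whose coordinates are the suprema of
    their left and lower sides. *)
Lemma pompeiu_nested (R : realType) (F G : R[i] -> R[i]) (y0 a b c d : R) :
  ccatb y0 F -> ccatb y0 G -> y0 <= c -> a <= b -> c <= d ->
  exists2 z : R[i], y0 <= Im z & forall n : nat, exists p : R * R,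
   [/\ y0 <= p.2, p.1 <= Re z <= p.1 + (b - a) / 2 ^+ n, p.2 <= Im z <= p.2 + (d - c) / 2 ^+ n &
     normc (pompeiu F G y0 a b c d) <= 4 ^+ n *
       normc (pompeiu F G y0 p.1 (p.1 + (b - a) / 2 ^+ n) p.2 (p.2 + (d - c) / 2 ^+ n))].
Proof.
move=> cF cG yc ab cd.
pose L1 := b - a; pose L2 := d - c.
have L10 : 0 <= L1 by rewrite subr_ge0.
have L20 : 0 <= L2 by rewrite subr_ge0.
pose l1 n : R := L1 / 2 ^+ n; pose l2 n : R := L2 / 2 ^+ n.
have p2 n : 0 < 2 ^+ n :> R by rewrite exprn_gt0.
have l10 n : 0 <= l1 n by rewrite divr_ge0// ltW.
have l20 n : 0 <= l2 n by rewrite divr_ge0// ltW.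
have l1S n : l1 n = 2 * l1 n.+1 by rewrite /l1 exprS; field; rewrite gt_eqF.
have l2S n : l2 n = 2 * l2 n.+1 by rewrite /l2 exprS; field; rewrite gt_eqF.
have ab1 : a + l1 0%N = b by rewrite /l1 expr0 divr1 addrC subrK.
have cd1 : c + l2 0%N = d by rewrite /l2 expr0 divr1 addrC subrK.
have E1 n : (b - a) / 2 ^+ n = l1 n by [].
have E2 n : (d - c) / 2 ^+ n = l2 n by [].
clearbody l1 l2; clear L1 L2 L10 L20 p2.
pose Ct n (p : R * R) := pompeiu F G y0 p.1 (p.1 + l1 n) p.2 (p.2 + l2 n).
pose Q n (p p' : R * R) := [/\ (p.1 <= p'.1 <= p.1 + l1 n.+1), (p.2 <= p'.2 <= p.2 + l2 n.+1) &
   normc (Ct n p) <= 4 * normc (Ct n.+1 p')].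
pose s := fix s n := if n is n'.+1 then xget (s n') (Q n' (s n')) else (a, c).
have sQ n : c <= (s n).2 -> Q n (s n) (s n.+1).
  move=> cs; have [p hp] := pompeiu_quad (s n).1 cF cG (le_trans yc cs) (l10 n.+1) (l20 n.+1).
  have Qp : Q n (s n) p.
    by move: hp => [h1 h2 h3]; split; [exact: h1|exact: h2|]; rewrite /Ct [l1 n]l1S [l2 n]l2S.
  exact: (@xgetPex _ (s n) (Q n (s n)) (ex_intro _ p Qp)).
have sc n : c <= (s n).2.
  elim: n => [|n IH] //; have [_ /andP[h _] _] := sQ n IH; exact: le_trans h.
have {}sQ n := sQ n (sc n).
have mono1 n k : (s n).1 <= (s (n + k)%N).1 /\ (s (n + k)%N).1 + l1 (n + k)%N <= (s n).1 + l1 n.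
  elim: k => [|k [IH1 IH2]]; first by rewrite addn0.
  rewrite addnS; have [/andP[h1 h2] _ _] := sQ (n + k)%N; have := l1S (n + k)%N; split; lra.
have mono2 n k : (s n).2 <= (s (n + k)%N).2 /\ (s (n + k)%N).2 + l2 (n + k)%N <= (s n).2 + l2 n.
  elim: k => [|k [IH1 IH2]]; first by rewrite addn0.
  rewrite addnS; have [_ /andP[h1 h2] _] := sQ (n + k)%N; have := l2S (n + k)%N; split; lra.
have ub1 n m : (s m).1 <= (s n).1 + l1 n.
  have [nm|mn] := leqP n m.
    have [_] := mono1 n (m - n)%N; rewrite subnKC// => h; have := l10 m; lra.
  have [+ _] := mono1 m (n - m)%N; rewrite subnKC ?(ltnW mn)// => h; have := l10 n; lra.
have ub2 n m : (s m).2 <= (s n).2 + l2 n.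
  have [nm|mn] := leqP n m.
    have [_] := mono2 n (m - n)%N; rewrite subnKC// => h; have := l20 m; lra.
  have [+ _] := mono2 m (n - m)%N; rewrite subnKC ?(ltnW mn)// => h; have := l20 n; lra.
pose X := [set (s n).1 | n in setT]; pose Y := [set (s n).2 | n in setT].
have hX : has_sup X.
  split; first by exists (s 0%N).1; exists 0%N.
  by exists ((s 0%N).1 + l1 0%N) => _ [m _ <-]; exact: ub1.
have hY : has_sup Y.
  split; first by exists (s 0%N).2; exists 0%N.
  by exists ((s 0%N).2 + l2 0%N) => _ [m _ <-]; exact: ub2.
have x1 n : (s n).1 <= sup X <= (s n).1 + l1 n.
  apply/andP; split; first by apply: ub_le_sup; [exact: hX.2|exists n].
  by apply: ge_sup; [exact: hX.1|move=> _ [m _ <-]; exact: ub1].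
have y1 n : (s n).2 <= sup Y <= (s n).2 + l2 n.
  apply/andP; split; first by apply: ub_le_sup; [exact: hY.2|exists n].
  by apply: ge_sup; [exact: hY.1|move=> _ [m _ <-]; exact: ub2].
pose z := sup X +i* sup Y.
have yz : y0 <= Im z by apply: (le_trans yc); have /andP[] := y1 0%N.
have Cn n : normc (Ct 0%N (s 0%N)) <= 4 ^+ n * normc (Ct n (s n)).
  elim: n => [|n IH]; first by rewrite expr0 mul1r.
  apply: (le_trans IH); have [_ _ h] := sQ n.
  by rewrite exprSr -mulrA ler_pM2l ?exprn_gt0.
have C0 : pompeiu F G y0 a b c d = Ct 0%N (s 0%N).
  by rewrite /Ct -{1}ab1 -{1}cd1.
exists z; first exact: yz.
move=> n; exists (s n); rewrite E1 E2; split; [exact: le_trans (sc n)|exact: x1|exact: y1|].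
by rewrite C0; exact: Cn.
Qed.

Lemma pompeiu_local (R : realType) (F G : R[i] -> R[i]) (y0 : R) (z A : R[i]) (e1 : R) : 0 < e1 ->
  (forall z, y0 <= Im z -> exists A, rdiff F z A (G z)) -> ccatb y0 G -> y0 <= Im z ->
  rdiff F z A (G z) -> exists2 dl, 0 < dl & forall (p : R * R) l1 l2, 0 <= l1 -> 0 <= l2 ->
   l1 + l2 < dl -> y0 <= p.2 -> p.1 <= Re z <= p.1 + l1 -> p.2 <= Im z <= p.2 + l2 ->
   normc (pompeiu F G y0 p.1 (p.1 + l1) p.2 (p.2 + l2)) <= 4 * e1 * ((l1 + l2) * (l1 + l2)).
Proof.
move=> e10 dF cG yz dA.
have cF : ccatb y0 F by move=> w /dF[B]; exact: rdiff_ccat.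
have [dl1 dl10 H1] := dA _ e10.
have [dl2 dl20 H2] := cG z yz _ e10.
exists (Num.min dl1 dl2); first by rewrite lt_min dl10.
move=> [p q] l1 l2 l10 l20; rewrite lt_min /= => nd yq pz qz.
(* The first order approximation of F at z. By differentiability F - P is at most e1 (l1 + l2) on
   the rectangle, and by continuity G - G z is at most e1. *)
pose P w := F z - A * z - G z * conjc z + A * w + G z * conjc w.
have cP : ccatb y0 P.
  move=> w _; apply: (@rdiff_ccat _ _ _ A (G z)); apply: rdiff_affine => h.
  by rewrite /P rmorphD /=; ring.
have cQ : ccatb y0 (fun=> G z) by move=> w _; exact: rdiff_ccat (rdiff_cst _ _).
have a1 : p <= p + l1 by rewrite lerDl.
have a2 : q <= q + l2 by rewrite lerDl.
have nz x y : p <= x <= p + l1 -> q <= y <= q + l2 ->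
    normc ((x +i* y) - z) <= l1 + l2.
  move=> xab ycd; apply: le_trans (normc_le_ReIm _) _; rewrite !raddfB /=.
  move: xab ycd pz qz => /andP[? ?] /andP[? ?] /andP[? ?] /andP[? ?].
  by apply: lerD; rewrite ler_norml; apply/andP; split; lra.
move/andP: nd => nd.
have main : normc (pompeiu F G y0 p (p + l1) q (q + l2)) <= 2 * (e1 * (l1 + l2)) * (l1 + l2) + 2 * e1 * (l1 * l2).
  have -> : pompeiu F G y0 p (p + l1) q (q + l2) = pompeiu (fun w => F w - P w) (fun w => G w - G z) y0 p (p + l1) q (q + l2).
    by rewrite pompeiuB// pompeiu_affine// subr0.
  have := @pompeiu_le _ (fun w => F w - P w) (fun w => G w - G z) y0 p (p + l1) q (q + l2) (e1 * (l1 + l2)) e1.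
  rewrite [p + l1 - _]addrC addKr [q + l2 - _]addrC addKr; apply => //.
  - move=> w yw; have -> : (fun w => F w - P w) = (fun w => F w + (-1) * P w) by apply/funext => v; ring.
    have [A' dF'] := dF w yw; apply: (rdiff_ccat (rdiffD dF' (rdiffZ (-1) (_ : rdiff P w A (G z))))).
    by apply: rdiff_affine => h; rewrite /P rmorphD /=; ring.
  - by move=> w yw e' e'0; have [d' d'0 H'] := cG w yw e' e'0; exists d' => // h /H'; rewrite opprB addrA subrK.
  - move=> x y xab ycd; have n0 := nz x y xab ycd; set h := (x +i* y) - z in n0.
    have -> : F (x +i* y) - P (x +i* y) = F (z + h) - F z - (A * h + G z * conjc h).
      have -> : x +i* y = z + h by rewrite /h addrC subrK.
      by rewrite /P rmorphD /=; ring.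
    apply: (@le_trans _ _ (e1 * normc h)); first by apply: H1; exact: le_lt_trans n0 nd.1.
    by rewrite ler_pM2l.
  - move=> x y xab ycd; have n0 := nz x y xab ycd.
    have -> : x +i* y = z + ((x +i* y) - z) by rewrite addrC subrK.
    by apply: H2; exact: le_lt_trans n0 nd.2.
have ll : l1 * l2 <= (l1 + l2) * (l1 + l2).
  by apply: ler_pM; rewrite ?lerDl ?lerDr.
apply: (le_trans main); move: ll (ltW e10).
move: (l1 + l2) (l1 * l2) (e1) => u v w; nra.
Qed.

(** Goursat's argument: after n bisections the local estimate gains 4^-n times an arbitrarily small
    constant, against the factor 4^n lost. Continuity is asked only of the derivative with respect
    to the conjugate variable. *)
Theorem cauchy_pompeiu (R : realType) (F G : R[i] -> R[i]) (y0 a b c d : R) :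
  (forall z, y0 <= Im z -> exists A, rdiff F z A (G z)) -> ccatb y0 G ->
  y0 <= c -> a <= b -> c <= d -> pompeiu F G y0 a b c d = 0.
Proof.
move=> dF cG yc ab cd.
have cF : ccatb y0 F by move=> z /dF[A]; exact: rdiff_ccat.
have [z yz Hz] := pompeiu_nested cF cG yc ab cd; have [A dA] := dF z yz.
apply: Normc.eq0_normc; apply/eqP; rewrite eq_le normc_ge0 andbT.
apply/ler_addgt0Pl => e e0; rewrite addr0.
have ba0 : 0 <= b - a by rewrite subr_ge0.
have dc0 : 0 <= d - c by rewrite subr_ge0.
pose D := (b - a) + (d - c).
have D0 : 0 <= D by rewrite addr_ge0.
have D21 : 0 < 4 * (D * D) + 1 by rewrite ltr_wpDl// !mulr_ge0.
have e10 : 0 < e / (4 * (D * D) + 1) by rewrite divr_gt0.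
have [dl dl0 H] := pompeiu_local e10 dF cG yz dA.
have [n] := pow2_small D0 dl0; rewrite mulrDl => hn.
have p2 : 0 < 2 ^+ n :> R by rewrite exprn_gt0.
have [p [yp px py hX]] := Hz n.
have {}H := H p _ _ (divr_ge0 ba0 (ltW p2)) (divr_ge0 dc0 (ltW p2)) hn yp px py.
apply: (le_trans hX); apply: le_trans (ler_wpM2l _ H) _; first by rewrite exprn_ge0.
rewrite -mulrDl -/D (_ : 4 ^+ n * _ = e / (4 * (D * D) + 1) * (4 * (D * D))); last first.
  have -> : (4 : R) ^+ n = 2 ^+ n * 2 ^+ n by rewrite -exprMn; congr (_ ^+ _); ring.
  by field; rewrite (gt_eqF p2) (gt_eqF D21).
apply: (@le_trans _ _ (e / (4 * (D * D) + 1) * (4 * (D * D) + 1))); first by apply: ler_wpM2l; [exact: ltW|rewrite lerDl].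
by rewrite divfK// gt_eqF.
Qed.

(** * Differential inequalities and the equation of the Fourier coefficients in y *)

Section RealDeriv.
Context {R : realType}.
Implicit Types (f g : R -> R) (a b k t x y : R).

Lemma dcst k x : is_derive x 1 (fun=> k) 0.
Proof. exact: is_derive_cst. Qed.

Lemma did x : is_derive x 1 (fun t : R => t) 1.
Proof. exact: is_derive_id. Qed.

Lemma dM f g a b x : is_derive x 1 f a -> is_derive x 1 g b ->
  is_derive x 1 (fun t => f t * g t) (a * g x + f x * b).
Proof.
by move=> df dg; apply: (is_derive_eq (is_deriveM df dg)); rewrite /GRing.scale/= addrC [g x * a]mulrC.
Qed.

Lemma dD f g a b x : is_derive x 1 f a -> is_derive x 1 g b ->
  is_derive x 1 (fun t => f t + g t) (a + b).
Proof. by move=> df dg; exact: is_deriveD. Qed.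

Lemma dZ f a k x : is_derive x 1 f a -> is_derive x 1 (fun t => k * f t) (k * a).
Proof. by move=> df; apply: (is_derive_eq (dM (dcst k x) df)); rewrite mul0r add0r. Qed.

Lemma dB f g a b x : is_derive x 1 f a -> is_derive x 1 g b ->
  is_derive x 1 (fun t => f t - g t) (a - b).
Proof.
move=> df dg; rewrite (_ : (fun t => _) = (fun t => f t + (-1) * g t)); last first.
  by apply/funext => t; rewrite mulN1r.
by apply: (is_derive_eq (dD df (dZ (-1) dg))); rewrite mulN1r.
Qed.

Lemma dexp k x : is_derive x 1 (fun t => expR (k * t)) (k * expR (k * x)).
Proof.
have d1 : is_derive x 1 (fun t => k * t) k by apply: (is_derive_eq (dZ k (did x))); rewrite mulr1.
by rewrite mulrC; exact: (is_derive1_comp (f := expR) (g := fun t => k * t) (is_derive_expR _) d1).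
Qed.

Lemma deriv_mono f (df : R -> R) a b : a <= b ->
  (forall x, a <= x <= b -> is_derive x 1 f (df x)) ->
  (forall x, a <= x <= b -> 0 <= df x) -> f a <= f b.
Proof.
move=> ab dF df0.
have cf : {within `[a, b], continuous f}.
  apply: derivable_within_continuous => x; rewrite in_itv /= => /dF d.
  exact: ex_derive.
have [c|c] := @MVT_segment _ f df a b ab _ cf.
  by rewrite in_itv /= => /andP[/ltW ac /ltW cb]; apply: dF; rewrite ac.
by rewrite in_itv /= => /df0 h e; rewrite -subr_ge0 e mulr_ge0// subr_ge0.
Qed.

(** Put v = w' + k w, so that v' >= k v. If v were positive at some point, v and then w would grow
    like exp (k y), against the polynomial bound. Hence v <= 0, that is, w exp (k y) decreases. *)
Lemma exp_decay (w w1 w2 : R -> R) (k y0 K : R) (A : nat) : 0 < k ->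
  (forall y, y0 <= y -> is_derive y 1 w (w1 y)) ->
  (forall y, y0 <= y -> is_derive y 1 w1 (w2 y)) ->
  (forall y, y0 <= y -> k ^+ 2 * w y <= w2 y) ->
  (forall y, y0 <= y -> 1 <= y -> w y <= K * y ^+ A) ->
  forall t y, y0 <= t -> t <= y -> w y <= w t * expR (- k * (y - t)).
Proof.
move=> k0 d1 d2 cw gw.
pose v y := w1 y + k * w y.
suff v0 t : y0 <= t -> v t <= 0.
  move=> t y yt ty.
  have h : w y * expR (k * y) <= w t * expR (k * t).
    rewrite -lerN2; apply: (@deriv_mono (fun y => - (w y * expR (k * y))) (fun y => - (v y * expR (k * y)))) => //.
      move=> x /andP[tx _]; have dw := d1 x (le_trans yt tx).
      rewrite (_ : (fun y => _) = (fun y => (-1) * (w y * expR (k * y)))); last first.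
        by apply/funext => u; rewrite mulN1r.
      by apply: (is_derive_eq (dZ (-1) (dM dw (dexp k x)))); rewrite /v; ring.
    move=> x /andP[tx _]; rewrite oppr_ge0 mulr_le0_ge0 ?expR_ge0//.
    exact: v0 (le_trans yt tx).
  rewrite -ler_pdivlMr ?expR_gt0// in h; apply: (le_trans h).
  rewrite -mulrA -expRB (_ : - k * (y - t) = k * t - k * y)//; ring.
move=> yt; rewrite leNgt; apply/negP => vt0.
pose c := v t * expR (- k * t).
have c0 : 0 < c by rewrite mulr_gt0 ?expR_gt0.
have hv y : t <= y -> c * expR (k * y) <= v y.
  move=> ty.
  have h : v t * expR (- k * t) <= v y * expR (- k * y).
    apply: (@deriv_mono (fun y => v y * expR (- k * y)) (fun y => (w2 y - k ^+ 2 * w y) * expR (- k * y))) => //.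
      move=> x /andP[tx _]; have yx := le_trans yt tx.
      by apply: (is_derive_eq (dM (dD (d2 x yx) (dZ k (d1 x yx))) (dexp (- k) x))); rewrite /v; ring.
    by move=> x /andP[tx _]; rewrite mulr_ge0 ?expR_ge0// subr_ge0; exact: cw (le_trans yt tx).
  apply: le_trans (ler_wpM2r (expR_ge0 (k * y)) h) _.
  by rewrite -mulrA -expRD mulNr addNr expR0 mulr1.
have hw y : t <= y -> w t * expR (k * t) + c / (2 * k) * (expR (2 * k * y) - expR (2 * k * t)) <= w y * expR (k * y).
  move=> ty.
  have : w t * expR (k * t) - c / (2 * k) * expR (2 * k * t) <= w y * expR (k * y) - c / (2 * k) * expR (2 * k * y).
    apply: (@deriv_mono (fun y => w y * expR (k * y) - c / (2 * k) * expR (2 * k * y)) (fun y => (v y - c * expR (k * y)) * expR (k * y))) => //.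
      move=> x /andP[tx _]; have yx := le_trans yt tx.
      apply: (is_derive_eq (dB (dM (d1 x yx) (dexp k x)) (dZ (c / (2 * k)) (dexp (2 * k) x)))).
      have -> : expR (2 * k * x) = expR (k * x) * expR (k * x) by rewrite -expRD; congr expR; ring.
      by rewrite /v; field; rewrite gt_eqF.
    by move=> x /andP[tx _]; rewrite mulr_ge0 ?expR_ge0// subr_ge0; exact: hv.
  by rewrite mulrBr; lra.
(* [w] would grow exponentially, against the polynomial bound *)
pose B := c / (2 * k) * expR (2 * k * t) - w t * expR (k * t).
have k2 : 0 < c / (2 * k) by rewrite divr_gt0// mulr_gt0.
pose D : R := A.+2`!%:R / k ^+ A.+2.
have D0 : 0 < D by rewrite divr_gt0 ?exprn_gt0// ltr0n fact_gt0.
have hy y : t <= y -> 1 <= y -> c / (2 * k) * expR (k * y) <= `|K| * y ^+ A + `|B|.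
  move=> ty y1; have y0' : 0 < y by exact: lt_le_trans y1.
  have := hw y ty; have := gw y (le_trans yt ty) y1.
  have -> : expR (2 * k * y) = expR (k * y) * expR (k * y) by rewrite -expRD; congr expR; ring.
  have E1 : 1 <= expR (k * y).
    by apply: le_trans (expR_ge1Dx _); rewrite lerDl mulr_ge0 ?ltW.
  have : K * y ^+ A <= `|K| * y ^+ A by rewrite ler_wpM2r ?ler_norm// exprn_ge0// ltW.
  have : B <= `|B| * expR (k * y).
    by apply: (le_trans (ler_norm _)); rewrite ler_peMr.
  rewrite /B; move: (expR (k * y)) E1 (expR (2 * k * t)) (expR (k * t)) (c / (2 * k)) k2 (y ^+ A) => E E1 E2 E3 q q0 Y.
  move: `|_| (w t) (w y) => Bn wt wy h1 h2 h3 h4.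
  have E0 : 0 < E by lra.
  rewrite -(ler_pM2r E0); nra.
pose M := (`|K| + `|B|) / (c / (2 * k)) * D + 1.
pose y := Num.max (Num.max t 1) M.
have [ty y1 yM] : [/\ t <= y, 1 <= y & M <= y] by rewrite !le_max !lexx ?orbT.
have y0' : 0 < y by exact: lt_le_trans y1.
have := hy y ty y1.
have yA1 : 1 <= y ^+ A by rewrite exprn_ege1.
have e1 : y ^+ A.+2 / D <= expR (k * y).
  have ky : 0 <= k * y by rewrite mulr_ge0// ltW.
  have := expR_ge1Dxn A.+1 ky; apply: le_trans; rewrite exprMn /D.
  rewrite (_ : y ^+ A.+2 / (A.+2`!%:R / k ^+ A.+2) = k ^+ A.+2 * y ^+ A.+2 / A.+2`!%:R) ?lerDr//.
  by field; rewrite pnatr_eq0 -lt0n fact_gt0 expf_neq0 ?gt_eqF.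
have e2 : M * y ^+ A.+1 <= y ^+ A.+2 by rewrite [y ^+ A.+2]exprS ler_wpM2r// exprn_ge0// ltW.
apply/negP; rewrite -ltNge.
apply: (@lt_le_trans _ _ (c / (2 * k) * (M * y ^+ A.+1 / D))); last first.
  rewrite ler_pM2l//; apply: le_trans e1; rewrite ler_pdivrMr// divfK ?gt_eqF//.
have yS : y ^+ A <= y ^+ A.+1 by rewrite exprS ler_peMl// exprn_ge0// ltW.
apply: (@le_lt_trans _ _ ((`|K| + `|B|) * y ^+ A.+1)).
  rewrite mulrDl; apply: lerD; first by rewrite ler_wpM2l.
  by rewrite ler_peMr//; exact: le_trans yS.
rewrite !mulrA ltr_pdivlMr// mulrAC ltr_pM2r ?exprn_gt0//.
have -> : c / (2 * k) * M = (`|K| + `|B|) * D + c / (2 * k).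
  by rewrite /M; field; rewrite (gt_eqF c0) (gt_eqF k0).
by rewrite ltrDl.
Qed.
End RealDeriv.

Section FourierODE.
Context {R : realType}.
Implicit Types (f g : R -> R[i]) (v w : R[i]) (x y k : R).

Definition cderive f x w := is_derive x 1 (fun t => Re (f t)) (Re w) /\ is_derive x 1 (fun t => Im (f t)) (Im w).

Lemma cReD v w : Re (v + w) = Re v + Re w. Proof. by case: v; case: w. Qed.
Lemma cImD v w : Im (v + w) = Im v + Im w. Proof. by case: v; case: w. Qed.

Lemma cderive_eq f x v w : cderive f x v -> v = w -> cderive f x w.
Proof. by move=> + <-. Qed.

Lemma cderive_near f g x w : (\near x, f x = g x) -> cderive f x w -> cderive g x w.
Proof.
move=> fg [d1 d2]; split; [move: d1|move: d2]; apply: near_eq_is_derive;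
  by apply: filterS fg => t ->.
Qed.

Lemma cderiveM f g x v w : cderive f x v -> cderive g x w ->
  cderive (fun t => f t * g t) x (v * g x + f x * w).
Proof.
move=> [f1 f2] [g1 g2]; split.
  rewrite (_ : (fun t => _) = (fun t => Re (f t) * Re (g t) - Im (f t) * Im (g t))); last first.
    by apply/funext => t; rewrite cReM.
  by apply: (is_derive_eq (dB (dM f1 g1) (dM f2 g2))); rewrite cReD !cReM; ring.
rewrite (_ : (fun t => _) = (fun t => Re (f t) * Im (g t) + Im (f t) * Re (g t))); last first.
  by apply/funext => t; rewrite cImM.
by apply: (is_derive_eq (dD (dM f1 g2) (dM f2 g1))); rewrite cImD !cImM; ring.
Qed.

Lemma cderive_cst w x : cderive (fun=> w) x 0.
Proof. by split; exact: dcst. Qed.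

Lemma cderive_real (h : R -> R) x (a : R) : is_derive x 1 h a -> cderive (fun t => (h t)%:C) x a%:C.
Proof. by move=> dh; split => //=; exact: dcst. Qed.

Lemma cderive_conj f x w : cderive f x w -> cderive (fun t => conjc (f t)) x (conjc w).
Proof.
move=> [d1 d2]; split.
  rewrite (_ : (fun t => _) = (fun t => Re (f t))); last by apply/funext => t; case: (f t).
  by case: w d1 d2.
rewrite (_ : (fun t => _) = (fun t => (-1) * Im (f t))); last by apply/funext => t; case: (f t) => a b; rewrite mulN1r.
by apply: (is_derive_eq (dZ (-1) d2)); case: w {d1 d2} => a b; rewrite mulN1r.
Qed.

Lemma ccatM (F G : R[i] -> R[i]) z : ccat F z -> ccat G z -> ccat (fun w => F w * G w) z.
Proof.
move=> cF cG e e0.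
have G1 : 0 < normc (G z) + 1 by rewrite ltr_wpDl// normc_ge0.
have F1 : 0 < normc (F z) + 1 by rewrite ltr_wpDl// normc_ge0.
have e2 : 0 < e / 2 by rewrite divr_gt0.
have [d1 d10 H1] := cG _ (divr_gt0 e2 F1).
have [d2 d20 H2] := cF _ (divr_gt0 e2 G1).
have [d3 d30 H3] := cF _ ltr01.
exists (Num.min d1 (Num.min d2 d3)); first by rewrite 2!lt_min d10 d20.
move=> h; rewrite 2!lt_min => /andP[/H1 h1 /andP[/H2 h2 /H3 h3]].
have -> : F (z + h) * G (z + h) - F z * G z = F (z + h) * (G (z + h) - G z) + (F (z + h) - F z) * G z.
  by ring.
have nF : normc (F (z + h)) <= normc (F z) + 1.
  rewrite -[F (z + h)](subrK (F z)); apply: le_trans (normcD _ _) _; lra.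
apply: le_trans (normcD _ _) _; rewrite !normcM [leRHS](splitr e); apply: lerD.
  apply: (@le_trans _ _ ((normc (F z) + 1) * (e / 2 / (normc (F z) + 1)))).
    by apply: ler_pM => //; exact: normc_ge0.
  by rewrite mulrCA divff ?mulr1// gt_eqF.
apply: (@le_trans _ _ (e / 2 / (normc (G z) + 1) * (normc (G z) + 1))).
  by apply: ler_pM => //; rewrite ?normc_ge0// lerDl.
by rewrite divfK// gt_eqF.
Qed.

Variables (N : R) (F G : R[i] -> R[i]).
Hypothesis N0 : 0 < N.
Hypothesis dF : forall z, uhp z -> exists A, rdiff F z A (G z).
Hypothesis cG : forall z, uhp z -> ccat G z.
Hypothesis pF : forall z, uhp z -> F (z + N%:C) = F z.
Implicit Types j : int.

Definition uh F j y := fc N (hline F y) j.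

Let fr j : R := 2 * pi * (j%:~R / N).

Let echE j x y : cexp (fr j) (x +i* y) = (expR (fr j * y))%:C * conjc (ech N j x).
Proof.
rewrite /cexp /ech /ee /=; congr (_ * _).
by rewrite /fr (_ : 2 * pi * (j%:~R / N) * x = 2 * pi * (j%:~R / N * x)) ?mulrA.
Qed.

Let hline_cexp (H : R[i] -> R[i]) j y : (forall c, 0 < c -> ccont (hline H c)) -> 0 < y ->
  cint 0 N (hline (fun z => H z * cexp (fr j) z) y) = N%:C * ((expR (fr j * y))%:C * uh H j y).
Proof.
move=> cH y0; rewrite /uh /fc /inp.
have -> w : N%:C * ((expR (fr j * y))%:C * ((N^-1)%:C * w)) = (expR (fr j * y))%:C * w.
  rewrite mulrCA; congr (_ * _); rewrite mulrA -rmorphM /= divff ?gt_eqF//; simpc; by case: w.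
rewrite -cintZ; last by apply: ccont_inp; [exact: cH|exact: ccont_ech].
by apply: eq_cint => x; rewrite /hline echE; ring.
Qed.

(** The Cauchy-Pompeiu formula for F(z) exp (- i r z) on rectangles one period wide: the vertical
    sides cancel, and the horizontal ones are Fourier coefficients. Differentiating in the upper
    height gives the equation. *)
Lemma fc_ode j y : 0 < y ->
  cderive (uh F j) y (- (fr j)%:C * uh F j y - 2 * 'i * uh G j y).
Proof.
move=> y0; pose c := y / 2.
have c0 : 0 < c by rewrite divr_gt0.
have cy : c < y by rewrite /c; lra.
have up x t : c <= t -> uhp (x +i* t : R[i]) by rewrite /uhp /=; exact: lt_le_trans.
have uc (z : R[i]) : c <= Im z -> uhp z by case: z => a b; exact: up.
pose E := cexp (fr j); pose FE z := F z * E z; pose GE z := G z * E z.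
have dFE z : c <= Im z -> exists A, rdiff FE z A (GE z).
  move=> /uc uz; have [A dA] := dF uz; have [B dE] := rdiff_cexp (fr j) z.
  exists (A * E z + F z * B); apply: (rdiff_eq (rdiffM dA dE)) => //.
  by rewrite mulr0 addr0.
have cGE : ccatb c GE.
  move=> z /uc uz; have [B dE] := rdiff_cexp (fr j) z.
  by apply: ccatM; [exact: cG|exact: rdiff_ccat dE].
have cHF t : 0 < t -> ccont (hline F t).
  by move=> t0; apply: (@ccont_hline _ F t) => // z tz; have [A] := dF (lt_le_trans t0 tz); exact: rdiff_ccat.
have cHG t : 0 < t -> ccont (hline G t).
  by move=> t0; apply: (@ccont_hline _ G t) => // z tz; exact: cG (lt_le_trans t0 tz).
pose phi t := (expR (fr j * t))%:C * uh F j t.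
pose psi := sline GE c 0 N.
have cpsi : ccont psi by apply: ccont_sline => //; exact: ltW.
have psiE t : c <= t -> psi t = N%:C * ((expR (fr j * t))%:C * uh G j t).
  by move=> ct; rewrite /psi /sline max_l// hline_cexp//; exact: lt_le_trans ct.
have key t : c <= t -> N%:C * phi t = N%:C * phi c - 2 * 'i * cint c t psi.
  move=> ct; have e0 := cauchy_pompeiu dFE cGE (lexx c) (ltW N0) ct.
  have vE : vline FE c N = vline FE c 0.
    apply/funext => u; rewrite /vline /FE /E; set m := Num.max u c.
    have um : uhp (0 +i* m : R[i]) by apply: up; rewrite /m le_max lexx orbT.
    have -> : N +i* m = (0 +i* m) + N%:C by simpc.
    rewrite pF//; congr (_ * _); simpc; rewrite !echE; congr (_ * conjc _).
    by have := ech_period N0 j 0; rewrite add0r.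
  have h1 : cint 0 N (hline FE c) = N%:C * phi c by exact: hline_cexp.
  have h2 : cint 0 N (hline FE t) = N%:C * phi t by apply: hline_cexp => //; exact: lt_le_trans ct.
  move: e0; rewrite /pompeiu /contour vE h1 h2 -/psi.
  move: (N%:C * phi c) (N%:C * phi t) (2 * 'i * cint c t psi) (cint c t (vline FE c 0)) => a b d v e0.
  by apply/eqP; rewrite -subr_eq0 (_ : _ - _ = - (a - b + 'i * (v - v) - d)); [rewrite e0 oppr0|ring].
have NC0 : N%:C != 0 :> R[i] by rewrite eq_complex /= eqxx andbT gt_eqF.
have dphi : cderive phi y (- 2 * 'i * ((expR (fr j * y))%:C * uh G j y)).
  have [P1 [Q1 [dP1 dQ1]]] := rint_prims (c - 1) cpsi.1 cpsi.2.
  pose g t := phi c - 2 * 'i * (N^-1)%:C * ((P1 t - P1 c) +i* (Q1 t - Q1 c)).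
  apply: (@cderive_near g).
    have n1 : \forall t \near y, `|y - t| < y - c.
      by have /cvgrPdist_lt := @cvg_id _ (nbhs y); apply; rewrite subr_gt0.
    near=> t; have ct : c <= t.
      have : `|y - t| < y - c by near: t.
      by rewrite ltr_norml => /andP[_ ?]; lra.
    have eI : cint c t psi = (P1 t - P1 c) +i* (Q1 t - Q1 c).
      by apply: cint_FTC => // x /andP[cx _]; [apply: dP1|apply: dQ1]; lra.
    have := key t ct; rewrite eI => e; apply: (mulfI NC0); rewrite e /g mulrBr; congr (_ - _).
    have NN : N%:C * (N^-1)%:C = 1 :> R[i] by rewrite -rmorphM /= divff ?gt_eqF.
    rewrite (_ : N%:C * _ = N%:C * (N^-1)%:C * (2 * 'i * ((P1 t - P1 c) +i* (Q1 t - Q1 c)))); last by ring.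
    by rewrite NN mul1r.
  have dPQ : cderive (fun t => (P1 t - P1 c) +i* (Q1 t - Q1 c)) y (psi y).
    have [h1 h2] : is_derive y 1 P1 (Re (psi y)) /\ is_derive y 1 Q1 (Im (psi y)).
      by split; [apply: dP1|apply: dQ1]; lra.
    by split; [apply: (is_derive_eq (dB h1 (dcst (P1 c) y)))|apply: (is_derive_eq (dB h2 (dcst (Q1 c) y)))]; rewrite subr0.
  rewrite (_ : g = fun t => phi c + (- 2 * 'i * (N^-1)%:C) * ((P1 t - P1 c) +i* (Q1 t - Q1 c))); last first.
    by apply/funext => t; rewrite /g; ring.
  have psi_val : - 2 * 'i * (N^-1)%:C * psi y = - 2 * 'i * ((expR (fr j * y))%:C * uh G j y).
    rewrite psiE ?(ltW cy)//.
    have NN : (N^-1)%:C * N%:C = 1 :> R[i] by rewrite -rmorphM /= mulVf ?gt_eqF.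
    by rewrite -mulrA [(N^-1)%:C * _]mulrA NN mul1r.
  have dd := cderiveM (cderive_cst (- 2 * 'i * (N^-1)%:C) y) dPQ.
  have [e1 e2] := dd; split.
    rewrite (_ : (fun t => _) = (fun t => Re (phi c) + Re (- 2 * 'i * (N^-1)%:C * ((P1 t - P1 c) +i* (Q1 t - Q1 c))))); last first.
      by apply/funext => t; rewrite cReD.
    apply: (is_derive_eq (dD (dcst (Re (phi c)) y) e1)); rewrite add0r mul0r add0r; congr Re.
    exact: psi_val.
  rewrite (_ : (fun t => _) = (fun t => Im (phi c) + Im (- 2 * 'i * (N^-1)%:C * ((P1 t - P1 c) +i* (Q1 t - Q1 c))))); last first.
    by apply/funext => t; rewrite cImD.
  apply: (is_derive_eq (dD (dcst (Im (phi c)) y) e2)); rewrite add0r mul0r add0r; congr Im.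
  exact: psi_val.
have uE : uh F j = (fun t => (expR (- fr j * t))%:C * phi t).
  by apply/funext => t; rewrite /phi mulrA -rmorphM /= -expRD mulNr addNr expR0 mul1r.
rewrite {1}uE.
apply: (cderive_eq (cderiveM (cderive_real (dexp (- fr j) y)) dphi)).
have ee : (expR (- fr j * y))%:C * (expR (fr j * y))%:C = 1 :> R[i].
  by rewrite -rmorphM /= -expRD mulNr addNr expR0.
rewrite uE rmorphM rmorphN /=; move: ee (uh G j y) (phi y) (fr j)%:C; move: (expR _)%:C (expR _)%:C => a b ab u p r.
have -> : b * (- 2 * 'i * (a * u)) = b * a * (- 2 * 'i * u) by ring.
by rewrite ab; ring.
Unshelve. all: by end_near. Qed.
End FourierODE.

(** * Fourier coefficients of cusp forms *)

Section Slash.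
Context {R : realType}.
Implicit Types (z : R[i]) (g h : 'M[int]_2) (f : R[i] -> R[i]) (k : nat).

Lemma slash_mul k g h f z : SL2Z g -> SL2Z h -> uhp z ->
  slash k (g *m h) f z = autj h z ^- k * slash k g f (moebius h z).
Proof.
move=> dg dh uz; rewrite /slash autj_mul// moebius_mul// exprMn invfM mulrA.
by congr (_ * _); rewrite mulrC.
Qed.

Lemma slash_T k g n f z : SL2Z g -> uhp z ->
  slash k (g *m Tmat n) f z = slash k g f (z + n%:~R).
Proof.
by move=> dg uz; rewrite slash_mul ?autj_T ?moebius_T ?expr1n ?invr1 ?mul1r//; exact: SL2Z_T.
Qed.

Lemma normc_autj k g z : SL2Z g -> uhp z ->
  normc (autj g z ^- k) = (normc (autj g z) ^- k).
Proof.
move=> dg uz; have j0 := autj_neq0 dg uz.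
have n0 : normc (autj g z) != 0 by apply: contra j0 => /eqP/Normc.eq0_normc ->.
elim: k => [|k IH]; first by rewrite !expr0 !invr1 /= expr1n expr0n /= addr0 sqrtr1.
rewrite !exprSr !invfM normcM IH; congr (_ * _).
by apply: (mulfI n0); rewrite -normcM !divff// /= expr1n expr0n /= addr0 sqrtr1.
Qed.

Lemma height_slash k g f z : SL2Z g -> uhp z ->
  height k (slash k g f) z = height k f (moebius g z).
Proof.
move=> dg uz; rewrite /height /slash normcM normc_autj// mulrA Im_moebius// -normc_nsq.
have j0 := autj_neq0 dg uz.
have n0 : 0 < normc (autj g z).
  by rewrite lt_def normc_ge0 andbT; apply: contra j0 => /eqP/Normc.eq0_normc ->.
congr (_ * _); rewrite powRM ?invr_ge0 ?sqr_ge0//; last exact: ltW.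
congr (_ * _); move: n0; move: (normc _) => n n0.
have n1 : 0 <= n^-1 by rewrite invr_ge0 ltW.
rewrite -[n ^- 2]exprVn -[n^-1 ^+ 2]powR_mulrn// -powRrM (_ : 2%:R * (k%:R / 2) = k%:R); last by field.
by rewrite powR_mulrn// exprVn.
Qed.

(* y^2 times the antiholomorphic derivative of a form of weight k has weight
   k - 2, and the Laplace equation is the statement that the holomorphic
   raising operator takes it back to a multiple of the form.  The case
   [h = 0], [lam = 0] is that of holomorphic functions. *)
Definition maass_sys k (lam : R) (f h : R[i] -> R[i]) := forall z, uhp z ->
  (exists A, rdiff f z A (h z * (((Im z)%:C)^-1 * ((Im z)%:C)^-1))) /\
  (exists B, rdiff h z (- (2 * 'i * (2 - k%:R) * h z * ((Im z)%:C)^-1 + lam%:C * f z) / 4) B).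

Lemma rdiff_autj g z : rdiff (autj g) z (g 1 0)%:~R 0.
Proof. by apply: rdiff_affine => w; rewrite /autj; ring. Qed.

Lemma rdiff_autjV g z : SL2Z g -> uhp z ->
  rdiff (fun w => (autj g w)^-1) z (- (g 1 0)%:~R * (autj g z)^-1 ^+ 2) 0.
Proof.
move=> dg uz; have j0 := autj_neq0 dg uz.
apply: (rdiff_eq (rdiff_comp (rdiff_inv j0) (rdiff_autj g z))); last by rewrite mul0r.
by rewrite mulNr mulrC mulNr.
Qed.

Lemma rdiff_moebius g z : SL2Z g -> uhp z ->
  rdiff (moebius g) z ((autj g z)^-1 ^+ 2) 0.
Proof.
move=> dg uz; have j0 := autj_neq0 dg uz.
have dn : rdiff (fun w => (g 0 0)%:~R * w + (g 0 1)%:~R) z (g 0 0)%:~R 0.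
  by apply: rdiff_affine => w; ring.
apply: (rdiff_eq (rdiffM dn (rdiff_autjV dg uz))); last by rewrite mul0r mulr0 addr0.
have dR : (g 0 0)%:~R * (g 1 1)%:~R - (g 0 1)%:~R * (g 1 0)%:~R = 1 :> R[i].
  by rewrite -!intrM -intrB (SL2Z_det dg).
have jE : autj g z * (autj g z)^-1 = 1 by rewrite divff.
move: jE; move: ((autj g z)^-1) => v; rewrite /autj => jE.
transitivity (v ^+ 2 * ((g 0 0)%:~R * (g 1 1)%:~R - (g 0 1)%:~R * (g 1 0)%:~R)); last by rewrite dR mulr1.
have ev : v = ((g 1 0)%:~R * z + (g 1 1)%:~R) * v * v by rewrite jE mul1r.
by rewrite {1}ev; ring.
Qed.

Lemma rdiff_autjX k g z : SL2Z g -> uhp z ->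
  rdiff (fun w => autj g w ^- k) z (- k%:R * (g 1 0)%:~R * (autj g z)^-1 * autj g z ^- k) 0.
Proof.
move=> dg uz; rewrite (_ : (fun w => _) = (fun w => (autj g w)^-1 ^+ k)); last first.
  by apply/funext => w; rewrite exprVn.
apply: (rdiff_eq (rdiffX k (rdiff_autjV dg uz))) => //; rewrite -exprVn.
by case: k => [|k] /=; rewrite ?exprS; ring.
Qed.

Lemma Im_moebiusC g z : SL2Z g -> uhp z ->
  ((Im (moebius g z))%:C)^-1 = ((Im z)%:C)^-1 * (autj g z * conjc (autj g z)).
Proof.
move=> dg uz; rewrite Im_moebius// mul_conj normc_nsq rmorphM /= invfM fmorphV /=; congr (_ * _).
by rewrite invrK.
Qed.

Lemma autj_conj g z : conjc (autj g z) = autj g z - 2 * 'i * (g 1 0)%:~R * (Im z)%:C.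
Proof. have e2 : 2 = (2 : R)%:C :> R[i] by rewrite rmorph_nat.
case: z => x y; rewrite autjE intc e2 /=; move: (g 1 0)%:~R (g 1 1)%:~R => c d.
apply/eqP; rewrite eq_complex /=; apply/andP; split; apply/eqP; ring. Qed.

Lemma slash_alg1 (j jc y jk H : R[i]) : j != 0 -> jc != 0 -> y != 0 ->
  jk * (H * (y^-1 * (j * jc) * (y^-1 * (j * jc))) * jc^-1 ^+ 2) = j ^+ 2 * (jk * H) * (y^-1 * y^-1).
Proof. by move=> j0 jc0 y0; field; rewrite jc0 y0. Qed.

Lemma slash_alg2 (j y c jk F H K L : R[i]) : j != 0 -> y != 0 ->
  2%:R * j * c * (jk * H) + j ^+ 2 * (- K * c * j^-1 * jk * H + jk *
    (- (2 * 'i * (2 - K) * H * (y^-1 * (j * (j - 2 * 'i * c * y))) + L * F) / 4 * j^-1 ^+ 2)) =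
  - (2 * 'i * (2 - K) * (j ^+ 2 * (jk * H)) * y^-1 + L * (jk * F)) / 4.
Proof.
move=> j0 y0; have i2 : 'i * 'i = -1 :> R[i] by rewrite -expr2 sqr_i.
have jE : j * j^-1 = 1 by rewrite divff.
have yE : y * y^-1 = 1 by rewrite divff.
have q4 : 4 * 4^-1 = 1 :> R[i] by rewrite divff// pnatr_eq0.
move: jE yE q4; move: (j^-1) (y^-1) (4^-1 : R[i]) => v Y q jE yE q4.
transitivity (2 * j * c * jk * H - (j * v) * j * K * c * jk * H -
   (2 * (j * v) * (j * v) * 'i * (2 - K) * H * jk * Y * j * j + (j * v) * (j * v) * L * F * jk) * q
   + (4 * q) * (j * v) * (j * v) * (y * Y) * (2 - K) * H * jk * j * c * ('i * 'i)); first by ring.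
by rewrite jE yE q4 i2; ring.
Qed.

(** The companion function is the weight k - 2 slash of [H]. It is written through the weight k
    slash because k is a natural number that may be less than 2. *)
Lemma maass_sys_slash k lam f H g : SL2Z g -> maass_sys k lam f H ->
  maass_sys k lam (slash k g f) (fun z => autj g z ^+ 2 * slash k g H z).
Proof.
move=> dg sys z uz; have j0 := autj_neq0 dg uz.
have [[A dA] [B dB]] := sys _ (uhp_moebius dg uz).
have dm := rdiff_moebius dg uz; have dj := rdiff_autjX k dg uz.
have y0 : (Im z)%:C != 0 :> R[i] by rewrite eq_complex /= eqxx andbT gt_eqF.
have jc0 : conjc (autj g z) != 0 by rewrite conjc_eq0.
split.
  eexists; apply: (rdiff_eq (rdiffM dj (rdiff_comp dA dm))); first by reflexivity.
  rewrite mul0r add0r Im_moebiusC// /slash rmorphXn fmorphV /=.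
  exact: slash_alg1.
eexists; apply: (rdiff_eq (rdiffM (rdiffX 2 (rdiff_autj g z)) (rdiffM dj (rdiff_comp dB dm)))); last by reflexivity.
have := @slash_alg2 (autj g z) (Im z)%:C (g 1 0)%:~R ((autj g z ^+ k)^-1) (f (moebius g z)) (H (moebius g z)) k%:R lam%:C j0 y0.
rewrite -autj_conj Im_moebiusC// /slash expr1; exact.
Qed.
End Slash.

Section Decay.
Context {R : realType}.
Implicit Types (F f h : R[i] -> R[i]) (z : R[i]) (x y t : R) (j : int) (k : nat).

Lemma rdiff_unique F z A B A' B' : rdiff F z A B -> rdiff F z A' B' -> A = A' /\ B = B'.
Proof.
move=> d1 d2.
have key (w : R[i]) : normc w = 1 -> (A - A') * w + (B - B') * conjc w = 0.
  move=> w1; apply: Normc.eq0_normc; apply/eqP; rewrite eq_le normc_ge0 andbT.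
  apply/ler_addgt0Pl => e e0; rewrite addr0.
  have e2 : 0 < e / 2 by rewrite divr_gt0.
  have [a a0 Ha] := d1 _ e2; have [b b0 Hb] := d2 _ e2.
  pose s := Num.min a b / 2.
  have s0 : 0 < s by rewrite divr_gt0// lt_min a0.
  have [sa sb] : s < a /\ s < b.
    have : Num.min a b <= a by rewrite ge_min lexx.
    have : Num.min a b <= b by rewrite ge_min lexx orbT.
    have : 0 < Num.min a b by rewrite lt_min a0.
    by rewrite /s; move: (Num.min a b) => m; split; lra.
  pose v := s%:C * w.
  have nv : normc v = s by rewrite normcM normc_real w1 mulr1 gtr0_norm.
  have ha := Ha v; have hb := Hb v; rewrite nv in ha hb.
  have {}ha := ha sa; have {}hb := hb sb.
  have : normc ((A - A') * v + (B - B') * conjc v) <= e * s.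
    have -> : (A - A') * v + (B - B') * conjc v =
      (F (z + v) - F z - (A' * v + B' * conjc v)) - (F (z + v) - F z - (A * v + B * conjc v)) by ring.
    apply: le_trans (normcD _ _) _; rewrite normcN; lra.
  have -> : (A - A') * v + (B - B') * conjc v = s%:C * ((A - A') * w + (B - B') * conjc w).
    have -> : conjc v = s%:C * conjc w by rewrite /v; case: (w) => p q; simpc.
    by rewrite /v; ring.
  by rewrite normcM normc_real gtr0_norm// mulrC ler_pM2r.
have h1 := key 1; have h2 := key 'i.
have {}h1 : A - A' + (B - B') = 0.
  by have := h1 _; rewrite rmorph1 !mulr1; apply; rewrite /= expr1n expr0n /= addr0 sqrtr1.
have {}h2 : A - A' - (B - B') = 0.
  have n1 : normc ('i : R[i]) = 1 by rewrite /= expr1n expr0n /= add0r sqrtr1.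
  have ci : conjc 'i = - 'i :> R[i] by simpc.
  have := h2 n1; rewrite ci mulrN -mulrBl => /eqP; rewrite mulf_eq0 => /orP[/eqP//|].
  by rewrite eq_complex /= oner_eq0 andbF.
have e2 : 2 != 0 :> R[i] by rewrite pnatr_eq0.
have a0 : 2 * (A - A') = 0.
  by rewrite (_ : _ * _ = (A - A' + (B - B')) + (A - A' - (B - B'))); [rewrite h1 h2 addr0|ring].
have {}a0 : A - A' = 0 by move/eqP: a0; rewrite mulf_eq0 (negPf e2) => /eqP.
split; first by apply/eqP; rewrite -subr_eq0 a0.
by move: h1; rewrite a0 add0r => /eqP; rewrite subr_eq0 => /eqP.
Qed.

Lemma rdiff_Im z : rdiff (fun w => (Im w)%:C) z (- 'i / 2) ('i / 2).
Proof.
apply: rdiff_affine => -[u v]; rewrite raddfD /= rmorphD /= [LHS]addrC addKr.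
have e2 : 2^-1 = (2^-1 : R)%:C :> R[i] by rewrite fmorphV rmorph_nat.
by rewrite e2; apply/eqP; rewrite eq_complex /=; apply/andP; split; apply/eqP; field.
Qed.

Lemma ccat_comp F (G : R[i] -> R[i]) z : ccat F (G z) -> ccat G z -> ccat (fun w => F (G w)) z.
Proof.
move=> cF cG e e0; have [d d0 H] := cF e e0; have d2 : 0 < d / 2 by rewrite divr_gt0.
have [d' d'0 H'] := cG _ d2; exists d' => // w /H' hw.
have := H (G (z + w) - G z); rewrite [G z + _]addrC subrK; apply.
by apply: (le_lt_trans hw); lra.
Qed.

Lemma ccatD F (G : R[i] -> R[i]) z : ccat F z -> ccat G z -> ccat (fun w => F w + G w) z.
Proof.
move=> c1 c2 e e0; have e2 : 0 < e / 2 by rewrite divr_gt0.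
have [d1 d10 H1] := c1 _ e2; have [d2 d20 H2] := c2 _ e2.
exists (Num.min d1 d2); first by rewrite lt_min d10.
move=> w; rewrite lt_min => /andP[/H1 h1 /H2 h2]; rewrite opprD addrACA.
by apply: le_trans (normcD _ _) _; rewrite [e]splitr; exact: lerD.
Qed.

Lemma ccat_ImV z : uhp z -> ccat (fun w => ((Im w)%:C)^-1) z.
Proof.
move=> uz; have yn : (Im z)%:C != 0 :> R[i] by rewrite eq_complex /= eqxx andbT gt_eqF.
apply: (@ccat_comp (fun w => w^-1) (fun w => (Im w)%:C)).
  exact: rdiff_ccat (rdiff_inv yn).
exact: rdiff_ccat (rdiff_Im z).
Qed.

Lemma fc_conj (N : R) (u : R -> R[i]) j : ccont u ->
  fc N (fun x => conjc (u x)) (- j) = conjc (fc N u j).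
Proof.
move=> cu; rewrite /fc inp_conj//; last exact: ccont_ech.
by rewrite /inp; congr (_ * _); apply: eq_cint => x; rewrite echN conjcK mulrC.
Qed.

Lemma conj_lin (a : R) (u v : R[i]) :
  conjc (- a%:C * u - 2 * 'i * v) = - a%:C * conjc u + 2 * 'i * conjc v.
Proof.
have e2 : 2 = (2 : R)%:C :> R[i] by rewrite rmorph_nat.
rewrite e2; case: u v => [u u'] [v v']; apply/eqP; rewrite eq_complex /=.
by apply/andP; split; apply/eqP; ring.
Qed.

Lemma deriv0_cst (u : R -> R) (a b : R) : a <= b ->
  (forall x, a <= x <= b -> is_derive x 1 u 0) -> u a = u b.
Proof.
move=> ab du; apply/eqP; rewrite eq_le; apply/andP; split.
  by apply: (@deriv_mono _ u (fun=> 0)).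
rewrite -lerN2; apply: (@deriv_mono _ (fun x => - u x) (fun=> 0)) => // x /du d.
rewrite (_ : (fun x => _) = (fun x => (-1) * u x)); last by apply/funext => v; rewrite mulN1r.
by apply: (is_derive_eq (dZ (-1) d)); rewrite mulr0.
Qed.

Definition uhw k (N : R) f j y : R := y `^ (k%:R / 2) * normc (uh N f j y).

Lemma uhw_ge0 k N f j y : 0 <= uhw k N f j y.
Proof. by rewrite mulr_ge0 ?powR_ge0 ?normc_ge0. Qed.

Lemma uhw_sqr k N f j y : 0 < y -> uhw k N f j y ^+ 2 = y ^+ k * normc (uh N f j y) ^+ 2.
Proof.
move=> y0; rewrite /uhw exprMn; congr (_ * _).
by rewrite -[LHS]powR_mulrn ?powR_ge0// -powRrM -[RHS]powR_mulrn ?ltW//; congr (_ `^ _); field.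
Qed.

(* Exponential decay of the Fourier coefficients beyond a height depending on
   the form only through [C]. *)
Definition exp_type (C : R) k (N : R) f := forall j t y, j != 0 -> 0 < t ->
  C * N <= t * `|j|%N%:R -> t <= y ->
  uhw k N f j y <= uhw k N f j t * expR (- (`|j|%N%:R / N * (y - t))).

Variables (N : R) (k : nat) (lam : R) (f h : R[i] -> R[i]).
Hypothesis N0 : 0 < N.
Hypothesis sys : maass_sys k lam f h.
Hypothesis pf : forall z, uhp z -> f (z + N%:C) = f z.

(** Up to y^2, h is the derivative of f with respect to the conjugate variable; it is therefore
    determined by f and inherits its period. *)
Lemma maass_sys_periodic z : uhp z -> h (z + N%:C) = h z.
Proof.
move=> uz; have uzN : uhp (z + N%:C) by move: uz; case: (z) => a b; rewrite /uhp /= addr0.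
have [[A dA] _] := sys uz; have [[A' dA'] _] := sys uzN.
have d1 : rdiff f z A' (h (z + N%:C) * (((Im (z + N%:C))%:C)^-1 * ((Im (z + N%:C))%:C)^-1)).
  apply: (@rdiff_uhp _ (fun w => f (w + N%:C)) f) => // e e0.
  have [d d0 H] := dA' e e0; exists d => // w /H.
  by rewrite (_ : z + N%:C + w = z + w + N%:C)//; ring.
have [_] := rdiff_unique d1 dA.
have -> : Im (z + N%:C) = Im z by case: (z) => a b; rewrite /= addr0.
apply: mulIf; rewrite mulf_neq0// invr_eq0 eq_complex /= eqxx andbT gt_eqF//.
Qed.

Lemma sys_ccont y : 0 < y -> ccont (hline f y) /\ ccont (hline h y).
Proof.
move=> y0; split; apply: (@ccont_hline _ _ y) => // z yz;
  have [[A dA] [B dB]] := sys (lt_le_trans y0 yz).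
  exact: rdiff_ccat dA.
exact: rdiff_ccat dB.
Qed.

Let fr j : R := 2 * pi * (j%:~R / N).
Let X j y := uh N f j y.
Let P j y : R[i] := - 2 * 'i * (uh N h j y * (((y%:C)^-1 * (y%:C)^-1))).

Lemma sys_ode1 j y : 0 < y -> cderive (X j) y (- (fr j)%:C * X j y + P j y).
Proof.
move=> y0.
have G1 z : uhp z -> exists A, rdiff f z A (h z * (((Im z)%:C)^-1 * ((Im z)%:C)^-1)).
  by move=> /sys[].
have cG z : uhp z -> ccat (fun w => h w * (((Im w)%:C)^-1 * ((Im w)%:C)^-1)) z.
  move=> uz; have [_ [B dB]] := sys uz.
  by apply: ccatM; [exact: rdiff_ccat dB|apply: ccatM; exact: ccat_ImV].
apply: (cderive_eq (fc_ode N0 G1 cG pf j y0)); congr (_ + _); rewrite /P.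
have [_ ch] := sys_ccont y0.
rewrite (_ : uh N _ j y = (y%:C^-1 / y%:C) * uh N h j y).
  by rewrite -!mulNr mulNr mulNr; ring.
rewrite /uh /fc -inpZl//; last exact: ccont_ech.
have -> // : hline (fun z => h z * (((Im z)%:C)^-1 / (Im z)%:C)) y = (fun x => y%:C^-1 / y%:C * hline h y x).
by apply/funext => x; rewrite /hline [LHS]mulrC.
Qed.

(** The system gives the holomorphic derivative of h, whereas [fc_ode] handles the conjugate one; so
    it is applied to the conjugate of h at the frequency - j. *)
Lemma sys_ode2 j y : 0 < y -> cderive (P j) y
  ((fr j - k%:R / y)%:C * P j y - (lam / y ^+ 2)%:C * X j y).
Proof.
move=> y0; have yC : y%:C != 0 :> R[i] by rewrite eq_complex /= eqxx andbT gt_eqF.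
pose a z := - (2 * 'i * (2 - k%:R) * h z * ((Im z)%:C)^-1 + lam%:C * f z) / 4.
have G1 z : uhp z -> exists A, rdiff (fun w => conjc (h w)) z A (conjc (a z)).
  by move=> /sys[_ [B dB]]; exists (conjc B); apply: rdiff_conj.
have cG z : uhp z -> ccat (fun w => conjc (a w)) z.
  move=> uz; have [[A dA] [B dB]] := sys uz.
  have c0 : ccat a z.
    rewrite (_ : a = fun w => h w * ((Im w)%:C)^-1 * (- (2 * 'i * (2 - k%:R)) / 4) + f w * (- lam%:C / 4)); last first.
      by apply/funext => w; rewrite /a; ring.
    have c1 := ccatM (ccatM (rdiff_ccat dB) (ccat_ImV uz)) (rdiff_ccat (rdiff_cst (- (2 * 'i * (2 - k%:R)) / 4) z)).
    have c2 := ccatM (rdiff_ccat dA) (rdiff_ccat (rdiff_cst (- lam%:C / 4) z)).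
    exact: ccatD.
  move=> e e0; have [d d0 H] := c0 e e0; exists d => // w /H.
  by rewrite -rmorphB normc_conj.
have ph z : uhp z -> conjc (h (z + N%:C)) = conjc (h z) by move=> /maass_sys_periodic ->.
have ode := fc_ode N0 G1 cG ph (- j) y0.
have [cf ch] := sys_ccont y0.
have hE t : 0 < t -> conjc (uh N (fun w => conjc (h w)) (- j) t) = uh N h j t.
  move=> t0; have [_ ct] := sys_ccont t0.
  by rewrite /uh -[hline _ t]/(fun x => conjc (hline h t x)) fc_conj// conjcK.
have haE : hline a y = (fun x => (- (2 * 'i * (2 - k%:R)) * (y%:C)^-1 / 4) * hline h y x - (lam%:C / 4) * hline f y x).
  apply/funext => x; rewrite /hline /a -[Im _]/y.
  by move: (h _) (f _) (y%:C^-1) (4^-1 : R[i]) => u v w q; ring.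
have aE : uh N a j y = - (2 * 'i * (2 - k%:R) * uh N h j y * (y%:C)^-1 + lam%:C * X j y) / 4.
  rewrite (_ : _ / 4 = (- (2 * 'i * (2 - k%:R)) * (y%:C)^-1 / 4) * uh N h j y - (lam%:C / 4) * X j y); last by ring.
  rewrite /X /uh /fc -!inpZl//; [|exact: ccont_ech..].
  rewrite -inpBl; [|exact: ccontZ|exact: ccontZ|exact: ccont_ech].
  by rewrite haE.
have caE : conjc (uh N (fun w => conjc (a w)) (- j) y) = uh N a j y.
  rewrite /uh -[hline _ y]/(fun x => conjc (hline a y x)) fc_conj ?conjcK//.
  by rewrite haE; apply: ccontB; exact: ccontZ.
have dH : cderive (uh N h j) y ((fr j)%:C * uh N h j y + 2 * 'i * uh N a j y).
  apply: (@cderive_near _ (fun t => conjc (uh N (fun w => conjc (h w)) (- j) t))).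
    have n1 : \forall t \near y, `|y - t| < y.
      by have /cvgrPdist_lt := @cvg_id _ (nbhs y); apply.
    by apply: filterS n1 => t; rewrite ltr_norml => /andP[_ ?]; apply: hE; lra.
  apply: (cderive_eq (cderive_conj ode)).
  rewrite conj_lin hE// caE; congr (_ * _ + _); rewrite -rmorphN /fr rmorphN /=.
  by congr (_ +i* _); ring.
have dY : cderive (fun t => (t%:C)^-1 * (t%:C)^-1) y (- 2 * ((y%:C)^-1) ^+ 3).
  have dv : is_derive y 1 (fun t : R => t^-1) (- (y ^- 2)).
    have yn : y != 0 by rewrite gt_eqF.
    by apply: (is_derive_eq (is_deriveV (f := fun t : R => t) yn (did y))); rewrite /GRing.scale/= mulr1.
  have d1 : cderive (fun t => (t%:C)^-1) y (- ((y%:C)^-1) ^+ 2).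
    rewrite (_ : (fun t => _) = (fun t => (t^-1)%:C)); last by apply/funext => t; rewrite fmorphV.
    by apply: (cderive_eq (cderive_real dv)); rewrite rmorphN fmorphV rmorphXn /= exprVn.
  by apply: (cderive_eq (cderiveM d1 d1)); ring.
have := cderiveM (cderive_cst (- 2 * 'i) y) (cderiveM dH dY).
have e1 : (fr j - k%:R / y)%:C = (fr j)%:C - k%:R * (y%:C)^-1 :> R[i].
  by rewrite rmorphB /=; congr (_ - _); rewrite rmorphM fmorphV rmorph_nat.
have e2 : (lam / y ^+ 2)%:C = lam%:C * (y%:C ^+ 2)^-1 :> R[i].
  by rewrite rmorphM fmorphV rmorphXn.
move/cderive_eq; apply; rewrite aE /P e1 e2.
have i2 : 'i * 'i = -1 :> R[i] by rewrite -expr2 sqr_i.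
have q4 : 4 * 4^-1 = 1 :> R[i] by rewrite divff// pnatr_eq0.
have yE : (y%:C ^+ 2)^-1 = (y%:C)^-1 ^+ 2 by rewrite exprVn.
rewrite yE; move: (y%:C^-1) (uh N h j y) (X j y) (fr j)%:C (lam%:C) (k%:R : R[i]) => Y H x r L K.
move: (4^-1 : R[i]) q4 => q q4.
transitivity (- 2 * 'i * Y ^+ 2 * (r * H) + (4 * q) * 2 * ('i * 'i) * 'i * (2 - K) * H * Y ^+ 3 + (4 * q) * ('i * 'i) * L * x * Y ^+ 2
   + 4 * 'i * H * Y ^+ 3); first by ring.
by rewrite q4 i2; ring.
Qed.
End Decay.

Section RealSystem.
Context {R : realType}.
Implicit Types (y t : R).
Variables (x1 x2 p1 p2 : R -> R) (r lam K : R).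
Hypothesis dx1 : forall y, 0 < y -> is_derive y 1 x1 (- r * x1 y + p1 y).
Hypothesis dx2 : forall y, 0 < y -> is_derive y 1 x2 (- r * x2 y + p2 y).
Hypothesis dp1 : forall y, 0 < y -> is_derive y 1 p1 ((r - K / y) * p1 y - lam / y ^+ 2 * x1 y).
Hypothesis dp2 : forall y, 0 < y -> is_derive y 1 p2 ((r - K / y) * p2 y - lam / y ^+ 2 * x2 y).

(** For X = x1 + i x2 and P = p1 + i p2, the three functions are |X|^2, the real part of X times the
    conjugate of P, and |P|^2. *)
Let q y := x1 y * x1 y + x2 y * x2 y.
Let s y := x1 y * p1 y + x2 y * p2 y.
Let n y := p1 y * p1 y + p2 y * p2 y.

Let dq y : 0 < y -> is_derive y 1 q (- 2 * r * q y + 2 * s y).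
Proof.
move=> y0; apply: (is_derive_eq (dD (dM (dx1 y0) (dx1 y0)) (dM (dx2 y0) (dx2 y0)))).
by rewrite /q /s; ring.
Qed.

Let ds y : 0 < y -> is_derive y 1 s (n y - K / y * s y - lam / y ^+ 2 * q y).
Proof.
move=> y0; apply: (is_derive_eq (dD (dM (dx1 y0) (dp1 y0)) (dM (dx2 y0) (dp2 y0)))).
by rewrite /q /s /n; ring.
Qed.

(** Completing the square: q'' - r^2 q = 2 |P - r X|^2 + q (r^2 - 2 lam / y^2), which is nonnegative
    beyond [y0], so that [exp_decay] applies. *)
Lemma sq_decay0 y0 B A : K = 0 -> r != 0 -> 0 < y0 -> 2 * `|lam| <= (r * y0) ^+ 2 ->
  (forall y, y0 <= y -> 1 <= y -> q y <= B * y ^+ A) ->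
  forall t y, y0 <= t -> t <= y -> q y <= q t * expR (- `|r| * (y - t)).
Proof.
move=> K0 r0 y00 hl gr; have pos y : y0 <= y -> 0 < y by exact: lt_le_trans.
apply: (@exp_decay _ q (fun y => - 2 * r * q y + 2 * s y)
  (fun y => - 2 * r * (- 2 * r * q y + 2 * s y) + 2 * (n y - K / y * s y - lam / y ^+ 2 * q y)) _ y0 B A); last exact: gr.
- by rewrite normr_gt0.
- by move=> y /pos; exact: dq.
- by move=> y /pos yp; exact: (dD (dZ (- 2 * r) (dq yp)) (dZ 2 (ds yp))).
move=> y yy; have yp := pos y yy.
rewrite real_normK ?num_real// -subr_ge0 K0.
have -> : - 2 * r * (- 2 * r * q y + 2 * s y) + 2 * (n y - 0 / y * s y - lam / y ^+ 2 * q y) - r ^+ 2 * q y =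
  2 * ((p1 y - r * x1 y) ^+ 2 + (p2 y - r * x2 y) ^+ 2) + q y * ((r ^+ 2 * y ^+ 2 - 2 * lam) / y ^+ 2).
  by rewrite /q /s /n; field; rewrite gt_eqF.
have q0 : 0 <= q y by rewrite /q -!expr2 addr_ge0 ?sqr_ge0.
apply: addr_ge0; first by rewrite mulr_ge0// addr_ge0 ?sqr_ge0.
apply: mulr_ge0 => //; apply: divr_ge0; last by rewrite exprn_ge0// ltW.
have h1 : (r * y0) ^+ 2 <= r ^+ 2 * y ^+ 2.
  by rewrite exprMn ler_wpM2l ?sqr_ge0// ler_pXn2r// nnegrE ltW.
have := ler_norm lam; move: h1 hl; move: (r ^+ 2 * y ^+ 2) ((r * y0) ^+ 2) => u v; lra.
Qed.

(** In weight 1 the natural quantity is y |X|^2. The square to complete is now |P - r X + X / (2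
    y)|^2, and the hypothesis on [y0] makes the remaining factor of q nonnegative. *)
Lemma sq_decay1 y0 B A : K = 1 -> r != 0 -> 0 < y0 -> 4 + 2 * `|lam| <= `|r| * y0 ->
  (forall y, y0 <= y -> 1 <= y -> y * q y <= B * y ^+ A) ->
  forall t y, y0 <= t -> t <= y -> y * q y <= t * q t * expR (- `|r| * (y - t)).
Proof.
move=> K1 r0 y00 hl gr; have pos y : y0 <= y -> 0 < y by exact: lt_le_trans.
apply: (@exp_decay _ (fun y => y * q y) (fun y => 1 * q y + y * (- 2 * r * q y + 2 * s y))
  (fun y => (- 2 * r * q y + 2 * s y) + (1 * (- 2 * r * q y + 2 * s y) + y * (- 2 * r * (- 2 * r * q y + 2 * s y) + 2 * (n y - K / y * s y - lam / y ^+ 2 * q y)))) _ y0 B A); last exact: gr.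
- by rewrite normr_gt0.
- by move=> y /pos yp; exact: (dM (did y) (dq yp)).
- move=> y /pos yp; apply: dD; first by apply: (is_derive_eq (dZ 1 (dq yp))); rewrite mul1r.
  exact: (dM (did y) (dD (dZ (- 2 * r) (dq yp)) (dZ 2 (ds yp)))).
move=> y yy; have yp := pos y yy.
rewrite real_normK ?num_real// -subr_ge0 K1.
have -> : (- 2 * r * q y + 2 * s y) + (1 * (- 2 * r * q y + 2 * s y) + y * (- 2 * r * (- 2 * r * q y + 2 * s y) + 2 * (n y - 1 / y * s y - lam / y ^+ 2 * q y))) - r ^+ 2 * (y * q y) =
  2 * y * ((p1 y - r * x1 y + x1 y / (2 * y)) ^+ 2 + (p2 y - r * x2 y + x2 y / (2 * y)) ^+ 2)
  + q y * ((r ^+ 2 * y ^+ 2 - 2^-1 - 2 * r * y - 2 * lam) / y).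
  by rewrite /q /s /n; field; rewrite gt_eqF.
have q0 : 0 <= q y by rewrite /q -!expr2 addr_ge0 ?sqr_ge0.
apply: addr_ge0; first by rewrite !mulr_ge0 ?addr_ge0 ?sqr_ge0 ?(ltW yp).
apply: mulr_ge0 => //; apply: divr_ge0; last exact: ltW.
have h1 : `|r| * y0 <= `|r| * y by rewrite ler_wpM2l.
have h2 : r * y <= `|r| * y by rewrite ler_wpM2r ?ler_norm ?ltW.
have h3 : r ^+ 2 * y ^+ 2 = (`|r| * y) ^+ 2 by rewrite exprMn real_normK ?num_real.
have h4 := ler_norm lam; have h5 := normr_ge0 lam.
have -> : 2 * r * y = 2 * (r * y) by ring.
rewrite h3; move: (`|r| * y) (`|r| * y0) (r * y) hl h1 h2 => a b c hl h1 h2; nra.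
Qed.
End RealSystem.

Section Decay.
Context {R : realType}.
Implicit Types (F f h : R[i] -> R[i]) (z : R[i]) (x y t : R) (j : int) (k : nat).

Lemma Re_real (a : R) (w : R[i]) : Re (a%:C * w) = a * Re w.
Proof. by case: w => p q /=; ring. Qed.
Lemma Im_real (a : R) (w : R[i]) : Im (a%:C * w) = a * Im w.
Proof. by case: w => p q /=; ring. Qed.
Lemma Re_Nreal (a : R) (w : R[i]) : Re (- a%:C * w) = - a * Re w.
Proof. by case: w => p q /=; ring. Qed.
Lemma Im_Nreal (a : R) (w : R[i]) : Im (- a%:C * w) = - a * Im w.
Proof. by case: w => p q /=; ring. Qed.

Lemma Re_subreal (a : R) (v w : R[i]) : Re (v - a%:C * w) = Re v - a * Re w.
Proof. by case: v w => p q [p' q'] /=; ring. Qed.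
Lemma Im_subreal (a : R) (v w : R[i]) : Im (v - a%:C * w) = Im v - a * Im w.
Proof. by case: v w => p q [p' q'] /=; ring. Qed.

Lemma normc_uh_le (N : R) f j y M : 0 < N -> ccont (hline f y) ->
  (forall x, normc (f (x +i* y)) <= M) -> normc (uh N f j y) <= M.
Proof.
move=> N0 cf fM; rewrite /uh /fc /inp normcM normc_real.
rewrite gtr0_norm ?invr_gt0// ler_pdivrMl// mulrC.
rewrite -[X in _ <= M * X]subr0; apply: normc_cint_cst; [|exact: ltW|].
  by apply: ccont_inp => //; exact: ccont_ech.
by move=> x _; rewrite normcM normc_conj normc_ech mulr1; exact: fM.
Qed.

Lemma abs_freq (N : R) j : 0 < N -> `|2 * pi * (j%:~R / N)| = 2 * pi * (`|j|%N%:R / N) :> R.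
Proof.
move=> N0; have p0 := pi_gt0 R.
rewrite !normrM normfV (gtr0_norm N0) (gtr0_norm p0) (@ger0_norm _ 2)//; congr (_ * (_ / _)).
by rewrite natr_absz intr_norm.
Qed.

Lemma maass_exp_type (N : R) k (lam : R) f h : 0 < N -> k = 0%N \/ k = 1%N -> maass_sys k lam f h ->
  (forall z, uhp z -> f (z + N%:C) = f z) ->
  (exists K A, forall z, 1 <= Im z -> normc (f z) <= K * Im z ^+ A) ->
  exp_type (4 + 2 * `|lam|) k N f.
Proof.
move=> N0 k01 sys pf [K [A fK]] j t y j0 t0 hC ty.
pose r : R := 2 * pi * (j%:~R / N); pose rr := `|r|; set C := 4 + _ in hC.
have C0 : 0 < C by rewrite ltr_pwDl// mulr_ge0.
have p2 : 2 <= pi :> R by exact: pi_ge2.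
have rrE : rr = 2 * pi * (`|j|%N%:R / N) by exact: abs_freq.
have nj1 : 1 <= `|j|%N%:R :> R by rewrite ler1n absz_gt0.
have rr0 : 0 < rr.
  by rewrite rrE mulr_gt0 ?divr_gt0 ?mulr_gt0 ?pi_gt0//; exact: lt_le_trans nj1.
have r0 : r != 0 by rewrite -normr_gt0.
(* At this height rr y0 = C, which meets the requirements of both weights. The assumption on t
   places it above [y0], because rr >= |j| / N. *)
pose y0 := C / rr; have y00 : 0 < y0 by rewrite divr_gt0.
have y0t : y0 <= t.
  rewrite ler_pdivrMr// rrE.
  have h1 : C <= t * (`|j|%N%:R / N) by rewrite mulrA ler_pdivlMr.
  rewrite (_ : t * _ = 2 * pi * (t * (`|j|%N%:R / N))); last by ring.
  by move: (t * _) h1 => T h1; nra.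
pose x1 u := Re (uh N f j u); pose x2 u := Im (uh N f j u).
pose P u : R[i] := - 2 * 'i * (uh N h j u * (((u%:C)^-1 * (u%:C)^-1))).
pose p1 u := Re (P u); pose p2' u := Im (P u).
have o1 (u : R) : 0 < u -> is_derive u 1 x1 (- r * x1 u + p1 u) /\ is_derive u 1 x2 (- r * x2 u + p2' u).
  move=> u0; have [d1 d2] := sys_ode1 N0 sys pf j u0; split.
    by apply: (is_derive_eq d1); rewrite cReD Re_Nreal.
  by apply: (is_derive_eq d2); rewrite cImD Im_Nreal.
have o2 (u : R) : 0 < u -> is_derive u 1 p1 ((r - k%:R / u) * p1 u - lam / u ^+ 2 * x1 u) /\
     is_derive u 1 p2' ((r - k%:R / u) * p2' u - lam / u ^+ 2 * x2 u).
  move=> u0; have [d1 d2] := sys_ode2 N0 sys pf j u0; split.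
    by apply: (is_derive_eq d1); rewrite Re_subreal Re_real.
  by apply: (is_derive_eq d2); rewrite Im_subreal Im_real.
have qE u : x1 u * x1 u + x2 u * x2 u = normc (uh N f j u) ^+ 2 by rewrite normc_nsq /nsq !expr2.
have gr (u : R) : 1 <= u -> u ^+ k * normc (uh N f j u) ^+ 2 <= K ^+ 2 * u ^+ (k + (A + A)).
  move=> u1; have u0 : 0 < u by exact: lt_le_trans u1.
  have := @normc_uh_le N f j u (K * u ^+ A) N0 (sys_ccont sys u0).1 (fun x => fK (x +i* u) u1) => hM.
  have -> : K ^+ 2 * u ^+ (k + (A + A)) = u ^+ k * (K * u ^+ A) ^+ 2 by rewrite !exprD; ring.
  apply: ler_wpM2l; first by rewrite exprn_ge0// ltW.
  rewrite ler_pXn2r// nnegrE ?normc_ge0//; exact: le_trans (normc_ge0 _) hM.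
have main : uhw k N f j y ^+ 2 <= uhw k N f j t ^+ 2 * expR (- rr * (y - t)).
  have yp : 0 < y by exact: lt_le_trans ty.
  rewrite (uhw_sqr k N f j yp) (uhw_sqr k N f j t0) -!qE.
  have gr' u : 1 <= u -> u ^+ k * (x1 u * x1 u + x2 u * x2 u) <= K ^+ 2 * u ^+ (k + (A + A)).
    by move=> u1; rewrite qE; exact: gr.
  move: o1 o2 gr'; clear gr qE; clearbody x1 x2 p1 p2'.
  case: k01 => -> o1 o2 gr.
    rewrite !expr0 !mul1r.
    apply: (@sq_decay0 _ x1 x2 p1 p2' r lam 0 _ _ _ _ y0 (K ^+ 2) (A + A) erefl r0 y00 _ _ _ _ y0t ty).
    - by move=> u /o1[].
    - by move=> u /o1[].
    - by move=> u /o2[].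
    - by move=> u /o2[].
    - rewrite exprMn -(real_normK (num_real r)) -exprMn /y0 -/rr mulrCA divff ?gt_eqF// mulr1.
      by have := normr_ge0 lam; rewrite /C; nra.
    - by move=> u _ u1; have := gr u u1; rewrite expr0 mul1r.
  rewrite !expr1.
  apply: (@sq_decay1 _ x1 x2 p1 p2' r lam 1 _ _ _ _ y0 (K ^+ 2) (1 + (A + A)) erefl r0 y00 _ _ _ _ y0t ty).
  - by move=> u /o1[].
  - by move=> u /o1[].
  - by move=> u /o2[].
  - by move=> u /o2[].
  - by rewrite -/rr /y0 mulrCA divff ?gt_eqF// mulr1.
  - by move=> u _ u1; have := gr u u1; rewrite expr1.
rewrite -(@ler_pXn2r _ 2)// ?nnegrE ?uhw_ge0//; last by rewrite mulr_ge0 ?uhw_ge0 ?expR_ge0.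
apply: (le_trans main); rewrite [leRHS]exprMn; apply: ler_wpM2l; first exact: sqr_ge0.
rewrite -expRM_natl ler_expR rrE.
have : 0 <= `|j|%N%:R / N * (y - t).
  by rewrite mulr_ge0 ?subr_ge0// divr_ge0 ?ltW//; exact: lt_le_trans nj1.
rewrite (_ : - (2 * pi * (`|j|%N%:R / N)) * (y - t) = - (2 * pi * (`|j|%N%:R / N * (y - t)))); last by ring.
by move: (_ * (y - t)) => v v0; rewrite mulrN lerN2; nra.
Qed.

Lemma hol_fourier (N : R) k f : 0 < N -> maass_sys k 0 f (fun=> 0) ->
  (forall z, uhp z -> f (z + N%:C) = f z) -> forall j t y, 0 < t -> t <= y ->
  uh N f j y = uh N f j t * (expR (- (2 * pi * (j%:~R / N)) * (y - t)))%:C.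
Proof.
move=> N0 sys pf j t y t0 ty; pose r : R := 2 * pi * (j%:~R / N).
pose phi u := uh N f j u * (expR (r * u))%:C.
have uh0 u : uh N (fun=> 0) j u = 0 :> R[i].
  rewrite /uh /fc /inp (_ : cint _ _ _ = 0) ?mulr0// -[RHS](cint0 0 N).
  by apply: eq_cint => x; rewrite /hline mul0r.
have dphi u : 0 < u -> cderive phi u 0.
  move=> u0; have d1 := sys_ode1 N0 sys pf j u0.
  apply: (cderive_eq (cderiveM d1 (cderive_real (dexp r u)))).
  have -> : (r * expR (r * u))%:C = r%:C * (expR (r * u))%:C by exact: rmorphM.
  by rewrite uh0 -/r; ring.
have phiE : phi y = phi t.
  have h1 : Re (phi t) = Re (phi y).
    by apply: (@deriv0_cst _ (fun u => Re (phi u)) t y ty) => u /andP[tu _]; have [] := dphi u (lt_le_trans t0 tu).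
  have h2 : Im (phi t) = Im (phi y).
    by apply: (@deriv0_cst _ (fun u => Im (phi u)) t y ty) => u /andP[tu _]; have [] := dphi u (lt_le_trans t0 tu).
  by apply/eqP; rewrite eq_complex h1 h2 !eqxx.
have ex : (expR (r * y))%:C * (expR (- r * y))%:C = 1 :> R[i].
  by rewrite -rmorphM /= -expRD mulNr addrN expR0.
rewrite -[LHS]mulr1 -ex mulrA -[_ * (expR (r * y))%:C]/(phi y) phiE /phi -mulrA -rmorphM /= -expRD.
by congr (_ * (expR _)%:C); rewrite -/r; ring.
Qed.

(** For j <= 0 the coefficient does not decrease in absolute value as y grows, yet it tends to 0 at
    the cusp; hence it vanishes. For j > 0 the growth of y^(k/2) beyond t is absorbed by part of the
    exponential, since k N <= t |j|. *)
Lemma hol_exp_type (N : R) k f : 0 < N -> maass_sys k 0 f (fun=> 0) ->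
  (forall z, uhp z -> f (z + N%:C) = f z) ->
  (forall e, 0 < e -> exists Y, forall z, uhp z -> Y < Im z -> normc (f z) < e) ->
  exp_type k%:R k N f /\ forall y, 0 < y -> uh N f 0 y = 0.
Proof.
move=> N0 sys pf van; have hf := hol_fourier N0 sys pf.
have nexp (a : R) : normc (expR a)%:C = expR a by rewrite normc_real ger0_norm ?expR_ge0.
have small j y e : 0 < y -> 0 < e -> exists2 Y, y <= Y & normc (uh N f j Y) <= e.
  move=> y0 e0; have [Y HY] := van _ e0; exists (Num.max y (Y + 1)); first by rewrite le_max lexx.
  have m0 : 0 < Num.max y (Y + 1) by rewrite lt_max y0.
  apply: normc_uh_le => //; first exact: (sys_ccont sys m0).1.
  move=> x; apply/ltW/HY => //=; rewrite lt_max; apply/orP; right; lra.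
have neg j y : (j <= 0)%R -> 0 < y -> uh N f j y = 0.
  move=> j0 y0; apply: Normc.eq0_normc; apply/eqP; rewrite eq_le normc_ge0 andbT.
  apply/ler_addgt0Pl => e e0; rewrite addr0; have [Y yY hY] := small j y e y0 e0.
  apply: le_trans hY; rewrite (hf j y Y y0 yY) normcM nexp ler_peMr ?normc_ge0//.
  apply: (@le_trans _ _ (expR 0)); first by rewrite expR0.
  rewrite ler_expR mulr_ge0 ?subr_ge0// -mulrN mulr_ge0 ?mulr_ge0 ?pi_ge0//.
  by rewrite -mulNr divr_ge0 ?(ltW N0)// oppr_ge0 lerz0.
split; last by move=> y y0; apply: neg.
move=> j t y j0 t0 hC ty; have y0 : 0 < y by exact: lt_le_trans ty.
have [jn|jp] := lerP j 0.
  by rewrite /uhw neg// Normc.normc0 mulr0 mulr_ge0 ?expR_ge0// uhw_ge0.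
have jE : (`|j|%N%:R : R) = j%:~R by rewrite natr_absz gtr0_norm.
rewrite jE in hC *; set v := j%:~R in hC *.
have v0 : 0 < v :> R by rewrite ltr0z.
rewrite /uhw (hf j t y t0 ty) normcM nexp -/v.
move: (normc _) (normc_ge0 (uh N f j t)) => X X0.
rewrite mulrA mulrAC [leRHS]mulrAC; apply: ler_wpM2r => //.
have yE : y = t * (1 + (y - t) / t) by field; rewrite gt_eqF.
have yt0 : 0 <= (y - t) / t by rewrite divr_ge0 ?subr_ge0// ltW.
rewrite {1}yE powRM ?(ltW t0)//; last by rewrite addr_ge0.
rewrite -[X in X <= _]mulrA; apply: ler_wpM2l; first exact: powR_ge0.
apply: (@le_trans _ _ (expR ((y - t) / t) `^ (k%:R / 2) * expR (- (2 * pi * (v / N)) * (y - t)))).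
  rewrite ler_wpM2r ?expR_ge0//; apply: ge0_ler_powR; rewrite ?divr_ge0// ?nnegrE ?expR_ge0 ?addr_ge0//.
  exact: expR_ge1Dx.
rewrite -expRM -expRD ler_expR.
have p2 : 2 <= pi :> R by exact: pi_ge2.
have h1 : (y - t) / t * (k%:R / 2) <= v / N * (y - t).
  have -> : (y - t) / t * (k%:R / 2) = (k%:R / t / 2) * (y - t) by field; rewrite gt_eqF.
  rewrite ler_wpM2r ?subr_ge0//.
  have h2 : k%:R / t <= v / N by rewrite ler_pdivrMr// mulrAC ler_pdivlMr// [v * t]mulrC.
  apply: le_trans h2; rewrite ler_pdivrMr// ler_peMr ?divr_ge0 ?(ltW t0)//; lra.
have h3 : 0 <= v / N * (y - t).
  by apply: mulr_ge0; [apply: divr_ge0; exact: ltW|rewrite subr_ge0].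
have -> : - (2 * pi * (v / N)) * (y - t) = - (2 * pi * (v / N * (y - t))) by ring.
by move: (v / N * (y - t)) h1 h3 => w h1 h3; nra.
Qed.
End Decay.

(** * From real partial derivatives to Wirtinger derivatives *)

Section Plane.
Context {R : realType}.
Implicit Types (w : R * R -> R) (x y t s a b e d : R) (W wx wy : R -> R -> R).

Lemma mvt_bound (g dg : R -> R) t L e d :
  (forall s, `|s - t| < d -> is_derive s 1 g (dg s)) ->
  (forall s, `|s - t| < d -> `|dg s - L| <= e) ->
  forall a, `|a| < d -> `|g (t + a) - g t - L * a| <= e * `|a|.
Proof.
move=> dG hL a ad.
have key u v : u <= v -> `|u - t| < d -> `|v - t| < d -> `|g v - g u - L * (v - u)| <= e * (v - u).
  move=> uv ud vd.
  have I s : u <= s <= v -> `|s - t| < d.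
    move=> /andP[us sv]; move: ud vd; rewrite !ltr_norml => /andP[? ?] /andP[? ?].
    by apply/andP; split; lra.
  have cg : {within `[u, v], continuous g}.
    apply: derivable_within_continuous => s; rewrite in_itv /= => /I/dG ds; exact: ex_derive.
  have [s|s] := @MVT_segment _ g dg u v uv _ cg.
    by rewrite in_itv /= => /andP[/ltW us /ltW sv]; apply/dG/I; rewrite us.
  rewrite in_itv /= => /I/hL h ->; rewrite -mulrBl normrM (ger0_norm (_ : 0 <= v - u)) ?subr_ge0//.
  by rewrite ler_wpM2r// subr_ge0.
have d0 : `|t - t| < d by rewrite subrr normr0; exact: le_lt_trans (normr_ge0 a) ad.
have ta : `|t + a - t| < d by rewrite addrC addKr.
have [a0|a0] := leP 0 a.
  have h : t <= t + a by rewrite lerDl.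
  by have := key t (t + a) h d0 ta; rewrite [t + a - t]addrC addKr (ger0_norm a0).
have h : t + a <= t by rewrite gerDl ltW.
have := key (t + a) t h ta d0.
rewrite opprD addrA subrr add0r (ltr0_norm a0).
by rewrite (_ : g t - g (t + a) - L * - a = - (g (t + a) - g t - L * a)) ?normrN//; ring.
Qed.

Lemma partial1 w x y : derivable w (x, y) (1, 0) ->
  is_derive x 1 (fun t => w (t, y)) ('D_(1, 0) w (x, y)).
Proof.
have e : (fun h : R => h^-1 *: (w (h *: ((1, 0) : R * R) + (x, y)) - w (x, y))) =
         (fun h : R => h^-1 *: (w (h *: 1 + x, y) - w (x, y))).
  by apply/funext => h; congr (_ *: (w _ - _)); congr (_, _) => /=; rewrite /GRing.scale/= mulr0 add0r.
by rewrite /derivable e => d; split => //; rewrite /derive e.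
Qed.

Lemma partial2 w x y : derivable w (x, y) (0, 1) ->
  is_derive y 1 (fun t => w (x, t)) ('D_(0, 1) w (x, y)).
Proof.
have e : (fun h : R => h^-1 *: (w (h *: ((0, 1) : R * R) + (x, y)) - w (x, y))) =
         (fun h : R => h^-1 *: (w (x, h *: 1 + y) - w (x, y))).
  by apply/funext => h; congr (_ *: (w _ - _)); congr (_, _) => /=; rewrite /GRing.scale/= mulr0 add0r.
by rewrite /derivable e => d; split => //; rewrite /derive e.
Qed.

Definition pcont W x y := forall e, 0 < e -> exists2 d, 0 < d &
  forall a b, `|a - x| < d -> `|b - y| < d -> `|W a b - W x y| <= e.

Lemma cont2 w x y : {for (x, y), continuous w} -> pcont (fun a b => w (a, b)) x y.
Proof.
move=> /cvgrPdist_le cw e e0; have /nbhs_ballP[d /= d0 H] := cw e e0.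
exists d => // a b ha hb; rewrite distrC; apply: H.
by split => /=; rewrite /ball /= distrC.
Qed.

Lemma C1_frechet W wx wy x y e : 0 < y -> 0 < e ->
  (forall a b, 0 < b -> is_derive a 1 (fun t => W t b) (wx a b)) ->
  (forall a b, 0 < b -> is_derive b 1 (fun t => W a t) (wy a b)) ->
  pcont wx x y -> pcont wy x y ->
  exists2 d, 0 < d & forall a b, `|a| < d -> `|b| < d ->
   `|W (x + a) (y + b) - W x y - (wx x y * a + wy x y * b)| <= e * (`|a| + `|b|).
Proof.
move=> y0 e0 dx dy c1 c2; have [d1 d10 H1] := c1 e e0; have [d2 d20 H2] := c2 e e0.
pose d := Num.min y (Num.min d1 d2).
have dP s : `|s| < d -> [/\ `|s| < y, `|s| < d1 & `|s| < d2].
  by rewrite /d 2!lt_min => /andP[-> /andP[-> ->]].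
exists d => [|a b ad bd]; first by rewrite 2!lt_min y0 d10.
have pos s : `|s - y| < d -> 0 < s.
  by move=> /dP[+ _ _]; rewrite ltr_norml => /andP[? ?]; lra.
have yb : 0 < y + b by apply: pos; rewrite addrC addKr.
have h1 : `|W (x + a) (y + b) - W x (y + b) - wx x y * a| <= e * `|a|.
  apply: (@mvt_bound (fun t => W t (y + b)) (fun t => wx t (y + b)) x _ e d _ _ a ad) => s sd.
    exact: dx.
  by apply: H1; [have [] := dP _ sd|rewrite addrC addKr; have [] := dP _ bd].
have h2 : `|W x (y + b) - W x y - wy x y * b| <= e * `|b|.
  apply: (@mvt_bound (fun t => W x t) (fun t => wy x t) y _ e d _ _ b bd) => s sd.
    by apply: dy; exact: pos.
  by apply: H2; [rewrite subrr normr0|have [] := dP _ sd].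
rewrite (_ : _ - _ = (W (x + a) (y + b) - W x (y + b) - wx x y * a) +
  (W x (y + b) - W x y - wy x y * b)); last by ring.
by apply: (le_trans (ler_normD _ _)); rewrite mulrDr; exact: lerD.
Qed.

Lemma mvt_step (g dg : R -> R) u t : 0 < t -> (forall s, u <= s -> is_derive s 1 g (dg s)) ->
  exists2 s, u <= s <= u + t & g (u + t) - g u = dg s * t.
Proof.
move=> t0 dg0; have ut : u <= u + t by rewrite lerDl ltW.
have cg : {within `[u, u + t], continuous g}.
  apply: derivable_within_continuous => s; rewrite in_itv /= => /andP[us _]; have ds := dg0 s us; exact: ex_derive.
have [s|s] := @MVT_segment _ g dg u (u + t) ut _ cg.
  by rewrite in_itv /= => /andP[/ltW us _]; exact: dg0.
by rewrite in_itv /= => su; rewrite [u + t - u]addrC addKr; exists s.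
Qed.

(** Schwarz's theorem: by two applications of the mean value theorem, the same second difference
    quotient is close to either mixed derivative. *)
Lemma mixed_partials W wx wy (wxy wyx : R -> R -> R) x y : 0 < y ->
  (forall a b, 0 < b -> is_derive a 1 (fun t => W t b) (wx a b)) ->
  (forall a b, 0 < b -> is_derive b 1 (fun t => W a t) (wy a b)) ->
  (forall a b, 0 < b -> is_derive b 1 (fun t => wx a t) (wxy a b)) ->
  (forall a b, 0 < b -> is_derive a 1 (fun t => wy t b) (wyx a b)) ->
  pcont wxy x y -> pcont wyx x y -> wxy x y = wyx x y.
Proof.
move=> y0 dx dy dxy dyx c1 c2; apply/eqP; rewrite -subr_eq0 -normr_eq0 eq_le normr_ge0 andbT.
apply/ler_addgt0Pl => e e0; rewrite addr0; have e2 : 0 < e / 2 by rewrite divr_gt0.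
have [d1 d10 H1] := c1 _ e2; have [d2 d20 H2] := c2 _ e2.
pose t := Num.min d1 d2 / 2.
have [t0 t1 t2] : [/\ 0 < t, t < d1 & t < d2].
  have : Num.min d1 d2 <= d1 by rewrite ge_min lexx.
  have : Num.min d1 d2 <= d2 by rewrite ge_min lexx orbT.
  have : 0 < Num.min d1 d2 by rewrite lt_min d10.
  by rewrite /t; move: (Num.min d1 d2) => m; split; lra.
pose D := W (x + t) (y + t) - W (x + t) y - W x (y + t) + W x y.
have near u s d : u <= s <= u + t -> t < d -> `|s - u| < d.
  by move=> /andP[? ?] ?; rewrite ltr_norml; apply/andP; split; lra.
have yt : 0 < y + t by rewrite addr_gt0.
have pos v : y <= v -> 0 < v by exact: lt_le_trans.
have h1 : `|D / t ^+ 2 - wxy x y| <= e / 2.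
  have [s hs es] := @mvt_step (fun s => W s (y + t) - W s y) (fun s => wx s (y + t) - wx s y) x t t0
    (fun s _ => dB (dx s _ yt) (dx s _ y0)).
  have [v hv ev] := @mvt_step (wx s) (wxy s) y t t0 (fun v yv => dxy s v (pos v yv)).
  have -> : D / t ^+ 2 = wxy s v.
    rewrite (_ : D = W (x + t) (y + t) - W (x + t) y - (W x (y + t) - W x y)); last by rewrite /D; ring.
    by rewrite es ev; field; rewrite gt_eqF.
  by apply: H1; apply: near.
have h2 : `|D / t ^+ 2 - wyx x y| <= e / 2.
  have [v hv ev] := @mvt_step (fun v => W (x + t) v - W x v) (fun v => wy (x + t) v - wy x v) y t t0
    (fun v yv => dB (dy (x + t) v (pos v yv)) (dy x v (pos v yv))).
  have vp : 0 < v by case/andP: hv => /pos.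
  have [s hs es] := @mvt_step (fun s => wy s v) (fun s => wyx s v) x t t0 (fun s _ => dyx s v vp).
  have -> : D / t ^+ 2 = wyx s v.
    rewrite (_ : D = W (x + t) (y + t) - W x (y + t) - (W (x + t) y - W x y)); last by rewrite /D; ring.
    by rewrite ev es; field; rewrite gt_eqF.
  by apply: H2; apply: near.
move: h1 h2; move: (D / _) (wxy x y) (wyx x y) => q p r h1 h2.
rewrite (_ : p - r = (q - r) - (q - p)); last by ring.
by apply: (le_trans (ler_normB _ _)); lra.
Qed.

Definition onC (u : R * R -> R[i]) : R[i] -> R[i] := fun z => u (Re z, Im z).

Section Bridge.
Variable u : R * R -> R[i].

Lemma Cn_pcont n x y : Cn_uhp n u -> 0 < y ->
  pcont (fun a b => Re (u (a, b))) x y /\ pcont (fun a b => Im (u (a, b))) x y.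
Proof.
case: n => [|n] [c _] y0; have [c1 c2] := c (x, y) y0;
  by split; [exact: (@cont2 (fun q => Re (u q)))|exact: (@cont2 (fun q => Im (u q)))].
Qed.

Lemma Cn_dx n x y : Cn_uhp n.+1 u -> 0 < y ->
  is_derive x 1 (fun t => Re (u (t, y))) (Re (partialx u (x, y))) /\
  is_derive x 1 (fun t => Im (u (t, y))) (Im (partialx u (x, y))).
Proof.
move=> [_ [d _ _]] y0; have [d1 d2] := d (x, y) (1, 0) y0.
by split; [exact: (@partial1 (fun q => Re (u q)))|exact: (@partial1 (fun q => Im (u q)))].
Qed.

Lemma Cn_dy n x y : Cn_uhp n.+1 u -> 0 < y ->
  is_derive y 1 (fun t => Re (u (x, t))) (Re (partialy u (x, y))) /\
  is_derive y 1 (fun t => Im (u (x, t))) (Im (partialy u (x, y))).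
Proof.
move=> [_ [d _ _]] y0; have [d1 d2] := d (x, y) (0, 1) y0.
by split; [exact: (@partial2 (fun q => Re (u q)))|exact: (@partial2 (fun q => Im (u q)))].
Qed.

Lemma Cn_partials n : Cn_uhp n.+1 u -> Cn_uhp n (partialx u) /\ Cn_uhp n (partialy u).
Proof. by move=> [_ []]. Qed.
End Bridge.

Lemma Cn_rdiff (u : R * R -> R[i]) z : Cn_uhp 1 u -> uhp z ->
  rdiff (onC u) z ((onC (partialx u) z - 'i * onC (partialy u) z) / 2)
                  ((onC (partialx u) z + 'i * onC (partialy u) z) / 2).
Proof.
case: z => x y C1; rewrite /uhp /= => y0 e e0.
have [Cx Cy] := Cn_partials C1.
have e4 : 0 < e / 4 by rewrite divr_gt0.
have dx a b (hb : 0 < b) := Cn_dx a C1 hb; have dy a b (hb : 0 < b) := Cn_dy a C1 hb.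
have [cx1 cx2] := Cn_pcont x Cx y0; have [cy1 cy2] := Cn_pcont x Cy y0.
have [d1 d10 H1] := C1_frechet y0 e4 (fun a b hb => (dx a b hb).1) (fun a b hb => (dy a b hb).1) cx1 cy1.
have [d2 d20 H2] := C1_frechet y0 e4 (fun a b hb => (dx a b hb).2) (fun a b hb => (dy a b hb).2) cx2 cy2.
rewrite /onC /=; move: (partialx u (x, y)) (partialy u (x, y)) H1 H2 => [p p'] [q q'] /= H1 H2.
clear dx dy cx1 cx2 cy1 cy2 Cx Cy C1.
exists (Num.min d1 d2); first by rewrite lt_min d10.
case=> a b; rewrite lt_min => /andP[hd1 hd2].
have na : `|a| <= normc (a +i* b) := normc_ge_Re (a +i* b).
have nb : `|b| <= normc (a +i* b) := normc_ge_Im (a +i* b).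
have {}H1 := H1 a b (le_lt_trans na hd1) (le_lt_trans nb hd1).
have {}H2 := H2 a b (le_lt_trans na hd2) (le_lt_trans nb hd2).
have -> : ((p +i* p') - 'i * (q +i* q')) / 2 * (a +i* b) +
     ((p +i* p') + 'i * (q +i* q')) / 2 * conjc (a +i* b) = (p * a + q * b) +i* (p' * a + q' * b).
  have e2 : 2^-1 = (2^-1 : R)%:C :> R[i] by rewrite fmorphV rmorph_nat.
  by rewrite e2; apply/eqP; rewrite eq_complex /=; apply/andP; split; apply/eqP; field.
move: H1 H2; rewrite -[Re (x +i* y + _)]/(x + a) -[Im (x +i* y + _)]/(y + b).
move: (u (x + a, y + b)) (u (x, y)) => [v v'] [r r'] /= H1 H2.
apply: le_trans (normc_le_ReIm ((v - r - (p * a + q * b)) +i* (v' - r' - (p' * a + q' * b)))) _.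
apply: (le_trans (lerD H1 H2)); move: na nb; rewrite -[Num.sqrt _]/(normc (a +i* b)).
move: (normc _) => n na nb; nra.
Qed.

Lemma Cn_mixed (u : R * R -> R[i]) p : Cn_uhp 2 u -> 0 < p.2 ->
  partialy (partialx u) p = partialx (partialy u) p.
Proof.
case: p => x y C2 /= y0; have [Cx Cy] := Cn_partials C2.
have [_ Cxy] := Cn_partials Cx; have [Cyx _] := Cn_partials Cy.
have dx a b (hb : 0 < b) := Cn_dx a C2 hb; have dy a b (hb : 0 < b) := Cn_dy a C2 hb.
have dxy a b (hb : 0 < b) := Cn_dy a Cx hb; have dyx a b (hb : 0 < b) := Cn_dx a Cy hb.
have [c1 c2] := Cn_pcont x Cxy y0; have [c3 c4] := Cn_pcont x Cyx y0.
have h1 := mixed_partials y0 (fun a b hb => (dx a b hb).1) (fun a b hb => (dy a b hb).1)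
  (fun a b hb => (dxy a b hb).1) (fun a b hb => (dyx a b hb).1) c1 c3.
have h2 := mixed_partials y0 (fun a b hb => (dx a b hb).2) (fun a b hb => (dy a b hb).2)
  (fun a b hb => (dxy a b hb).2) (fun a b hb => (dyx a b hb).2) c2 c4.
by move: h1 h2; move: (partialy (partialx u) (x, y)) (partialx (partialy u) (x, y)) => [a b] [c d] /= -> ->.
Qed.

Lemma rdiff_Imfun (s : R -> R) (z : R[i]) (l : R) : is_derive (Im z) 1 s l ->
  rdiff (fun v => (s (Im v))%:C) z (l%:C * (- 'i / 2)) (l%:C * ('i / 2)).
Proof.
case: z => x y /= ds e e0.
have d0 : is_derive (0 : R) (1 : R) (fun t => s (t + y)) l.
  have d1 : is_derive (0 : R) (1 : R) (fun t => t + y) 1.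
    by apply: (is_derive_eq (dD (did 0) (dcst y 0))); rewrite addr0.
  have d2 : is_derive (0 + y) 1 s l by rewrite add0r.
  by apply: (is_derive_eq (is_derive1_comp (f := s) (g := fun t => t + y) d2 d1)); rewrite mulr1.
have [d dp H] := deriv_o d0 e0; exists d => // -[a b] hd.
have nb : `|b| <= normc (a +i* b) := normc_ge_Im (a +i* b).
have -> : l%:C * (- 'i / 2) * (a +i* b) + l%:C * ('i / 2) * conjc (a +i* b) = (l * b)%:C :> R[i].
  have e2 : 2^-1 = (2^-1 : R)%:C :> R[i] by rewrite fmorphV rmorph_nat.
  by rewrite e2; apply/eqP; rewrite eq_complex /=; apply/andP; split; apply/eqP; field.
rewrite -!rmorphB normc_real /=; have := H b (le_lt_trans nb hd); rewrite add0r [b + y]addrC => h.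
by apply: (le_trans h); rewrite ler_wpM2l// ltW.
Qed.
End Plane.

(** [U] and its companions stand for u = y^(k/2) f and its partial derivatives at a point, [Y] for
    Im z, [S] for Y^(- k/2); the second hypothesis is the Laplace equation of u. *)
Lemma maass_alg (R : realType) (Y S U Ux Uy Uxx Uyy Uxy K L : R[i]) : Y != 0 ->
  Y ^+ 2 * (Uxx + Uyy) = 'i * (K * Y) * Ux - L * U ->
  (2 - K / 2) * (Y * S) * (- 'i / 2) * (2^-1 * (Ux + 'i * Uy)) +
  Y ^+ 2 * S * (2^-1 * ((Uxx - 'i * Uxy) / 2 + 'i * ((Uxy - 'i * Uyy) / 2))) +
  - ('i * K / 4) * ((1 - K / 2) * S * (- 'i / 2) * U + Y * S * ((Ux - 'i * Uy) / 2)) =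
  - (2 * 'i * (2 - K) * (Y ^+ 2 * S * ((Ux + 'i * Uy) / 2) - 'i * K / 4 * (Y * S * U)) / Y +
     (L + K ^+ 2 / 4 - K / 2) * (S * U)) / 4.
Proof.
move=> Y0 eqn; have i2 : 'i * 'i = -1 :> R[i] by rewrite -expr2 sqr_i.
transitivity ((2 - K / 2) * Y * S / 4 * (- 'i * Ux - ('i * 'i) * Uy) +
  (Y ^+ 2 * (Uxx - ('i * 'i) * Uyy)) * S / 4 +
  (('i * 'i) * (K / 8) * (1 - K / 2) * S * U - (K / 8) * Y * S * ('i * Ux - ('i * 'i) * Uy))); first by field.
transitivity (- ('i * (2 - K) / 4) * Y * S * Ux - ('i * 'i) * (2 - K) / 4 * Y * S * Uy +
   ('i * 'i) * (2 - K) * K / 8 * S * U - (L + K ^+ 2 / 4 - K / 2) * (S * U) / 4); last by field.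
rewrite i2 (_ : Uxx - -1 * Uyy = Uxx + Uyy); last by ring.
by rewrite eqn; field.
Qed.

Lemma powRD0 (R : realType) (y : R) : 0 < y -> forall a b : R, y `^ (a + b) = y `^ a * y `^ b.
Proof. by move=> y0 a b; apply: powRD; rewrite (gt_eqF y0) implybT. Qed.

Lemma powRNK (R : realType) (y a : R) : 0 < y -> y `^ (- a) * y `^ a = 1.
Proof. by move=> y0; rewrite -powRD0// addNr powRr0. Qed.

Section PowC.
Context {R : realType}.
Implicit Types (y K a l : R) (k : nat).

Lemma powRC2 y K : 0 < y -> (y `^ (2 - K))%:C = y%:C ^+ 2 * (y `^ (- K))%:C.
Proof. by move=> y0; rewrite powRD0// -[2]/(2%:R) powR_mulrn ?ltW// rmorphM rmorphXn. Qed.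

Lemma powRC1 y K : 0 < y -> (y `^ (1 - K))%:C = y%:C * (y `^ (- K))%:C.
Proof. by move=> y0; rewrite powRD0// powRr1 ?ltW// rmorphM. Qed.

Lemma powRCm y K : 0 < y -> (y `^ (- K - 1))%:C = (y `^ (- K))%:C * (y%:C)^-1.
Proof. by move=> y0; rewrite powRD0// powR_inv1 ?ltW// rmorphM fmorphV. Qed.

Lemma halfC k : (k%:R / 2 : R)%:C = k%:R / 2 :> R[i].
Proof. by rewrite rmorphM fmorphV !rmorph_nat. Qed.

Lemma powRC_l2 K a : ((2 - K) * a)%:C = (2 - K%:C) * a%:C :> R[i].
Proof. by rewrite rmorphM rmorphB rmorph_nat. Qed.

Lemma powRC_l1 K a : ((1 - K) * a)%:C = (1 - K%:C) * a%:C :> R[i].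
Proof. by rewrite rmorphM rmorphB rmorph1. Qed.

Lemma lamC l k : (l + k%:R ^+ 2 / 4 - k%:R / 2)%:C = l%:C + k%:R ^+ 2 / 4 - k%:R / 2 :> R[i].
Proof.
rewrite rmorphB rmorphD; congr (_ + _ - _); last exact: halfC.
by rewrite rmorphM fmorphV rmorphXn /= !rmorph_nat.
Qed.

Lemma powRC_lm K a : (- K * a)%:C = - K%:C * a%:C :> R[i].
Proof. by rewrite rmorphM rmorphN. Qed.
End PowC.

Lemma maass_alg_eqn (R : realType) (Y a b c d L i K : R[i]) :
  Y ^+ 2 * (a + b) - i * (K * Y) * c + L * d = 0 -> Y ^+ 2 * (a + b) = i * (K * Y) * c - L * d.
Proof. by move=> e; apply/eqP; rewrite -subr_eq0 -e; apply/eqP; ring. Qed.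

Section MaassSystem.
Context {R : realType}.
Variables (lam : R) (k : nat).
Let K : R := k%:R / 2.

(** This is y^2 times the derivative of f = y^(- k/2) u with respect to the conjugate variable,
    expressed through u. *)
Definition maass_h (U Ux Uy : R[i] -> R[i]) (z : R[i]) : R[i] :=
  (Im z `^ (2 - K))%:C * (2^-1 * (Ux z + 'i * Uy z)) - ('i * k%:R / 4) * ((Im z `^ (1 - K))%:C * U z).

(** Rewriting the Laplace equation of u = y^(k/2) f for f itself shifts the eigenvalue by k^2/4 -
    k/2. The partial derivatives are abstract functions here, one [Uxy] serving for both mixed
    ones. *)
Lemma maass_sys_abs (f U Ux Uy Uxx Uxy Uyy : R[i] -> R[i]) :
  (forall w, uhp w -> (Im w `^ (- K))%:C * U w = f w) ->
  (forall z, uhp z -> rdiff U z ((Ux z - 'i * Uy z) / 2) ((Ux z + 'i * Uy z) / 2)) ->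
  (forall z, uhp z -> rdiff Ux z ((Uxx z - 'i * Uxy z) / 2) ((Uxx z + 'i * Uxy z) / 2)) ->
  (forall z, uhp z -> rdiff Uy z ((Uxy z - 'i * Uyy z) / 2) ((Uxy z + 'i * Uyy z) / 2)) ->
  (forall z, uhp z -> (Im z)%:C ^+ 2 * (Uxx z + Uyy z) = 'i * (k%:R * (Im z)%:C) * Ux z - lam%:C * U z) ->
  maass_sys k (lam + k%:R ^+ 2 / 4 - k%:R / 2) f (maass_h U Ux Uy).
Proof.
move=> fE rU rUx rUy eqn z uz; have y0 : 0 < Im z := uz.
have dU := rU z uz; have dUx := rUx z uz; have dUy := rUy z uz.
have ps (a : R) : rdiff (fun v : R[i] => (Im v `^ a)%:C) z ((a * Im z `^ (a - 1))%:C * (- 'i / 2)) ((a * Im z `^ (a - 1))%:C * ('i / 2)).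
  by apply: (@rdiff_Imfun _ (fun t => t `^ a)); exact: is_derive1_powR.
have Y0 : (Im z)%:C != 0 :> R[i] by rewrite eq_complex /= eqxx andbT gt_eqF.
have S2 := powRC2 K y0; have S1 := powRC1 K y0; have Sm := powRCm K y0.
have KE : K%:C = k%:R / 2 :> R[i] by exact: halfC.
split.
  eexists; apply: (rdiff_uhp fE uz (rdiff_eq (rdiffM (ps (- K)) dU) _ _)); first by reflexivity.
  rewrite powRC_lm Sm KE /maass_h S2 S1.
  move: (U z) (Ux z) (Uy z) (Im z)%:C Y0 (Im z `^ (- K))%:C (k%:R : R[i]) => a b c Y hY T L.
  by field.
eexists.
have dB := rdiffZ 2^-1 (rdiffD dUx (rdiffZ 'i dUy)).
have d1 := rdiffM (ps (2 - K)) dB.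
have d2 := rdiffZ (- ('i * k%:R / 4)) (rdiffM (ps (1 - K)) dU).
apply: (@rdiff_uhp _ _ (maass_h U Ux Uy) _ _ _ _ uz (rdiff_eq (rdiffD d1 d2) _ _)).
- by move=> w _; rewrite /maass_h mulNr.
- have := @maass_alg _ (Im z)%:C (Im z `^ (- K))%:C (U z) (Ux z) (Uy z) (Uxx z) (Uyy z) (Uxy z) k%:R lam%:C Y0 (eqn z uz).
  have -> : 2 - K - 1 = 1 - K by ring.
  have -> : 1 - K - 1 = - K by ring.
  rewrite powRC_l2 powRC_l1 KE -(fE z uz) lamC /maass_h S2 S1 => ma.
  by rewrite ma; congr (- (_ * (_ - _) / _ + _) / _); rewrite [2^-1 * _]mulrC.
- by reflexivity.
Qed.
End MaassSystem.

Lemma maass_sysP (R : realType) (lam : R) k (f : R[i] -> R[i]) :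
  let u := plane_fun (fun z => (Im z `^ (k%:R / 2))%:C * f z) in
  smooth_uhp u -> (forall p, 0 < p.2 -> laplacian k u p + lam%:C * u p = 0) ->
  exists h, maass_sys k (lam + k%:R ^+ 2 / 4 - k%:R / 2) f h.
Proof.
move=> u su eqn; have [Cx Cy] := Cn_partials (su 2).
exists (maass_h k (onC u) (onC (partialx u)) (onC (partialy u))).
apply: (@maass_sys_abs _ _ _ _ _ _ _ (onC (partialx (partialx u))) (onC (partialy (partialx u))) (onC (partialy (partialy u)))).
- move=> w uw; rewrite /onC /u /plane_fun -[Re w +i* Im w]/(toC (ofC w)) ofCK mulrA -rmorphM.
  by rewrite (powRNK _ uw) rmorph1 mul1r.
- by move=> z uz; exact: Cn_rdiff (su 1) uz.
- by move=> z uz; exact: Cn_rdiff Cx uz.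
- move=> z uz; have e : onC (partialy (partialx u)) z = onC (partialx (partialy u)) z := @Cn_mixed _ u (Re z, Im z) (su 2) uz.
  exact (eq_ind_r (fun t => rdiff (onC (partialy u)) z ((t - 'i * onC (partialy (partialy u)) z) / 2)
    ((t + 'i * onC (partialy (partialy u)) z) / 2)) (Cn_rdiff Cy uz) e).
move=> z uz.
have e : (Im z ^+ 2)%:C * (onC (partialx (partialx u)) z + onC (partialy (partialy u)) z)
  - 'i * (k%:R * Im z)%:C * onC (partialx u) z + lam%:C * onC u z = 0 := eqn (Re z, Im z) uz.
move: e; rewrite rmorphXn rmorphM rmorph_nat.
exact: maass_alg_eqn.
Qed.

Section Forms.
Context {R : realType}.
Implicit Types (f h : R[i] -> R[i]) (z : R[i]) (g : 'M[int]_2) (k N : nat).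

Lemma slash_Gamma1 k N f g g1 z : weakly_modular N k f -> Gamma1 N g1 -> SL2Z g -> uhp z ->
  slash k (g1 *m g) f z = slash k g f z.
Proof.
move=> wm G1 dg uz; have d1 : SL2Z g1 by case: G1.
rewrite slash_mul// {2}/slash; congr (_ * _); have ug := uhp_moebius dg uz.
by rewrite /slash wm// mulKf// expf_neq0// autj_neq0.
Qed.

(** Conjugates of T^N are congruent to 1 modulo N, so every SL2(Z)-slash of f has period N. *)
Lemma conj_T_Gamma1 N g (n : int) : SL2Z g -> Gamma1 N (g *m Tmat (N%:Z * n) *m inv2 g).
Proof.
move=> dg; have dg1 := SL2Z_det dg; split.
- by apply: SL2Z_mul; [apply: SL2Z_mul => //; exact: SL2Z_T|exact: SL2Z_inv].
- rewrite !mulmx2E !mat2E; apply/dvdzP; exists (- (n * (g 1%R 0%R * g 1%R 0%R))); ring.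
- rewrite !mulmx2E !mat2E; apply/eqP; rewrite eqz_mod_dvd; apply/dvdzP.
  exists (- (n * (g 0%R 0%R * g 1%R 0%R))); rewrite -[X in _ - X]dg1; ring.
- rewrite !mulmx2E !mat2E; apply/eqP; rewrite eqz_mod_dvd; apply/dvdzP.
  exists (n * (g 0%R 0%R * g 1%R 0%R)); rewrite -[X in _ - X]dg1; ring.
Qed.

Lemma slash_periodic k N f g z (n : int) : weakly_modular N k f -> SL2Z g -> uhp z ->
  slash k g f (z + (N%:Z * n)%:~R) = slash k g f z.
Proof.
move=> wm dg uz; rewrite -slash_T//.
have -> : g *m Tmat (N%:Z * n) = (g *m Tmat (N%:Z * n) *m inv2 g) *m g.
  by rewrite -[RHS]mulmxA mulVmx2// mulmx1.
exact: (slash_Gamma1 wm (conj_T_Gamma1 N n dg) dg uz).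
Qed.

(* What the argument uses about a cusp form: continuity, modularity and, at each
   cusp, a vanishing constant term and uniform decay of the other Fourier
   coefficients. *)
Definition good_form (C : R) k N f :=
  [/\ forall z, uhp z -> ccat f z, weakly_modular N k f,
      forall g, SL2Z g -> exp_type C k N%:R (slash k g f) &
      forall g, SL2Z g -> forall y, 0 < y -> uh N%:R (slash k g f) 0 y = 0].

Lemma slash_periodicN k N f g z : weakly_modular N k f -> SL2Z g -> uhp z ->
  slash k g f (z + (N%:R)%:C) = slash k g f z.
Proof.
by move=> wm dg uz; rewrite -[RHS](slash_periodic 1 wm dg uz) mulr1 rmorph_nat pmulrn.
Qed.

Lemma maass_sys_ccat k (lam : R) f h z : maass_sys k lam f h -> uhp z -> ccat f z.
Proof. by move=> sys uz; have [[A dA] _] := sys z uz; exact: rdiff_ccat dA. Qed.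

Lemma hol_good k N f : (0 < N)%N -> hol_cusp_form k N f -> good_form k%:R k N f.
Proof.
move=> N0 [hol wm van]; have N0R : 0 < N%:R :> R by rewrite ltr0n.
have sys : maass_sys k 0 f (fun=> 0).
  move=> z uz; split.
    by have [A dA] := derivable_cdiff (hol z uz); exists A; rewrite mul0r.
  by exists 0; rewrite mulr0 !mul0r addr0 oppr0 mul0r; exact: rdiff_cst.
have sysg g : SL2Z g -> maass_sys k 0 (slash k g f) (fun=> 0).
  move=> dg z uz; have [h1 h2] := maass_sys_slash dg sys uz.
  split; first by have [A dA] := h1; exists A; move: dA; rewrite /slash !mulr0.
  by exists 0; rewrite mulr0 !mul0r addr0 oppr0 mul0r; exact: rdiff_cst.
have et g : SL2Z g -> exp_type k%:R k N%:R (slash k g f) /\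
     forall y, 0 < y -> uh N%:R (slash k g f) 0 y = 0.
  move=> dg; apply: hol_exp_type => //; first exact: sysg.
    by move=> z uz; exact: slash_periodicN.
  exact: van.
split; [by move=> z uz; exact: maass_sys_ccat sys uz|exact: wm|..].
  by move=> g /et[].
by move=> g /et[].
Qed.

Lemma exp_type_le (C C' : R) k (N : R) f : 0 <= N -> C <= C' -> exp_type C k N f -> exp_type C' k N f.
Proof.
move=> N0 CC et j t y j0 t0 h ty; apply: et => //; apply: le_trans h.
by rewrite ler_wpM2r.
Qed.

(** For k at most 1 the shifted eigenvalue exceeds that of the form by at most 1 in absolute value,
    and 4 + 2 (|lam| + 1) = 6 + 2 |lam|. So one constant, depending on lambda only, serves both
    weights. *)
Lemma maass_good (lam : R) k N f : (0 < N)%N -> k = 0%N \/ k = 1%N -> maass_cusp_form lam k N f ->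
  good_form (6 + 2 * `|lam|) k N f.
Proof.
move=> N0 k01 [su eqn wm mg cu]; have N0R : 0 < N%:R :> R by rewrite ltr0n.
have [h sys] := maass_sysP su eqn.
set lam' := lam + _ - _ in sys.
have lam_le : `|lam'| <= `|lam| + 1.
  have : `|lam'| <= `|lam| + `|k%:R ^+ 2 / 4 - k%:R / 2 : R| by rewrite /lam' -addrA; exact: ler_normD.
  move/le_trans; apply; rewrite lerD2l; case: k01 => ->; rewrite ler_norml; apply/andP; split; lra.
split; [by move=> z uz; exact: maass_sys_ccat sys uz|exact: wm|..].
  move=> g dg; apply: (@exp_type_le (4 + 2 * `|lam'|)); [exact: ltW|lra|].
  apply: (maass_exp_type N0R k01 (maass_sys_slash dg sys)).
    by move=> z uz; exact: slash_periodicN.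
  by have [C [A H]] := mg g dg; exists C, A.
move=> g dg y y0; have [c1 c2] := cu g dg y y0.
rewrite /uh /fc /inp (@eq_cint _ _ _ _ (hline (slash k g f) y)); last first.
  by move=> x; rewrite ech0 rmorph1 mulr1.
by rewrite /cint /rint /hline c1 c2 mulr0.
Qed.
End Forms.

(** * Boundedness *)

Section Bounded.
Context {R : realType}.
Implicit Types (f : R[i] -> R[i]) (z : R[i]) (g : 'M[int]_2) (x y : R).

Lemma rect_bounded f (a b c d : R) : 0 < c -> (forall z, uhp z -> ccat f z) ->
  exists M : R, forall x y, a <= x <= b -> c <= y <= d -> normc (f (x +i* y)) <= M.
Proof.
move=> c0 cf.
have /compact_near_coveringP cab := compact_setX (@segment_compact R a b) (@segment_compact R c d).
have [p [/= hx hy]|M HM] := @cab R (@pinfty_nbhs R) (fun M p => normc (f (p.1 +i* p.2)) <= M) _ _.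
  case: p hx hy => x y /= hx; rewrite in_itv /= => /andP[cy yd].
  have y0 : 0 < y by exact: lt_le_trans cy.
  have [e e0 H] := ccat_near (cf (x +i* y) y0) ltr01.
  exists (ball (x, y) e, [set M | normc (f (x +i* y)) + 1 < M]) => /=.
    split; first exact: nbhsx_ballx.
    by exists (normc (f (x +i* y)) + 1); split => //; exact: num_real.
  move=> [[x' y'] M] [[/= b1 b2] /= hM]; apply: ltW; apply: le_lt_trans hM.
  rewrite -[f (x' +i* y')](subrK (f (x +i* y))) addrC; apply: le_trans (normcD _ _) _.
  by rewrite lerD2l; apply: H; rewrite distrC.
have [M0 [_ /= h]] : \forall M \near +oo, `[a, b] `*` `[c, d] `<=` (fun p => normc (f (p.1 +i* p.2)) <= M).
  by exists M; exact: HM.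
exists (M0 + 1) => x y hx hy; apply: (h (M0 + 1) _ (x, y)); first by rewrite ltrDl.
by split; rewrite /= in_itv.
Qed.

(** If Im z < 1/2 and |Re z| <= 1/2, then |z|^2 < 1/2, so the inversion at least doubles the height.
    The bound 1/2 thus allows a plain induction on the number of doublings. *)
Lemma reduce_half z : uhp z -> exists2 g, SL2Z g & 1 / 2 <= Im (moebius g z).
Proof.
move=> uz.
suff H n z' : uhp z' -> 1 / 2 <= 2 ^+ n * Im z' -> exists2 g, SL2Z g & 1 / 2 <= Im (moebius g z').
  have D0 : 0 <= 1 / 2 / Im z by rewrite divr_ge0 ?ltW.
  have [n hn] : exists n, 1 / 2 / Im z <= 2 ^+ n.
    have [n hn] := pow2_small D0 ltr01; exists n.
    by apply: ltW; rewrite -[ltRHS]mul1r -ltr_pdivrMr.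
  by apply: (H n) => //; rewrite -ler_pdivrMr.
elim: n z' => [w uw h|n IH w uw].
  by exists 1%:M; [apply: SL2Z1|rewrite moebius1 -[leRHS]mul1r].
move=> hn; have [h|h] := leP (1 / 2) (Im w); first by exists 1%:M; [apply: SL2Z1|rewrite moebius1].
pose m := - Num.floor (Re w + 1 / 2); pose w1 := moebius (Tmat m) w.
have w1E : w1 = w + m%:~R by exact: moebius_T.
have rI : Im w1 = Im w by rewrite w1E intc; case: (w) => a b /=; rewrite addr0.
have rR : `|Re w1| <= 1 / 2.
  have -> : Re w1 = Re w - (Num.floor (Re w + 1 / 2))%:~R.
    by rewrite w1E intc /m rmorphN /=; case: (w).
  have /andP[h1 h2] := floor_itv (Re w + 1 / 2); move: h2; rewrite intrD => h2.
  by rewrite ler_norml; apply/andP; split; lra.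
have u1 : uhp w1 by rewrite /uhp /= rI.
have dS := SL2Z_S.
pose w2 := moebius Smat w1; have u2 : uhp w2 by exact: uhp_moebius.
have h2 : 2 * Im w <= Im w2.
  rewrite /w2 Im_moebius// rI.
  have -> : nsq (autj Smat w1) = Re w1 ^+ 2 + Im w1 ^+ 2.
    by case: (w1) => a b; rewrite nsq_autj !mat2E /= !mul1r addr0.
  rewrite ler_pdivlMr; last first.
    by rewrite ltr_wpDl ?sqr_ge0// exprn_gt0.
  rewrite rI; have h0 : 0 < Im w := uw.
  have : Re w1 ^+ 2 <= 1 / 4.
    by rewrite -(real_normK (num_real (Re w1))); have := normr_ge0 (Re w1); nra.
  nra.
have [|g dg hg] := IH w2 u2.
  by apply: (le_trans hn); rewrite exprSr -mulrA ler_wpM2l// exprn_ge0.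
exists (g *m (Smat *m Tmat m)).
  by apply: SL2Z_mul => //; apply: SL2Z_mul => //; exact: SL2Z_T.
have dT := SL2Z_T m.
by rewrite moebius_mul// ?moebius_mul//; exact: SL2Z_mul.
Qed.

Lemma normc_uh_le_in (N : R) f j y M : 0 < N -> ccont (hline f y) ->
  (forall x, 0 <= x <= N -> normc (f (x +i* y)) <= M) -> normc (uh N f j y) <= M.
Proof.
move=> N0 cf fM; rewrite /uh /fc /inp normcM normc_real.
rewrite gtr0_norm ?invr_gt0// ler_pdivrMl// mulrC.
rewrite -[X in _ <= M * X]subr0; apply: normc_cint_cst; [|exact: ltW|].
  by apply: ccont_inp => //; exact: ccont_ech.
by move=> x hx; rewrite normcM normc_conj normc_ech mulr1; exact: fM.
Qed.

Lemma expRN_sq (x : R) : 0 < x -> expR (- x) <= 2 / x ^+ 2.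
Proof.
move=> x0; rewrite expRN -[leRHS]invrK lef_pV2 ?posrE ?expR_gt0 ?invr_gt0 ?divr_gt0 ?exprn_gt0//.
have := expR_ge1Dxn 1 (ltW x0); rewrite invf_div; apply: le_trans.
by rewrite (_ : 2`!%:R = 2)//; rewrite lerDr.
Qed.

Variables (C : R) (k N : nat) (f : R[i] -> R[i]).
Hypothesis N0 : (0 < N)%N.
Hypothesis C0 : 0 <= C.
Hypothesis gf : good_form C k N f.

Let N0R : 0 < N%:R :> R. Proof. by rewrite ltr0n. Qed.
Let cf z : uhp z -> ccat f z. Proof. by case: gf => + _ _ _; apply. Qed.
Let wm : weakly_modular N k f. Proof. by case: gf. Qed.

Lemma slash_ccat g z : SL2Z g -> uhp z -> ccat (slash k g f) z.
Proof.
move=> dg uz; apply: ccatM.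
  by have := rdiff_autjX k dg uz; exact: rdiff_ccat.
apply: ccat_comp; first by apply: cf; exact: uhp_moebius.
exact: rdiff_ccat (rdiff_moebius dg uz).
Qed.

Lemma slash_ccont g y : SL2Z g -> 0 < y -> ccont (hline (slash k g f) y).
Proof.
move=> dg y0; apply: (@ccont_hline _ _ y) => // z yz; apply: slash_ccat => //.
exact: lt_le_trans yz.
Qed.

Lemma slash_per g x y (n : int) : SL2Z g -> 0 < y ->
  slash k g f ((x + N%:R * n%:~R) +i* y) = slash k g f (x +i* y).
Proof.
move=> dg y0; rewrite -(slash_periodic (z := x +i* y) n wm dg y0); congr slash.
by rewrite intc rmorphM /=; simpc.
Qed.

Lemma reduce_period x : exists2 n : int, 0 <= x + N%:R * n%:~R <= N%:R & True.
Proof.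
exists (- Num.floor (x / N%:R)) => //; rewrite rmorphN /= mulrN.
have /andP[h1 h2] := floor_itv (x / N%:R); move: h1 h2; rewrite intrD.
rewrite ler_pdivlMr// ltr_pdivrMr// mulrDl mul1r [_%:~R * _]mulrC => h1 h2.
by apply/andP; split; lra.
Qed.

Lemma cusp_bounded g : SL2Z g ->
  exists B : R, forall z, 1 / 2 <= Im z -> height k (slash k g f) z <= B.
Proof.
move=> dg; pose F := slash k g f.
have et : exp_type C k N%:R F by case: gf => _ _ + _; exact.
have u0 y : 0 < y -> uh N%:R F 0 y = 0 by case: gf => _ _ _; apply.
have half0 : 0 < (1 / 2 : R) by rewrite divr_gt0.
(* From this height on the exponential decay holds at every nonzero frequency. Above y1 + N it has
   gained exp (- |j|), and what lies below is compact modulo the period. *)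
pose y1 : R := 1 + C * N%:R.
have CN : 0 <= C * N%:R by rewrite mulr_ge0// ltW.
have y10 : 0 < y1 by rewrite ltr_pwDl.
have hy1 : 1 / 2 <= y1 by rewrite /y1; lra.
have [M HM] := rect_bounded 0 N%:R (y1 + N%:R) half0 (fun z uz => slash_ccat dg uz).
have M0 : 0 <= M.
  apply: le_trans (normc_ge0 (F (0 +i* y1))) _; apply: HM; first by rewrite lexx ltW.
  by apply/andP; split; [rewrite /y1; lra|rewrite lerDl ltW].
pose K1 := y1 `^ (k%:R / 2) * M.
have K10 : 0 <= K1 by rewrite mulr_ge0// powR_ge0.
pose K2 := (y1 + N%:R) `^ (k%:R / 2) * M.
have K20 : 0 <= K2 by rewrite mulr_ge0// powR_ge0.
exists (8 * K1 + K2) => -[x y] hy; rewrite /= in hy.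
have y0 : 0 < y by exact: lt_le_trans hy.
have [n hn _] := reduce_period x.
have -> : height k F (x +i* y) = height k F ((x + N%:R * n%:~R) +i* y).
  by rewrite /height /F slash_per.
move: (x + _) hn => {}x hx; rewrite /height /=.
have [yy|yy] := leP y (y1 + N%:R).
  apply: (@le_trans _ _ K2); last by rewrite lerDr mulr_ge0.
  apply: ler_pM; rewrite ?powR_ge0 ?normc_ge0//; last by apply: HM; rewrite // hy.
  by apply: ge0_ler_powR; rewrite ?nnegrE ?divr_ge0// ltW// addr_gt0.
apply: (@le_trans _ _ (8 * K1)); last by rewrite lerDl.
have yp : 0 < y `^ (k%:R / 2) by exact: powR_gt0.
have dec j : j != 0 -> normc (uh N%:R F j y) <= (2 * K1 / y `^ (k%:R / 2)) / `|j|%N%:R ^+ 2.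
  move=> j0; have nj : 0 < `|j|%N%:R :> R by rewrite ltr0n absz_gt0.
  have nj1 : 1 <= `|j|%N%:R :> R by rewrite ler1n absz_gt0.
  have y1y : y1 <= y by apply: le_trans (ltW yy); rewrite lerDl ltW.
  have h1 : C * N%:R <= y1 * `|j|%N%:R.
    by apply: (@le_trans _ _ y1); [rewrite lerDr|rewrite ler_peMr// ltW].
  have h2 := et j y1 y j0 y10 h1 y1y.
  have h3 : uhw k N%:R F j y1 <= K1.
    rewrite /uhw; apply: ler_wpM2l; first exact: powR_ge0.
    apply: normc_uh_le_in => //; first exact: slash_ccont.
    by move=> u hu; apply: HM => //; rewrite hy1 lerDl ltW.
  rewrite mulrAC ler_pdivlMr// mulrC -/(uhw k N%:R F j y).
  apply: (le_trans h2); apply: (@le_trans _ _ (K1 * expR (- `|j|%N%:R))).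
    apply: ler_pM; rewrite ?uhw_ge0 ?expR_ge0// ler_expR lerN2.
    by rewrite mulrAC ler_pdivlMr// ler_pM2l// lerBrDl ltW.
  have -> : 2 * K1 / `|j|%N%:R ^+ 2 = K1 * (2 / `|j|%N%:R ^+ 2) by ring.
  by apply: ler_wpM2l; [exact: K10|exact: expRN_sq].
have := @fourier_sup _ N%:R N0R (hline F y) (2 * K1 / y `^ (k%:R / 2)) (slash_ccont dg y0) _ dec x (u0 y y0).
have pF x' : hline F y (x' + N%:R) = hline F y x'.
  by have := slash_per x' 1 dg y0; rewrite mulr1.
move=> /(_ pF) h; rewrite mulrC -ler_pdivlMr//; apply: (le_trans h).
by apply: eq_ler; field; rewrite gt_eqF.
Qed.

(** Slashes of f depend on the matrix only through its residue modulo N; so finitely many of them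
    describe f near all cusps. *)
Definition mod_class (g : 'M[int]_2) : 'I_N * 'I_N * ('I_N * 'I_N) :=
  let r (a : int) : 'I_N := insubd (Ordinal N0) `|(a %% N%:Z)%Z|%N in
  ((r (g 0 0), r (g 0 1)), (r (g 1 0), r (g 1 1))).

Lemma mod_classP (g h : 'M[int]_2) : mod_class g = mod_class h ->
  forall i j, (g i j = h i j %[mod N%:Z])%Z.
Proof.
have rP (a b : int) : insubd (Ordinal N0) `|(a %% N%:Z)%Z|%N = insubd (Ordinal N0) `|(b %% N%:Z)%Z|%N -> (a = b %[mod N%:Z])%Z.
  move=> /(congr1 val); rewrite !val_insubd.
  have NZ : N%:Z != 0 by rewrite -lt0n.
  have lt c : (`|(c %% N%:Z)%Z|%N < N)%N by have := ltz_mod c NZ; have := modz_ge0 c NZ; lia.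
  by rewrite !lt; have := modz_ge0 a NZ; have := modz_ge0 b NZ; lia.
rewrite /mod_class => -[/rP h1 /rP h2 /rP h3 /rP h4] i j.
by case: (ord2P i) => ->; case: (ord2P j) => ->.
Qed.

Lemma slash_mod g h z : SL2Z g -> SL2Z h -> mod_class g = mod_class h -> uhp z ->
  slash k g f z = slash k h f z.
Proof.
move=> dg dh /mod_classP e uz.
have gE : g = (g *m inv2 h) *m h by rewrite -mulmxA mulVmx2 // mulmx1.
rewrite {1}gE; apply: (slash_Gamma1 wm) => //.
have e' i j : exists q, g i j = h i j + q * N%:Z.
  by have /eqP := e i j; rewrite eqz_mod_dvd => /dvdzP[q hq]; exists q; rewrite -hq addrC subrK.
have [q00 h00] := e' 0 0; have [q01 h01] := e' 0 1; have [q10 h10] := e' 1 0; have [q11 h11] := e' 1 1.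
have dh1 := SL2Z_det dh; split.
- by apply: SL2Z_mul => //; exact: SL2Z_inv.
- rewrite mulmx2E !mat2E h10 h11; apply/dvdzP; exists (q10 * h 1%R 1%R - q11 * h 1%R 0%R); ring.
- rewrite mulmx2E !mat2E h00 h01; apply/eqP; rewrite eqz_mod_dvd; apply/dvdzP.
  exists (q00 * h 1%R 1%R - q01 * h 1%R 0%R); rewrite -[X in _ - X]dh1; ring.
- rewrite mulmx2E !mat2E h10 h11; apply/eqP; rewrite eqz_mod_dvd; apply/dvdzP.
  exists (q11 * h 0%R 0%R - q10 * h 0%R 1%R); rewrite -[X in _ - X]dh1; ring.
Qed.

(** Reduction to height 1/2 leaves finitely many slashes to bound. The point of the lemma is that
    [sup_norm] is then a true supremum and not the default value of [sup] on an unbounded set. *)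
Lemma height_bounded : exists B : R, forall z, uhp z -> height k f z <= B.
Proof.
have Hc (c : 'I_N * 'I_N * ('I_N * 'I_N)) : exists B : R, 0 <= B /\
    forall g z, SL2Z g -> mod_class g = c -> 1 / 2 <= Im z -> height k (slash k g f) z <= B.
  have [[g dg gc]|ng] := pselect (exists2 g, SL2Z g & mod_class g = c); last first.
    by exists 0; split=> // g z dg gc; case: ng; exists g.
  have [B HB] := cusp_bounded dg; exists `|B|; split=> // g' z dg' gc' hz.
  have uz : uhp z by apply: lt_le_trans hz; rewrite divr_gt0.
  rewrite /height (slash_mod dg' dg) ?gc'//; apply: le_trans (ler_norm B); exact: HB.
have [B HB] := choice Hc.
exists (\sum_c B c) => z uz; have [g dg hg] := reduce_half uz.
have ug : uhp (moebius g z) by exact: uhp_moebius.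
have di := SL2Z_inv dg.
rewrite -(moebiusK dg uz) -(height_slash k f di ug).
apply: (@le_trans _ _ (B (mod_class (inv2 g)))); first exact: (HB _).2.
by rewrite (bigD1 (mod_class (inv2 g)))//= lerDl sumr_ge0// => c _; exact: (HB c).1.
Qed.

Lemma height_sup z : uhp z -> height k f z <= sup_norm k f.
Proof.
move=> uz; apply: ub_le_sup; last by exists z.
by have [B HB] := height_bounded; exists B => _ [w uw <-]; exact: HB.
Qed.

Lemma sup_norm_ge0 : 0 <= sup_norm k f.
Proof.
have u : uhp (0 +i* 1 : R[i]) by rewrite /uhp /= ltr01.
by apply: le_trans (height_sup u); rewrite mulr_ge0 ?powR_ge0 ?normc_ge0.
Qed.

Lemma uhw_sup g j y : SL2Z g -> 0 < y -> uhw k N%:R (slash k g f) j y <= sup_norm k f.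
Proof.
move=> dg y0; have yp : 0 < y `^ (k%:R / 2) by exact: powR_gt0.
rewrite /uhw mulrC -ler_pdivlMr//; apply: normc_uh_le_in => //; first exact: slash_ccont.
move=> x _; rewrite ler_pdivlMr// mulrC.
by rewrite -[_ * _]/(height k (slash k g f) (x +i* y)) height_slash// height_sup//; exact: uhp_moebius.
Qed.

(** When C N <= |j| y / 2 the exponential decay from y / 2 to y is used; otherwise |j| y / N < 2 C,
    and the trivial bound [uhw_sup] is already of this form. *)
Lemma uhw_decay g j y : SL2Z g -> j != 0 -> 0 < y ->
  uhw k N%:R (slash k g f) j y <= (8 + 4 * C ^+ 2) * sup_norm k f * (N%:R / (`|j|%N%:R * y)) ^+ 2.
Proof.
move=> dg j0 y0; have nj : 0 < `|j|%N%:R :> R by rewrite ltr0n absz_gt0.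
have S0 := sup_norm_ge0.
pose v := `|j|%N%:R * y / N%:R; have v0 : 0 < v by rewrite divr_gt0// mulr_gt0.
have -> : N%:R / (`|j|%N%:R * y) = v^-1 by rewrite /v invf_div.
have vV : 0 <= v^-1 ^+ 2 by rewrite exprn_ge0// invr_ge0 ltW.
have y2 : 0 < y / 2 by rewrite divr_gt0.
have [h|h] := leP (C * N%:R) (y / 2 * `|j|%N%:R).
  have et : exp_type C k N%:R (slash k g f) by case: gf => _ _ + _; exact.
  have yy : y / 2 <= y by lra.
  apply: (le_trans (et j (y / 2) y j0 y2 h yy)).
  have -> : `|j|%N%:R / N%:R * (y - y / 2) = v / 2 by rewrite /v; field; rewrite gt_eqF.
  have v2 : 0 < v / 2 by rewrite divr_gt0.
  have hs := uhw_sup j dg y2; have he := expRN_sq v2.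
  apply: (@le_trans _ _ (sup_norm k f * (2 / (v / 2) ^+ 2))).
    by apply: ler_pM; rewrite ?uhw_ge0 ?expR_ge0.
  have -> : 2 / (v / 2) ^+ 2 = 8 * v^-1 ^+ 2 by field; rewrite gt_eqF.
  rewrite mulrCA mulrA; apply: ler_wpM2r => //; apply: ler_wpM2r => //.
  by rewrite lerDl mulr_ge0// sqr_ge0.
apply: (le_trans (uhw_sup j dg y0)).
have hv : v < 2 * C by rewrite /v ltr_pdivrMr//; lra.
have h1 : 1 <= 4 * C ^+ 2 * v^-1 ^+ 2.
  rewrite exprVn ler_pdivlMr ?exprn_gt0// mul1r.
  by have -> : 4 * C ^+ 2 = (2 * C) ^+ 2 by [ring]; rewrite ler_pXn2r// ?nnegrE ltW//; lra.
rewrite [_ * sup_norm k f]mulrC -mulrA ler_peMr//; apply: (le_trans h1).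
by rewrite ler_wpM2r// lerDr.
Qed.
End Bounded.

(** * Arithmetic of the level and the conductor *)

Lemma logn_prodX (s : seq nat) (e : nat -> nat) p : uniq s -> all prime s ->
  logn p (\prod_(i <- s) i ^ e i)%N = if p \in s then e p else 0%N.
Proof.
elim: s => [|i s IH] /=; first by rewrite big_nil logn1.
move=> /andP[is_ us] /andP[pi ps]; rewrite big_cons lognM; last 2 first.
- by rewrite expn_gt0 prime_gt0.
- rewrite big_seq; apply: prodn_cond_gt0 => j js; rewrite expn_gt0 prime_gt0//.
  exact: (allP ps).
rewrite IH// lognX logn_prime// in_cons; case: eqVneq => [->|_] /=; last by rewrite muln0.
by rewrite (negbTE is_) muln1 addn0.
Qed.

Lemma all_prime_primes n : all prime (primes n).
Proof. by apply/allP => p; rewrite mem_primes => /and3P[]. Qed.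

Lemma prod_logn m n : (0 < n)%N -> (m %| n)%N -> (m = \prod_(p <- primes n) p ^ logn p m)%N.
Proof.
move=> n0 mn; have m0 := dvdn_gt0 n0 mn.
apply: (@eqn_from_log m _ m0).
  rewrite big_seq; apply: prodn_cond_gt0 => p; rewrite mem_primes => /and3P[pp _ _].
  by rewrite expn_gt0 prime_gt0.
move=> p; rewrite logn_prodX ?primes_uniq ?all_prime_primes//.
case: ifPn => // pn; apply/eqP; rewrite -leqn0 leqNgt logn_gt0.
apply: contra pn; rewrite !mem_primes => /and3P[-> _ pm].
by rewrite n0 (dvdn_trans pm).
Qed.

Lemma dvdn_logn m n : (0 < m)%N -> (0 < n)%N -> (forall p, prime p -> logn p m <= logn p n)%N -> (m %| n)%N.
Proof.
move=> m0 n0 h; apply/dvdn_partP => // p; rewrite mem_primes => /and3P[pp _ _].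
by rewrite p_part pfactor_dvdn// h.
Qed.

(** The least c with N | c^2, called c in the overview. *)
Definition half_level N := (\prod_(p <- primes N) p ^ uphalf (logn p N))%N.

Lemma logn_half_level N p : logn p (half_level N) = uphalf (logn p N).
Proof.
rewrite logn_prodX ?primes_uniq ?all_prime_primes//; case: ifPn => //.
by rewrite -logn_gt0 -eqn0Ngt => /eqP ->.
Qed.

Lemma half_level_gt0 N : (0 < half_level N)%N.
Proof.
rewrite /half_level big_seq; apply: prodn_cond_gt0 => p; rewrite mem_primes => /and3P[pp _ _].
by rewrite expn_gt0 prime_gt0.
Qed.

Lemma half_level_dvd N : (0 < N)%N -> (half_level N %| N)%N.
Proof.
move=> N0; apply: dvdn_logn => // [|p _]; first exact: half_level_gt0.
by rewrite logn_half_level uphalf_half; have := odd_double_half (logn p N); lia.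
Qed.

Lemma dvd_half_level_sqr N : (0 < N)%N -> (N %| half_level N ^ 2)%N.
Proof.
move=> N0; apply: dvdn_logn => // [|p _]; first by rewrite expn_gt0 half_level_gt0.
by rewrite lognX logn_half_level uphalf_half; have := odd_double_half (logn p N); lia.
Qed.

Definition excess N M := (M %/ gcdn M (half_level N))%N.

Section Excess.
Variables (N M : nat).
Hypotheses (N0 : (0 < N)%N) (MN : (M %| N)%N).

Let M0 : (0 < M)%N. Proof. exact: dvdn_gt0 MN. Qed.
Let G0 : (0 < gcdn M (half_level N))%N. Proof. by rewrite gcdn_gt0 M0. Qed.

Lemma excess_gt0 : (0 < excess N M)%N.
Proof. by rewrite divn_gt0// dvdn_leq// dvdn_gcdl. Qed.

Lemma dvd_excess d : (M %| d * half_level N)%N = (excess N M %| d)%N.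
Proof.
rewrite -[X in (X %| _)%N](divnK (dvdn_gcdl M (half_level N))).
rewrite -[X in (_ %| _ * X)%N](divnK (dvdn_gcdr M (half_level N))) mulnA dvdn_pmul2r// Gauss_dvdl// /coprime.
by rewrite -(eqn_pmul2r G0) muln_gcdl !divnK ?dvdn_gcdl ?dvdn_gcdr// mul1n.
Qed.

Lemma excess_dvd : (excess N M %| N %/ half_level N)%N.
Proof. by rewrite -dvd_excess divnK// half_level_dvd. Qed.

(** With m, n the exponents of p in M, N: the difference of m - ceil(n/2) and floor(3m/2) - n is
    floor(n/2) - floor(m/2), nonnegative as m <= n. The truncated subtraction corresponds to the
    maximum with 1 in the product. *)
Lemma logn_excess p : ((3 * logn p M)./2 - logn p N <= logn p (excess N M))%N.
Proof.
rewrite logn_div ?dvdn_gcdl// logn_gcd ?half_level_gt0// logn_half_level uphalf_half.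
have := dvdn_leq_log p N0 MN; have := odd_double_half (logn p N).
have := odd_double_half (3 * logn p M); have := odd_double_half (logn p M).
move: (odd _) (odd _) (odd _) => [] [] []; lia.
Qed.

Lemma local_product_le (R : realType) : local_product R N M <= (excess N M)%:R `^ (1 / 2).
Proof.
have qN : (excess N M %| N)%N by apply: dvdn_trans (dvdn_div (half_level_dvd N0)); exact: excess_dvd.
rewrite {1}(prod_logn N0 qN) /local_product.
have P0 : all prime (primes N) := all_prime_primes N.
elim: (primes N) P0 => [|p s IH] /=; first by rewrite !big_nil powR1.
move=> /andP[pp ps]; rewrite !big_cons natrM powRM//.
have p1 : 1 <= p%:R :> R by rewrite ler1n prime_gt0.
apply: ler_pM; last exact: IH.
- by rewrite le_max ler01 orbT.
- by apply: prodr_ge0 => i _; rewrite le_max ler01 orbT.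
rewrite natrX -powR_mulrn ?ler0n// -powRrM ge_max; apply/andP; split.
  apply: ler_powR => //; have := logn_excess p; rewrite leq_subLR -(ler_nat R) natrD => h.
  lra.
by rewrite -[leLHS](powRr0 p%:R); apply: ler_powR => //; rewrite mulr_ge0.
Qed.

(** For M = r^2 the floor in the local exponents is exact, so [logn_excess] says, prime by prime,
    that r^3 divides q N. *)
Lemma square_conductor_le (R : realType) r : M = (r ^ 2)%N -> (N ^ 2 %| M ^ 3)%N ->
  M%:R `^ (3 / 4) / N%:R `^ (1 / 2) <= (excess N M)%:R `^ (1 / 2) :> R.
Proof.
move=> Mr NM; have q0 := excess_gt0; have r0 : (0 < r)%N by move: M0; rewrite Mr expn_gt0 orbF.
have le : (r ^ 3 <= excess N M * N)%N.
  apply: dvdn_leq; first by rewrite muln_gt0 q0.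
  apply: dvdn_logn => [||p pp]; rewrite ?expn_gt0 ?r0 ?muln_gt0 ?q0//.
  rewrite lognM// lognX; have := logn_excess p.
  have M30 : (0 < M ^ 3)%N by rewrite expn_gt0 M0.
  have := dvdn_leq_log p M30 NM; rewrite !lognX Mr lognX.
  have -> : (3 * (2 * logn p r) = (3 * logn p r).*2)%N by rewrite -muln2; lia.
  rewrite doubleK; lia.
rewrite ler_pdivrMr ?powR_gt0 ?ltr0n// -powRM ?ler0n//.
have P m e : (r ^ m)%:R `^ e = r%:R `^ (m%:R * e) :> R.
  by rewrite natrX -powR_mulrn ?ler0n// -powRrM.
have -> : M%:R `^ (3 / 4) = (r ^ 3)%:R `^ (1 / 2) :> R.
  by rewrite {1}Mr (P 2%N) (P 3%N) (_ : 2%:R * (3 / 4) = 3%:R * (1 / 2) :> R)//; field.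
apply: ge0_ler_powR; rewrite ?nnegrE ?ler0n ?mulr_ge0 ?ler0n//.
by rewrite -natrM ler_nat.
Qed.
End Excess.

(** * Divisor bound, totient and numbers composed of primes of N *)

Lemma size_divisors n : (0 < n)%N -> size (divisors n) = (\prod_(p <- primes n) (logn p n).+1)%N.
Proof.
move=> n0; rewrite /divisors prime_decompE.
have H s (e : nat -> nat) : size (foldr PrimeDecompAux.add_divisors [:: 1%N] [seq (p, e p) | p <- s]) = (\prod_(p <- s) (e p).+1)%N.
  elim: s => [|p s IH] /=; first by rewrite big_nil.
  rewrite big_cons -IH; move: (foldr _ _ _) => ds; rewrite /PrimeDecompAux.add_divisors /=.
  have G m x : size (iter m (fun d' : seq nat => merge leq [seq NatTrec.mul p i | i <- d'] ds) x)
      = (m * size ds + size x)%N.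
    elim: m => [|m IHm] //=; rewrite size_merge size_cat size_map IHm; lia.
  by rewrite G mulSn addnC.
exact: H.
Qed.

(** From the formula n = sum of phi(d) over d | n, because phi(d) <= phi(n) for every such d. *)
Lemma totient_divisors n : (0 < n)%N -> (n <= totient n * size (divisors n))%N.
Proof.
move=> n0; rewrite -{1}(cyclic.sum_totient_dvd n).
have le d : (d %| n)%N -> (totient d <= totient n)%N.
  move=> dn; have d0 := dvdn_gt0 n0 dn.
  rewrite !totientE// [X in (_ <= X)%N](bigID (fun p => p \in primes d))/=.
  rewrite -[X in (X <= _)%N]muln1 leq_mul//; last first.
    rewrite big_seq_cond; apply: prodn_cond_gt0 => p /andP[]; rewrite mem_primes => /and3P[pp _ _] _.
    rewrite muln_gt0; apply/andP; split; last by rewrite expn_gt0 prime_gt0.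
    by have := prime_gt1 pp; lia.
  rewrite -[X in (_ <= X)%N]big_filter [X in (_ <= X)%N](perm_big (primes d))/=; last first.
    apply: uniq_perm; rewrite ?filter_uniq ?primes_uniq// => p; rewrite mem_filter.
    by rewrite andb_idr// !mem_primes n0 => /and3P[-> _ pd]; rewrite (dvdn_trans pd).
  rewrite !big_seq; apply: leq_prod => p; rewrite mem_primes => /and3P[pp _ pd].
  by rewrite leq_mul// leq_pexp2l ?prime_gt0// -!subn1 leq_sub2r// dvdn_leq_log.
apply: leq_trans (leq_sum _ (fun (d : 'I_n.+1) (dn : (d %| n)%N) => le d dn)) _.
rewrite sum_nat_const mulnC leq_mul//; rewrite cardE -(size_map val).
apply: uniq_leq_size; first by rewrite (map_inj_uniq val_inj) enum_uniq.
apply/allP; rewrite all_map; apply/allP => i; rewrite mem_enum => hi.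
by rewrite /= -dvdn_divisors.
Qed.

Lemma powR_natX (R : realType) (p a : nat) (e : R) : (p ^ a)%:R `^ e = (p%:R `^ e) ^+ a :> R.
Proof.
rewrite natrX -(powR_mulrn a (ler0n R p)) -(powR_mulrn a (powR_ge0 p%:R e)).
by rewrite -powRrM -powRrM mulrC.
Qed.

Section DivisorBound.
Variable R : realType.
Implicit Types e : R.

(** A factor a + 1 is at most p^(e a) as soon as p^e >= 2; each of the finitely many smaller primes
    costs at most the constant [K]. *)
Lemma divisors_le e : 0 < e ->
  exists2 C : R, 1 <= C & forall n, (0 < n)%N -> (size (divisors n))%:R <= C * n%:R `^ e.
Proof.
move=> e0; have l2 : 0 < ln 2 :> R by rewrite ln_gt0// ltr1n.
have el : 0 < e * ln 2 by rewrite mulr_gt0.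
pose K := 1 + (e * ln 2)^-1; have K1 : 1 <= K by rewrite lerDl invr_ge0 ltW.
pose P0 := (Num.truncn (2 `^ (e^-1) : R)).+1.
have hP0 p : (P0 <= p)%N -> 2 <= p%:R `^ e :> R.
  move=> hp; have h : 2 `^ e^-1 <= p%:R :> R.
    by apply: ltW; apply: lt_le_trans (truncnS_gt _) _; rewrite ler_nat.
  have : (2 `^ e^-1) `^ e <= p%:R `^ e by apply: ge0_ler_powR; rewrite ?nnegrE ?powR_ge0// ltW.
  by rewrite -powRrM mulVf ?gt_eqF// powRr1.
exists (K ^+ P0); first exact: exprn_ege1.
move=> n n0; rewrite size_divisors// [in leRHS](prod_logn n0 (dvdnn n)).
pose w p : R := if (p < P0)%N then K else 1.
have w1 p : 1 <= w p by rewrite /w; case: ifP.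
have term p a : prime p -> a.+1%:R <= w p * (p ^ a)%:R `^ e :> R.
  move=> pp; rewrite powR_natX.
  rewrite /w; case: ltnP => hp; last first.
    rewrite mul1r; apply: (@le_trans _ _ (2 ^+ a)); last first.
      apply: lerXn2r; rewrite ?nnegrE ?powR_ge0 ?ler0n//; exact: hP0.
    by rewrite -natrX ler_nat; exact: ltn_expl.
  apply: (@le_trans _ _ (K * (2 `^ e) ^+ a)); last first.
    apply: ler_wpM2l; first by apply: le_trans K1.
    apply: lerXn2r; rewrite ?nnegrE ?powR_ge0//; apply: ge0_ler_powR; rewrite ?nnegrE ?(ltW e0)//.
    by rewrite ler_nat prime_gt1.
  rewrite -powR_mulrn ?powR_ge0// -powRrM /powR gt_eqF//.
  apply: (@le_trans _ _ (K * (1 + e * a%:R * ln 2))); last first.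
    by apply: ler_wpM2l; [exact: le_trans K1|exact: expR_ge1Dx].
  have -> : K * (1 + e * a%:R * ln 2) = 1 + a%:R + (e * ln 2)^-1 + e * ln 2 * a%:R.
    by rewrite /K; field; rewrite !gt_eqF.
  have h1 : 0 < (e * ln 2)^-1 by rewrite invr_gt0.
  have h2 : 0 <= e * ln 2 * a%:R by rewrite mulr_ge0 ?ler0n// ltW.
  by rewrite -addn1 natrD; move: h1 h2; move: (_^-1) (_ * a%:R) => u v; lra.
apply: (@le_trans _ _ (\prod_(p <- primes n) (w p * (p ^ logn p n)%:R `^ e))).
  rewrite natr_prod !big_seq; apply: ler_prod => p; rewrite mem_primes => /and3P[pp _ _].
  by rewrite ler0n term.
rewrite big_split/=; apply: ler_pM; try by apply: prodr_ge0 => p _; rewrite ?powR_ge0// (le_trans ler01).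
  rewrite (eq_bigr (fun p => if (p < P0)%N then K else 1))// -big_mkcond/= -big_filter big_const_seq/=.
  rewrite count_predT iter_mulr_1; apply: ler_weXn2l => //.
  rewrite -[leqRHS](size_iota 0); apply: uniq_leq_size; first by rewrite filter_uniq ?primes_uniq.
  by move=> p; rewrite mem_filter mem_iota /= add0n => /andP[].
rewrite le_eqVlt; apply/orP; left; apply/eqP.
elim: (primes n) => [|p s IH]; first by rewrite !big_nil powR1.
by rewrite !big_cons natrM powRM// IH.
Qed.

(** As long as some prime p of d has an exponent larger than r times its exponent in N, a factor p^r
    can be moved into a^r. *)
Lemma smooth_decomp N r d : (0 < N)%N -> (0 < r)%N -> \pi(N).-nat d ->
  exists a b, [/\ d = (a ^ r * b)%N, (0 < a)%N & (b %| N ^ r)%N].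
Proof.
move=> N0 r0; elim/ltn_ind: d => d IH sd; have d0 : (0 < d)%N by case/andP: sd.
have Nr : (0 < N ^ r)%N by rewrite expn_gt0 N0.
have [h|] := boolP (d %| N ^ r)%N; first by exists 1%N, d; rewrite exp1n mul1n.
move=> nd; have /existsP[p /andP[pp hp]] : [exists p : 'I_d.+1, prime p && (logn p (N ^ r) < logn p d)%N].
  apply: contraR nd; rewrite negb_exists => /forallP h; apply: dvdn_logn => // p pp.
  have [pd|pd] := leqP p d; first by have := h (inord p); rewrite inordK// pp/= -leqNgt.
  by rewrite (_ : logn p d = 0%N)//; apply/eqP; rewrite -leqn0 leqNgt logn_gt0 mem_primes pp d0/=; apply: contraL pd => /dvdn_leq; rewrite -leqNgt; apply.
have pd : (p %| d)%N by move: (leq_ltn_trans (leq0n _) hp); rewrite logn_gt0 mem_primes => /and3P[].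
have pN : (0 < logn p N)%N.
  by rewrite logn_gt0; move/pnatP: sd => /(_ d0 _ pp pd).
have pr : (p ^ r %| d)%N.
  by rewrite pfactor_dvdn// (leq_trans _ (ltnW hp))// lognX leq_pmulr.
have [||a [b [e a0 hb]]] := IH (d %/ p ^ r)%N.
- by rewrite ltn_Pdiv// -(exp1n r) ltn_exp2r// prime_gt1.
- by apply: pnat_dvd sd; exact: dvdn_div.
exists (p * a)%N, b; split => //; last by rewrite muln_gt0 prime_gt0.
by rewrite expnMn -mulnA -e mulnC divnK.
Qed.

(** By [smooth_decomp] there are at most J^(1/r) choices of a and as many of b as N^r has divisors.
    Taking r about 1/e, and the divisor bound with exponent e/r, gives the power e of both N and
    J. *)
Lemma smooth_count e : 0 < e -> exists2 C : R, 1 <= C & forall N J : nat, (0 < N)%N -> (0 < J)%N ->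
  (size [seq d <- iota 1 J | \pi(N).-nat d])%:R <= C * (N * J)%:R `^ e.
Proof.
move=> e0; pose r := (Num.truncn (e^-1)).+1.
have re : r%:R^-1 <= e.
  by rewrite -[leRHS]invrK lef_pV2 ?posrE ?invr_gt0//; apply: ltW; exact: truncnS_gt.
have er0 : 0 < e / r%:R by rewrite divr_gt0.
have [C C1 HC] := divisors_le er0; exists C => // N J N0 J0.
have J1 : 1 <= J%:R :> R by rewrite ler1n.
pose A := Num.truncn (J%:R `^ (r%:R^-1) : R).
apply: (@le_trans _ _ (A * size (divisors (N ^ r)))%:R).
  rewrite ler_nat -[A](size_iota 1) -(size_allpairs (fun a b => a ^ r * b)%N).
  apply: uniq_leq_size; first by rewrite filter_uniq ?iota_uniq.
  move=> d; rewrite mem_filter mem_iota add1n ltnS => /andP[sd /andP[d0 dJ]].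
  have [a [b [dE a0 hb]]] := smooth_decomp N0 (ltn0Sn _ : (0 < r)%N) sd.
  apply/allpairsP; exists (a, b); rewrite /= mem_iota a0 add1n ltnS; split => //; last first.
    by rewrite -dvdn_divisors// expn_gt0 N0.
  rewrite /A truncn_ge_nat ?powR_ge0//.
  have ar : a%:R ^+ r <= J%:R :> R.
    rewrite -natrX ler_nat (leq_trans _ dJ)// dE leq_pmulr// lt0n.
    by apply: contraTneq d0 => b0; rewrite dE b0 muln0.
  have -> : a%:R = (a%:R ^+ r) `^ (r%:R^-1) :> R.
    by rewrite -powR_mulrn// -powRrM mulfV ?gt_eqF// powRr1.
  by apply: ge0_ler_powR; rewrite ?nnegrE ?exprn_ge0 ?invr_ge0.
rewrite !natrM mulrC powRM// mulrA; apply: ler_pM => //.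
  apply: (le_trans (HC _ _)); first by rewrite expn_gt0 N0.
  by rewrite natrX -powR_mulrn// -powRrM mulrCA mulfV ?gt_eqF// mulr1.
apply: (@le_trans _ _ (J%:R `^ r%:R^-1)); last exact: ler_powR.
by rewrite /A truncn_le ?powR_ge0.
Qed.
End DivisorBound.

Section Nebentypus.
Variables (R : realType) (N M : nat) (chi : int -> R[i]).
Hypothesis N0 : (0 < N)%N.
Hypothesis dchi : dirichlet_char N chi.

Let c0 := half_level N.
Let N1 := (N %/ c0)%N.

Lemma chi_modz (a b : int) : (a = b %[mod N%:Z])%Z -> chi a = chi b.
Proof.
case: dchi => per _ _ ab.
have H (n : nat) c : chi (c + n%:Z * N%:Z) = chi c.
  elim: n c => [|n IH] c; first by rewrite mul0r addr0.
  by rewrite -addn1 PoszD mulrDl mul1r addrA per IH.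
have K c : chi (c %% N%:Z)%Z = chi c.
  rewrite {2}(divz_eq c N%:Z) addrC; case: (c %/ N%:Z)%Z => n; first by rewrite H.
  by rewrite NegzE -[LHS](H n.+1); rewrite mulNr -(H n.+1 (_ - _)) subrK H.
by rewrite -K ab K.
Qed.

Lemma chi1 : chi 1 = 1.
Proof.
case: dchi => _ mul nz; have c1 : chi 1 != 0 by rewrite nz /coprimez gcd1z.
by apply: (mulfI c1); rewrite mulr1 -mul mulr1.
Qed.

Definition psi (b : int) : R[i] := chi (1 + b * c0%:Z).

Lemma half_sqr_dvd : exists t, c0%:Z * c0%:Z = t * N%:Z.
Proof.
have /dvdnP[t ht] := dvd_half_level_sqr N0; exists t%:Z.
by rewrite -!PoszM -ht -mulnn.
Qed.

Lemma psiD a b : psi (a + b) = psi a * psi b.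
Proof.
have [t ht] := half_sqr_dvd; case: dchi => _ mul _; rewrite /psi -mul.
apply: chi_modz; apply/eqP; rewrite eqz_mod_dvd; apply/dvdzP; exists (- (a * b * t)).
transitivity (- (a * b) * (c0%:Z * c0%:Z)); first by ring.
by rewrite ht; ring.
Qed.

Lemma coprimez_half d : coprimez d c0%:Z -> coprimez d N%:Z.
Proof.
rewrite !/(coprimez _ _) /= => h; have /dvdnP[t ht] := dvd_half_level_sqr N0.
have : coprimez d (c0%:Z * c0%:Z) by rewrite coprimezMr /coprimez h.
rewrite -PoszM (_ : (c0 * c0 = t * N)%N); last by rewrite -ht -mulnn.
by rewrite PoszM coprimezMr => /andP[].
Qed.

Lemma psi_coprime b : coprimez (1 + b * c0%:Z) N%:Z.
Proof.
apply: coprimez_half; apply/coprimezP; exists (1, - b) => /=; ring.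
Qed.

Lemma psi_neq0 b : psi b != 0.
Proof. by case: dchi => _ _ nz; rewrite /psi nz psi_coprime. Qed.

Lemma psi0 : psi 0 = 1. Proof. by rewrite /psi mul0r addr0 chi1. Qed.

Lemma psi_mul1 d t : psi d = 1 -> psi (t * d) = 1.
Proof.
move=> d1; have H (n : nat) : psi (n%:Z * d) = 1.
  elim: n => [|n IH]; first by rewrite mul0r psi0.
  by rewrite -addn1 PoszD mulrDl mul1r psiD IH d1 mulr1.
case: t => n; first exact: H.
by apply: (mulfI (psi_neq0 (n.+1%:Z * d))); rewrite -psiD NegzE mulNr subrr psi0 mulr1 H.
Qed.

Hypothesis condM : is_conductor N chi M.

(** If psi d = 1, then chi is trivial on 1 + d c Z; since it also factors through M, it factors
    through gcd (M, d c). Minimality of the conductor forces M | d c, that is, q | d. *)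
Lemma psi_ker d : psi d = 1 -> (excess N M %| `|d|)%N.
Proof.
case: condM => MN ft min d1; case: dchi => _ mul _.
have M0 : (0 < M)%N := dvdn_gt0 N0 MN.
pose G := gcdn M (`|d| * c0).
have GM : (G %| M)%N := dvdn_gcdl _ _.
suff fG : factors_through N chi G.
  have MG : M = G.
    by apply/eqP; rewrite eqn_leq (min _ (dvdn_trans GM MN) fG) dvdn_leq.
  by rewrite -dvd_excess// MG dvdn_gcdr.
move=> a b ca cb /eqP; rewrite eqz_mod_dvd => /dvdzP[s hs].
have [[x y] /= hxy] : exists xy, xy.1 * b + xy.2 * N%:Z = 1 by move/coprimezP: cb.
have [X [Y hXY]] : exists X Y, X * M%:Z + Y * (d * c0%:Z) = G%:Z.
  have [X [Y hXY]] := Bezoutz M%:Z (d * c0%:Z); exists X, Y.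
  by rewrite hXY /G /gcdz abszM !absz_nat.
pose v := 1 + (x * s * Y * d) * c0%:Z.
have v1 : chi v = 1 by exact: psi_mul1.
(* Here x inverts b modulo N. By Bezout x a is congruent to v modulo M, while v lies in 1 + d c Z;
   both chi (x a) and chi (x b) are therefore 1. *)
have cx : coprimez x N%:Z by apply/coprimezP; exists (b, y) => /=; rewrite -hxy; ring.
have uv : chi (x * a) = chi v.
  apply: ft; [by rewrite coprimezMl cx|exact: psi_coprime|].
  have /dvdnP[w hw] := MN.
  apply/eqP; rewrite eqz_mod_dvd; apply/dvdzP; exists (x * s * X - y * w%:Z).
  rewrite /v mulrBl -[1](hxy) hw PoszM.
  transitivity (x * (a - b) - x * s * Y * d * c0%:Z - y * (w%:Z * M%:Z)); first by ring.
  by rewrite hs -hXY; ring.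
have xb : chi (x * b) = 1.
  rewrite -chi1; apply: chi_modz; apply/eqP; rewrite eqz_mod_dvd; apply/dvdzP.
  by exists (- y); rewrite -hxy; ring.
have x0 : chi x != 0 by case: dchi => _ _ ->.
by apply: (mulfI x0); rewrite -!mul uv v1 xb.
Qed.

(** Two elements of a fibre of psi are congruent modulo q, so an element is determined by its
    quotient by q, which takes N1 / q values. *)
Lemma psi_count z : (#|[pred b : 'I_N1 | psi b%:Z == z]| * excess N M <= N1)%N.
Proof.
have MN : (M %| N)%N by case: condM.
set q := excess N M; have q0 : (0 < q)%N by exact: excess_gt0.
have qN1 : (q %| N1)%N by exact: excess_dvd.
rewrite -leq_divRL//; set A := [pred b | _].
have le (b : 'I_N1) : (b %/ q < N1 %/ q)%N by rewrite ltn_divLR// divnK.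
rewrite -[leqRHS]card_ord -(@card_in_image _ _ (fun b => Ordinal (le b)) A); last first.
  move=> b b'; rewrite !inE => /eqP hb /eqP hb' [e]; apply: val_inj.
  have hq : (q %| `|b%:Z - b'%:Z|)%N.
    apply: psi_ker; apply: (mulfI (psi_neq0 b'%:Z)); rewrite -psiD mulr1.
    by rewrite addrCA subrr addr0 hb hb'.
  rewrite [LHS](divn_eq _ q) [RHS](divn_eq _ q) e; congr addn.
  have /eqP : (b%:Z = b'%:Z %[mod q%:Z])%Z by apply/eqP; rewrite eqz_mod_dvd.
  by rewrite !modz_nat => /eqP [].
exact: max_card.
Qed.
End Nebentypus.

(** * Hecke relations *)

Section Dilation.
Variables (R : realType) (N : R).
Hypothesis N0 : 0 < N.
Implicit Types (f h : R -> R[i]) (j : int).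

Let N0' : N != 0. Proof. by rewrite gt_eqF. Qed.
Let Nge0 : 0 <= N. Proof. exact: ltW. Qed.

Let phi f j x := f x * (ech N j x)^*.
Let ccont_phi f j : ccont f -> ccont (phi f j).
Proof. by move=> cf; apply: ccont_inp => //; exact: ccont_ech. Qed.
Let phi_per f j : (forall x, f (x + N) = f x) -> forall x, phi f j (x + N) = phi f j x.
Proof. by move=> pf x; rewrite /phi pf ech_period. Qed.

Lemma ech_conjK j s : ech N j s * (ech N j s)^* = 1.
Proof. by rewrite mul_conj normc_ech expr1n. Qed.

Lemma fc_shift f j s : ccont f -> (forall x, f (x + N) = f x) ->
  fc N (fun x => f (x + s)) j = ech N j s * fc N f j.
Proof.
move=> cf pf; rewrite /fc /inp.
rewrite (@eq_cint _ _ _ _ (fun x => ech N j s * phi f j (x + s))); last first.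
  move=> x; rewrite /phi ech_addx rmorphM /=.
  transitivity (f (x + s) * (ech N j x)^* * (ech N j s * (ech N j s)^*)); first by rewrite ech_conjK mulr1.
  by ring.
rewrite cintZ; last by apply: (ccont_comp (ccont_phi j cf)); exact: continuous_shift.
rewrite (cint_shift s (ccont_phi j cf))// add0r [N + s]addrC.
by rewrite (cint_periodic s Nge0 (ccont_phi j cf) (phi_per j pf)) mulrCA.
Qed.

Lemma cint_periods f m : ccont f -> (forall x, f (x + N) = f x) ->
  cint 0 (m%:R * N) f = m%:R * cint 0 N f.
Proof.
move=> cf pf; elim: m => [|m IH].
  by rewrite !mul0r /cint /rint !set_itv1 !Rintegral_set1.
rewrite (@cint_split _ _ (m%:R * N)) ?mulr_ge0//; last by rewrite ler_wpM2r// ler_nat.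
rewrite IH -natr1 mulrDl mul1r (cint_periodic _ Nge0 cf pf).
by rewrite -[in RHS]natr1 mulrDl mul1r.
Qed.

(** The function f(m x) does not change under the shift by N / m, which multiplies its j-th
    coefficient by e(j / m); hence the coefficient vanishes unless m | j. *)
Lemma fc_dilate f (m : nat) j : (0 < m)%N -> ccont f -> (forall x, f (x + N) = f x) ->
  fc N (fun x => f (m%:R * x)) j =
  if (m%:Z %| j)%Z then fc N f (j %/ m%:Z)%Z else 0.
Proof.
move=> m0 cf pf; have m0R : 0 < m%:R :> R by rewrite ltr0n.
have m0' : m%:R != 0 :> R by rewrite gt_eqF.
have cm : ccont (fun x => f (m%:R * x)).
  by apply: (ccont_comp cf) => x; apply: cvgM; [exact: cvg_cst|exact: cvg_id].
have pn (i : nat) x : f (x + i%:R * N) = f x.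
  by elim: i x => [|i IH] x; rewrite ?mul0r ?addr0// -natr1 mulrDl mul1r addrA pf.
case: ifPn => [/dvdzP[q ->]|mj].
  rewrite mulzK ?eqz_nat -?lt0n//.
  rewrite /fc /inp; congr (_ * _).
  rewrite (@eq_cint _ _ _ _ (fun x => phi f q (m%:R * x + 0))); last first.
    by move=> x; rewrite /phi /ech addr0 rmorphM /=; congr (_ * (ee _)^*); ring.
  have := cint_affine 0 (ccont_phi q cf) Nge0 m0R; rewrite mulr0 !addr0 (cint_periods _ (ccont_phi q cf) (phi_per q pf)).
  rewrite rmorph_nat => /mulfI; apply.
  by rewrite pnatr_eq0 -lt0n.
have : fc N (fun x => f (m%:R * (x + N / m%:R))) j = ech N j (N / m%:R) * fc N (fun x => f (m%:R * x)) j.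
  rewrite -(@fc_shift (fun x => f (m%:R * x)))// => x.
  by rewrite mulrDr -[X in f (_ + X)]/(m%:R * N) pn.
have -> : (fun x => f (m%:R * (x + N / m%:R))) = (fun x => f (m%:R * x)).
  by apply/funext => x; rewrite mulrDr mulrCA mulfV// mulr1 pf.
move=> /eqP; rewrite -[X in X == _]mul1r -subr_eq0 -mulrBl mulf_eq0 => /orP[|/eqP//].
rewrite subr_eq0 => /eqP e1; case/negP: mj.
have : ee (j%:~R / m%:R) = 1 :> R[i].
  by rewrite [RHS]e1 /ech; congr ee; field; rewrite N0' m0'.
move=> e2.
have mz : m%:Z != 0 by rewrite -lt0n.
apply/dvdz_mod0P; apply/eqP; apply/negPn/negP => r0.
pose r := (j %% m%:Z)%Z.
have r0' : 0 <= r := modz_ge0 j mz.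
have rm : r < m%:Z := ltz_mod j mz.
have e3 : ee (r%:~R / m%:R) = 1 :> R[i].
  rewrite -e2 (_ : j%:~R / m%:R = (j %/ m%:Z)%Z%:~R + r%:~R / m%:R :> R).
    by rewrite eeD ee_int mul1r.
  by rewrite {1}(divz_eq j m%:Z) intrD intrM mulrDl -[m%:Z%:~R]/(m%:R) mulfK.
pose t : R := r%:~R / m%:R.
have t0 : 0 < t by rewrite divr_gt0// ltr0z lt_def r0 r0'.
have t1 : t < 1 by rewrite ltr_pdivrMr// mul1r -[m%:R]/(m%:Z%:~R) ltr_int.
have : Re (ee t) = 1 by rewrite /t e3.
have pi0 := pi_gt0 R.
rewrite /ee /= (_ : 2 * pi * t = (pi * t) *+ 2); last by ring.
rewrite cos_mulr2n => h.
have s0 : 0 < sin (pi * t).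
  by apply: sin_gt0_pi; rewrite mulr_gt0//= gtr_pMr.
have := cos2Dsin2 (pi * t); have : 0 < sin (pi * t) ^+ 2 by rewrite exprn_gt0.
by move: h; rewrite mulr2n; lra.
Qed.

(** The substitutions t = (x + N b) / d, for b < d, lay the d integrals end to end over one
    period. *)
Lemma fc_contract f (d : nat) j : (0 < d)%N -> ccont f ->
  fc N (fun x => \sum_(b < d) f ((x + N * b%:R) / d%:R)) j = d%:R * fc N f (j * d%:Z).
Proof.
move=> d0 cf; have d0R : 0 < d%:R :> R by rewrite ltr0n.
have d0' : d%:R != 0 :> R by rewrite gt_eqF.
have dV : 0 < d%:R^-1 :> R by rewrite invr_gt0.
pose Phi := phi f (j * d%:Z).
have cP : ccont Phi by exact: ccont_phi.
have cb (b : R) : ccont (fun x => Phi (d%:R^-1 * x + d%:R^-1 * (N * b))).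
  by apply: (ccont_comp cP); exact: continuous_affine.
rewrite /fc /inp (@eq_cint _ _ _ _ (fun x => \sum_(b < d) Phi (d%:R^-1 * x + d%:R^-1 * (N * b%:R)))); last first.
  move=> x; rewrite mulr_suml; apply: eq_bigr => b _; rewrite -mulrDr [d%:R^-1 * _]mulrC /Phi /phi; congr (_ * conjc _).
  rewrite /ech rmorphM /= -[d%:Z%:~R]/(d%:R).
  transitivity (ee (j%:~R / N * x + (j * b%:Z)%:~R) : R[i]).
    by rewrite eeD ee_int mulr1.
  by congr ee; rewrite rmorphM /= -[b%:Z%:~R]/(b%:R); field; rewrite N0' d0'.
rewrite cint_sum => [|b]; last exact: cb.
rewrite mulrCA; congr (_ * _).
suff H m : \sum_(b < m) cint 0 N (fun x => Phi (d%:R^-1 * x + d%:R^-1 * (N * b%:R))) =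
    d%:R * cint 0 (N * m%:R / d%:R) Phi by rewrite H mulfK.
elim: m => [|m IH].
  rewrite big_ord0 mulr0 mul0r /cint /rint !set_itv1 !Rintegral_set1.
  by rewrite (_ : 0 +i* 0 = 0 :> R[i])// mulr0.
rewrite big_ord_recr /= IH (@cint_split _ 0 (N * m%:R / d%:R) (N * m.+1%:R / d%:R))//; last 2 first.
- by rewrite divr_ge0// mulr_ge0.
- by rewrite ler_pM2r// ler_pM2l// ler_nat.
rewrite mulrDr; congr (_ + _).
have := cint_affine (d%:R^-1 * (N * m%:R)) cP Nge0 dV.
rewrite mulr0 add0r -mulrDr [d%:R^-1 * (N * _)]mulrC -[X in N + N * X]/(m%:R).
have -> : d%:R^-1 * (N + N * m%:R) = N * m.+1%:R / d%:R.
  by rewrite -natr1; field; rewrite d0'.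
move=> <-; rewrite fmorphV rmorph_nat mulrA mulfV ?mul1r//.
by rewrite pnatr_eq0 -lt0n.
Qed.

Lemma fc_hecke f (m d : nat) j : (0 < m)%N -> (0 < d)%N -> ccont f -> (forall x, f (x + N) = f x) ->
  fc N (fun x => \sum_(b < d) f ((m%:R * x + N * b%:R) / d%:R)) j =
  if (m%:Z %| j)%Z then d%:R * fc N f ((j %/ m%:Z)%Z * d%:Z) else 0.
Proof.
move=> m0 d0 cf pf; have d0' : d%:R != 0 :> R by rewrite pnatr_eq0 -lt0n.
pose H x := \sum_(b < d) f ((x + N * b%:R) / d%:R).
have cH : ccont H.
  apply: ccont_sum => b; apply: (ccont_comp cf) => x.
  rewrite (_ : (fun x => _) = (fun x => d%:R^-1 * x + N * b%:R / d%:R)); first exact: continuous_affine.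
  by apply/funext => y; rewrite mulrDl mulrC.
have pH x : H (x + N) = H x.
  rewrite /H; case: (d) d0 d0' => // d' _ dn.
  rewrite big_ord_recr big_ord_recl /= addrC; congr (_ + _).
    by rewrite mulr0 addr0 -[RHS]pf; congr f; move: dn; rewrite -natr1 => dn; field.
  by apply: eq_bigr => b _; congr (f (_ / _)); rewrite /bump /= -natr1; ring.
by rewrite -(fc_contract _ d0 cf) -(fc_dilate j m0 cH pH).
Qed.
End Dilation.

Section Hecke.
Variables (R : realType) (C : R) (k N : nat) (f : R[i] -> R[i]) (chi : int -> R[i]).
Hypothesis N0 : (0 < N)%N.
Hypothesis gf : good_form C k N f.
Hypothesis dchi : dirichlet_char N chi.
Hypothesis neb : nebentypus N k chi f.
Implicit Types (z : R[i]) (b j : int) (y : R).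

Let c0 := half_level N.
Let N1 := (N %/ c0)%N.

Definition gam b : 'M[int]_2 := mat2 1 0 (b * c0%:Z) 1.
Definition fb b := slash k (gam b) f.

Lemma SL2Z_gam b : SL2Z (gam b).
Proof. by rewrite /SL2Z /= det2E !mat2E; ring. Qed.

Lemma slash_Gamma0 h g z : Gamma0 N h -> SL2Z g -> uhp z ->
  slash k (h *m g) f z = chi (h 1 1) * slash k g f z.
Proof.
move=> h0 dg uz; have dh : SL2Z h by case: h0.
have ug := uhp_moebius dg uz.
rewrite slash_mul// {1}/slash neb// /slash.
have j0 : autj h (moebius g z) ^+ k != 0 by rewrite expf_neq0// autj_neq0.
move: (autj g z ^- k) (chi _) (f _) => A B D; move: j0; move: (_ ^+ k) => J j0.
by field.
Qed.

Lemma gamD a b : gam (a + b) = gam a *m gam b.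
Proof.
rewrite [RHS]mat2_eta !mulmx2E !mat2E /gam; congr mat2; ring.
Qed.

Lemma half_mul : c0%:Z * N1%:Z = N%:Z.
Proof. by rewrite -PoszM mulnC divnK// half_level_dvd. Qed.

Lemma fb_mod a b : (a = b %[mod N1%:Z])%Z -> forall z, uhp z -> fb a z = fb b z.
Proof.
move=> /eqP; rewrite eqz_mod_dvd => /dvdzP[q hq] z uz.
have -> : a = q * N1%:Z + b by rewrite -hq subrK.
rewrite /fb gamD slash_Gamma0//; last exact: SL2Z_gam.
  by rewrite !mat2E (chi1 dchi) mul1r.
split; first exact: SL2Z_gam.
rewrite !mat2E -mulrA [N1%:Z * _]mulrC half_mul; exact: dvdz_mull.
Qed.

(** Because N | c^2, the conjugate of T by [gam] b lies in Gamma0(N); its lower right entry is 1 + b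
    c, on which chi takes the value psi b. *)
Lemma fb_add1 b z : uhp z -> fb b (z + 1) = psi N chi b * fb b z.
Proof.
move=> uz; have [t ht] := half_sqr_dvd N0.
have dg := SL2Z_gam b.
have := slash_T k 1 f dg uz; rewrite -[1%:~R]/(1 : R[i]) -/(fb b) => <-.
pose h := gam b *m Tmat 1 *m gam (- b).
have hg : h *m gam b = gam b *m Tmat 1.
  by rewrite /h -mulmxA -gamD addNr (_ : gam 0 = 1%:M) ?mulmx1// [RHS]mat2_eta !mxE /gam mul0r.
rewrite -hg slash_Gamma0//.
  by congr (_ * _); congr chi; rewrite !mulmx2E !mat2E; ring.
split.
  by apply: SL2Z_mul; [apply: SL2Z_mul; [exact: SL2Z_gam|exact: SL2Z_T]|exact: SL2Z_gam].
rewrite !mulmx2E !mat2E; apply/dvdzP; exists (- (b * b * t)).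
transitivity (- (b * b) * (c0%:Z * c0%:Z)); first by ring.
by rewrite ht; ring.
Qed.

Lemma form_addz z (n : int) : uhp z -> f (z + n%:~R) = f z.
Proof.
move=> uz; rewrite -(moebius_T n) neb// ?autj_T ?mat2E ?(chi1 dchi) ?expr1n ?mul1r//.
by split; [exact: SL2Z_T|rewrite mat2E dvdz0].
Qed.

Lemma sum_units (V : zmodType) (n m : nat) (F : int -> V) : (0 < n)%N -> coprime n m ->
  (forall a b, (a = b %[mod n%:Z])%Z -> F a = F b) ->
  \sum_(b < n) F (m%:Z * b%:Z) = \sum_(b < n) F b%:Z.
Proof.
move=> n0 nm pF; have lt (b : 'I_n) : (m * b %% n < n)%N by rewrite ltn_mod.
rewrite [RHS](reindex_inj (h := fun b : 'I_n => Ordinal (lt b))) /=.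
  by apply: eq_bigr => b _; apply: pF; rewrite -PoszM !modz_nat modn_mod.
suff H (a b : 'I_n) : (a <= b)%N -> (m * a %% n = m * b %% n)%N -> a = b.
  move=> a b [e]; case: (leqP a b) => [ab|/ltnW ba]; first exact: H.
  by apply/esym; apply: H.
move=> ab /esym/eqP; rewrite eqn_mod_dvd ?leq_mul2l ?ab ?orbT// -mulnBr Gauss_dvdr//.
move=> h; apply: val_inj; apply/eqP; rewrite eqn_leq ab/= -subn_eq0 -leqn0 leqNgt.
apply/negP => /dvdn_leq => /(_ _ h); rewrite leqNgt (leq_ltn_trans (leq_subr _ _))//.
Qed.

Section Eigen.
Variables (n : nat) (a : R[i]).
Hypotheses (n0 : (0 < n)%N) (nN : coprime n N).
Hypothesis eig : forall z, uhp z -> hecke k chi n f z = a * f z.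

Let uhp_aff (m d : nat) (b : R) z : (0 < m)%N -> (0 < d)%N -> uhp z ->
  uhp ((m%:R * z + b%:C) / d%:R).
Proof.
move=> m0 d0; case: z => x y; rewrite /uhp /= => y0.
rewrite -[m%:R](rmorph_nat (real_complex R)) -[d%:R](rmorph_nat (real_complex R)) -fmorphV /=.
by rewrite !(mul0r, mulr0, addr0, add0r) divr_gt0 ?mulr_gt0 ?ltr0n.
Qed.

(** As d is prime to N, the shifts e modulo d may be taken divisible by N. Moving (m z + N e) / d
    past [gam] (n b) then costs the matrix [h], which is [gam] (d^2 b) up to an element of Gamma0(N)
    whose lower right entry is 1 modulo N. *)
Lemma hecke_slash b z : uhp z ->
  a * fb (n%:Z * b) z = n%:R ^+ k / n%:R *
    \sum_(d <- divisors n) (chi (n %/ d)%N%:Z / d%:R ^+ k *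
      \sum_(e < d) fb (d%:Z ^+ 2 * b) (((n %/ d)%N%:R * z + (N%:R * e%:R)%:C) / d%:R)).
Proof.
move=> uz; have dg := SL2Z_gam (n%:Z * b); have ug := uhp_moebius dg uz.
have [t ht] := half_sqr_dvd N0.
rewrite /fb {1}/slash mulrCA -eig// /hecke mulrCA; congr (_ * _).
rewrite mulr_sumr big_seq [RHS]big_seq; apply: eq_bigr => d; rewrite -dvdn_divisors// => dn.
have d0 : (0 < d)%N := dvdn_gt0 n0 dn.
have nE : n = (n %/ d * d)%N by rewrite divnK.
set m := (n %/ d)%N in nE *.
have m0 : (0 < m)%N by rewrite divn_gt0// dvdn_leq.
have dR : (d%:R : R[i]) != 0 by rewrite pnatr_eq0 -lt0n.
rewrite mulrCA; congr (_ * _).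
pose w0 := moebius (gam (n%:Z * b)) z.
have uw (e : R) : uhp ((m%:R * w0 + e%:C) / d%:R) by exact: uhp_aff.
rewrite (eq_bigr (fun e : 'I_d => f ((m%:R * w0 + ((e%:Z)%:~R : R)%:C) / d%:R))); last first.
  by move=> e _; rewrite rmorph_nat.
rewrite -(@sum_units _ d N (fun e => f ((m%:R * w0 + ((e%:~R : R)%:C)) / d%:R))) //; last 2 first.
- by apply: coprime_dvdl dn nN.
- move=> e1 e2 /eqP; rewrite eqz_mod_dvd => /dvdzP[q hq].
  have -> : e1 = e2 + q * d%:Z by rewrite -hq addrC subrK.
  rewrite -[RHS](form_addz q)//; congr f; rewrite !rmorphD !rmorphM /= !rmorph_int.
  by rewrite -[d%:Z%:~R]/(d%:R); field.
rewrite mulr_sumr; apply: eq_bigr => e _.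
have [B BE] : exists B, B = b * c0%:Z by exists (b * c0%:Z).
pose h := mat2 (1 + N%:Z * e%:Z * d%:Z * B) (- (N%:Z * e%:Z) ^+ 2 * B) (d%:Z ^+ 2 * B) (1 - N%:Z * e%:Z * d%:Z * B).
pose w := (m%:R * z + (N%:R * e%:R)%:C) / d%:R : R[i].
have uw1 : uhp w by exact: uhp_aff.
have dh : SL2Z h by rewrite /SL2Z /= det2E !mat2E; ring.
pose Br : R[i] := B%:~R.
have eN : (N%:R * e%:R : R)%:C = N%:R * e%:R :> R[i] by rewrite rmorphM /= !rmorph_nat.
have eNz : ((N%:Z * e%:Z)%:~R : R)%:C = N%:R * e%:R :> R[i].
  by rewrite rmorphM /= -eN.
have h00 : (h 0 0)%:~R = 1 + N%:R * e%:R * d%:R * Br.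
  by rewrite !mat2E !(rmorphD, rmorphM, rmorph1).
have h01 : (h 0 1)%:~R = - (N%:R * e%:R) ^+ 2 * Br.
  by rewrite !mat2E !(rmorphXn, rmorphN, rmorphM).
have h10 : (h 1 0)%:~R = d%:R ^+ 2 * Br by rewrite !mat2E rmorphM rmorphXn.
have h11 : (h 1 1)%:~R = 1 - N%:R * e%:R * d%:R * Br.
  by rewrite !mat2E !(rmorphB, rmorphM, rmorph1).
have gE : autj (gam (n%:Z * b)) z = m%:R * d%:R * Br * z + 1.
  rewrite /autj !mat2E -mulrA -BE nE PoszM !rmorphM rmorph1 /=.
  by rewrite -[d%:Z%:~R]/(d%:R) -[m%:Z%:~R]/(m%:R).
have jE : autj h w = autj (gam (n%:Z * b)) z.
  by rewrite gE /autj h10 h11 /w eN; field.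
have j0 : autj (gam (n%:Z * b)) z != 0 by exact: autj_neq0.
have mE : moebius h w = (m%:R * w0 + (((N%:Z * e%:Z)%:~R : R)%:C)) / d%:R.
  rewrite /w0 /moebius jE; move: j0; rewrite gE h00 h01 /w eN eNz !mat2E mul1r addr0 => j0.
  by field; rewrite dR.
rewrite -mE -jE -[LHS]/(slash k h f w).
pose eta := h *m gam (- (d%:Z ^+ 2 * b)).
have -> : h = eta *m gam (d%:Z ^+ 2 * b).
  by rewrite /eta -mulmxA -gamD addNr (_ : gam 0 = 1%:M) ?mulmx1// [RHS]mat2_eta !mxE /gam mul0r.
rewrite slash_Gamma0//; last exact: SL2Z_gam.
  rewrite (_ : chi _ = 1) ?mul1r// -(chi1 dchi); apply: (chi_modz dchi).
  rewrite !mulmx2E !mat2E; apply/eqP; rewrite eqz_mod_dvd; apply/dvdzP.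
  exists (- (e%:Z * d%:Z * B)); rewrite BE; ring.
split; first by apply: SL2Z_mul => //; exact: SL2Z_gam.
rewrite !mulmx2E !mat2E; apply/dvdzP.
exists (e%:Z * d%:Z ^+ 3 * B * b * c0%:Z); rewrite BE; ring.
Qed.
End Eigen.
End Hecke.

Section FcLinear.
Variables (R : realType) (N : R).
Implicit Types (f : R -> R[i]).

Lemma fcZ w f j : ccont f -> fc N (fun x => w * f x) j = w * fc N f j.
Proof.
move=> cf; rewrite /fc /inp (@eq_cint _ _ _ _ (fun x => w * (f x * (ech N j x)^*%C))); last first.
  by move=> x; rewrite mulrA.
rewrite cintZ; first by rewrite mulrCA.
by apply: ccont_inp => //; exact: ccont_ech.
Qed.

Lemma fc_sum (I : Type) (r : seq I) (f : I -> R -> R[i]) j : (forall i, ccont (f i)) ->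
  fc N (fun x => \sum_(i <- r) f i x) j = \sum_(i <- r) fc N (f i) j.
Proof.
move=> cf; rewrite /fc /inp -mulr_sumr; congr (_ * _).
rewrite (@eq_cint _ _ _ _ (fun x => \sum_(i <- r) (f i x * (ech N j x)^*%C))); last first.
  by move=> x; rewrite mulr_suml.
by rewrite cint_sum => // i; apply: ccont_inp => //; exact: ccont_ech.
Qed.
End FcLinear.

(** By Euler's theorem the value of chi is a root of unity. *)
Lemma normc_chi (R : realType) N (chi : int -> R[i]) (n : nat) : (0 < N)%N ->
  dirichlet_char N chi -> coprime n N -> normc (chi n%:Z) = 1.
Proof.
move=> N0 dchi nN; have [_ mul _] := dchi.
have X i : chi (n ^ i)%N%:Z = chi n%:Z ^+ i.
  elim: i => [|i IH]; first by rewrite expn0 expr0 (chi1 dchi).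
  by rewrite expnS PoszM mul IH exprS.
have e1 : normc (chi n%:Z) ^+ totient N = 1.
  have normcX (w : R[i]) i : normc (w ^+ i) = normc w ^+ i.
    elim: i => [|i IH]; first by rewrite !expr0 Normc.normc1.
    by rewrite !exprS normcM IH.
  rewrite -normcX -X (_ : chi _ = 1) ?Normc.normc1// -(chi1 dchi).
  by apply: (chi_modz dchi); rewrite !modz_nat cyclic.Euler_exp_totient.
have t0 : (0 < totient N)%N by rewrite totient_gt0.
by apply/eqP; rewrite -(@pexpr_eq1 _ _ (totient N))// ?normc_ge0// e1.
Qed.

Section HeckeFourier.
Variables (R : realType) (C : R) (k N : nat) (f : R[i] -> R[i]) (chi : int -> R[i]).
Hypothesis N0 : (0 < N)%N.
Hypothesis gf : good_form C k N f.
Hypothesis dchi : dirichlet_char N chi.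
Hypothesis neb : nebentypus N k chi f.
Implicit Types (z : R[i]) (b j : int) (y : R) (n m d : nat).

Let c0 := half_level N.
Let N1 := (N %/ c0)%N.
Local Notation fb := (fb k N f).
Definition uf b j y : R[i] := uh N%:R (fb b) j y.

Let N0R : 0 < N%:R :> R. Proof. by rewrite ltr0n. Qed.

Lemma fb_ccont b y : 0 < y -> ccont (hline (fb b) y).
Proof. by move=> y0; exact: (slash_ccont gf (SL2Z_gam N b)). Qed.

Lemma fb_per b y x : 0 < y -> hline (fb b) y (x + N%:R) = hline (fb b) y x.
Proof. by move=> y0; have := slash_per gf x 1 (SL2Z_gam N b) y0; rewrite mulr1. Qed.

Lemma uf_mod a b j y : 0 < y -> (a = b %[mod N1%:Z])%Z -> uf a j y = uf b j y.
Proof.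
move=> y0 ab; rewrite /uf /uh (_ : hline (fb a) y = hline (fb b) y)//.
by apply/funext => x; exact: (fb_mod N0 dchi neb ab).
Qed.

Lemma hline_hecke b y (m d : nat) x : (0 < d)%N ->
  \sum_(e < d) fb b ((m%:R * (x +i* y) + (N%:R * e%:R)%:C) / d%:R) =
  \sum_(e < d) hline (fb b) (m%:R * y / d%:R) ((m%:R * x + N%:R * e%:R) / d%:R).
Proof.
move=> d0; apply: eq_bigr => e _; rewrite /hline; congr fb.
rewrite -[m%:R](rmorph_nat (real_complex R)) -[d%:R](rmorph_nat (real_complex R)) -fmorphV.
by apply/eqP; rewrite eq_complex /=; apply/andP; split; apply/eqP; rewrite ?rmorph_nat; ring.
Qed.

Lemma fourier_hecke n a b j y : (0 < n)%N -> coprime n N ->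
  (forall z, uhp z -> hecke k chi n f z = a * f z) -> 0 < y ->
  a * uf (n%:Z * b) j y = n%:R ^+ k / n%:R *
    \sum_(d <- divisors n) (chi (n %/ d)%N%:Z / d%:R ^+ k *
      (if ((n %/ d)%N%:Z %| j)%Z then
         d%:R * uf (d%:Z ^+ 2 * b) ((j %/ (n %/ d)%N%:Z)%Z * d%:Z) ((n %/ d)%N%:R * y / d%:R)
       else 0)).
Proof.
move=> n0 nN eig y0.
have yd d : d \in divisors n -> [/\ (0 < d)%N, (0 < n %/ d)%N & 0 < (n %/ d)%N%:R * y / d%:R].
  rewrite -dvdn_divisors// => dn; have d0 := dvdn_gt0 n0 dn.
  have nd0 : (0 < n %/ d)%N by rewrite divn_gt0// dvdn_leq.
  by split => //; rewrite divr_gt0 ?mulr_gt0 ?ltr0n.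
pose G d x := if d \in divisors n then
  \sum_(e < d) hline (fb (d%:Z ^+ 2 * b)) ((n %/ d)%N%:R * y / d%:R) (((n %/ d)%N%:R * x + N%:R * e%:R) / d%:R) else 0.
have cG d : ccont (G d).
  rewrite /G; case dn: (d \in divisors n); last exact: ccont_cst.
  have [d0 m0 y1] := yd d dn.
  apply: ccont_sum => e; apply: (ccont_comp (fb_ccont _ y1)) => x.
  rewrite (_ : (fun x => _) = (fun x => (n %/ d)%N%:R / d%:R * x + N%:R * e%:R / d%:R)); first exact: continuous_affine.
  by apply/funext => u; ring.
rewrite /uf /uh -fcZ; last exact: fb_ccont.
have e1 x : a * hline (fb (n%:Z * b)) y x =
    n%:R ^+ k / n%:R * \sum_(d <- divisors n) (chi (n %/ d)%N%:Z / d%:R ^+ k * G d x).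
  have uz : uhp (x +i* y) := y0.
  have -> := hecke_slash N0 dchi neb n0 nN eig b uz.
  congr (_ * _); rewrite big_seq [RHS]big_seq; apply: eq_bigr => d dn; congr (_ * _).
  by rewrite /G dn hline_hecke//; case: (yd d dn).
rewrite (funext e1).
rewrite fcZ; last by apply: ccont_sum => d; exact: ccontZ.
congr (_ * _); rewrite fc_sum => [|d]; last exact: ccontZ.
rewrite big_seq [RHS]big_seq; apply: eq_bigr => d dn; rewrite fcZ//; congr (_ * _).
have [d0 m0 y1] := yd d dn.
rewrite /G dn (fc_hecke N0R j m0 d0 (fb_ccont _ y1))// => x; exact: fb_per.
Qed.

Lemma mod_inverse n b : coprime n N -> exists b', (n%:Z * b' = b %[mod N1%:Z])%Z.
Proof.
move=> nN; have nN1 : coprimez n%:Z N1%:Z.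
  by rewrite /coprimez /gcdz !absz_nat; apply: coprime_dvdr nN; rewrite dvdn_div// half_level_dvd.
have /coprimezP[[u v] /= uv] := nN1; exists (u * b).
apply/eqP; rewrite eqz_mod_dvd; apply/dvdzP; exists (- v * b).
by rewrite -[X in _ - X]mul1r -uv; ring.
Qed.

Lemma mod_mul n a b : (a = b %[mod N1%:Z])%Z -> (n%:Z * a = n%:Z * b %[mod N1%:Z])%Z.
Proof.
move=> /eqP; rewrite eqz_mod_dvd => h; apply/eqP; rewrite eqz_mod_dvd -mulrBr; exact: dvdz_mull.
Qed.

(** A term of [fourier_hecke] survives only if n / d divides the frequency; for j prime to n this
    leaves d = n alone. The index b is first divided by n modulo N1, so that d^2 = n^2 brings it to
    n b. *)
Lemma uf_hecke n a b j y : (0 < n)%N -> coprime n N ->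
  (forall z, uhp z -> hecke k chi n f z = a * f z) -> coprime `|j| n -> 0 < y ->
  uf (n%:Z * b) (n%:Z * j) y = a * uf b j (n%:R * y).
Proof.
move=> n0 nN eig jn y0; have [b' hb] := mod_inverse b nN.
have nR : n%:R != 0 :> R[i] by rewrite pnatr_eq0 -lt0n.
have nRr : n%:R != 0 :> R by rewrite pnatr_eq0 -lt0n.
have ny : 0 < n%:R * y by rewrite mulr_gt0// ltr0n.
rewrite -(uf_mod j ny hb) (fourier_hecke _ _ n0 nN eig ny).
rewrite (bigD1_seq n) ?divisors_id ?divisors_uniq//= (_ : (n %/ n)%N = 1%N) ?dvd1z ?divz1; last by rewrite divnn n0.
rewrite big_seq_cond big1 ?addr0; last first.
  move=> d /andP[]; rewrite -dvdn_divisors// => dn dn'.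
  case: ifPn; rewrite ?mulr0// => dj; case/negP: dn'; apply/eqP.
  have : (n %/ d %| gcdn `|j| n)%N by rewrite dvdn_gcd dvdn_div// andbT.
  rewrite (eqP jn) dvdn1 => /eqP e; by rewrite -[RHS](divnK dn) e mul1n.
rewrite (chi1 dchi) [n%:Z * j]mulrC.
have -> : 1%:R * (n%:R * y) / n%:R = y by field.
rewrite (_ : uf (n%:Z * b) _ _ = uf (n%:Z ^+ 2 * b') (j * n%:Z) y); last first.
  by apply: uf_mod => //; rewrite -(mod_mul n hb) mulrA -expr2.
by field; rewrite expf_neq0.
Qed.

Lemma uhw_uf b j y : 0 < y -> uhw k N%:R (fb b) j y ^+ 2 = y ^+ k * normc (uf b j y) ^+ 2.
Proof. exact: uhw_sqr. Qed.

Definition umass j y : R := \sum_(b < N1) uhw k N%:R (fb b%:Z) j y ^+ 2.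

Lemma umass_ge0 j y : 0 <= umass j y.
Proof. by apply: sumr_ge0 => b _; exact: sqr_ge0. Qed.

(** The power n^k compensates for the factor y^k of the mass being taken at height n y instead of
    y. *)
Definition hecke_weight n a : R := normc a ^+ 2 / n%:R ^+ k.

Lemma N1_gt0 : (0 < N1)%N.
Proof. by rewrite divn_gt0 ?half_level_gt0// dvdn_leq// half_level_dvd. Qed.

Lemma umass_hecke n a j y : (0 < n)%N -> coprime n N ->
  (forall z, uhp z -> hecke k chi n f z = a * f z) -> coprime `|j| n -> 0 < y ->
  umass (n%:Z * j) y = hecke_weight n a * umass j (n%:R * y).
Proof.
move=> n0 nN eig jn y0; have ny : 0 < n%:R * y by rewrite mulr_gt0// ltr0n.
have nR : n%:R != 0 :> R by rewrite pnatr_eq0 -lt0n.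
pose F (j : int) (y : R) b : R := y ^+ k * normc (uf b j y) ^+ 2.
have umE j' y' : 0 < y' -> umass j' y' = \sum_(b < N1) F j' y' b%:Z.
  by move=> y'0; apply: eq_bigr => b _; rewrite uhw_uf.
have nN1 : coprime N1 n.
  by rewrite coprime_sym; apply: coprime_dvdr nN; rewrite dvdn_div// half_level_dvd.
have FE a' b' : (a' = b' %[mod N1%:Z])%Z -> F (n%:Z * j) y a' = F (n%:Z * j) y b'.
  by move=> ab; rewrite /F (uf_mod _ y0 ab).
rewrite (umE _ _ y0) (umE _ _ ny) -(sum_units N1_gt0 nN1 FE).
rewrite mulr_sumr; apply: eq_bigr => b _; rewrite /F (uf_hecke _ n0 nN eig jn y0).
by rewrite normcM /hecke_weight !exprMn; field; rewrite expf_neq0.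
Qed.

(** The multiplication law is read off by evaluating the eigenvalue equation for n at the frequency
    m j: each term is an eigenvalue times the same coefficient at j, which is cancelled because it
    does not vanish. *)
Lemma eigen_mul (a : nat -> R[i]) n m j b y :
  (forall n, (0 < n)%N -> coprime n N -> forall z, uhp z -> hecke k chi n f z = a n * f z) ->
  (forall n, coprime n N -> coprime `|j| n) -> 0 < y -> uf b j y != 0 ->
  (0 < n)%N -> (0 < m)%N -> coprime n N -> coprime m N ->
  a n * a m = \sum_(d <- divisors n | (n %/ d %| m)%N)
     chi (n %/ d)%N%:Z * ((n %/ d)%N%:R ^+ k / (n %/ d)%N%:R) * a (m %/ (n %/ d) * d)%N.
Proof.
move=> eig jN y0 u0 n0 m0 nN mN; have [b0 hb] := mod_inverse b nN.
have mR : m%:R != 0 :> R by rewrite pnatr_eq0 -lt0n.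
have ym : 0 < y / m%:R by rewrite divr_gt0// ltr0n.
apply: (mulIf u0); rewrite -(uf_mod j y0 hb).
have := fourier_hecke (m%:Z * b0) (m%:Z * j) n0 nN (eig n n0 nN) ym.
rewrite [n%:Z * (m%:Z * b0)]mulrCA (uf_hecke _ m0 mN (eig m m0 mN) (jN m mN) ym).
have -> : m%:R * (y / m%:R) = y by field.
rewrite mulrA => ->; rewrite mulr_suml mulr_sumr [RHS]big_mkcond big_seq [RHS]big_seq.
apply: eq_bigr => d; rewrite -dvdn_divisors// => dn.
have d0 := dvdn_gt0 n0 dn.
have nE : n = (n %/ d * d)%N by rewrite divnK.
set e := (n %/ d)%N in nE *.
have e0 : (0 < e)%N by rewrite divn_gt0// dvdn_leq.
have eN : coprime e N by apply: coprime_dvdl nN; rewrite nE dvdn_mulr.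
have dN : coprime d N by apply: coprime_dvdl nN.
have ej : (e%:Z %| m%:Z * j)%Z = (e %| m)%N.
  by rewrite Gauss_dvdzl ?dvdzE ?absz_nat// /coprimez /gcdz absz_nat gcdnC; exact: jN.
rewrite ej; case: ifPn => em; last by rewrite !mulr0.
have mE : m = (m %/ e * e)%N by rewrite divnK.
set l := (m %/ e)%N in mE *.
have l0 : (0 < l)%N by rewrite divn_gt0// dvdn_leq.
have ldN : coprime (l * d) N.
  by rewrite coprimeMl dN andbT; apply: coprime_dvdl mN; rewrite mE dvdn_mulr.
have dR : d%:R != 0 :> R by rewrite pnatr_eq0 -lt0n.
have eR : e%:R != 0 :> R by rewrite pnatr_eq0 -lt0n.
have lR : l%:R != 0 :> R by rewrite pnatr_eq0 -lt0n.
have yd : 0 < e%:R * (y / m%:R) / d%:R by rewrite !(mulr_gt0, divr_gt0) ?ltr0n ?invr_gt0 ?ltr0n.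
have e1 : d%:Z ^+ 2 * (m%:Z * b0) = (l * d)%N%:Z * (n%:Z * b0).
  by rewrite mE nE !PoszM; ring.
have e2 : (m%:Z * j %/ e%:Z)%Z * d%:Z = (l * d)%N%:Z * j.
  rewrite mE PoszM -mulrA [e%:Z * j]mulrC mulrA mulzK; last by rewrite -lt0n.
  by rewrite PoszM; ring.
have ld0 : (0 < l * d)%N by rewrite muln_gt0 l0.
rewrite e1 e2 (uf_hecke _ ld0 ldN (eig _ ld0 ldN) (jN _ ldN) yd).
have -> : (l * d)%:R * (e%:R * (y / m%:R) / d%:R) = y.
  by rewrite mE !natrM; field; rewrite dR eR lR.
have dC : d%:R != 0 :> R[i] by rewrite pnatr_eq0 -lt0n.
have eC : e%:R != 0 :> R[i] by rewrite pnatr_eq0 -lt0n.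
rewrite nE natrM exprMn; field.
by rewrite dC eC expf_neq0.
Qed.
End HeckeFourier.

(** * Moments of Hecke eigenvalues *)

Section Moments.
Variable R : realType.
Implicit Types (c : nat -> R) (X n m d e : nat).

Lemma sqr_sum_le (I : Type) (r : seq I) (P : pred I) (x : I -> R) :
  (\sum_(i <- r | P i) x i) ^+ 2 <= (size r)%:R * \sum_(i <- r | P i) x i ^+ 2.
Proof.
elim: r => [|i r IH]; first by rewrite !big_nil expr0n mul0r.
rewrite !big_cons /= -natr1; have Q0 : 0 <= \sum_(j <- r | P j) x j ^+ 2.
  by apply: sumr_ge0 => j _; exact: sqr_ge0.
move: IH; case: (size r) => [|s]; case: (P i) => IH.
- have S0 : \sum_(j <- r | P j) x j = 0.
    by apply/eqP; rewrite -sqrf_eq0 eq_le sqr_ge0 andbT; rewrite mul0r in IH.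
  by rewrite S0 addr0 add0r mul1r lerDl.
- by apply: (le_trans IH); rewrite mul0r add0r mul1r.
- move: (\sum_(j <- r | P j) x j) (\sum_(j <- r | P j) x j ^+ 2) (x i) Q0 IH => S Q y Q0 IH.
  have s0 : 0 < s.+1%:R :> R by rewrite ltr0n.
  rewrite -(ler_pM2l s0); move: (s.+1%:R : R) s0 IH => t t0 IH.
  have := sqr_ge0 (t * y - S); nra.
- by apply: (le_trans IH); rewrite ler_wpM2r// lerDl.
Qed.

(** What remains of the multiplication law for the weights |a_n|^2 / n^k after Cauchy-Schwarz over
    the divisors of n. *)
Definition hecke_mult c := forall n m, (0 < n)%N -> (0 < m)%N ->
  c n * c m <= (size (divisors n))%:R *
    \sum_(d <- divisors n | (n %/ d %| m)%N) c (m %/ (n %/ d) * d)%N / (n %/ d)%N%:R ^+ 2.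

Definition csum c X : R := \sum_(n <- iota 1 X) c n.

Lemma csum_ge0 c X : (forall n, 0 <= c n) -> 0 <= csum c X.
Proof. by move=> c0; apply: sumr_ge0. Qed.

Lemma sum_inv_sqr X : \sum_(e <- iota 1 X) (e%:R ^- 2 : R) <= 2.
Proof.
suff : \sum_(e <- iota 1 X) (e%:R ^- 2 : R) <= 2 - X%:R^-1.
  by move/le_trans; apply; rewrite gerDl oppr_le0 invr_ge0.
elim: X => [|X IH]; first by rewrite big_nil invr0; lra.
rewrite -[X in iota 1 X]addn1 iotaD big_cat big_seq1 /= add1n.
have [->|X0] := posnP X; first by rewrite big_nil expr1n invr1; lra.
have x0 : 0 < X%:R :> R by rewrite ltr0n.
have := lerD IH (lexx (X.+1%:R ^- 2 : R)); move/le_trans; apply.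
rewrite -[X.+1%:R]natr1; move: (X%:R) x0 => x x0.
have x1 : 0 < x + 1 by rewrite addr_gt0.
have -> : 2 - x^-1 + (x + 1) ^- 2 = 2 - (x + 1)^-1 - (x * (x + 1) ^+ 2)^-1.
  by field; rewrite !gt_eqF.
by rewrite gerDl oppr_le0 invr_ge0 mulr_ge0 ?exprn_ge0// ltW.
Qed.

(** A number t is a product l d in at most as many ways as it has divisors. *)
Lemma sum_pair_le c X (T : R) : (forall n, 0 <= c n) ->
  (forall n, (0 < n <= X ^ 2)%N -> (size (divisors n))%:R <= T) ->
  \sum_(l <- iota 1 X) \sum_(d <- iota 1 X) c (l * d)%N <= T * csum c (X ^ 2).
Proof.
move=> c0 hT.
have e1 l d : l \in iota 1 X -> d \in iota 1 X ->
    c (l * d)%N = \sum_(t <- iota 1 (X ^ 2)) (if t == (l * d)%N then c t else 0).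
  rewrite !mem_iota !add1n !ltnS => /andP[l1 lX] /andP[d1 dX].
  rewrite -big_mkcond -big_filter (perm_big [:: (l * d)%N]) ?big_seq1//.
  rewrite filter_pred1_uniq ?iota_uniq// mem_iota muln_gt0 l1 d1/= add1n ltnS.
  by rewrite -mulnn leq_mul.
rewrite big_seq; under eq_bigr => l hl do (rewrite big_seq; under eq_bigr => d hd do rewrite (e1 l d hl hd)).
under eq_bigr => l hl do rewrite -big_seq.
rewrite -big_seq.
under eq_bigr => l _ do rewrite exchange_big.
rewrite exchange_big /csum mulr_sumr !big_seq /=; apply: ler_sum => t.
rewrite mem_iota add1n ltnS => ht.
have /andP[t0 _] := ht.
apply: (@le_trans _ _ (\sum_(l <- divisors t) c t)); last first.
  by rewrite big_const_seq count_predT iter_addr_0 -[c t *+ _]mulr_natl ler_wpM2r// hT.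
have inner l : (0 < l)%N -> \sum_(d <- iota 1 X) (if t == (l * d)%N then c t else 0) <= if (l %| t)%N then c t else 0.
  move=> l0; case: ifPn => [/dvdnP[q ->]|lt].
    rewrite (eq_bigr (fun d => if d == q then c (q * l)%N else 0)); last first.
      by move=> d _; rewrite [(q * l)%N]mulnC eqn_pmul2l// eq_sym.
    rewrite -big_mkcond/= big_const_seq count_uniq_mem ?iota_uniq// iter_addr_0.
    by case: (q \in _); rewrite ?mulr1n ?mulr0n.
  by rewrite big1// => d _; case: eqP => // e; rewrite e dvdn_mulr in lt.
apply: (@le_trans _ _ (\sum_(l <- iota 1 X) if (l %| t)%N then c t else 0)).
  by rewrite big_seq [leRHS]big_seq; apply: ler_sum => l; rewrite mem_iota => /andP[l0 _]; exact: inner.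
rewrite -big_mkcond/= !big_const_seq !iter_addr_0 count_predT; apply: ler_wpMn2l => //.
rewrite -size_filter; apply: uniq_leq_size; first by rewrite filter_uniq ?iota_uniq.
by move=> l; rewrite mem_filter => /andP[lt _]; rewrite -dvdn_divisors.
Qed.

(** Writing n = e d and m = e l, the multiplication law replaces c(n) c(m) by c(l d) / e^2. The sum
    over e converges, and the products l d are at most X^2, so the square of a sum of length X is
    controlled by a sum of length X^2. *)
Lemma csum_sqr_le c X (T : R) : (forall n, 0 <= c n) -> hecke_mult c ->
  (forall n, (0 < n <= X ^ 2)%N -> (size (divisors n))%:R <= T) ->
  csum c X ^+ 2 <= 2 * T ^+ 2 * csum c (X ^ 2).
Proof.
move=> c0 hm hT; have [->|X0] := posnP X.
  by rewrite /csum /= !big_nil expr0n mulr0.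
have T0 : 0 <= T by apply: le_trans (hT 1%N _); rewrite ?ler0n// expn_gt0 X0.
have TX n : n \in iota 1 X -> (size (divisors n))%:R <= T.
  rewrite mem_iota add1n ltnS => /andP[n0 nX]; apply: hT; rewrite n0 (leq_trans nX)//.
  by rewrite -mulnn leq_pmull.
pose S := \sum_(l <- iota 1 X) \sum_(d <- iota 1 X) c (l * d)%N.
have S0 : 0 <= S by apply: sumr_ge0 => l _; exact: sumr_ge0.
have hS : S <= T * csum c (X ^ 2) by exact: sum_pair_le.
apply: (@le_trans _ _ (T * (2 * S))); last first.
  by have := ler_wpM2l T0 hS; nra.
(* Indicator form of the substitution: once the sums are exchanged, n and m are determined by (d, e,
   l) and disappear. *)
pose G n m d e l : R := if (n == (e * d)%N) && (m == (e * l)%N) then c (l * d)%N / e%:R ^+ 2 else 0.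
have G0 n m d e l : 0 <= G n m d e l.
  by rewrite /G; case: ifP => // _; rewrite divr_ge0// exprn_ge0.
have step n m : n \in iota 1 X -> m \in iota 1 X ->
    c n * c m <= T * \sum_(d <- iota 1 X) \sum_(e <- iota 1 X) \sum_(l <- iota 1 X) G n m d e l.
  move=> nX mX; have := nX; have := mX; rewrite !mem_iota !add1n !ltnS => /andP[m0 mX'] /andP[n0 nX'].
  apply: (le_trans (hm n m n0 m0)).
  apply: ler_pM; rewrite ?ler0n ?TX//.
    by apply: sumr_ge0 => d _; rewrite divr_ge0// exprn_ge0.
  rewrite -big_filter; set r := [seq d <- divisors n | (n %/ d %| m)%N].
  have ur : uniq r by rewrite filter_uniq ?divisors_uniq.
  have hr d : d \in r -> [/\ d \in iota 1 X, (0 < d)%N, (d %| n)%N & (n %/ d %| m)%N].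
    rewrite mem_filter -dvdn_divisors// => /andP[h dn]; have d0 := dvdn_gt0 n0 dn; split=> //.
    by rewrite mem_iota d0 add1n ltnS (leq_trans (dvdn_leq n0 dn)).
  apply: (@le_trans _ _ (\sum_(d <- r) \sum_(e <- iota 1 X) \sum_(l <- iota 1 X) G n m d e l)); last first.
    rewrite [leRHS](bigID (mem r))/= -[leLHS]addr0; apply: lerD; last first.
      by apply: sumr_ge0 => d _; apply: sumr_ge0 => e _; exact: sumr_ge0.
    apply: eq_ler; rewrite -[RHS]big_filter; apply: perm_big.
    apply: uniq_perm => //; first by rewrite filter_uniq ?iota_uniq.
    by move=> d; rewrite [in RHS]mem_filter andb_idr// => /hr[].
  rewrite big_seq [leRHS]big_seq; apply: ler_sum => d /hr[dX d0 dn em].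
  have n_d : (n %/ d)%N \in iota 1 X.
    by rewrite mem_iota add1n ltnS divn_gt0// dvdn_leq//= (leq_trans (leq_div _ _)).
  have e0' : (0 < n %/ d)%N by rewrite divn_gt0// dvdn_leq.
  have m_e : (m %/ (n %/ d))%N \in iota 1 X.
    by rewrite mem_iota add1n ltnS divn_gt0// dvdn_leq//= (leq_trans (leq_div _ _)).
  rewrite (bigD1_seq (n %/ d)%N) ?iota_uniq//= (bigD1_seq (m %/ (n %/ d))%N) ?iota_uniq//=.
  rewrite {1}/G divnK// mulnC [(n %/ d * _)%N]mulnC divnK// !eqxx/= [(d * _)%N]mulnC -addrA lerDl.
  by apply: addr_ge0; apply: sumr_ge0 => // e _; exact: sumr_ge0.
rewrite expr2 {1 2}/csum mulr_suml.
apply: (@le_trans _ _ (\sum_(n <- iota 1 X) \sum_(m <- iota 1 X)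
   (T * \sum_(d <- iota 1 X) \sum_(e <- iota 1 X) \sum_(l <- iota 1 X) G n m d e l))).
  rewrite big_seq [leRHS]big_seq; apply: ler_sum => n nX.
  by rewrite mulr_sumr big_seq [leRHS]big_seq; apply: ler_sum => m mX; exact: step.
under eq_bigr => n _ do rewrite -mulr_sumr.
rewrite -mulr_sumr; apply: ler_wpM2l => //.
have -> : \sum_(n <- iota 1 X) \sum_(m <- iota 1 X) \sum_(d <- iota 1 X) \sum_(e <- iota 1 X) \sum_(l <- iota 1 X) G n m d e l =
  \sum_(e <- iota 1 X) \sum_(l <- iota 1 X) \sum_(d <- iota 1 X) \sum_(n <- iota 1 X) \sum_(m <- iota 1 X) G n m d e l.
  under eq_bigr => n _ do rewrite exchange_big/=.
  rewrite exchange_big/=.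
  under eq_bigr => d _.
    under eq_bigr => n _ do rewrite exchange_big/=.
    rewrite exchange_big/=.
    under eq_bigr => e _.
      under eq_bigr => n _ do rewrite exchange_big/=.
      rewrite exchange_big/=.
      over.
    over.
  rewrite exchange_big/=; apply: eq_bigr => e _; exact: exchange_big.
apply: (@le_trans _ _ (\sum_(e <- iota 1 X) (e%:R ^- 2 * S))); last first.
  by rewrite -mulr_suml ler_wpM2r// sum_inv_sqr.
apply: ler_sum => e _; rewrite mulr_sumr; apply: ler_sum => l _; rewrite mulr_sumr; apply: ler_sum => d _.
have one (q : nat) (v : R) : 0 <= v -> \sum_(n <- iota 1 X) (if n == q then v else 0) <= v.
  move=> v0; rewrite -big_mkcond/= big_const_seq count_uniq_mem ?iota_uniq// iter_addr_0.
  by case: (q \in _); rewrite ?mulr1n ?mulr0n.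
have v0 : 0 <= e%:R ^- 2 * c (l * d)%N by rewrite mulr_ge0// invr_ge0 exprn_ge0.
apply: le_trans (one (e * d)%N _ v0); apply: ler_sum => n _; rewrite /G; case: eqP => /= _; last by rewrite big1.
by rewrite [_ / _]mulrC; exact: one.
Qed.

Lemma csum_iter (s : nat) (de : R) : 0 < de -> exists2 K : R, 1 <= K &
  forall c X, (forall n, 0 <= c n) -> hecke_mult c -> (0 < X)%N ->
    csum c X ^+ (2 ^ s) <= K * X%:R `^ de * csum c (X ^ (2 ^ s)).
Proof.
elim: s de => [|s IH] de de0.
  exists 1 => // c X c0 _ X0; rewrite expn0 expr1 expn1 mul1r ler_peMl ?csum_ge0//.
  by rewrite -[leLHS](powRr0 X%:R); apply: ler_powR; [rewrite ler1n|exact: ltW].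
have d2 : 0 < de / 4 by rewrite divr_gt0.
have [K K1 HK] := IH _ d2.
(* With this exponent, numbers up to X^(2^(s+1)) have at most T X^(de/4) divisors. *)
have d3 : 0 < de / 8 / (2 ^ s)%:R by rewrite !divr_gt0.
have [T T1 HT] := @divisors_le R _ d3.
have K0 : 0 <= K by exact: le_trans K1.
have T0 : 0 <= T by exact: le_trans T1.
exists (K ^+ 2 * (2 * T ^+ 2)).
  by apply: mulr_ege1; [exact: exprn_ege1|apply: mulr_ege1; [rewrite ler1n|exact: exprn_ege1]].
move=> c X c0 hm X0; have X1 : 1 <= X%:R :> R by rewrite ler1n.
have Xr : 0 < X%:R :> R by rewrite ltr0n.
rewrite expnSr exprM; pose Y := (X ^ 2 ^ s)%N.
have h1 : csum c Y ^+ 2 <= 2 * (T * X%:R `^ (de / 4)) ^+ 2 * csum c (Y ^ 2).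
  apply: csum_sqr_le => // n /andP[n0 nY]; apply: (le_trans (HT n n0)); apply: ler_wpM2l => //.
  apply: (@le_trans _ _ ((Y ^ 2)%:R `^ (de / 8 / (2 ^ s)%:R))).
    by apply: ge0_ler_powR; rewrite ?nnegrE ?(ltW d3)// ler_nat.
  rewrite /Y -expnM natrX -powR_mulrn ?ler0n// -powRrM ler_powR//.
  by rewrite natrM; apply: eq_ler; field; rewrite gt_eqF.
have P2 : X%:R `^ (de / 4) ^+ 2 = X%:R `^ (de / 2) :> R.
  by rewrite -powR_mulrn ?powR_ge0// -powRrM; congr (_ `^ _); field.
have P3 : X%:R `^ de = X%:R `^ (de / 2) * X%:R `^ (de / 2) :> R.
  by rewrite -powRD ?(gt_eqF Xr) ?implybT//; congr (_ `^ _); field.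
apply: (@le_trans _ _ ((K * X%:R `^ (de / 4) * csum c Y) ^+ 2)).
  apply: lerXn2r; rewrite ?nnegrE ?exprn_ge0 ?csum_ge0//; last exact: HK.
  by rewrite !mulr_ge0 ?powR_ge0 ?csum_ge0.
rewrite exprMn exprMn P2; rewrite exprMn P2 in h1; rewrite expnM -/Y P3.
apply: (le_trans (ler_wpM2l _ h1)); first by rewrite mulr_ge0 ?powR_ge0 ?exprn_ge0.
by apply: eq_ler; ring.
Qed.

(** On the upper half of [1, X] one has c(n) <= (2 / X) n c(n), so each dyadic block contributes at
    most 2 B. *)
Lemma csum_dyadic c (B : R) : (forall n, 0 <= c n) ->
  (forall X, (0 < X)%N -> \sum_(n <- iota 1 X) n%:R * c n <= X%:R * B) ->
  forall t X, (X < 2 ^ t)%N -> csum c X <= 2 * B * t%:R.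
Proof.
move=> c0 hB; elim=> [|t IH] X; first by rewrite expn0 ltnS leqn0 => /eqP ->; rewrite /csum big_nil mulr0.
move=> hX; have [->|X0] := posnP X.
  have := hB 1%N isT; rewrite /csum !big_nil big_seq1 !mul1r => /(le_trans (c0 1%N)) B0.
  by rewrite !mulr_ge0.
have Xr : 0 < X%:R :> R by rewrite ltr0n.
have XE : X = (X./2 + (X - X./2))%N by rewrite subnKC// -divn2 leq_div.
have hh : csum c X <= csum c X./2 + 2 * B.
  rewrite /csum {1}XE iotaD big_cat lerD2l /=.
  rewrite -(ler_pM2l Xr); apply: (@le_trans _ _ (2 * \sum_(n <- iota 1 X) n%:R * c n)); last first.
    by have := hB X X0; nra.
  rewrite [X in iota 1 X]XE iotaD big_cat /= mulrDr -[leLHS]add0r; apply: lerD.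
    by rewrite mulr_ge0// sumr_ge0// => n _; rewrite mulr_ge0.
  rewrite !mulr_sumr big_seq [leRHS]big_seq; apply: ler_sum => n; rewrite mem_iota => /andP[hn _].
  rewrite mulrA ler_wpM2r// -natrM ler_nat.
  by move: hn; rewrite add1n => hn; have := odd_double_half X; lia.
apply: (le_trans hh); rewrite -[t.+1%:R]natr1 mulrDr mulr1 lerD2r; apply: IH.
by rewrite expnS in hX; have := odd_double_half X; lia.
Qed.

Lemma csum_le (de : R) : 0 < de -> exists2 K : R, 1 <= K & forall c (B : R), (forall n, 0 <= c n) ->
  (forall X, (0 < X)%N -> \sum_(n <- iota 1 X) n%:R * c n <= X%:R * B) ->
  forall X, (0 < X)%N -> csum c X <= K * X%:R `^ de * B.
Proof.
move=> de0; have [T T1 HT] := @divisors_le R _ de0; exists (2 * T).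
  by apply: mulr_ege1 => //; rewrite ler1n.
move=> c B c0 hB X X0; set t := trunc_log 2 X.
have B0 : 0 <= B.
  by have := hB 1%N isT; rewrite big_seq1 !mul1r; exact: le_trans.
have lt : (X < 2 ^ t.+1)%N by exact: trunc_log_ltn.
have le : (2 ^ t <= X)%N by exact: trunc_logP.
apply: (le_trans (csum_dyadic c0 hB lt)).
(* The number of dyadic blocks is the number of divisors of 2^t, so the divisor bound also turns
   this logarithm into a small power of X. *)
have tau : size (divisors (2 ^ t)) = t.+1.
  rewrite size_divisors ?expn_gt0//; case: (t) => [|t']; first by rewrite expn0 /= big_nil.
  by rewrite primesX// primes_prime// big_seq1 pfactorK.
have : t.+1%:R <= T * X%:R `^ de.
  rewrite -tau; apply: (le_trans (HT _ _)); first by rewrite expn_gt0.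
  apply: ler_wpM2l; first exact: le_trans T1.
  by apply: ge0_ler_powR; rewrite ?nnegrE ?(ltW de0)// ler_nat.
by move: (t.+1%:R) (_ `^ _) => u v h; have := ler_wpM2l B0 h; lra.
Qed.

(** To be used with c the Hecke weights, [J] t the mass above height t at one fixed frequency, B0
    the Bessel bound for all frequencies and B1 the sharper bound for one. Their ratio Q appears to
    the first power against a 2^s-th power on the left. *)
Definition moment_ineq (s : nat) (de K : R) := forall (c : nat -> R) (J : R -> R) (B0 B1 Q : R),
  (forall n, 0 <= c n) -> (forall t, 0 < t -> 0 <= J t) ->
  (forall t u, 0 < t -> t <= u -> J u <= J t) ->
  (forall t, 0 < t -> J t != 0 -> hecke_mult c) ->
  (forall t X, 0 < t -> \sum_(n <- iota 1 X) n%:R * c n * J (n%:R * t) <= B0 / t) ->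
  (forall t, 0 < t -> t * J t <= B1) -> B0 <= Q * B1 -> 0 <= Q ->
  forall (t : R) X, 0 < t -> (0 < X)%N ->
  (t * \sum_(n <- iota 1 X) n%:R * c n * J (n%:R * t)) ^+ (2 ^ s) <= K * X%:R `^ de * Q * B1 ^+ (2 ^ s).

(** Bound the sum by v(m) times the sum of c up to X, with m the place where v(n) = n t J(n t) is
    largest, and raise the latter sum to the power 2^s by [csum_iter]. The long sum is at most about
    B0 / v(m) by the Bessel hypothesis, and v(m) <= B1 bounds the remaining powers of v(m). *)
Lemma moment_bound (s : nat) (de : R) : 0 < de -> exists2 K : R, 1 <= K & moment_ineq s de K.
Proof.
move=> de0; have d2 : 0 < de / 2 by rewrite divr_gt0.
have [K K1 HK] := csum_iter s d2.
have d3 : 0 < de / 2 / (2 ^ s)%:R by rewrite !divr_gt0.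
have [T T1 HT] := csum_le d3.
have K0 : 0 <= K by exact: le_trans K1.
have T0 : 0 <= T by exact: le_trans T1.
exists (K * T); first exact: mulr_ege1.
move=> c J B0 B1 Q c0 J0 Jle hm bes ind B01 Q0 t X t0 X0.
have Xr : 0 < X%:R :> R by rewrite ltr0n.
have B10 : 0 <= B1 by apply: le_trans (ind 1 ltr01); rewrite mul1r J0.
pose v n := n%:R * t * J (n%:R * t).
have v0 n : (0 < n)%N -> 0 <= v n by move=> n0; rewrite !mulr_ge0 ?J0 ?mulr_gt0 ?ltr0n// ltW.
have rhs0 : 0 <= K * T * X%:R `^ de * Q * B1 ^+ (2 ^ s).
  by rewrite !mulr_ge0 ?powR_ge0 ?exprn_ge0.
have AE : t * \sum_(n <- iota 1 X) n%:R * c n * J (n%:R * t) = \sum_(n <- iota 1 X) c n * v n.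
  by rewrite mulr_sumr; apply: eq_bigr => n _; rewrite /v; ring.
rewrite AE.
have [m [m0 mx]] : exists m, (0 < m)%N /\ forall n, n \in iota 1 X -> v n <= v m.
  case: X X0 {Xr rhs0 AE} => // X _; elim: X => [|X [m [m0 IH]]].
    by exists 1%N; split=> // n; rewrite mem_seq1 => /eqP ->.
  have nE n : n \in iota 1 X.+2 -> n = X.+2 \/ n \in iota 1 X.+1.
    by rewrite !mem_iota !add1n => /andP[n1]; rewrite ltnS leq_eqVlt => /orP[/eqP|h]; [left|right; rewrite n1].
  have [h|h] := leP (v X.+2) (v m).
    by exists m; split=> // n /nE[->|/IH].
  by exists X.+2; split=> // n /nE[->//|/IH/le_trans]; apply; exact: ltW.
have Ale : \sum_(n <- iota 1 X) c n * v n <= csum c X * v m.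
  rewrite /csum mulr_suml big_seq [leRHS]big_seq; apply: ler_sum => n nX.
  by rewrite ler_wpM2l// mx.
have A0 : 0 <= \sum_(n <- iota 1 X) c n * v n.
  by rewrite big_seq sumr_ge0// => n; rewrite mem_iota => /andP[n0 _]; rewrite mulr_ge0// v0.
apply: (@le_trans _ _ ((csum c X * v m) ^+ (2 ^ s))).
  by apply: lerXn2r; rewrite ?nnegrE// mulr_ge0 ?csum_ge0 ?v0.
have [vm0|vmn] := eqVneq (v m) 0.
  by rewrite vm0 mulr0 expr0n (gtn_eqF (_ : 0 < 2 ^ s)%N) ?expn_gt0.
have vm : 0 < v m by rewrite lt_def vmn v0.
have u0 : 0 < m%:R * t by rewrite mulr_gt0// ltr0n.
have Jm : J (m%:R * t) != 0 by apply: contraNneq vmn => h; rewrite /v h mulr0.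
have mult := hm _ u0 Jm.
have Jp : 0 < J (m%:R * t) by rewrite lt_def Jm J0.
have vE : v m = (m%:R * t) * J (m%:R * t) by [].
have vB1 : v m <= B1 by exact: ind.
(* The Bessel hypothesis at height m t / Y: for n <= Y the argument of [J] is then at most m t, and
   [J] is nonincreasing. *)
have hB Y : (0 < Y)%N -> \sum_(n <- iota 1 Y) n%:R * c n <= Y%:R * (B0 / v m).
  move=> Y0; have Yr : 0 < Y%:R :> R by rewrite ltr0n.
  have t1 : 0 < m%:R * t / Y%:R by rewrite divr_gt0.
  rewrite -(ler_pM2r Jp) vE; apply: (@le_trans _ _ (B0 / (m%:R * t / Y%:R))); last first.
    by apply: eq_ler; field; rewrite !gt_eqF ?ltr0n.
  apply: le_trans (bes _ Y t1); rewrite mulr_suml big_seq [leRHS]big_seq.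
  apply: ler_sum => n; rewrite mem_iota add1n ltnS => /andP[n0 nY].
  have nr : 0 < n%:R :> R by rewrite ltr0n.
  apply: ler_wpM2l; first by rewrite mulr_ge0// ltW.
  apply: Jle; first by rewrite mulr_gt0.
  by rewrite mulrA ler_pdivrMr// mulrC ler_pM2l// ler_nat.
have Xs : (0 < X ^ (2 ^ s))%N by rewrite expn_gt0 X0.
have h1 := HK c X c0 mult X0; have h2 := HT c _ c0 hB _ Xs.
have P3 : (X ^ (2 ^ s))%:R `^ (de / 2 / (2 ^ s)%:R) = X%:R `^ (de / 2) :> R.
  by rewrite natrX -powR_mulrn ?ler0n// -powRrM; congr (_ `^ _); field; rewrite gt_eqF.
have P4 : X%:R `^ de = X%:R `^ (de / 2) * X%:R `^ (de / 2) :> R.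
  by rewrite -powRD ?(gt_eqF Xr) ?implybT//; congr (_ `^ _); field.
rewrite P3 in h2; rewrite P4 exprMn.
apply: (@le_trans _ _ (K * X%:R `^ (de / 2) * (T * X%:R `^ (de / 2) * (B0 / v m)) * v m ^+ (2 ^ s))).
  apply: ler_wpM2r; first by rewrite exprn_ge0// ltW.
  by apply: (le_trans h1); apply: ler_wpM2l => //; rewrite mulr_ge0.
have [r rE] : exists r, (2 ^ s = r.+1)%N by case: (2 ^ s)%N (expn_gt0 2 s) => // r _; exists r.
rewrite rE !exprS.
have h3 : B0 * v m ^+ r <= Q * (B1 * B1 ^+ r).
  apply: (@le_trans _ _ (Q * B1 * v m ^+ r)).
    by apply: ler_wpM2r => //; rewrite exprn_ge0// ltW.
  rewrite -mulrA; apply: ler_wpM2l => //; apply: ler_wpM2l => //.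
  by apply: lerXn2r; rewrite ?nnegrE// ltW.
have -> : K * X%:R `^ (de / 2) * (T * X%:R `^ (de / 2) * (B0 / v m)) * (v m * v m ^+ r) =
    K * T * (X%:R `^ (de / 2) * X%:R `^ (de / 2)) * (B0 * v m ^+ r).
  by field; rewrite gt_eqF.
rewrite -[leRHS]mulrA; apply: ler_wpM2l => //.
by rewrite !mulr_ge0.
Qed.
End Moments.

(** * The mass of a strip *)

Section Measurability.
Context {R : realType}.
Implicit Types (F : R[i] -> R[i]).
Local Notation mu := (@lebesgue_measure R).

(** An open set of the plane is a countable union of boxes with rational centre and size. *)
Lemma open2_measurable (V : set (R * R)) :
  (forall p, V p -> exists2 d : R, 0 < d & forall q, `|q.1 - p.1| < d -> `|q.2 - p.2| < d -> V q) ->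
  measurable (V : set (plane R)).
Proof.
move=> oV; pose Sq (a b r : rat) : set (R * R) :=
  (fun p => `|p.1 - ratr a| < ratr r :> R) `&` (fun p => `|p.2 - ratr b| < ratr r :> R).
have -> : V = \bigcup_a \bigcup_b \bigcup_r (if `[< Sq a b r `<=` V >] then Sq a b r else set0).
  apply/seteqP; split=> [p Vp|p [a _ [b _ [r _]]]]; last by case: asboolP => [h /h//|//].
  have [d d0 hd] := oV p Vp.
  have d20 : 0 < d / 2 by rewrite divr_gt0.
  have [r] := rat_in_itvoo d20; rewrite in_itv /= => /andP[r0 rd].
  have i1 : p.1 - ratr r < p.1 + ratr r by rewrite ltrD2l gtrN.
  have i2 : p.2 - ratr r < p.2 + ratr r by rewrite ltrD2l gtrN.
  have [a] := rat_in_itvoo i1; rewrite in_itv /= => /andP[a1 a2].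
  have [b] := rat_in_itvoo i2; rewrite in_itv /= => /andP[b1 b2].
  exists a => //; exists b => //; exists r => //.
  have pS : Sq a b r p by split=> /=; rewrite ltr_norml; apply/andP; split; lra.
  case: asboolP => // -[]; move=> q [/= q1 q2]; case: pS => /= p1 p2.
  move: q1 q2 p1 p2; rewrite !ltr_norml => /andP[? ?] /andP[? ?] /andP[? ?] /andP[? ?].
  by apply: hd; rewrite ltr_norml; apply/andP; split; lra.
apply: bigcupT_measurable_rat => a; apply: bigcupT_measurable_rat => b; apply: bigcupT_measurable_rat => r.
case: ifP => // _; apply: measurableI.
  have m : mfunT (fun p : plane R => `|p.1 - ratr a|).
    by apply: measurableT_comp => //; apply: measurable_funB => //; exact: measurable_fst.
  have := m measurableT _ (measurable_itv `]-oo, ratr r[); rewrite setTI.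
  by congr measurable; apply/seteqP; split=> p /=; rewrite in_itv.
have m : mfunT (fun p : plane R => `|p.2 - ratr b|).
  by apply: measurableT_comp => //; apply: measurable_funB => //; exact: measurable_snd.
have := m measurableT _ (measurable_itv `]-oo, ratr r[); rewrite setTI.
by congr measurable; apply/seteqP; split=> p /=; rewrite in_itv.
Qed.

Lemma measurable_normc F : (forall z, uhp z -> ccat F z) ->
  mfunT (fun p : plane R =>
    if 0 < p.2 then normc (F (toC p)) else 0).
Proof.
move=> cF; apply: (measurability _ (RGenOInfty.measurableE R)) => _ [_ [a ->] <-].
rewrite setTI; have [a0|a0] := leP 0 a.
  apply: open2_measurable => -[x y] /=; rewrite in_itv /= andbT; case: ifPn => [y0 ha|_]; last first.
    by rewrite ltNge a0.
  have e0 : 0 < (normc (F (x +i* y)) - a) / 2 by rewrite divr_gt0// subr_gt0.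
  have [d d0 hd] := ccat_near (cF (x +i* y) y0) e0.
  exists (Num.min d y); first by rewrite lt_min d0.
  move=> [x' y'] /=; rewrite !lt_min => /andP[h1 _] /andP[h2 h3].
  rewrite in_itv /= andbT.
  have -> : 0 < y' by move: h3; rewrite ltr_norml => /andP[? ?]; lra.
  have hh := hd x' y' h1 h2.
  have := normcD (F (x' +i* y')) (F (x +i* y) - F (x' +i* y')).
  rewrite addrC subrK => h4; rewrite -normcN opprB in hh; rewrite /toC /=; lra.
rewrite (_ : _ @^-1` _ = setT) //; apply/seteqP; split=> // p _ /=; rewrite in_itv/= andbT.
by case: ifP => // _; apply: lt_le_trans a0 (normc_ge0 _).
Qed.

Lemma hline_near F (N y e : R) : (forall z, uhp z -> ccat F z) -> 0 < y -> 0 < e ->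
  exists2 d, 0 < d & forall y', `|y' - y| < d -> 0 < y' /\
    forall x, 0 <= x <= N -> normc (F (x +i* y') - F (x +i* y)) <= e.
Proof.
move=> cF y0 e0; have e20 : 0 < e / 2 by rewrite divr_gt0.
have /compact_near_coveringP cN := @segment_compact R 0 N.
have [x /= hx|d /= d0 hd] := @cN R (nbhs y) (fun y' x => normc (F (x +i* y') - F (x +i* y)) <= e) _ _.
  have [d d0 hd] := ccat_near (cF (x +i* y) y0) e20.
  exists (ball x d, ball y d); first by split; exact: nbhsx_ballx.
  move=> [x' y'] [/= b1 b2].
  have b1' : `|x' - x| < d by rewrite distrC.
  have h1 : normc (F (x' +i* y') - F (x +i* y)) <= e / 2 by apply: hd => //; rewrite distrC.
  have h2 : normc (F (x' +i* y) - F (x +i* y)) <= e / 2 by apply: hd; rewrite //= subrr normr0.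
  have := normcD (F (x' +i* y') - F (x +i* y)) (- (F (x' +i* y) - F (x +i* y))).
  rewrite normcN opprB addrA subrK; lra.
exists (Num.min d y); first by rewrite lt_min d0.
move=> y'; rewrite lt_min => /andP[h1 h2]; split.
  by move: h2; rewrite ltr_norml => /andP[? ?]; lra.
by move=> x hx; apply: (hd y' _ x); rewrite /= ?in_itv//= distrC.
Qed.

Lemma uh_continuous F (N : R) j y : 0 < N -> (forall z, uhp z -> ccat F z) -> 0 < y ->
  {for y, continuous (fun y => normc (uh N F j y))}.
Proof.
move=> N0 cF y0; apply/cvgrPdist_le => e e0.
have [d d0 hd] := hline_near N cF y0 e0.
near=> y'; have [|y'0 h] := hd y'.
  by near: y'; have /cvgrPdist_lt := @cvg_id _ (nbhs y); move=> /(_ d d0); apply: filterS => t; rewrite distrC.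
have ch t : 0 < t -> ccont (hline F t).
  by move=> t0; apply: (@ccont_hline _ _ t) => // z tz; apply: cF; exact: lt_le_trans tz.
have le1 (u v : R[i]) : `|normc u - normc v| <= normc (u - v).
  rewrite ler_norml; apply/andP; split.
    by have := normcD u (v - u); rewrite addrC subrK -[v - u]opprB normcN; lra.
  by have := normcD v (u - v); rewrite addrC subrK; lra.
apply: (le_trans (le1 _ _)); rewrite -normcN opprB.
rewrite /uh /fc /inp -mulrBr -cintB; last 2 first.
- by apply: ccont_inp; [exact: ch|exact: ccont_ech].
- by apply: ccont_inp; [exact: ch|exact: ccont_ech].
rewrite normcM normc_real gtr0_norm ?invr_gt0// ler_pdivrMl// mulrC.
rewrite -[X in _ <= e * X]subr0; apply: normc_cint_cst; [|exact: ltW|].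
  by apply: ccontB; apply: ccont_inp; (try exact: ccont_ech); exact: ch.
by move=> x hx; rewrite -mulrBl normcM normc_conj normc_ech mulr1; exact: h.
Unshelve. all: by end_near.
Qed.

Lemma measurable_tail (g : R -> R) (t : R) : 0 < t -> (forall y, 0 < y -> {for y, continuous g}) ->
  mfunT (fun y => if t <= y then g y else 0).
Proof.
move=> t0 cg; have mg : measurable_fun (`]0, +oo[ : set (measurableTypeR R)) g.
  apply: open_continuous_measurable_fun; first exact: interval_open.
  by move=> y; rewrite inE /= in_itv/= andbT; exact: cg.
have mg1 : measurable_fun (`[t, +oo[ : set (measurableTypeR R)) g.
  by apply: measurable_funS mg => // y /=; rewrite !in_itv/= !andbT; exact: lt_le_trans.
have := (measurable_restrictT g (measurable_itv `[t, +oo[)).1 mg1.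
congr measurable_fun; apply/funext => y; rewrite patchE mem_setE in_itv/= andbT.
by [].
Qed.

Lemma integral_inv_sqr (t : R) : 0 < t ->
  (\int[mu]_y (if t <= y then hyp_weight y else 0)%:E = (t^-1)%:E)%E.
Proof.
move=> t0; transitivity (\int[mu]_(y in `[t, +oo[) (y ^- 2)%:E)%E.
  rewrite [RHS]integral_mkcond; apply: eq_integral => y _; rewrite patchE mem_setE in_itv/= andbT.
  by case: ifPn => // ty; rewrite /hyp_weight /invpos (lt_le_trans t0 ty) exprVn.
have dV (y : R) : t < y -> is_derive y 1 (fun y : R => - y^-1) (y ^- 2).
  move=> ty; have y0 : y != 0 by rewrite gt_eqF// (lt_trans t0).
  have h := is_deriveV (f := id) y0 (is_derive_id y (1 : R)).
  by have := is_deriveN (f := fun y : R => y^-1); move/(_ _ _ _ h); move/is_derive_eq; apply; rewrite -[_ *: _]/(_ * _) mulr1 opprK.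
have cV (y : R) : t <= y -> y ^- 2 @[y --> y] --> y ^- 2.
  move=> ty; have y0 : y != 0 by rewrite gt_eqF// (lt_le_trans t0).
  by apply: cvgV; [rewrite expf_neq0|exact: exprn_continuous].
rewrite (@ge0_continuous_FTC2y _ _ (fun y => - y^-1) _ 0).
- by rewrite EFinN sub0e oppeK.
- by move=> y ty; rewrite invr_ge0 exprn_ge0// (le_trans (ltW t0)).
- apply/continuous_within_itvcyP; split.
    by move=> y; rewrite in_itv/= andbT => ty; apply: cV; exact: ltW.
  by apply: cvg_at_right_filter; apply: cV.
- rewrite -[0]oppr0; apply: cvgN; apply/gtr0_cvgV0 => //.
  by exists 0; split=> //; exact: num_real.
- by move=> y ty; have := dV y ty => -[].
- apply: cvgN; apply: cvg_at_right_filter; apply: cvgV; [by rewrite gt_eqF|exact: cvg_id].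
- by move=> y; rewrite in_itv/= andbT => ty; rewrite derive1E; have [_ ->] := dV y ty.
Qed.
End Measurability.

Section Masses.
Variables (R : realType) (C : R) (k N M : nat) (f : R[i] -> R[i]) (chi : int -> R[i]).
Hypothesis N0 : (0 < N)%N.
Hypothesis C0 : 0 <= C.
Hypothesis gf : good_form C k N f.
Hypothesis dchi : dirichlet_char N chi.
Hypothesis neb : nebentypus N k chi f.
Hypothesis condM : is_conductor N chi M.
Variable a : nat -> R[i].
Hypothesis eig : forall n, (0 < n)%N -> coprime n N -> forall z, uhp z -> hecke k chi n f z = a n * f z.
Implicit Types (z : R[i]) (b j : int) (y t : R) (n m d : nat).
Local Notation mu := (@lebesgue_measure R).

Let c0 := half_level N.
Let N1 := (N %/ c0)%N.
Let q := excess N M.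
Local Notation fb := (fb k N f).
Local Notation S := (sup_norm k f).
Local Notation umass := (umass k N f).

Let N0R : 0 < N%:R :> R. Proof. by rewrite ltr0n. Qed.
Let MN : (M %| N)%N. Proof. by case: condM. Qed.
Let q0 : (0 < q)%N. Proof. exact: excess_gt0. Qed.
Let S0 : 0 <= S. Proof. exact: sup_norm_ge0 gf. Qed.

(** The shift x -> x + 1 multiplies the form by psi b and its j-th coefficient by e(j / N). *)
Lemma ech1_eq b j y : 0 < y -> uf k N f b j y != 0 -> psi N chi b = ech N%:R j 1.
Proof.
move=> y0 u0; have cf := fb_ccont gf b y0.
have pf x : hline (fb b) y (x + N%:R) = hline (fb b) y x by exact: (fb_per gf).
have h1 := fc_shift N0R j 1 cf pf.
have e x : hline (fb b) y (x + 1) = psi N chi b * hline (fb b) y x.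
  have uz : uhp (x +i* y) := y0.
  rewrite -[RHS](fb_add1 N0 neb b uz) /hline; congr fb.
  by apply/eqP; rewrite eq_complex /= addr0 !eqxx.
move: h1; rewrite (funext e) fcZ// => /eqP.
by rewrite -subr_eq0 -mulrBl mulf_eq0 (negbTE u0) orbF subr_eq0 => /eqP.
Qed.

(** Only the b with psi b = e(j / N) contribute, at most N1 / q of them. This is the one place where
    the conductor enters. *)
Lemma umass_le j y : 0 < y -> umass j y <= N1%:R * S ^+ 2 / q%:R.
Proof.
move=> y0; rewrite ler_pdivlMr ?ltr0n//; pose w : R[i] := ech N%:R j 1.
apply: (@le_trans _ _ (#|[pred b : 'I_N1 | psi N chi b%:Z == w]|%:R * S ^+ 2 * q%:R)).
  rewrite ler_pM2r ?ltr0n//.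
  apply: (@le_trans _ _ (\sum_(b < N1 | psi N chi b%:Z == w) S ^+ 2)); last first.
    by rewrite sumr_const mulr_natl.
  rewrite [leRHS]big_mkcond; apply: ler_sum => b _; case: ifPn => hb.
    by apply: lerXn2r; rewrite ?nnegrE ?uhw_ge0//; apply: (uhw_sup N0 C0 gf) => //; exact: SL2Z_gam.
  rewrite uhw_uf//; have [->|u0] := eqVneq (uf k N f b%:Z j y) 0.
    by rewrite Normc.normc0 expr0n mulr0.
  by case/eqP: hb; exact: ech1_eq u0.
rewrite mulrAC -natrM ler_wpM2r ?sqr_ge0// ler_nat.
exact: (psi_count N0 dchi condM).
Qed.

Lemma umass_bessel (r : seq int) y : uniq r -> 0 < y -> \sum_(j <- r) umass j y <= N1%:R * S ^+ 2.
Proof.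
move=> ur y0; rewrite exchange_big /= -[N1 in leRHS]card_ord mulr_natl -sumr_const.
apply: ler_sum => b _; have cf := fb_ccont gf b%:Z y0.
under eq_bigr => j _ do rewrite uhw_uf//.
rewrite -mulr_sumr; have yk : 0 < y ^+ k by rewrite exprn_gt0.
rewrite mulrC -ler_pdivlMr//.
apply: (le_trans (bessel N0R ur cf)); rewrite ler_pdivrMl// mulrC -[N%:R in leRHS]subr0.
have cn : continuous (fun x => normc (hline (fb b%:Z) y x) ^+ 2).
  rewrite (_ : (fun x => _) = (fun x => Re (hline (fb b%:Z) y x) ^+ 2 + Im (hline (fb b%:Z) y x) ^+ 2)).
    by case: cf => c1 c2 x; apply: cvgD; apply: cvgM; (try exact: c1); exact: c2.
  by apply/funext => x; rewrite normc_nsq.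
rewrite -(@rint_cst R) ?(ltW N0R)//; apply: rint_le => //; first by move=> x; exact: cvg_cst.
move=> x _; rewrite ler_pdivlMr// mulrC.
have uz : uhp (x +i* y) := y0.
have h := @height_sup _ _ _ _ _ N0 C0 gf (moebius (gam N b%:Z) (x +i* y)) (uhp_moebius (SL2Z_gam N b%:Z) uz).
rewrite -height_slash// in h; last exact: SL2Z_gam.
have -> : y ^+ k * normc (hline (fb b%:Z) y x) ^+ 2 = height k (fb b%:Z) (x +i* y) ^+ 2.
  rewrite /height exprMn; congr (_ * _); rewrite -[in RHS]powR_mulrn ?powR_ge0// -powRrM /=.
  by rewrite -[LHS]powR_mulrn ?ltW//; congr (_ `^ _); field.
by apply: lerXn2r; rewrite ?nnegrE// mulr_ge0 ?powR_ge0 ?normc_ge0.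
Qed.

Lemma umass0 y : 0 < y -> umass 0 y = 0.
Proof.
move=> y0; rewrite /umass big1// => b _; rewrite uhw_uf// /uf.
case: gf => _ _ _ ->//; last exact: SL2Z_gam.
by rewrite Normc.normc0 expr0n mulr0.
Qed.

Definition utail j t y : R := if t <= y then umass j y else 0.

Lemma utail_ge0 j t y : 0 <= utail j t y.
Proof. by rewrite /utail; case: ifP => // _; exact: umass_ge0. Qed.

Lemma measurable_utail j t : 0 < t -> mfunT (utail j t).
Proof.
move=> t0; have -> : utail j t = (fun y => \sum_(b < N1)
    (y `^ (k%:R / 2) * (if t <= y then normc (uh N%:R (fb b%:Z) j y) else 0)) ^+ 2).
  apply/funext => y; rewrite /utail; case: ifP => _; first by [].
  by rewrite big1// => b _; rewrite mulr0 expr0n.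
apply: measurable_sum => b; apply: measurable_funX; apply: measurable_funM.
  exact: measurable_powR.
apply: measurable_tail => // y y0; apply: uh_continuous => // z uz.
by apply: (slash_ccat gf) => //; exact: SL2Z_gam.
Qed.

Local Open Scope ereal_scope.

Definition utail_int j t : \bar R := \int[mu]_y (utail j t y * hyp_weight y)%:E.

Lemma measurable_utailw j t : (0 < t)%R ->
  mfunT (fun y => (utail j t y * hyp_weight y)%:E).
Proof.
move=> t0; apply/measurable_EFinP; apply: measurable_funM; first exact: measurable_utail.
exact: measurable_hyp_weight.
Qed.

Lemma utailw_ge0 j t y : 0 <= (utail j t y * hyp_weight y)%:E.
Proof. by rewrite lee_fin mulr_ge0 ?utail_ge0 ?hyp_weight_ge0. Qed.

Lemma measurable_tail_cst t (B : R) : (0 < t)%R ->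
  mfunT (fun y => (B * (if (t <= y)%R then hyp_weight y else 0))%:E).
Proof.
move=> t0; apply/measurable_EFinP; apply: measurable_funM => //.
rewrite (_ : (fun y => _) = (fun y => (if (t <= y)%R then 1 else 0) * hyp_weight y)%R).
  apply: measurable_funM; last exact: measurable_hyp_weight.
  by apply: (@measurable_tail _ (fun=> 1)%R) => // y _; exact: cvg_cst.
by apply/funext => y; case: ifP; rewrite ?mul1r ?mul0r.
Qed.

Lemma integral_tail_cst t (B : R) : (0 < t)%R -> (0 <= B)%R ->
  \int[mu]_y (B * (if (t <= y)%R then hyp_weight y else 0))%:E = (B / t)%:E.
Proof.
move=> t0 B0; under eq_integral => y _ do rewrite EFinM.
rewrite ge0_integralZl ?integral_inv_sqr ?lee_fin//.
  have := measurable_tail_cst 1 t0; congr measurable_fun.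
  by apply/funext => y; rewrite mul1r.
by move=> y _; rewrite lee_fin; case: ifP => // _; exact: hyp_weight_ge0.
Qed.

Lemma sum_utail_le (r : seq int) t (B : R) : (0 < t)%R -> (0 <= B)%R ->
  (forall y, (0 < y)%R -> (\sum_(j <- r) umass j y <= B)%R) ->
  \sum_(j <- r) utail_int j t <= (B / t)%:E.
Proof.
move=> t0 B0 hB; rewrite -ge0_integral_sum//; last 2 first.
- by move=> j; exact: measurable_utailw.
- by move=> j y _; exact: utailw_ge0.
rewrite -integral_tail_cst//; apply: ge0_le_integral => //.
- by move=> y _; apply: sume_ge0 => j _; exact: utailw_ge0.
- by apply: emeasurable_sum => j; exact: measurable_utailw.
- exact: measurable_tail_cst.
- move=> y _; rewrite sumEFin lee_fin -mulr_suml /utail.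
  have [ty|ty] := leP t y; last by rewrite big1// mul0r mulr0.
  by apply: ler_wpM2r; [exact: hyp_weight_ge0|apply: hB; exact: lt_le_trans ty].
Qed.

Lemma utail_int_le j t : (0 < t)%R -> utail_int j t <= (N1%:R * S ^+ 2 / q%:R / t)%:E.
Proof.
move=> t0; have := @sum_utail_le [:: j] t (N1%:R * S ^+ 2 / q%:R) t0; rewrite big_seq1; apply.
  by rewrite divr_ge0 ?mulr_ge0 ?sqr_ge0.
by move=> y y0; rewrite big_seq1; exact: umass_le.
Qed.

Lemma utail_int_ge0 j t : 0 <= utail_int j t.
Proof. by apply: integral_ge0 => y _; exact: utailw_ge0. Qed.

Definition ujay j t : R := fine (utail_int j t).

Lemma ujayE j t : (0 < t)%R -> utail_int j t = (ujay j t)%:E.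
Proof.
move=> t0; rewrite /ujay fineK// ge0_fin_numE ?utail_int_ge0//.
by apply: le_lt_trans (utail_int_le j t0) _; rewrite ltry.
Qed.

Lemma ujay_ge0 j t : (0 <= ujay j t)%R.
Proof. by rewrite fine_ge0 ?utail_int_ge0. Qed.

Lemma ujay_mono j t u : (0 < t)%R -> (t <= u)%R -> (ujay j u <= ujay j t)%R.
Proof.
move=> t0 tu; have u0 : (0 < u)%R by exact: lt_le_trans tu.
rewrite -lee_fin -!ujayE//; apply: ge0_le_integral => //.
- by move=> y _; exact: utailw_ge0.
- exact: measurable_utailw.
- exact: measurable_utailw.
- move=> y _; rewrite lee_fin; apply: ler_wpM2r; first exact: hyp_weight_ge0.
  rewrite /utail; case: (leP u y) => uy; last by case: ifP => // _; exact: umass_ge0.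
  by rewrite (le_trans tu uy).
Qed.

(** The substitution y -> n y: the density 1/y^2 contributes n^2 and dy takes one n back. *)
Lemma utail_int_hecke n j t : (0 < n)%N -> coprime n N -> coprime `|j| n -> (0 < t)%R ->
  utail_int (n%:Z * j) t = (hecke_weight k n (a n) * n%:R * ujay j (n%:R * t))%:E.
Proof.
move=> n0 nN jn t0; have nR : (0 < n%:R :> R)%R by rewrite ltr0n.
have nt : (0 < n%:R * t)%R by rewrite mulr_gt0.
pose H v : \bar R := (utail j (n%:R * t) v * hyp_weight v)%:E.
have cw0 : (0 <= hecke_weight k n (a n))%R by rewrite divr_ge0 ?sqr_ge0 ?exprn_ge0.
have e y : (utail (n%:Z * j) t y * hyp_weight y)%:E = (hecke_weight k n (a n) * n%:R ^+ 2)%:E * H (n%:R * y)%R.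
  rewrite /H -EFinM; congr (_%:E); rewrite /utail ler_pM2l//.
  have [ty|ty] := leP t y; last by rewrite !mul0r mulr0.
  have y0 : (0 < y)%R by exact: lt_le_trans ty.
  rewrite (umass_hecke N0 gf dchi neb n0 nN (eig n0 nN) jn y0) /hyp_weight /invpos y0 mulr_gt0//.
  by field; rewrite !gt_eqF.
have mH : mfunT H by exact: measurable_utailw.
have H0 v : 0 <= H v by exact: utailw_ge0.
rewrite /utail_int; under eq_integral => y _ do rewrite e.
rewrite ge0_integralZl//; last 2 first.
- by apply: (measurableT_comp mH); apply: measurable_funM.
- by rewrite lee_fin mulr_ge0// exprn_ge0.
rewrite expr2 mulrA EFinM -muleA (integral_scale nR mH H0).
by rewrite -[\int[mu]_x H x]/(utail_int j (n%:R * t)) ujayE// -EFinM.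
Qed.
End Masses.

Lemma pow_rootP (R : realType) (x y : R) r : (0 < r)%N -> 0 <= x -> x ^+ r <= y -> x <= y `^ (r%:R^-1).
Proof.
move=> r0 x0 xy; have rR : r%:R != 0 :> R by rewrite pnatr_eq0 -lt0n.
have xr : 0 <= x ^+ r by rewrite exprn_ge0.
have -> : x = (x ^+ r) `^ (r%:R^-1) by rewrite -powR_mulrn// -powRrM mulfV// powRr1.
by apply: ge0_ler_powR; rewrite ?nnegrE ?invr_ge0 ?ler0n//; exact: le_trans xy.
Qed.

Lemma sum_sub_le (R : realType) (T : eqType) (s t : seq T) (G : T -> R) :
  uniq s -> {subset s <= t} -> (forall x, 0 <= G x) -> \sum_(x <- s) G x <= \sum_(x <- t) G x.
Proof.
elim: s t => [|x s IH] t /=; first by move=> _ _ G0; rewrite big_nil sumr_ge0.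
move=> /andP[xs us] st G0.
have xt : x \in t by apply: st; rewrite mem_head.
rewrite big_cons (perm_big _ (perm_to_rem xt)) big_cons lerD2l; apply: IH => // y ys.
have := st y; rewrite in_cons ys orbT => /(_ isT).
rewrite (perm_mem (perm_to_rem xt)) in_cons => /orP[/eqP yx|//].
by rewrite -yx ys in xs.
Qed.

Lemma continuous_bigsum (R : realType) (I : Type) (r : seq I) (g : I -> R -> R) :
  (forall i, continuous (g i)) -> continuous (fun x => \sum_(i <- r) g i x).
Proof.
move=> cg; elim: r => [|i r IH].
  by rewrite (_ : (fun x => _) = fun=> 0) => [|]; [move=> x; exact: cvg_cst|apply/funext => x; rewrite big_nil].
rewrite (_ : (fun x => _) = (fun x => g i x + \sum_(j <- r) g j x)); last by apply/funext => x; rewrite big_cons.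
by move=> x; apply: cvgD; [exact: cg|exact: IH].
Qed.

Lemma rint_sum (R : realType) (I : Type) (r : seq I) (g : I -> R -> R) (a b : R) : a <= b ->
  (forall i, continuous (g i)) -> rint a b (fun x => \sum_(i <- r) g i x) = \sum_(i <- r) rint a b (g i).
Proof.
move=> ab cg; elim: r => [|i r IH].
  by rewrite big_nil (_ : (fun x => _) = fun=> 0) ?rint_cst ?mul0r//; apply/funext => x; rewrite big_nil.
rewrite big_cons -IH -rintD//; last exact: continuous_bigsum.
by congr rint; apply/funext => x; rewrite big_cons.
Qed.

Section Upper.
Variables (R : realType) (C : R) (k N M : nat) (f : R[i] -> R[i]) (chi : int -> R[i]).
Hypothesis N0 : (0 < N)%N.
Hypothesis C0 : 0 <= C.
Hypothesis gf : good_form C k N f.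
Hypothesis dchi : dirichlet_char N chi.
Hypothesis neb : nebentypus N k chi f.
Hypothesis condM : is_conductor N chi M.
Variable a : nat -> R[i].
Hypothesis eig : forall n, (0 < n)%N -> coprime n N -> forall z, uhp z -> hecke k chi n f z = a n * f z.
Implicit Types (z : R[i]) (b j : int) (y t : R) (n m d : nat).
Local Notation mu := (@lebesgue_measure R).

Let c0 := half_level N.
Let N1 := (N %/ c0)%N.
Let q := excess N M.
Local Notation fb := (fb k N f).
Local Notation S := (sup_norm k f).
Local Notation umass := (umass k N f).
Local Notation ujay := (ujay k N f).
Local Notation utail_int := (utail_int k N f).

Let MN : (M %| N)%N. Proof. by case: condM. Qed.
Let q0 : (0 < q)%N. Proof. exact: excess_gt0. Qed.

Let S0 : 0 <= S. Proof. exact: sup_norm_ge0 gf. Qed.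

(** The value 0 at n not prime to N lets the sums run over all n up to X and keeps the
    multiplicative inequality true. *)
Definition cw n : R := if (0 < n)%N && coprime n N then hecke_weight k n (a n) else 0.

Lemma cw_ge0 n : 0 <= cw n.
Proof. by rewrite /cw; case: ifP => // _; rewrite divr_ge0 ?sqr_ge0 ?exprn_ge0. Qed.

(** The frequencies whose primes all divide N, in the form in which the Hecke relations use them. *)
Definition smooth j := forall n, coprime n N -> coprime `|j| n.

(** Cauchy-Schwarz applied to [eigen_mul], with |chi| = 1. A nonzero mass provides the nonzero
    coefficient that [eigen_mul] divides by. *)
Lemma cw_mult j y : smooth j -> 0 < y -> umass j y != 0 -> hecke_mult cw.
Proof.
move=> sj y0 u0.
have [b ub] : exists b, uf k N f b j y != 0.
  apply/not_existsP => h; case/eqP: u0; rewrite /umass big1// => b _.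
  by rewrite uhw_uf//; have /negP := h b%:Z; rewrite negbK => /eqP ->; rewrite Normc.normc0 expr0n mulr0.
move=> n m n0 m0.
have rhs0 : 0 <= (size (divisors n))%:R * (\sum_(d <- divisors n | (n %/ d %| m)%N) cw (m %/ (n %/ d) * d)%N / (n %/ d)%N%:R ^+ 2).
  by rewrite mulr_ge0// sumr_ge0// => d _; rewrite divr_ge0 ?cw_ge0 ?exprn_ge0.
rewrite {1 2}/cw n0 m0 /=; case: ifPn => nN; last by rewrite mul0r.
case: ifPn => mN; last by rewrite mulr0.
have h := eigen_mul N0 gf dchi neb eig sj y0 ub n0 m0 nN mN.
have nR : n%:R != 0 :> R by rewrite pnatr_eq0 -lt0n.
have mR : m%:R != 0 :> R by rewrite pnatr_eq0 -lt0n.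
have nk : 0 < n%:R ^+ k :> R by rewrite exprn_gt0 ?ltr0n.
have mk : 0 < m%:R ^+ k :> R by rewrite exprn_gt0 ?ltr0n.
rewrite /hecke_weight mulrACA -exprMn -normcM h -invfM ler_pdivrMr ?mulr_gt0//.
set X := fun d => _ in h *.
pose r := [seq d <- divisors n | (n %/ d %| m)%N].
apply: (@le_trans _ _ ((\sum_(d <- divisors n | (n %/ d %| m)%N)
   normc (chi (n %/ d)%N * ((n %/ d)%:R ^+ k / (n %/ d)%:R) * a (m %/ (n %/ d) * d)%N)) ^+ 2)).
  apply: lerXn2r; rewrite ?nnegrE ?normc_ge0//; last exact: normc_sum.
  by apply: sumr_ge0 => d _; exact: normc_ge0.
apply: (le_trans (sqr_sum_le _ _ _)).
rewrite -mulrA; apply: ler_wpM2l => //; rewrite mulr_suml big_seq_cond [leRHS]big_seq_cond.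
apply: ler_sum => d /andP[]; rewrite -dvdn_divisors// => dn em.
have d0 := dvdn_gt0 n0 dn.
have nE : n = (n %/ d * d)%N by rewrite divnK.
set e := (n %/ d)%N in nE em *.
have e0 : (0 < e)%N by rewrite divn_gt0// dvdn_leq.
have mE : m = (m %/ e * e)%N by rewrite divnK.
set l := (m %/ e)%N in mE *.
have l0 : (0 < l)%N by rewrite divn_gt0// dvdn_leq.
have eN : coprime e N by apply: coprime_dvdl nN; rewrite nE dvdn_mulr.
have ldN : coprime (l * d) N.
  rewrite coprimeMl; apply/andP; split; first by apply: coprime_dvdl mN; rewrite mE dvdn_mulr.
  exact: coprime_dvdl nN.
rewrite /cw muln_gt0 l0 d0 ldN /= /hecke_weight !normcM (normc_chi N0 dchi eN) mul1r.
have normc_nat i : normc (i%:R : R[i]) = i%:R by rewrite -(rmorph_nat (real_complex R)) normc_real ger0_norm.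
have -> : normc ((e%:R : R[i]) ^+ k) = e%:R ^+ k.
  by rewrite -natrX normc_nat natrX.
have -> : normc ((e%:R : R[i])^-1) = e%:R^-1.
  by rewrite -(rmorph_nat (real_complex R)) -fmorphV normc_real ger0_norm.
have eR : e%:R != 0 :> R by rewrite pnatr_eq0 -lt0n.
have dR : d%:R != 0 :> R by rewrite pnatr_eq0 -lt0n.
have lR : l%:R != 0 :> R by rewrite pnatr_eq0 -lt0n.
rewrite mE nE !natrM !exprMn; apply: eq_ler; field.
by rewrite eR !expf_neq0.
Qed.

Lemma tail_weights j t n : smooth j -> 0 < t -> (0 < n)%N -> coprime n N ->
  utail_int (n%:Z * j) t = (n%:R * cw n * ujay j (n%:R * t))%:E.
Proof.
move=> sj t0 n0 nN; rewrite (utail_int_hecke N0 C0 gf dchi neb condM eig n0 nN (sj n nN) t0).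
by rewrite /cw n0 nN /= [n%:R * hecke_weight _ _ _]mulrC.
Qed.

Definition cops X := [seq n <- iota 1 X | coprime n N].

Lemma sum_tail_weights j t X : smooth j -> 0 < t ->
  (\sum_(n <- cops X) utail_int (n%:Z * j) t = (\sum_(n <- iota 1 X) n%:R * cw n * ujay j (n%:R * t))%:E)%E.
Proof.
move=> sj t0; rewrite -sumEFin /cops big_filter [in LHS]big_mkcond big_seq [RHS]big_seq.
apply: eq_bigr => n; rewrite mem_iota => /andP[n0 _]; case: ifPn => nN; first exact: tail_weights.
by rewrite /cw (negbTE nN) andbF mulr0 mul0r.
Qed.

Let B1 := N1%:R * S ^+ 2 / q%:R.

Let B10 : 0 <= B1. Proof. by rewrite divr_ge0// mulr_ge0 ?sqr_ge0. Qed.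

(** The moment inequality with B0 = N1 S^2 from [umass_bessel], B1 from [umass_le] and Q = q,
    followed by a 2^s-th root. Without the Hecke relations the factor of B1 would be q itself. *)
Lemma sum_tail_le s de K j t X : moment_ineq s de K -> 1 <= K -> smooth j -> j != 0 -> 0 < t -> (0 < X)%N ->
  (\sum_(n <- cops X) utail_int (n%:Z * j) t <=
    ((K * X%:R `^ de * q%:R) `^ ((2 ^ s)%:R^-1) * B1 / t)%:E)%E.
Proof.
move=> hK K1 sj j0 t0 X0; rewrite sum_tail_weights// lee_fin ler_pdivlMr// mulrC.
have qR : 0 < q%:R :> R by rewrite ltr0n.
have K0 : 0 <= K by exact: le_trans K1.
set A := t * _.
have A0 : 0 <= A.
  by rewrite mulr_ge0 ?(ltW t0)// sumr_ge0// => n _; rewrite !mulr_ge0 ?cw_ge0// ujay_ge0.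
have r0 : (0 < 2 ^ s)%N by rewrite expn_gt0.
have rR : (2 ^ s)%:R != 0 :> R by rewrite pnatr_eq0 -lt0n.
have h : A ^+ (2 ^ s) <= K * X%:R `^ de * q%:R * B1 ^+ (2 ^ s).
  apply: (hK cw (ujay j) (N1%:R * S ^+ 2)) => //.
  - exact: cw_ge0.
  - by move=> u _; exact: ujay_ge0.
  - by move=> u v u0 uv; exact: (ujay_mono N0 C0 gf dchi neb condM).
  - move=> u u0 hu.
    have [y [y0 uy]] : exists y, 0 < y /\ umass j y != 0.
      apply/not_existsP => hn; case/eqP: hu; rewrite /ujay /utail_int.
      rewrite integral0_eq// => y _; rewrite /utail; case: ifPn => [uy|_]; last by rewrite mul0r.
      have y0 : 0 < y by exact: lt_le_trans uy.
      have [->|hy] := eqVneq (umass j y) 0; first by rewrite mul0r.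
      by case: (hn y).
    exact: cw_mult sj y0 uy.
  - move=> u Y u0; rewrite -lee_fin -sum_tail_weights//.
    rewrite -(big_map (fun n => n%:Z * j) xpredT (fun i => utail_int i u)).
    apply: (sum_utail_le N0 gf u0) => [|y y0]; first by rewrite mulr_ge0 ?sqr_ge0.
    apply: (umass_bessel N0 C0 gf) => //.
    rewrite map_inj_in_uniq ?filter_uniq ?iota_uniq// => n m _ _ /(mulIf j0); by case.
  - move=> u u0; rewrite mulrC -ler_pdivlMr// -lee_fin -(ujayE N0 C0 gf dchi neb condM)//.
    exact: (utail_int_le N0 C0 gf dchi neb condM).
  - by rewrite /B1 [q%:R * _]mulrCA mulfV ?mulr1// gt_eqF.
have h1 := pow_rootP r0 A0 h; apply: (le_trans h1).
rewrite powRM ?exprn_ge0 ?mulr_ge0 ?powR_ge0//.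
by rewrite -[B1 ^+ _]powR_mulrn// -powRrM mulfV// powRr1.
Qed.

Definition smooths J := [seq d <- iota 1 J | \pi(N).-nat d].

Lemma smoothP d : \pi(N).-nat d -> smooth d%:Z /\ smooth (- d%:Z).
Proof.
move=> dN; suff h : smooth d%:Z by split=> // n nN; rewrite abszN; exact: h.
move=> n nN; rewrite absz_nat; have [n0|n0] := posnP n.
  move: nN; rewrite n0 /coprime gcd0n => /eqP N1'; rewrite N1' in dN.
  have d0 : (0 < d)%N by case/andP: dN.
  rewrite gcdn0 eqn_leq d0 andbT leqNgt; apply/negP => d1.
  by move/pnatP: dN => /(_ d0 (pdiv d) (pdiv_prime d1) (pdiv_dvd d)).
apply: (pnat_coprime dN); rewrite -coprime_pi'//; by rewrite coprime_sym.
Qed.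

(** Each m splits into the part composed of primes of N and the part prime to N. *)
Lemma sum_nat_smooth (G : nat -> R) J : (forall n, 0 <= G n) ->
  \sum_(m <- iota 1 J) G m <= \sum_(d <- smooths J) \sum_(n <- cops J) G (n * d)%N.
Proof.
move=> G0; rewrite -(big_allpairs_dep (h := fun d n => (n * d)%N) (F := G)) //=.
apply: sum_sub_le => //; first exact: iota_uniq.
move=> m; rewrite mem_iota add1n ltnS => /andP[m0 mJ].
apply/allpairsP; exists (m`_\pi(N), m`_\pi(N)^')%N; rewrite /= !mem_filter !mem_iota !add1n !ltnS.
rewrite !part_gt0 part_pnat mulnC partnC// !(leq_trans (dvdn_leq m0 (dvdn_part _ _)))//.
by split=> //; rewrite andbT coprime_sym coprime_pi' ?part_gt0// part_pnat.
Qed.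

Lemma rint_periods (g : R -> R) n : continuous g -> (forall x, g (x + 1) = g x) ->
  rint 0 n%:R g = n%:R * rint 0 1 g.
Proof.
move=> cg pg; elim: n => [|n IH]; first by rewrite mul0r /rint set_itv1 Rintegral_set1.
rewrite (@rint_split _ _ n%:R)//; last by rewrite ler_nat.
by rewrite IH -[n.+1%:R]natr1 (rint_periodic _ ler01 cg pg) mulrDl mul1r.
Qed.

Lemma normc_psi b : normc (psi N chi b) = 1.
Proof.
have [n hn] : exists n : nat, (1 + b * c0%:Z = n%:Z %[mod N%:Z])%Z.
  exists `|((1 + b * c0%:Z) %% N%:Z)%Z|%N; rewrite gez0_abs ?modz_ge0 ?modz_mod//.
  by rewrite -lt0n.
rewrite /psi (chi_modz dchi hn); apply: (normc_chi N0 dchi).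
have := psi_coprime N0 b; case: dchi => _ _ nz; rewrite -nz (chi_modz dchi hn) nz.
by rewrite /coprimez /gcdz !absz_nat.
Qed.

Lemma height_sqr (g : R[i] -> R[i]) x y : 0 < y ->
  height k g (x +i* y) ^+ 2 = y ^+ k * normc (g (x +i* y)) ^+ 2.
Proof.
move=> y0; rewrite /height exprMn; congr (_ * _); rewrite -[in LHS]powR_mulrn ?powR_ge0// -powRrM /=.
by rewrite -[RHS]powR_mulrn ?ltW//; congr (_ `^ _); field.
Qed.

Lemma continuous_hline b y : 0 < y -> continuous (fun x => normc (hline (fb b) y x) ^+ 2).
Proof.
move=> y0; have [c1 c2] := fb_ccont gf b y0.
rewrite (_ : (fun x => _) = (fun x => Re (hline (fb b) y x) ^+ 2 + Im (hline (fb b) y x) ^+ 2)).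
  by move=> x; apply: cvgD; apply: cvgM; (try exact: c1); exact: c2.
by apply/funext => x; rewrite normc_nsq.
Qed.

(** Parseval with frequencies cut off at J; the coefficient decay of [uhw_decay] controls the rest.
    Integrating over [0, 1] is enough because |f_b| has period 1. *)
Lemma fiber_le y J : 0 < y -> (0 < J)%N ->
  \sum_(b < N1) y ^+ k * rint 0 1 (fun x => normc (hline (fb b%:Z) y x) ^+ 2) <=
  \sum_(j <- zr J) umass j y + N1%:R * (2 * (8 + 4 * C ^+ 2) * S ^+ 2 * (N%:R / y) ^+ 2 / J%:R).
Proof.
move=> y0 J0; have N0R : 0 < N%:R :> R by rewrite ltr0n.
rewrite exchange_big /= -[N1 in X in _ + X]card_ord mulr_natl -sumr_const -big_split /=.
apply: ler_sum => b _; set F := hline (fb b%:Z) y.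
have yk : 0 < y ^+ k by rewrite exprn_gt0.
have yp : 0 < y `^ (k%:R / 2) by exact: powR_gt0.
have yE : y ^+ k = y `^ (k%:R / 2) * y `^ (k%:R / 2).
  by rewrite -powRD ?(gt_eqF y0) ?implybT// -powR_mulrn ?ltW//; congr (_ `^ _); field.
have cn := @continuous_hline b%:Z y y0.
have F1 x : normc (F (x + 1)) ^+ 2 = normc (F x) ^+ 2.
  have uz : uhp (x +i* y) := y0.
  have := fb_add1 N0 neb b%:Z uz; rewrite /F /hline => e.
  have -> : (x + 1) +i* y = (x +i* y) + 1 by apply/eqP; rewrite eq_complex /= addr0 !eqxx.
  by rewrite e normcM normc_psi mul1r.
have -> : rint 0 1 (fun x => normc (F x) ^+ 2) = N%:R^-1 * rint 0 N%:R (fun x => normc (F x) ^+ 2).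
  by rewrite rint_periods// mulrA mulVf ?mul1r// gt_eqF.
have dg := SL2Z_gam N b%:Z.
pose D := 8 + 4 * C ^+ 2.
have dec j : j != 0 -> normc (fc N%:R F j) <= (D * S * (N%:R / y) ^+ 2 / y `^ (k%:R / 2)) / `|j|%:R ^+ 2.
  move=> j0; have nj : 0 < `|j|%N%:R :> R by rewrite ltr0n absz_gt0.
  have := uhw_decay N0 C0 gf dg j0 y0; rewrite /uhw /uh -/F -/D => h.
  rewrite mulrAC ler_pdivlMr// mulrC; apply: (le_trans h).
  by apply: eq_ler; field; rewrite !gt_eqF.
have bd x : normc (F x) <= S / y `^ (k%:R / 2).
  have uz : uhp (x +i* y) := y0.
  rewrite ler_pdivlMr// mulrC.
  rewrite -[leLHS]/(height k (fb b%:Z) (x +i* y)) height_slash//.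
  by apply: (height_sup N0 C0 gf); exact: uhp_moebius.
have := parseval_le N0R (fb_ccont gf b%:Z y0) (fun x => fb_per gf b%:Z x y0) dec J0 bd.
move/(ler_wpM2l (ltW yk))/le_trans; apply.
rewrite mulrDr; apply: lerD.
  by rewrite mulr_sumr; apply: ler_sum => j _; rewrite uhw_uf.
rewrite yE -/D; apply: eq_ler; field.
by rewrite !gt_eqF// ltr0n.
Qed.

Lemma zr_sum_le J (G : int -> R) : (forall j, 0 <= G j) -> G 0 = 0 -> \sum_(j <- zr J) G j <=
  \sum_(d <- smooths J) (\sum_(n <- cops J) G (n%:Z * d%:Z) + \sum_(n <- cops J) G (n%:Z * (- d%:Z))).
Proof.
move=> u0 G0.
apply: (@le_trans _ _ (\sum_(j <- 0 :: ([seq m%:Z | m <- iota 1 J] ++ [seq - m%:Z | m <- iota 1 J])) G j)).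
  apply: sum_sub_le => //; first exact: uniq_zr.
  move=> j; rewrite (mem_zr (@ltr01 R)) in_cons mem_cat => jJ.
  have [//|j0] := eqVneq j 0; rewrite orFb; apply/orP.
  case: j jJ j0 => m jJ j0; [left|right]; apply/seq.mapP.
    by exists m => //; rewrite mem_iota add1n ltnS; move: jJ j0; rewrite absz_nat lt0n => -> ->.
  by exists m.+1; [rewrite mem_iota; lia|rewrite NegzE].
rewrite big_cons G0 add0r big_cat !big_map big_split; apply: lerD.
  by apply: (le_trans (sum_nat_smooth J (fun n => u0 n%:Z))).
apply: (le_trans (sum_nat_smooth J (fun n => u0 (- n%:Z)))).
apply: eq_ler; apply: eq_bigr => d _; apply: eq_bigr => n _.
by rewrite PoszM mulrN.
Qed.

Definition mass p : R := \sum_(b < N1) height k (fb b%:Z) (toC p) ^+ 2.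

Lemma mass_ge0 p : 0 <= mass p.
Proof. by apply: sumr_ge0 => b _; exact: sqr_ge0. Qed.

Lemma measurable_height (g : R[i] -> R[i]) : (forall z, uhp z -> ccat g z) ->
  mfunT (fun p : plane R =>
    if 0 < p.2 then height k g (toC p) else 0).
Proof.
move=> cg; rewrite (_ : (fun p => _) = (fun p : plane R =>
    p.2 `^ (k%:R / 2) * (if 0 < p.2 then normc (g (toC p)) else 0))); last first.
  by apply/funext => -[x y] /=; case: ifP; rewrite ?mulr0.
apply: measurable_funM; last exact: measurable_normc.
exact: (measurableT_comp (@measurable_powR R _) measurable_snd).
Qed.

Lemma measurable_mass : mfunT (fun p : plane R =>
    if 0 < p.2 then mass p else 0).
Proof.
rewrite (_ : (fun p => _) = (fun p : plane R =>
    \sum_(b < N1) (if 0 < p.2 then height k (fb b%:Z) (toC p) else 0) ^+ 2)); last first.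
  apply/funext => p; rewrite /mass; case: ifP => // _.
  by rewrite big1// => b _; rewrite expr0n.
apply: measurable_sum => b; apply: measurable_funX; apply: measurable_height => z uz.
by apply: (slash_ccat gf) => //; exact: SL2Z_gam.
Qed.

Definition strip (Y1 : R) (p : R * R) : bool := (0 <= p.1 <= 1) && (Y1 <= p.2).

Lemma measurable_strip Y1 :
  mfunT (fun p : plane R => (strip Y1 p)%:R : R).
Proof.
rewrite (_ : (fun p => _) = (fun p : plane R =>
   \1_(`[0, 1] : set (measurableTypeR R)) p.1 * \1_(`[Y1, +oo[ : set (measurableTypeR R)) p.2)); last first.
  by apply/funext => -[x y]; rewrite /strip !indicE !mem_setE !in_itv/= andbT -natrM mulnb.
apply: measurable_funM; apply: measurableT_comp; [exact: measurable_indic|exact: measurable_fst|exact: measurable_indic|exact: measurable_snd].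
Qed.

Lemma upper s de K Z (Y1 : R) : moment_ineq s de K -> 1 <= K -> (0 < Z)%N -> Z%:R^-1 <= Y1 ->
  (hyp (fun p => ((strip Y1 p)%:R * mass p)%:E) <=
   ((2 * (size (smooths (N ^ 3 * Z ^ 2)))%:R * ((K * (N ^ 3 * Z ^ 2)%:R `^ de * q%:R) `^ ((2 ^ s)%:R^-1) * B1)
     + 2 * (8 + 4 * C ^+ 2) * (N1%:R * S ^+ 2) / N%:R) / Y1)%:E)%E.
Proof.
(* For y >= 1/Z the truncation error of [fiber_le] contains (N / y)^2 / J, which this J makes at
   most 1/N. *)
move=> hK K1 Z0 ZY; set J := (N ^ 3 * Z ^ 2)%N.
have ZR : 0 < Z%:R :> R by rewrite ltr0n.
have NR : 0 < N%:R :> R by rewrite ltr0n.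
have J0 : (0 < J)%N by rewrite muln_gt0 !expn_gt0 N0 Z0.
have Y10 : 0 < Y1 by apply: lt_le_trans ZY; rewrite invr_gt0.
pose E := 2 * (8 + 4 * C ^+ 2) * (N1%:R * S ^+ 2) / N%:R.
have E0 : 0 <= E.
  by rewrite /E divr_ge0// !mulr_ge0// ?sqr_ge0// addr_ge0// mulr_ge0// sqr_ge0.
pose h p : \bar R := ((strip Y1 p)%:R * (if 0 < p.2 then mass p else 0))%:E.
rewrite (_ : hyp _ = hyp h); last by apply: eq_hyp => p p0; rewrite /h p0.
have mh : mfunT h.
  apply/measurable_EFinP; apply: measurable_funM; first exact: measurable_strip.
  exact: measurable_mass.
have h0 p : (0 <= h p)%E by rewrite lee_fin mulr_ge0//; case: ifP => // _; exact: mass_ge0.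
rewrite (hyp_tonelli mh h0).
pose V y : \bar R := (\sum_(j <- zr J) (utail k N f j Y1 y * hyp_weight y)%:E + (E * (if Y1 <= y then hyp_weight y else 0))%:E)%E.
have mu_ j : mfunT (fun y => (utail k N f j Y1 y * hyp_weight y)%:E).
  exact: (measurable_utailw N0 gf).
have u0 j y : (0 <= (utail k N f j Y1 y * hyp_weight y)%:E)%E by exact: utailw_ge0.
have mE : mfunT (fun y => (E * (if Y1 <= y then hyp_weight y else 0))%:E).
  exact: measurable_tail_cst.
have e0 y : (0 <= (E * (if Y1 <= y then hyp_weight y else 0))%:E)%E.
  by rewrite lee_fin mulr_ge0//; case: ifP => // _; exact: hyp_weight_ge0.
apply: (@le_trans _ _ (\int[mu]_y V y)%E).
  apply: ge0_le_integral => //.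
  - by move=> y _; rewrite mule_ge0 ?lee_fin ?hyp_weight_ge0//; exact: integral_ge0.
  - apply: emeasurable_funM; first exact: measurable_fun_fubini_tonelli_G.
    by apply/measurable_EFinP; exact: measurable_hyp_weight.
  - by apply: emeasurable_funD => //; exact: emeasurable_sum.
  - move=> y _; rewrite /V sumEFin -EFinD -mulr_suml /utail.
    have [yY|yY] := leP Y1 y; last first.
      rewrite integral0_eq ?mul0e ?lee_fin//.
        by rewrite big1// mul0r mulr0 addr0.
      by move=> x _; rewrite /h /strip/= (lt_geF yY) andbF mul0r.
    have y0 : 0 < y by exact: lt_le_trans yY.
    rewrite -mulrDl [leRHS]EFinM; apply: lee_pmul; rewrite ?lee_fin ?hyp_weight_ge0//.
      exact: integral_ge0.
    pose G x := \sum_(b < N1) y ^+ k * normc (hline (fb b%:Z) y x) ^+ 2.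
    have cG : continuous G.
      apply: continuous_bigsum => b x; apply: cvgM; first exact: cvg_cst.
      exact: continuous_hline.
    have -> : (\int[mu]_x h (x, y) = (rint 0 1 G)%:E)%E.
      rewrite -rint_EFin// [RHS]integral_mkcond; apply: eq_integral => x _.
      rewrite patchE mem_setE in_itv /h /strip /= yY andbT y0.
      case: ifP => _; rewrite ?mul1r ?mul0r//; congr (_%:E).
      by apply: eq_bigr => b _; exact: height_sqr.
    rewrite lee_fin.
    have -> : rint 0 1 G = \sum_(b < N1) y ^+ k * rint 0 1 (fun x => normc (hline (fb b%:Z) y x) ^+ 2).
      rewrite rint_sum//.
        by apply: eq_bigr => b _; rewrite rintZ//; exact: continuous_hline.
      by move=> b x; apply: cvgM; [exact: cvg_cst|exact: continuous_hline].
    apply: (le_trans (fiber_le y0 J0)); rewrite lerD2l.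
    have yZ : y^-1 <= Z%:R by rewrite -[leRHS]invrK lef_pV2 ?posrE ?invr_gt0// (le_trans ZY).
    have hJ : (N%:R / y) ^+ 2 / J%:R <= N%:R^-1.
      rewrite ler_pdivrMr ?ltr0n// exprMn /J natrM !natrX.
      have -> : N%:R^-1 * (N%:R ^+ 3 * Z%:R ^+ 2) = N%:R ^+ 2 * Z%:R ^+ 2 :> R by field; rewrite gt_eqF.
      apply: ler_wpM2l; first by rewrite exprn_ge0.
      by apply: lerXn2r; rewrite ?nnegrE ?invr_ge0// ltW.
    have W0 : 0 <= N1%:R * (2 * (8 + 4 * C ^+ 2) * S ^+ 2).
      by rewrite !mulr_ge0 ?sqr_ge0// addr_ge0// mulr_ge0// sqr_ge0.
    have := ler_wpM2l W0 hJ; rewrite /E => h1.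
    apply: le_trans (le_trans h1 _); apply: eq_ler; ring.
rewrite ge0_integralD//; last 2 first.
- by move=> y _; exact: sume_ge0.
- exact: emeasurable_sum.
rewrite ge0_integral_sum// (integral_tail_cst Y10 E0) mulrDl EFinD; apply: leeD2r.
have jE j : utail_int j Y1 = (ujay j Y1)%:E by exact: (ujayE N0 C0 gf dchi neb condM).
have u00 : ujay 0 Y1 = 0.
  rewrite /ujay /utail_int integral0_eq// => y _; rewrite /utail.
  case: ifPn => [yY|_]; last by rewrite mul0r.
  by rewrite (umass0 gf) ?mul0r// (lt_le_trans Y10).
have -> : (\sum_(j <- zr J) \int[mu]_y (utail k N f j Y1 y * hyp_weight y)%:E = (\sum_(j <- zr J) ujay j Y1)%:E)%E.
  by rewrite -sumEFin; apply: eq_bigr => j _; rewrite -jE.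
rewrite lee_fin; apply: (le_trans (zr_sum_le J (fun j => ujay_ge0 k N f j Y1) u00)).
set Bd := _ `^ _ * B1.
have hd j : smooth j -> j != 0 -> \sum_(n <- cops J) ujay (n%:Z * j) Y1 <= Bd / Y1.
  move=> sj j0; rewrite -lee_fin -sumEFin.
  under eq_bigr => n _ do rewrite -jE.
  exact: sum_tail_le hK K1 sj j0 Y10 J0.
apply: (@le_trans _ _ (\sum_(d <- smooths J) (2 * Bd / Y1))); last first.
  rewrite big_const_seq count_predT iter_addr_0 -mulr_natl; apply: eq_ler; ring.
rewrite big_seq [leRHS]big_seq; apply: ler_sum => d; rewrite mem_filter mem_iota => /andP[sd /andP[d0 _]].
have [s1 s2] := smoothP sd.
have -> : 2 * Bd / Y1 = Bd / Y1 + Bd / Y1 by ring.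
by apply: lerD; apply: hd; rewrite // ?oppr_eq0 -lt0n.
Qed.
End Upper.

(** * Mass transport to the fundamental domain *)

Section Transport.
Variables (R : realType) (I : countType) (P : pred I).
Local Open Scope ereal_scope.
Implicit Types (F : I -> \bar R) (s : seq I).
Local Notation mu2 := (@lebesgue_measure R \x @lebesgue_measure R).

(** A sum over the countable type of indices as a series over the natural numbers, numbers that
    encode no index contributing 0. *)
Definition ser_term F n : \bar R := if pickle_inv n is Some i then (if P i then F i else 0) else 0.

Lemma ser_term_ge0 F n : (forall i, 0 <= F i) -> 0 <= ser_term F n.
Proof. by move=> F0; rewrite /ser_term; case: pickle_inv => // i; case: ifP. Qed.

Lemma esum_sub_le (T : eqType) (s t : seq T) (G : T -> \bar R) :
  uniq s -> {subset s <= t} -> (forall x, 0 <= G x) -> \sum_(x <- s) G x <= \sum_(x <- t) G x.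
Proof.
elim: s t => [|x s IH] t /=; first by move=> _ _ G0; rewrite big_nil; exact: sume_ge0.
move=> /andP[xs us] st G0.
have xt : x \in t by apply: st; rewrite mem_head.
rewrite big_cons (perm_big _ (perm_to_rem xt)) big_cons; apply: leeD2l; apply: IH => // y ys.
have := st y; rewrite in_cons ys orbT => /(_ isT).
rewrite (perm_mem (perm_to_rem xt)) in_cons => /orP[/eqP yx|//].
by rewrite -yx ys in xs.
Qed.

Lemma ser_ge F s : uniq s -> all P s -> (forall i, 0 <= F i) ->
  \sum_(i <- s) F i <= \sum_(n <oo) ser_term F n.
Proof.
move=> us Ps F0; have t0 n := ser_term_ge0 n F0.
pose k := (\max_(i <- s) (pickle i).+1)%N.
apply: le_trans (nneseries_lim_ge (P := xpredT) (m := 0%N) k (fun n _ _ => t0 n)).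
apply: (@le_trans _ _ (\sum_(n <- [seq pickle i | i <- s]) ser_term F n)).
  rewrite big_map big_seq [leRHS]big_seq; apply: lee_sum => i si.
  by rewrite /ser_term pickleK_inv (allP Ps).
apply: esum_sub_le => //; first by rewrite map_inj_uniq//; exact: (pcan_inj pickleK_inv).
move=> n /seq.mapP[i si ->]; rewrite mem_index_iota /=.
exact: (@leq_bigmax_seq _ _ xpredT (fun i => (pickle i).+1)).
Qed.

Lemma ser_le F (E : \bar R) : (forall i, 0 <= F i) ->
  (forall s, uniq s -> all P s -> \sum_(i <- s) F i <= E) -> \sum_(n <oo) ser_term F n <= E.
Proof.
move=> F0 h; have t0 n := ser_term_ge0 n F0.
apply: lime_le; first by apply: is_cvg_nneseries => n _ _; exact: t0.
apply: nearW => k; apply: le_trans (h [seq i <- pmap pickle_inv (index_iota 0 k) | P i] _ _).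
- rewrite big_filter big_mkcond /=; elim: (index_iota 0 k) => [|n r IH]; first by rewrite !big_nil.
  rewrite big_cons /=; case e: (pickle_inv n) => [i|] /=.
    have -> : ser_term F n = if P i then F i else 0 by rewrite /ser_term e.
    by rewrite big_cons; case: ifP => _; [exact: leeD2l|rewrite add0e].
  by rewrite {1}/ser_term e add0e.
- by rewrite filter_uniq// (pmap_uniq (@pickle_invK I))// iota_uniq.
- exact: filter_all.
Qed.

Lemma hyp_series (F : I -> R * R -> \bar R) : (forall i p, 0 <= F i p) ->
  (forall i, P i -> mfunT (F i)) ->
  hyp (fun p => \sum_(n <oo) ser_term (F^~ p) n) = \sum_(n <oo) ser_term (fun i => hyp (F i)) n.
Proof.
move=> F0 mF; rewrite /hyp.
have w0 (p : R * R) : (0 <= hyp_weight p.2)%R := hyp_weight_ge0 p.2.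
have t0 n p : 0 <= ser_term (F^~ p) n by apply: ser_term_ge0.
under eq_integral => p _.
  rewrite muleC -nneseriesZl; last by move=> n _; exact: t0.
  over.
rewrite integral_nneseries//.
- apply: eq_eseriesr => n _; rewrite /ser_term; case: pickle_inv => [i|]; last first.
    by rewrite integral0_eq// => p _; rewrite mule0.
  case: ifP => _; first by apply: eq_integral => p _; rewrite muleC.
  by rewrite integral0_eq// => p _; rewrite mule0.
- move=> n; rewrite /ser_term; case: pickle_inv => [i|]; last by under eq_fun do rewrite mule0; exact: measurable_cst.
  case Pi: (P i); last by under eq_fun do rewrite mule0; exact: measurable_cst.
  by under eq_fun do rewrite muleC; apply: measurable_hyp_integrand; exact: mF.
- by move=> n p _; rewrite mule_ge0// lee_fin.
Qed.

Lemma hyp_le (E1 E2 : R * R -> \bar R) : mfunT E1 -> mfunT E2 ->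
  (forall p, 0 <= E1 p) -> (forall p, 0 <= E2 p) ->
  (forall p, (0 < p.2)%R -> E1 p <= E2 p) -> hyp E1 <= hyp E2.
Proof.
move=> m1 m2 E10 E20 le; apply: ge0_le_integral => //.
- by move=> p _; rewrite mule_ge0// lee_fin hyp_weight_ge0.
- exact: measurable_hyp_integrand.
- exact: measurable_hyp_integrand.
- move=> p _; rewrite /hyp_weight /invpos; case: ifPn => p0; last by rewrite expr0n !mule0.
  by apply: lee_pmul => //; [rewrite lee_fin sqr_ge0|exact: le].
Qed.

Variables (m : I -> 'M[int]_2) (b : I -> R * R -> \bar R) (H E1 E2 : R * R -> \bar R).
Hypothesis mSL : forall i, P i -> SL2Z (m i).
Hypothesis mb : forall i, mfunT (b i).
Hypothesis b0 : forall i p, 0 <= b i p.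
Hypothesis mH : mfunT H.
Hypothesis H0 : forall p, 0 <= H p.

(** By invariance the integral of H(z) b_i(m_i z) equals that of b_i(w) H(m_i^-1 w). Summed over i,
    the first form is bounded below pointwise, for which one finite set of indices per point
    suffices, and the second is bounded above, for which all finite sets have to be considered. *)
Lemma mass_transport : mfunT E1 -> mfunT E2 ->
  (forall p, 0 <= E1 p) -> (forall p, 0 <= E2 p) ->
  (forall z, (0 < z.2)%R -> exists s, [/\ uniq s, all P s & E1 z <= \sum_(i <- s) H z * b i (mobp (m i) z)]) ->
  (forall w, (0 < w.2)%R -> forall s, uniq s -> all P s -> \sum_(i <- s) b i w * H (mobp (inv2 (m i)) w) <= E2 w) ->
  hyp E1 <= hyp E2.
Proof.
move=> m1 m2 E10 E20 low up.
pose F i p := if P i then H p * b i (mobp (m i) p) else 0.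
pose F' i p := if P i then b i p * H (mobp (inv2 (m i)) p) else 0.
have F0 i p : 0 <= F i p by rewrite /F; case: ifP => // _; exact: mule_ge0.
have F'0 i p : 0 <= F' i p by rewrite /F'; case: ifP => // _; exact: mule_ge0.
have mF i : P i -> mfunT (F i).
  move=> Pi; rewrite /F Pi; apply: emeasurable_funM => //.
  by apply: measurableT_comp => //; exact: measurable_mobp (mSL Pi).
have mF' i : P i -> mfunT (F' i).
  move=> Pi; rewrite /F' Pi; apply: emeasurable_funM => //.
  by apply: measurableT_comp => //; exact: measurable_mobp (SL2Z_inv (mSL Pi)).
have mS (G : I -> R * R -> \bar R) : (forall i p, 0 <= G i p) -> (forall i, P i -> mfunT (G i)) ->
    mfunT (fun p => \sum_(n <oo) ser_term (G^~ p) n).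
  move=> G0 mG; apply: ge0_emeasurable_sum => [n p _ _|n _]; first by apply: ser_term_ge0.
  rewrite /ser_term; case: pickle_inv => [i|]; last exact: measurable_cst.
  by case Pi: (P i); [exact: mG|exact: measurable_cst].
have S0 (G : I -> R * R -> \bar R) : (forall i p, 0 <= G i p) -> forall p, 0 <= \sum_(n <oo) ser_term (G^~ p) n.
  by move=> G0 p; apply: nneseries_ge0 => n _ _; apply: ser_term_ge0.
apply: (@le_trans _ _ (hyp (fun p => \sum_(n <oo) ser_term (F^~ p) n))).
  apply: hyp_le => //; [exact: mS|exact: S0|].
  move=> z z0; have [s [us Ps le]] := low z z0; apply: (le_trans le).
  rewrite [leLHS](_ : _ = \sum_(i <- s) F i z); first exact: ser_ge.
  by rewrite big_seq [RHS]big_seq; apply: eq_bigr => i si; rewrite /F (allP Ps).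
rewrite hyp_series// (_ : \sum_(n <oo) _ = \sum_(n <oo) ser_term (fun i => hyp (F' i)) n); last first.
  apply: eq_eseriesr => n _; rewrite /ser_term; case: pickle_inv => // i; case: ifP => // Pi.
  have dg := mSL Pi; have di := SL2Z_inv dg.
  rewrite -(hyp_mobp di (mF i Pi) (F0 i)); apply: eq_hyp => w w0.
  rewrite /F /F' /= Pi muleC; congr (b i _ * _).
  by rewrite -mobp_mul// mulmxK2// /mobp moebius1 toCK.
rewrite -hyp_series//; apply: hyp_le => //; [exact: mS|exact: S0|].
move=> w w0; apply: ser_le => // s us Ps; apply: le_trans (up w w0 s us Ps).
by rewrite big_seq [leRHS]big_seq; apply: lee_sum => i si; rewrite /F' (allP Ps).
Qed.
End Transport.

(** * The fundamental domain of Gamma0(N) and its translates *)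

Lemma Gamma0_SL2 N g : Gamma0 N g -> SL2Z g. Proof. by case. Qed.

Lemma Gamma0_1 N : Gamma0 N 1%:M.
Proof. by split; [exact: SL2Z1|rewrite mxE dvdz0]. Qed.

Lemma Gamma0_mul N g h : Gamma0 N g -> Gamma0 N h -> Gamma0 N (g *m h).
Proof.
move=> [dg cg] [dh ch]; split; first exact: SL2Z_mul.
by rewrite mulmx2E; apply: rpredD; [exact: dvdz_mulr|exact: dvdz_mull].
Qed.

Lemma Gamma0_inv N g : Gamma0 N g -> Gamma0 N (inv2 g).
Proof. by move=> [dg cg]; split; [exact: SL2Z_inv|rewrite mat2E rpredN]. Qed.

Lemma Gamma0_T N n : Gamma0 N (Tmat n).
Proof. by split; [exact: SL2Z_T|rewrite mat2E dvdz0]. Qed.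

Section FundDom.
Variables (R : realType) (N : nat).
Implicit Types (z w : R[i]) (g h : 'M[int]_2).
Local Notation A := (@fund_dom R (Gamma0 N)).

Lemma measurable_le_set (u v : plane R -> R) :
  mfunT u -> mfunT v -> measurable [set p | u p <= v p].
Proof.
move=> mu_ mv; have := measurable_fun_ler mu_ mv measurableT (Y := [set true]) I.
by rewrite setTI; congr measurable; apply/seteqP; split=> p /=.
Qed.

Lemma measurable_fund_dom :
  measurable ([set p | A (p.1 +i* p.2)] : set (plane R)).
Proof.
pose Sg g : set (plane R) :=
  [set p | (mobp g p).2 <= p.2] `&`
  (~` ([set p | p.2 <= (mobp g p).2] `&` [set p | 0 <= (mobp g p).1]) `|` [set p | p.1 <= (mobp g p).1]).
have -> : [set p : R * R | A (p.1 +i* p.2)] = (~` [set p | p.2 <= 0]) `&` [set p | 0 <= p.1] `&`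
   \bigcap_(n : nat) (if pickle_inv n is Some g then (if `[< Gamma0 N g >] then Sg g else setT) else setT).
  apply/seteqP; split=> -[x y].
    move=> [/= uz x0 h]; split; first by split=> //; apply/negP; rewrite -ltNge.
    move=> n _; case: pickle_inv => // g; case: asboolP => // Gg.
    have [h1 h2] := h g Gg; split=> //.
    have [e|ne] := pselect (Im (moebius g (x +i* y)) = y).
      by have [r|r] := pselect (0 <= Re (moebius g (x +i* y))); [right; apply: h2|left=> -[]].
    by left=> -[/= h3 _]; apply: ne; apply/eqP; rewrite eq_le h1.
  move=> [[/= /negP y0 x0] h]; split=> //; first by rewrite /uhp /= ltNge.
  move=> g Gg; have := h (pickle g) I; rewrite pickleK_inv; case: asboolP => // _ [/= h1 h2].
  by split=> // e r; case: h2 => // -[]; split=> //; rewrite /mobp /= e.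
apply: measurableI.
  by apply: measurableI; [apply: measurableC|]; exact: measurable_le_set.
apply: bigcapT_measurable => n; case: pickle_inv => [g|]; last exact: measurableT.
case: asboolP => [Gg|_]; last exact: measurableT.
have mg := measurable_mobp (Gamma0_SL2 Gg) (R := R).
have mg1 : mfunT (fun p : plane R => (mobp g p).1).
  exact: (measurableT_comp measurable_fst mg).
have mg2 : mfunT (fun p : plane R => (mobp g p).2).
  exact: (measurableT_comp measurable_snd mg).
apply: measurableI; first exact: measurable_le_set.
apply: measurableU; last exact: measurable_le_set.
by apply: measurableC; apply: measurableI; exact: measurable_le_set.
Qed.

Lemma fund_dom_uniq z g : Gamma0 N g -> A z -> A (moebius g z) -> moebius g z = z.
Proof.
move=> Gg [uz xz hz] [uw xw hw]; have dg := Gamma0_SL2 Gg.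
have [h1 h2] := hz g Gg; have [h3 h4] := hw _ (Gamma0_inv Gg).
rewrite moebiusK// in h3 h4.
have e : Im (moebius g z) = Im z by apply/eqP; rewrite eq_le h1 h3.
have e2 : Re (moebius g z) = Re z by apply/eqP; rewrite eq_le (h2 e xw) (h4 (esym e) xz).
by apply/eqP; rewrite eq_complex e e2 !eqxx.
Qed.

Lemma stabE g z : SL2Z g -> uhp z -> moebius g z = z ->
  [/\ (g 0 0)%:~R = 2 * (g 1 0)%:~R * Re z + (g 1 1)%:~R :> R,
      (g 0 1)%:~R = - ((g 1 0)%:~R * (Re z ^+ 2 + Im z ^+ 2)) :> R &
      ((g 1 0)%:~R * Re z + (g 1 1)%:~R) ^+ 2 + ((g 1 0)%:~R * Im z) ^+ 2 = 1 :> R].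
Proof.
case: z => x y dg uz e; have y0 : 0 < y := uz; have j0 := autj_neq0 dg uz.
have e1 : nsq (autj g (x +i* y)) = 1.
  have := congr1 (@complex.Im R) e; rewrite Im_moebius// /= => /eqP.
  rewrite -[X in _ == X]mulr1 => /eqP /(mulfI (lt0r_neq0 y0)) h.
  by rewrite -[LHS]invrK h invr1.
have e2 : (g 0 0)%:~R * (x +i* y) + (g 0 1)%:~R = (x +i* y) * autj g (x +i* y).
  by rewrite -{2}e /moebius divfK.
rewrite nsq_autj in e1; move: e2; rewrite autjE !intc; simpc => -[r1 r2].
have a1 : (g 0 0)%:~R = 2 * (g 1 0)%:~R * x + (g 1 1)%:~R :> R.
  by apply: (mulIf (lt0r_neq0 y0)); rewrite r2; ring.
split=> //=.
have -> : (g 0 1)%:~R = (x * ((g 1 0)%:~R * x + (g 1 1)%:~R) - y * ((g 1 0)%:~R * y)) - (g 0 0)%:~R * x by rewrite -r1; ring.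
by rewrite a1; ring.
Qed.

(** With t the trace, a matrix fixing z satisfies t^2 / 4 + (c Im z)^2 = 1, so |t| <= 2 and t
    determines c^2. Together with the sign of c it determines the matrix: 5 traces times 3 signs. *)
Lemma stab_size (s : seq 'M[int]_2) z : uhp z -> uniq s ->
  (forall g, g \in s -> SL2Z g /\ moebius g z = z) -> (size s <= 15)%N.
Proof.
move=> uz us hs; have y0 : 0 < Im z := uz.
pose key g := (absz (g 0%R 0%R + g 1%R 1%R + 2)%R, absz (sgz (g 1%R 0%R) + 1)%R).
have trE g : g \in s -> ((g 0 0 + g 1 1)%:~R : R) ^+ 2 / 4 + ((g 1 0)%:~R * Im z) ^+ 2 = 1.
  by move=> /hs[dg e]; have [h1 _ h3] := stabE dg uz e; rewrite -[RHS]h3 intrD h1; field.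
have trB g : g \in s -> -2 <= g 0 0 + g 1 1 <= 2.
  move=> /trE h; have : ((g 0 0 + g 1 1)%:~R : R) ^+ 2 <= 4.
    by have := sqr_ge0 ((g 1 0)%:~R * Im z); lra.
  by rewrite -rmorphXn /= (_ : 4 = 4%:~R)// ler_int => h'; apply/andP; split; nia.
rewrite -(size_map key) (_ : 15%N = size (allpairs pair (iota 0 5) (iota 0 3)))//.
apply: uniq_leq_size; last first.
  move=> _ /seq.mapP[g gs ->]; apply/allpairsP; exists (key g).
  have hB := trB g gs; split; last by [].
    by move: hB; rewrite mem_iota -[(key g).1]/(absz (g 0 0 + g 1 1 + 2)); move: (g 0 0 + g 1 1) => T; lia.
  by rewrite mem_iota -[(key g).2]/(absz (sgz (g 1 0) + 1)); case: sgzP.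
rewrite map_inj_in_uniq// => g h gs hh_ [/eqP e1 /eqP e2].
have et : g 0 0 + g 1 1 = h 0 0 + h 1 1.
  move: (trB g gs) (trB h hh_) e1; move: (g 0 0 + g 1 1) (h 0 0 + h 1 1) => T T' hT hT' /eqP; lia.
have es : sgz (g 1 0) = sgz (h 1 0) by move/eqP: e2; case: sgzP; case: sgzP; lia.
have ec2 : g 1 0 ^+ 2 = h 1 0 ^+ 2.
  have h1 := trE g gs; have h2 := trE h hh_; rewrite et in h1.
  have h3 : ((g 1 0)%:~R * Im z) ^+ 2 = ((h 1 0)%:~R * Im z) ^+ 2 by lra.
  have y2 : Im z ^+ 2 != 0 by rewrite expf_neq0 ?gt_eqF.
  apply: (@intr_inj R); rewrite !rmorphXn /=; apply: (mulIf y2).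
  by move: h3; rewrite !exprMn.
have ec : g 1 0 = h 1 0.
  move/eqP: ec2; rewrite eqf_sqr => /orP[/eqP//|/eqP e]; move: es; rewrite e sgzN => es.
  by have : sgz (h 1 0) = 0 by [lia]; move/eqP; rewrite sgz_eq0 => /eqP ->; rewrite oppr0.
have [dg fg] := hs g gs; have [dh fh] := hs h hh_.
have [a1 b1 _] := stabE dg uz fg; have [a2 b2 _] := stabE dh uz fh.
have etR : (g 0 0)%:~R + (g 1 1)%:~R = (h 0 0)%:~R + (h 1 1)%:~R :> R by rewrite -!intrD et.
have ed : g 1 1 = h 1 1.
  by apply: (@intr_inj R); move: etR; rewrite a1 a2 ec; lra.
have ea : g 0 0 = h 0 0 by apply: (@intr_inj R); move: etR; rewrite ed; lra.
have eb : g 0 1 = h 0 1 by apply: (@intr_inj R); rewrite b1 b2 ec.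
by rewrite (mat2_eta g) (mat2_eta h) ea eb ec ed.
Qed.

(** Two translates of w in the fundamental domain by matrices of the same class are equivalent under
    Gamma0(N), hence equal. So the quotients of these matrices lie in one stabilizer, of at most 15
    elements. *)
Lemma fund_count (K : finType) (cl : 'M[int]_2 -> K) (s : seq 'M[int]_2) w : uhp w -> uniq s ->
  (forall g, g \in s -> SL2Z g) ->
  (forall g h, g \in s -> h \in s -> cl g = cl h -> Gamma0 N (g *m inv2 h)) ->
  (count (fun g => `[< A (moebius g w) >]) s <= 15 * #|K|)%N.
Proof.
move=> uw us ds hc; rewrite -sum1_count (partition_big cl xpredT)//= mulnC -sum_nat_const.
apply: leq_sum => c _; rewrite sum1_count -size_filter.
set t := [seq _ <- _ | _].
have ht g : g \in t -> [/\ g \in s, A (moebius g w) & cl g = c].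
  by rewrite mem_filter => /andP[/andP[/asboolP h /eqP e] gs].
have ut : uniq t by exact: filter_uniq.
case et : t => [//|g0 t']; have [g0s A0 c0] := ht g0 ltac:(by rewrite et mem_head).
have d0 := ds _ g0s.
rewrite -et -(size_map (mulmx^~ (inv2 g0))); apply: (@stab_size _ (moebius g0 w)).
- exact: uhp_moebius.
- rewrite map_inj_in_uniq// => g h gt_ ht_ /(congr1 (mulmx^~ g0)) /=.
  by rewrite -!mulmxA !mulVmx2// !mulmx1.
- move=> _ /seq.mapP[g gt ->]; have [gs Ag cg] := ht g gt; have dg := ds _ gs.
  have di := SL2Z_inv d0; split; first exact: SL2Z_mul.
  apply: fund_dom_uniq => //; first by apply: hc; rewrite // cg c0.
  by rewrite -moebius_mul ?SL2Z_mul// -?mulmxA ?mulVmx2 ?mulmx1//; exact: SL2Z_mul.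
Qed.
End FundDom.

Lemma seq_min (R : realType) (T : eqType) (F : T -> R) (s : seq T) x0 : x0 \in s ->
  exists2 x, x \in s & forall y, y \in s -> F x <= F y.
Proof.
elim: s x0 => [//|a s IH] x0 _; case: s IH => [_|b s IH].
  by exists a; [rewrite mem_head|move=> y; rewrite mem_seq1 => /eqP ->].
have [x xs hx] := IH b (mem_head _ _).
have [h|h] := leP (F a) (F x).
  exists a; first by rewrite mem_head.
  by move=> y; rewrite in_cons => /orP[/eqP ->//|/hx]; exact: le_trans.
exists x; first by rewrite in_cons xs orbT.
by move=> y; rewrite in_cons => /orP[/eqP ->|/hx//]; exact: ltW.
Qed.

Section Representative.
Variables (R : realType) (N : nat).
Implicit Types (z w : R[i]) (g h : 'M[int]_2).
Local Notation A := (@fund_dom R (Gamma0 N)).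

Definition box (B : nat) : seq 'M[int]_2 :=
  [seq mat2 p.1 p.2 r.1 r.2 | p <- [seq (a, b) | a <- zr B, b <- zr B], r <- [seq (a, b) | a <- zr B, b <- zr B]].

Lemma mem_box B g : (forall i j, (`|g i j| <= B)%N) -> g \in box B.
Proof.
move=> h; apply/allpairsP; exists ((g 0 0, g 0 1), (g 1 0, g 1 1)); split; last exact: mat2_eta.
  by apply/allpairsP; exists (g 0 0, g 0 1); rewrite !(mem_zr (@ltr01 R)) !h.
by apply/allpairsP; exists (g 1 0, g 1 1); rewrite !(mem_zr (@ltr01 R)) !h.
Qed.

Lemma absz_le_real (m : int) (B : R) : `|m%:~R : R| <= B -> (`|m| <= (Num.truncn B).+1)%N.
Proof.
move=> h; rewrite -(ler_nat R) natr_absz intr_norm; apply: (le_trans h); apply: ltW; exact: truncnS_gt.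
Qed.

(** The bottom row is controlled by |c z + d| <= 1, and the top row by a z + b = (g z) (c z + d). *)
Lemma entries_bound g z (X Y Y' : R) : SL2Z g -> uhp z -> 0 < Y -> Y <= Im z -> `|Re z| <= X ->
  nsq (autj g z) <= 1 -> `|Re (moebius g z)| <= 1 -> Im (moebius g z) <= Y' ->
  forall i j, `|(g i j)%:~R : R| <= (1 + Y') / Y * (1 + X) + 1 + Y' + X.
Proof.
case: z => x y dg uz Y0 /= Yy xX n1; have y0 : 0 < y := uz.
have j0 := autj_neq0 dg uz; have n0 := nsq_gt0 j0.
move: n1 n0; rewrite nsq_autj => n1 n0.
have X0 : 0 <= X by apply: le_trans xX.
set w := moebius g (x +i* y) => w1 wY.
have uw : uhp w by exact: uhp_moebius.
have Y'0 : 0 <= Y' by apply: le_trans wY; exact: ltW.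
have e2 : (g 0 0)%:~R * (x +i* y) + (g 0 1)%:~R = w * autj g (x +i* y) by rewrite /w /moebius divfK.
move: w1 wY uw e2; case: (w) => u v /= w1 wY v0; rewrite /uhp/= in v0.
rewrite autjE !intc; simpc => -[r1 r2].
move: n1 n0 r1 r2; move: (dg) => _.
set c : R := (g 1 0)%:~R; set d : R := (g 1 1)%:~R; set a : R := (g 0 0)%:~R; set b : R := (g 0 1)%:~R.
move=> n1 n0 r1 r2.
have hcy : `|c * y| <= 1.
  by rewrite -(@ler_pXn2r _ 2)// ?nnegrE// real_normK ?num_real// expr1n; have := sqr_ge0 (c * x + d); lra.
have hcd : `|c * x + d| <= 1.
  by rewrite -(@ler_pXn2r _ 2)// ?nnegrE// real_normK ?num_real// expr1n; have := sqr_ge0 (c * y); lra.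
have yY : y^-1 <= Y^-1 by rewrite lef_pV2.
have hc : `|c| <= Y^-1.
  have -> : c = c * y * y^-1 by rewrite mulfK// gt_eqF.
  rewrite normrM [`|y^-1|]gtr0_norm ?invr_gt0//; apply: le_trans yY.
  by rewrite -[leRHS]mul1r ler_wpM2r// invr_ge0 ltW.
have hd : `|d| <= 1 + X / Y.
  have -> : d = (c * x + d) - c * x by ring.
  apply: (le_trans (ler_normB _ _)); apply: lerD => //.
  by rewrite normrM mulrC; apply: ler_pM.
have v1 : `|v| <= Y' by rewrite gtr0_norm.
have hay : `|a * y| <= 1 + Y'.
  have -> : a * y = u * (c * y) + v * (c * x + d) by rewrite r2; ring.
  apply: (le_trans (ler_normD _ _)); rewrite !normrM -!normrM; apply: lerD; rewrite normrM.
    by rewrite -[1]mulr1; apply: ler_pM.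
  by rewrite -[Y']mulr1; apply: ler_pM.
have ha : `|a| <= (1 + Y') / Y.
  have -> : a = a * y * y^-1 by rewrite mulfK// gt_eqF.
  by rewrite normrM [`|y^-1|]gtr0_norm ?invr_gt0//; apply: ler_pM; rewrite // invr_ge0 ltW.
have hb : `|b| <= 1 + Y' + (1 + Y') / Y * X.
  have -> : b = u * (c * x + d) - v * (c * y) - a * x by have : a * x + b = u * (c * x + d) - v * (c * y) := r1; lra.
  apply: (le_trans (ler_normB _ _)); apply: lerD; last by rewrite normrM; apply: ler_pM.
  apply: (le_trans (ler_normB _ _)); apply: lerD; rewrite normrM.
    by rewrite -[1]mulr1; apply: ler_pM.
  by rewrite -[Y']mulr1; apply: ler_pM.
have P0 : 0 <= (1 + Y') / Y by rewrite divr_ge0 ?addr_ge0// ltW.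
have P1 : Y^-1 <= (1 + Y') / Y by rewrite mulrDl mul1r lerDl mulr_ge0 ?invr_ge0// ltW.
have PX : 0 <= (1 + Y') / Y * X by rewrite mulr_ge0.
have PX1 : X / Y <= (1 + Y') / Y * X by rewrite mulrC ler_wpM2r.
have E : (1 + Y') / Y * (1 + X) = (1 + Y') / Y + (1 + Y') / Y * X by ring.
by move=> i j; rewrite E; case: (ord2P i) => ->; case: (ord2P j) => ->; move: P0 P1 PX PX1 ha hb hc hd; rewrite -/a -/b -/c -/d;
  move: ((1 + Y') / Y) (Y^-1) (_ * X) => q1 q2 q3; move: (X / Y) => q4; lra.
Qed.

(** Only finitely many matrices give |c z + d| <= 1 and a real part in [0, 1). So the minimum of |c
    z + d|, and among its minimizers the least real part, are attained. *)
Lemma fund_rep z : uhp z -> exists2 g, Gamma0 N g & A (moebius g z).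
Proof.
move=> uz; have y0 : 0 < Im z := uz.
(* A lower bound for |c z + d|^2 over all of SL2(Z). It bounds the heights of the translates, as
   [entries_bound] requires. *)
pose mu1 := Num.min 1 (Im z ^+ 2).
have mu0 : 0 < mu1 by rewrite lt_min ltr01 exprn_gt0.
have nsq_mu g : SL2Z g -> mu1 <= nsq (autj g z).
  move=> dg; have -> : nsq (autj g z) = ((g 1 0)%:~R * Re z + (g 1 1)%:~R) ^+ 2 + ((g 1 0)%:~R * Im z) ^+ 2.
    by case: (z) => x y; rewrite nsq_autj.
  have [c0|c0] := eqVneq (g 1 0) 0.
    have := SL2Z_det dg; rewrite c0 mulr0 subr0 => ad.
    have d0 : g 1 1 != 0 by apply/eqP => e; move: ad; rewrite e mulr0.
    have d1 : 1 <= (g 1 1)%:~R ^+ 2 :> R.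
      by rewrite -rmorphXn /= (_ : 1 = 1%:~R)// ler_int -gtz0_ge1 exprn_even_gt0.
    by rewrite mul0r add0r mul0r expr0n addr0; apply: le_trans d1; rewrite ge_min lexx.
  have c1 : 1 <= (g 1 0)%:~R ^+ 2 :> R.
    by rewrite -rmorphXn /= (_ : 1 = 1%:~R)// ler_int -gtz0_ge1 exprn_even_gt0.
  apply: (@le_trans _ _ (Im z ^+ 2)); first by rewrite ge_min lexx orbT.
  rewrite exprMn -[leLHS]add0r; apply: lerD; first exact: sqr_ge0.
  by rewrite -[leLHS]mul1r ler_wpM2r// sqr_ge0.
pose B := (Num.truncn ((1 + Im z / mu1) / Im z * (1 + `|Re z|) + 1 + Im z / mu1 + `|Re z|)).+1.
pose L := [seq g <- box B | [&& `[< Gamma0 N g >], nsq (autj g z) <= 1, 0 <= Re (moebius g z) & Re (moebius g z) < 1]].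
have inL g : Gamma0 N g -> nsq (autj g z) <= 1 -> 0 <= Re (moebius g z) -> Re (moebius g z) < 1 -> g \in L.
  move=> Gg n1 r0 r1; have dg := Gamma0_SL2 Gg; rewrite mem_filter n1 r0 r1 !andbT.
  apply/andP; split; first exact/asboolP.
  apply: mem_box => i j; apply: absz_le_real; apply: (@entries_bound g z) => //.
    by rewrite ger0_norm// ltW.
  rewrite Im_moebius//; apply: ler_pM; rewrite ?invr_ge0 ?(ltW y0)// ?(le_trans (ltW mu0) (nsq_mu g dg))//.
  by rewrite lef_pV2 ?posrE ?nsq_mu// (lt_le_trans mu0)// nsq_mu.
have shift g : Gamma0 N g -> exists n : int, [/\ Gamma0 N (Tmat n *m g), 0 <= Re (moebius (Tmat n *m g) z) < 1,
    Im (moebius (Tmat n *m g) z) = Im (moebius g z), nsq (autj (Tmat n *m g) z) = nsq (autj g z) &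
    Re (moebius (Tmat n *m g) z) <= Re (moebius g z) \/ Re (moebius g z) < 0].
  move=> Gg; have dg := Gamma0_SL2 Gg; exists (- Num.floor (Re (moebius g z))).
  have GT := Gamma0_T N (- Num.floor (Re (moebius g z))); have dT := Gamma0_SL2 GT.
  have e : moebius (Tmat (- Num.floor (Re (moebius g z))) *m g) z = moebius g z - (Num.floor (Re (moebius g z)))%:~R.
    by rewrite moebius_mul// moebius_T rmorphN.
  have eR : Re (moebius (Tmat (- Num.floor (Re (moebius g z))) *m g) z) = Re (moebius g z) - (Num.floor (Re (moebius g z)))%:~R.
    by rewrite e intc; case: (moebius g z).
  have /andP[h1 h2] := floor_itv (Re (moebius g z)); move: h2; rewrite intrD => h2.
  split.
  - exact: Gamma0_mul.
  - by rewrite eR; apply/andP; split; lra.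
  - by rewrite e intc; case: (moebius g z) => u v /=; rewrite subr0.
  - by rewrite autj_mul// autj_T mul1r.
  - rewrite eR; have [h|h] := leP 0 (Re (moebius g z)); [left|by right].
    by rewrite gerBl ler0z floor_ge0.
have [n0 [G0 /andP[r0 r1] _ n1 _]] := shift _ (Gamma0_1 N).
rewrite autj1 in n1; have nsq1 : nsq (1 : R[i]) = 1 by rewrite /nsq /= expr1n expr0n addr0.
rewrite nsq1 in n1.
have L0 : Tmat n0 *m 1%:M \in L by apply: inL => //; rewrite n1.
have [g1 g1L hg1] := seq_min (fun g => nsq (autj g z)) L0.
pose L' := [seq g <- L | nsq (autj g z) == nsq (autj g1 z)].
have L1 : g1 \in L' by rewrite mem_filter eqxx.
have [g g_L hg] := seq_min (fun g => Re (moebius g z)) L1.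
move: g_L; rewrite mem_filter => /andP[/eqP ng gL].
move: (gL); rewrite mem_filter => /andP[/and4P[/asboolP Gg n1g rg0 rg1] _].
have dg := Gamma0_SL2 Gg.
have Imle h : SL2Z h -> nsq (autj g z) <= nsq (autj h z) -> Im (moebius h z) <= Im (moebius g z).
  move=> dh le; rewrite !Im_moebius// ler_wpM2l ?(ltW y0)// lef_pV2 ?posrE//; apply: nsq_gt0; exact: autj_neq0.
exists g => //; split; [exact: uhp_moebius|by []|].
move=> h Gh; have Ghg := Gamma0_mul Gh Gg; have dhg := Gamma0_SL2 Ghg.
rewrite -moebius_mul//; last exact: Gamma0_SL2 Gh.
have [n [Gn /andP[rn0 rn1] In nn rr]] := shift _ Ghg.
have nle : nsq (autj g z) <= nsq (autj (h *m g) z).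
  have [le1|gt1] := leP (nsq (autj (h *m g) z)) 1; last exact: le_trans (ltW gt1).
  by rewrite ng -nn; apply: hg1; apply: inL => //; rewrite nn.
split; first exact: Imle.
move=> eI rh0.
have en : nsq (autj (h *m g) z) = nsq (autj g z).
  move: eI; rewrite !Im_moebius// => /(mulfI (lt0r_neq0 y0)) /(congr1 GRing.inv); by rewrite !invrK.
case: rr => [rr|]; last by rewrite ltNge rh0.
apply: le_trans rr; apply: hg; rewrite mem_filter nn en ng eqxx /=.
by apply: inL => //; rewrite nn en.
Qed.
End Representative.

(** * Volume bounds for the fundamental domain *)

Section Volume.
Variables (R : realType).
Local Notation mu := (@lebesgue_measure R).
Implicit Types (p : R * R).

Definition rect (a b c e : R) p : bool := (a <= p.1 <= b) && (c <= p.2 <= e).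

Lemma measurable_rect a b c e :
  mfunT (fun p : plane R => (rect a b c e p)%:R : R).
Proof.
rewrite (_ : (fun p => _) = (fun p : plane R =>
   \1_(`[a, b] : set (measurableTypeR R)) p.1 * \1_(`[c, e] : set (measurableTypeR R)) p.2)); last first.
  by apply/funext => -[x y]; rewrite /rect !indicE !mem_setE !in_itv/= -natrM mulnb.
apply: measurable_funM; apply: measurableT_comp; [exact: measurable_indic|exact: measurable_fst|exact: measurable_indic|exact: measurable_snd].
Qed.

Lemma integral_itv_nat (a b : R) (c : bool) : a <= b ->
  (\int[mu]_x ((a <= x <= b) && c)%:R%:E = (if c then b - a else 0)%:E)%E.
Proof.
move=> ab; case: c; last by under eq_integral => x _ do rewrite andbF; rewrite integral_cst// mul0e.
transitivity (\int[mu]_x (\1_(`[a, b] : set (measurableTypeR R)) x)%:E)%E.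
  by apply: eq_integral => x _; rewrite andbT indicE mem_setE in_itv.
transitivity (mu [set` `[a, b]]).
  by rewrite integral_indic ?setIT//; exact: measurable_itv.
rewrite lebesgue_measure_itv /= lte_fin; by case: ltgtP ab => // -> _; rewrite subrr.
Qed.

Lemma hyp_strip (t : R) : 0 < t -> (hyp (fun p : R * R => ((strip t p)%:R)%:E) = (t^-1)%:E)%E.
Proof.
move=> t0; rewrite hyp_tonelli; last by move=> p; rewrite lee_fin.
  rewrite -integral_inv_sqr//; apply: eq_integral => y _; rewrite /strip /= integral_itv_nat// subr0.
  by rewrite -EFinM; case: ifP; rewrite ?mul1r ?mul0r.
by apply/measurable_EFinP; exact: measurable_strip.
Qed.

Lemma hyp_rect (a b c e : R) : a <= b -> 0 < c -> c <= e ->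
  (((b - a) * (e - c) / e ^+ 2)%:E <= hyp (fun p : R * R => ((rect a b c e p)%:R)%:E))%E.
Proof.
move=> ab c0 ce; rewrite hyp_tonelli; last by move=> p; rewrite lee_fin.
  have e0 : 0 < e by exact: lt_le_trans ce.
  have ba0 : 0 <= b - a by rewrite subr_ge0.
  have -> : (((b - a) * (e - c) / e ^+ 2)%:E = \int[mu]_y (((b - a) / e ^+ 2)%:E * ((c <= y <= e) && true)%:R%:E))%E.
    rewrite ge0_integralZl//; last 2 first.
    - apply/measurable_EFinP; rewrite (_ : (fun y => _) = \1_(`[c, e] : set (measurableTypeR R))).
        exact: measurable_indic.
      by apply/funext => y; rewrite indicE mem_setE in_itv/= andbT.
    - by rewrite lee_fin divr_ge0// exprn_ge0// ltW.
    by rewrite integral_itv_nat// -EFinM; congr (_%:E); ring.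
  apply: ge0_le_integral => //.
  - by move=> y _; rewrite mule_ge0// lee_fin// divr_ge0// exprn_ge0// ltW.
  - apply: emeasurable_funM => //; apply/measurable_EFinP; rewrite (_ : (fun y => _) = \1_(`[c, e] : set (measurableTypeR R))).
      exact: measurable_indic.
    by apply/funext => y; rewrite indicE mem_setE in_itv/= andbT.
  - apply: emeasurable_funM; last by apply/measurable_EFinP; exact: measurable_hyp_weight.
    by apply: (@measurable_fun_fubini_tonelli_G _ _ _ _ _ mu (fun p : R * R => ((rect a b c e p)%:R)%:E)) => //; apply/measurable_EFinP; exact: measurable_rect.
  - move=> y _; rewrite /rect /= integral_itv_nat// andbT.
    case: ifPn => [/andP[cy ye]|_]; last by rewrite mule0 mul0e.
    have y0 : 0 < y by exact: lt_le_trans cy.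
    rewrite mulr1n mule1 -EFinM lee_fin ler_wpM2l// /hyp_weight /invpos y0 exprVn lef_pV2 ?posrE ?exprn_gt0//.
    by apply: lerXn2r => //; rewrite nnegrE ltW.
by apply/measurable_EFinP; exact: measurable_rect.
Qed.

Variable N : nat.
Hypothesis N0 : (0 < N)%N.
Local Notation A := (@fund_dom R (Gamma0 N)).

Definition fdi p : R := (`[< A (toC p) >])%:R.

Lemma measurable_fdi : mfunT (fdi : plane R -> R).
Proof.
rewrite (_ : fdi = \1_([set p | A (p.1 +i* p.2)] : set (plane R))).
  by apply: measurable_indic; exact: measurable_fund_dom.
by apply/funext => p; rewrite indicE /fdi; congr (_%:R); apply/asboolP/idP; rewrite inE.
Qed.

Lemma fdi_ge0 p : 0 <= fdi p. Proof. by rewrite ler0n. Qed.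

Lemma sum_fdi (s : seq 'M[int]_2) (w : R * R) :
  \sum_(g <- s) fdi (mobp g w) = (count (fun g => `[< A (moebius g (toC w)) >]) s)%:R.
Proof.
rewrite -sum1_count natr_sum [RHS]big_mkcond; apply: eq_bigr => g _.
by rewrite /fdi /mobp ofCK; case: asboolP.
Qed.

Lemma inv2K : involutive inv2.
Proof. by move=> g; rewrite [RHS]mat2_eta /inv2 !mat2E !opprK. Qed.

(** Matrices congruent modulo N lie in the same coset of Gamma0(N), and there are N^4 residues. The
    index is much smaller, but a power of N suffices here. *)
Lemma SL2_count (s : seq 'M[int]_2) (w : R * R) : 0 < w.2 -> uniq s -> (forall g, g \in s -> SL2Z g) ->
  \sum_(g <- s) fdi (mobp (inv2 g) w) <= (15 * N ^ 4)%:R.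
Proof.
move=> w0 us ds; rewrite -(big_map (@inv2) xpredT (fun g => fdi (mobp g w))) sum_fdi ler_nat.
have -> : (15 * N ^ 4 = 15 * #|{: 'I_N * 'I_N * ('I_N * 'I_N)}|)%N.
  by rewrite !card_prod !card_ord !expnS expn0 muln1 !mulnA.
apply: (fund_count (cl := mod_class N0)) => //.
- by rewrite map_inj_uniq//; exact: (can_inj inv2K).
- by move=> _ /seq.mapP[g gs ->]; apply: SL2Z_inv; exact: ds.
- move=> _ _ /seq.mapP[g gs ->] /seq.mapP[h hs ->] /mod_classP e.
  have dg := SL2Z_inv (ds _ gs); have dh := SL2Z_inv (ds _ hs); have {}e := e R 0 (lexx 0).
  move: dg dh e; move: (inv2 g) (inv2 h) => {gs hs g h} g h dg dh e; split; first exact: SL2Z_mul dg (SL2Z_inv dh).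
  have [/eqP e0 /eqP e1] := (e 1 0, e 1 1); move: e0 e1; rewrite !eqz_mod_dvd => /dvdzP[q0 h0] /dvdzP[q1 h1].
  rewrite mulmx2E !mat2E; apply/dvdzP; exists (q0 * h 1 1 - q1 * h 1 0).
  transitivity ((q0 * N%:Z) * h 1 1 - (q1 * N%:Z) * h 1 0); last by ring.
  by rewrite -h0 -h1; ring.
Qed.

Lemma shift_strip (z : R[i]) : uhp z -> exists n : int, (0 <= Re (z + n%:~R) <= 1) /\ Im (z + n%:~R) = Im z.
Proof.
move=> uz; exists (- Num.floor (Re z)); rewrite intc rmorphN /=; case: z uz => x y _ /=.
have /andP[h1 h2] := floor_itv x; move: h2; rewrite intrD => h2.
by split; [apply/andP; split; lra|rewrite addr0].
Qed.

Local Open Scope ereal_scope.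

(** The union of the neighbourhoods of all cusps, of height t with respect to SL2(Z). *)
Definition high (t : R) p : bool := `[< exists2 g, SL2Z g & (t <= Im (moebius g (toC p)))%R >].

Lemma measurable_high t : mfunT (fun p : plane R => (high t p)%:R : R).
Proof.
pose V : set (plane R) := \bigcup_(n : nat)
  (if pickle_inv n is Some g then (if `[< SL2Z g >] then [set p | (t <= (mobp g p).2)%R] else set0) else set0).
rewrite (_ : (fun p => _) = \1_V).
  apply: measurable_indic; apply: bigcupT_measurable => n; case: pickle_inv => [g|]; last exact: measurable0.
  case: asboolP => // dg; apply: measurable_le_set; first exact: measurable_cst.
  exact: (measurableT_comp measurable_snd (measurable_mobp dg)).
apply/funext => p; rewrite indicE /high; congr (nat_of_bool _)%:R; apply/idP/idP.
  by move=> /asboolP[g dg h]; rewrite inE; exists (pickle g) => //; rewrite pickleK_inv; case: asboolP.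
rewrite inE => -[n _] h; apply/asboolP; move: h; case: pickle_inv => // g; case: asboolP => // dg h; exists g => //; exact: h.
Qed.

(** Each point of the region is sent to an SL2(Z)-translate in the strip above t, of area 1/t; by
    [SL2_count] a point of the strip is hit at most 15 N^4 times. *)
Lemma fund_high (t : R) : (0 < t)%R ->
  hyp (fun p => (fdi p * (high t p)%:R)%:E) <= ((15 * N ^ 4)%:R / t)%:E.
Proof.
move=> t0; have -> : ((15 * N ^ 4)%:R / t)%:E = hyp (fun p : R * R => ((15 * N ^ 4)%:R)%:E * ((strip t p)%:R)%:E) :> \bar R.
  rewrite EFinM -hyp_strip// /hyp -ge0_integralZl//.
  - by apply: eq_integral => p _; rewrite muleA.
  - by apply: measurable_hyp_integrand; apply/measurable_EFinP; exact: measurable_strip.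
  - by move=> p _; rewrite mule_ge0// lee_fin ?hyp_weight_ge0.
apply: (@mass_transport _ 'M[int]_2 (fun g => `[< SL2Z g >]) id (fun _ p => ((strip t p)%:R)%:E)
   (fun p => (fdi p)%:E)).
- by move=> g /asboolP.
- by move=> _; apply/measurable_EFinP; exact: measurable_strip.
- by move=> _ p; rewrite lee_fin.
- by apply/measurable_EFinP; exact: measurable_fdi.
- by move=> p; rewrite lee_fin fdi_ge0.
- by apply/measurable_EFinP; apply: measurable_funM; [exact: measurable_fdi|exact: measurable_high].
- by apply: emeasurable_funM => //; apply/measurable_EFinP; exact: measurable_strip.
- by move=> p; rewrite lee_fin mulr_ge0// fdi_ge0.
- by move=> p; rewrite -EFinM lee_fin mulr_ge0.
- move=> z z0; rewrite /high; case: asboolP => [[g dg hg]|_]; last first.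
    by exists [::]; split=> //; rewrite big_nil mulr0.
  have ug : uhp (moebius g (toC z)) by exact: uhp_moebius.
  have [n [hr hi]] := shift_strip ug.
  have dT := SL2Z_T n; exists [:: Tmat n *m g]; split=> //=; first by rewrite andbT; apply/asboolP; exact: SL2Z_mul.
  rewrite big_seq1 -EFinM lee_fin /strip /mobp moebius_mul// moebius_T /=.
  by rewrite hr hi hg.
- move=> w w0 s us /allP hs; have ds g : g \in s -> SL2Z g by move=> /hs /asboolP.
  rewrite -!EFinM sumEFin lee_fin -mulr_sumr mulrC ler_wpM2r//; exact: SL2_count.
Qed.

(** Every point has a translate of height at least 1/2. Finiteness matters because [fine] would turn
    an infinite volume into 0. *)
Lemma hyp_fdi_fin : hyp (fun p => (fdi p)%:E) <= (30 * (N ^ 4)%:R)%:E.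
Proof.
have -> : hyp (fun p => (fdi p)%:E) = hyp (fun p => (fdi p * (high (1 / 2) p)%:R)%:E).
  apply: eq_hyp => p p0; rewrite (_ : high _ p = true) ?mulr1//; apply/asboolP; exact: reduce_half.
apply: le_trans (fund_high _) _; first by rewrite divr_gt0.
rewrite lee_fin natrM invf_div divr1; apply: eq_ler; ring.
Qed.

(** The bound of [entries_bound] for X = Y = 1 and Y' = 2, which fits the rectangle [0, 1] x
    [1, 2]. *)
Let B0 := (Num.truncn ((1 + 2) / 1 * (1 + 1) + 1 + 2 + 1 : R)).+1.

(** Take h mapping one point of the rectangle to another. The factors |c z + d|^2 of h and of its
    inverse multiply to 1, so one of them is at most 1 and bounds the entries of both. *)
Lemma rect_maps (s : seq 'M[int]_2) w : (0 < w.2)%R -> uniq s -> (forall g, g \in s -> SL2Z g) ->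
  (\sum_(g <- s) (rect 0 1 1 2 (mobp g w))%:R <= (size (box B0))%:R :> R)%R.
Proof.
move=> w0 us ds; rewrite -natr_sum ler_nat -(big_mkcond _ (fun=> 1%N)) sum1_count -size_filter.
set t := [seq _ <- _ | _]; have ut : uniq t by exact: filter_uniq.
have ht g : g \in t -> SL2Z g /\ rect 0 1 1 2 (mobp g w).
  by rewrite mem_filter => /andP[h /ds].
case et : t => [//|g0 t']; have [d0 r0] := ht g0 ltac:(by rewrite et mem_head); rewrite -et.
rewrite -(size_map (mulmx^~ (inv2 g0))); apply: uniq_leq_size.
  rewrite map_inj_in_uniq// => g h _ _ /(congr1 (mulmx^~ g0)) /=.
  by rewrite -!mulmxA !mulVmx2// !mulmx1.
move=> _ /seq.mapP[g gt ->]; have [dg rg] := ht g gt; have di := SL2Z_inv d0.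
set h := g *m inv2 g0; have dh : SL2Z h by exact: SL2Z_mul.
set z0 := moebius g0 (toC w); set z1 := moebius g (toC w).
have u0 : uhp z0 by exact: uhp_moebius.
have u1 : uhp z1 by exact: uhp_moebius.
have e1 : moebius h z0 = z1.
  rewrite /h /z0 -moebius_mul// -?mulmxA ?mulVmx2 ?mulmx1//; exact: SL2Z_mul.
have e0 : moebius (inv2 h) z1 = z0 by rewrite -e1 moebiusK.
have rz (z : R[i]) : rect 0 1 1 2 (ofC z) -> [/\ (`|Re z| <= 1)%R, (1 <= Im z)%R & (Im z <= 2)%R].
  by move=> /andP[/andP[a1 a2] /andP[a3 a4]]; split=> //; rewrite ger0_norm.
have [x0 y0 v0] := rz z0 r0; have [x1 y1 v1] := rz z1 rg.
have [n1|n1] := leP (nsq (autj h z0)) 1%R.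
  apply: (mem_box R) => i j; apply: absz_le_real; apply: (@entries_bound _ h z0) => //; by rewrite e1.
have dhi := SL2Z_inv dh.
have n2 : (nsq (autj (inv2 h) z1) <= 1)%R.
  have := Im_moebius z0 dh; rewrite e1 => a1; have := Im_moebius z1 dhi; rewrite e0 => a2.
  have p0 : (0 < Im z0)%R := u0; have p1 : (0 < Im z1)%R := u1.
  have q1 : (0 < nsq (autj h z0))%R by exact: lt_trans n1.
  have q2 : (0 < nsq (autj (inv2 h) z1))%R by apply: nsq_gt0; exact: autj_neq0.
  have : (nsq (autj (inv2 h) z1) * nsq (autj h z0) = 1)%R.
    apply: (mulfI (lt0r_neq0 p0)); rewrite mulr1 {1}a2 a1; field; rewrite !gt_eqF//.
  by move: n1 q1 q2; move: (nsq _) (nsq _) => a b; nra.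
apply: (mem_box R) => i j; have hB i' j' : (`|inv2 h i' j'| <= B0)%N.
  apply: absz_le_real; apply: (@entries_bound _ (inv2 h) z1) => //; by rewrite e0.
have h1 := hB 1%R 1%R; have h2 := hB 0%R 0%R; have h3 := hB 0%R 1%R; have h4 := hB 1%R 0%R.
move: h1 h2 h3 h4; rewrite !mat2E !abszN.
by case: (ord2P i) => ->; case: (ord2P j) => ->.
Qed.

(** Modulo N the bottom row of the i-th matrix is d (1, i) with d a unit, so it determines i. *)
Lemma cosets_uniq (ga : nat -> 'M[int]_2) : (forall i, Gamma0 N (ga i)) ->
  uniq [seq ga i *m Smat *m Tmat i%:Z | i <- iota 0 N].
Proof.
move=> hg; rewrite map_inj_in_uniq ?iota_uniq// => i j; rewrite !mem_iota /= !add0n => iN jN e.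
have [d1 c1] := hg i; have [d2 c2] := hg j.
have := congr1 (fun g : 'M[int]_2 => g 1%R 0%R) e; have := congr1 (fun g : 'M[int]_2 => g 1%R 1%R) e.
rewrite !mulmx2E !mat2E !mulr0 !mulr1 !add0r !addr0 mulrN1 => e1 e0.
have := SL2Z_det d1; move: c1 c2 e1; rewrite -e0.
move: (ga i 0%R 0%R) (ga i 0%R 1%R) (ga i 1%R 0%R) (ga i 1%R 1%R) (ga j 1%R 0%R) => a b c d c' /dvdzP[q ->] /dvdzP[q' ->] e1 ad.
have e2 : (i%:Z - j%:Z = N%:Z * (a * (q - q') - b * q * (i%:Z - j%:Z)))%R.
  have : (d * (i%:Z - j%:Z) = (q - q') * N%:Z)%R by lia.
  move=> e3; transitivity ((a * d - b * (q * N%:Z)) * (i%:Z - j%:Z))%R; first by rewrite ad mul1r.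
  transitivity (a * (d * (i%:Z - j%:Z)) - b * (q * N%:Z) * (i%:Z - j%:Z))%R; first by ring.
  by rewrite e3; ring.
have : (N%:Z %| (i%:Z - j%:Z)%R)%Z by apply/dvdzP; exists (a * (q - q') - b * q * (i%:Z - j%:Z))%R; rewrite mulrC.
rewrite dvdzE /= => h3.
have [/eqP h4|h4] := boolP (`|(i%:Z - j%:Z)%R| == 0)%N; first lia.
have := dvdn_leq _ h3; rewrite lt0n h4 => /(_ isT); lia.
Qed.

Lemma hyp_scale (c : R) (h : R * R -> \bar R) : (0 <= c)%R -> mfunT h -> (forall p, 0 <= h p) ->
  hyp (fun p => c%:E * h p) = c%:E * hyp h.
Proof.
move=> c0 mh h0; rewrite /hyp -ge0_integralZl//.
- by apply: eq_integral => p _; rewrite muleA.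
- exact: measurable_hyp_integrand.
- by move=> p _; rewrite mule_ge0// lee_fin ?hyp_weight_ge0.
Qed.

(** A point of the rectangle has N translates in the domain, one for each coset of S T^i with i < N,
    and a point of the domain comes from at most a bounded number of points of the rectangle. The 4
    bounds 1/y^2 from below on the rectangle. *)
Lemma volume_ge : (((4 * (size (box B0)).+1%:R)^-1 * N%:R : R)%:E <= hyp (fun p => (fdi p)%:E)).
Proof.
set Cb : R := (size (box B0)).+1%:R; have Cb0 : (0 < Cb)%R by rewrite ltr0n.
have Ci0 : (0 <= Cb^-1)%R by rewrite invr_ge0 ltW.
have mr := measurable_rect 0 1 1 2.
apply: (@le_trans _ _ (hyp (fun p => (N%:R * Cb^-1)%:E * ((rect 0 1 1 2 p)%:R)%:E))).
  rewrite hyp_scale//; last 2 first.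
  - by rewrite mulr_ge0.
  - exact/measurable_EFinP.
  apply: (@le_trans _ _ ((N%:R * Cb^-1)%:E * (((1 - 0) * (2 - 1) / 2 ^+ 2)%R%:E))).
    by rewrite -EFinM lee_fin; apply: eq_ler; field; rewrite gt_eqF.
  apply: lee_wpmul2l; first by rewrite lee_fin mulr_ge0.
  by apply: hyp_rect => //; lra.
apply: (@mass_transport _ 'M[int]_2 (fun g => `[< SL2Z g >]) id (fun _ p => (fdi p)%:E)
   (fun p => (Cb^-1 * (rect 0 1 1 2 p)%:R)%:E)).
- by move=> g /asboolP.
- by move=> _; apply/measurable_EFinP; exact: measurable_fdi.
- by move=> _ p; rewrite lee_fin fdi_ge0.
- by apply/measurable_EFinP; apply: measurable_funM.
- by move=> p; rewrite lee_fin mulr_ge0.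
- by apply: emeasurable_funM => //; exact/measurable_EFinP.
- by apply/measurable_EFinP; exact: measurable_fdi.
- by move=> p; rewrite -EFinM lee_fin !mulr_ge0.
- by move=> p; rewrite lee_fin fdi_ge0.
- move=> z z0.
  have hex i : exists g, Gamma0 N g /\ A (moebius (g *m Smat *m Tmat i%:Z) (toC z)).
    have dST := SL2Z_mul SL2Z_S (SL2Z_T i%:Z).
    have [g Gg Ag] := fund_rep N (uhp_moebius dST (z0 : uhp (toC z))).
    exists g; split=> //; rewrite -mulmxA moebius_mul//; exact: Gamma0_SL2 Gg.
  have [ga hga] := choice hex.
  exists [seq ga i *m Smat *m Tmat i%:Z | i <- iota 0 N]; split.
  + by apply: cosets_uniq => i; case: (hga i).
  + apply/allP => _ /seq.mapP[i _ ->]; apply/asboolP; have [[dg _] _] := hga i.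
    by apply: SL2Z_mul; [apply: SL2Z_mul => //; exact: SL2Z_S|exact: SL2Z_T].
  + rewrite big_map; under eq_bigr => i _ do rewrite -EFinM.
    rewrite sumEFin -EFinM lee_fin -mulr_sumr.
    rewrite (eq_bigr (fun=> 1%R)) => [|i _]; last by rewrite /fdi /mobp ofCK; case: asboolP => // -[]; case: (hga i).
    by rewrite big_const_seq count_predT size_iota iter_addr_0; apply: eq_ler; ring.
- move=> w w0 s us /allP hs; have ds g : g \in s -> SL2Z g by move=> /hs /asboolP.
  under eq_bigr => g _ do rewrite -EFinM.
  rewrite sumEFin lee_fin -mulr_sumr -[leRHS]mulr1 ler_wpM2l ?fdi_ge0//.
  rewrite -mulr_sumr mulrC ler_pdivrMr// mul1r.
  rewrite -(big_map (@inv2) xpredT (fun g => (rect 0 1 1 2 (mobp g w))%:R)).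
  apply: (@le_trans _ _ ((size (box B0))%:R)%R); last by rewrite ler_nat.
  apply: rect_maps => //.
  + by rewrite map_inj_uniq//; exact: (can_inj inv2K).
  + by move=> _ /seq.mapP[g gs ->]; apply: SL2Z_inv; exact: ds.
Qed.
End Volume.

(** * Counting translates in a strip, and heights in the fundamental domain *)

Lemma complete_row (c d : int) : coprimez c d -> exists g, [/\ SL2Z g, g 1 0 = c & g 1 1 = d].
Proof.
move=> /coprimezP[[u v] /= e]; exists (mat2 v (- u) c d); rewrite !mat2E; split=> //.
by rewrite /SL2Z /= det2E !mat2E -e; ring.
Qed.

Lemma size_totatives N : size [seq r <- iota 0 N | coprime N r] = totient N.
Proof.
by rewrite size_filter -sum1_count totient_count_coprime /index_iota subn0 big_mkcond; apply: eq_bigr => r _; case: coprime.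
Qed.

Section OrbitCount.
Variables (R : realType) (N c : nat).
Hypotheses (N0 : (0 < N)%N) (c0 : (0 < c)%N) (cN : (c %| N)%N).
Implicit Types (z : R[i]).

(** Dividing (u, w) by its gcd gives a bottom row. The gcd is prime to c because w is prime to N, so
    c still divides the left entry. *)
Lemma pair_matrix z (u w : int) : uhp z -> 0 < u -> (c%:Z %| u)%Z -> coprimez w N%:Z ->
  exists d, [/\ Gamma0 c d, d 1 0 * gcdz u w = u, d 1 1 * gcdz u w = w & 0 <= Re (moebius d z) <= 1].
Proof.
move=> uz u0 cu wN; set g := gcdz u w.
have g0 : g != 0 by rewrite /g gcdz_eq0 negb_and (gt_eqF u0).
have eu : (u %/ g)%Z * g = u by apply: divzK; exact: dvdz_gcdl.
have ew : (w %/ g)%Z * g = w by apply: divzK; exact: dvdz_gcdr.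
have [u' [v' e]] := Bezoutz u w; rewrite -/g in e.
have cop : coprimez (u %/ g)%Z (w %/ g)%Z.
  apply/coprimezP; exists (u', v') => /=; apply: (mulIf g0).
  by rewrite mulrDl mul1r -!mulrA eu ew.
have [h [dh h0 h1]] := complete_row cop.
have cw : coprimez c%:Z w.
  by rewrite coprimez_sym; apply: coprimez_dvdr wN; exact: cN.
have cg : coprimez c%:Z g by apply: coprimez_dvdr cw; exact: dvdz_gcdr.
have ch : (c%:Z %| h 1%R 0%R)%Z by rewrite h0 -(Gauss_dvdzl _ cg) eu.
have [n [hr hi]] := shift_strip (uhp_moebius dh uz).
exists (Tmat n *m h); split.
- by apply: Gamma0_mul => //; exact: Gamma0_T.
- by rewrite mulmx2E !mat2E mul0r add0r mul1r h0.
- by rewrite mulmx2E !mat2E mul0r add0r mul1r h1.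
- by rewrite moebius_mul ?moebius_T//; exact: SL2Z_T.
Qed.

Lemma truncn_half (x : R) : 1 <= x -> x / 2 <= (Num.truncn x)%:R.
Proof.
move=> x1; have x0 : 0 <= x by exact: le_trans x1.
have := truncnS_gt x; rewrite -natr1 => h.
have : 1 <= (Num.truncn x)%:R :> R by rewrite ler1n truncn_gt0.
by lra.
Qed.

(* The pairs (u, w) with c | u, w prime to N and |u z + w| <= rho, where
   rho ^ 2 = Im z / Y, are parametrized by (u / c, j, r) with w = w0(u) + N j + r. *)
Lemma orbit_count z (Y : R) : uhp z -> 0 < Y -> 16 * N%:R ^+ 2 * Y <= Im z -> 4 * c%:R ^+ 2 * Y * Im z <= 1 ->
  exists s : seq (nat * 'M[int]_2), [/\ uniq s,
    forall i, i \in s -> [/\ (0 < i.1)%N, i.1%:R <= Y^-1, Gamma0 c i.2, 0 <= Re (moebius i.2 z) <= 1 &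
      i.1%:R ^+ 2 * Y <= Im (moebius i.2 z)] &
    (totient N)%:R / (32 * N%:R * c%:R * Y) <= (size s)%:R].
Proof.
case: z => x y uz Y0 /= hy1 hy2; have y0 : 0 < y := uz.
have NR : 1 <= N%:R :> R by rewrite ler1n.
have cR : 1 <= c%:R :> R by rewrite ler1n.
pose rho := Num.sqrt (y / Y).
have rho2 : rho ^+ 2 = y / Y by rewrite sqr_sqrtr// divr_ge0// ltW.
have rho0 : 0 < rho by rewrite sqrtr_gt0 divr_gt0.
have ge_rho (t : R) : 0 <= t -> t ^+ 2 <= y / Y -> t <= rho.
  by move=> t0; rewrite -rho2 ler_pXn2r// nnegrE// ltW.
have r1 : 4 * N%:R <= rho.
  by apply: ge_rho; [lra|rewrite ler_pdivlMr// exprMn; move: hy1; rewrite (_ : 4 ^+ 2 = 16 :> R)//; ring].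
have r2 : 2 * c%:R * y <= rho.
  apply: ge_rho; first by rewrite !mulr_ge0// ltW.
  rewrite ler_pdivlMr// -[leRHS]mulr1; apply: le_trans (ler_wpM2l (ltW y0) hy2).
  by apply: eq_ler; ring.
(* The ranges are such that u y and u x + w are both at most rho / 2. One block of length N is given
   up in m, to make room for the offset of [w0]. *)
pose U := Num.truncn (rho / (2 * c%:R * y)); pose m := (Num.truncn (rho / (2 * N%:R))).-1.
have cy0 : 0 < 2 * c%:R * y by rewrite !mulr_gt0//; lra.
have N20 : 0 < 2 * N%:R :> R by lra.
have U1 : rho / (2 * c%:R * y) / 2 <= U%:R by apply: truncn_half; rewrite ler_pdivlMr// mul1r.
have U2 : U%:R * (2 * c%:R * y) <= rho.
  by rewrite -ler_pdivlMr//; have /andP[] := truncn_itv (ltW (divr_gt0 rho0 cy0)).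
have x2 : 2 <= rho / (2 * N%:R) by rewrite ler_pdivlMr//; lra.
have m2 : (2 <= Num.truncn (rho / (2 * N%:R)))%N by rewrite truncn_gt_nat.
have mE : (m%:R + 1 : R) = (Num.truncn (rho / (2 * N%:R)))%:R by rewrite natr1 /m prednK//; exact: ltnW m2.
have m1 : rho / (2 * N%:R) / 4 <= m%:R.
  have : rho / (2 * N%:R) / 2 <= (Num.truncn (rho / (2 * N%:R)))%:R by apply: truncn_half; lra.
  have : 2 <= (Num.truncn (rho / (2 * N%:R)))%:R :> R by rewrite ler_nat.
  by rewrite -mE; lra.
have m3 : (m%:R + 1) * (2 * N%:R) <= rho.
  by rewrite mE -ler_pdivlMr//; have /andP[] := truncn_itv (ltW (divr_gt0 rho0 N20)).
(* The multiple of N that moves u x into [0, N). Being a multiple of N, it leaves w prime to N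
   exactly when r is. *)
pose w0 (u : nat) : int := N%:Z * (- Num.floor ((u * c)%N%:R * x / N%:R)).
have w0P u : 0 <= (u * c)%N%:R * x + (w0 u)%:~R < N%:R.
  rewrite /w0 intrM mulrNz; have /andP[] := floor_itv ((u * c)%N%:R * x / N%:R).
  have NR0 : 0 < N%:R :> R by lra.
  rewrite intrD ler_pdivlMr// ltr_pdivrMr// => h1 h2; rewrite -[N%:Z%:~R]/(N%:R).
  by apply/andP; split; lra.
pose idx := [seq (u, p) | u <- iota 1 U, p <- [seq (j, r) | j <- iota 0 m, r <- [seq r <- iota 0 N | coprime N r]]].
have idxP t : t \in idx -> [/\ (0 < t.1)%N, (t.1 <= U)%N, (t.2.1 < m)%N, (t.2.2 < N)%N & coprime N t.2.2].
  case/allpairsP => -[u p] /= [hu hp ->]; case/allpairsP: hp => -[j r] /= [hj hr ->] /=.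
  by move: hu hj hr; rewrite mem_filter !mem_iota add1n ltnS !add0n /= => /andP[-> ->] -> /andP[-> ->].
pose uu (t : nat * (nat * nat)) : int := (t.1 * c)%N%:Z.
pose ww (t : nat * (nat * nat)) : int := w0 t.1 + (N * t.2.1 + t.2.2)%N%:Z.
(* The gcd g is kept next to the matrix d: with the bottom row it recovers (u, w), and the height of
   d z is g^2 Im z / |u z + w|^2 >= g^2 Y. *)
have key t : exists i : nat * 'M[int]_2, t \in idx -> [/\ (0 < i.1)%N, i.1%:R <= Y^-1, Gamma0 c i.2,
    0 <= Re (moebius i.2 (x +i* y)) <= 1 & i.1%:R ^+ 2 * Y <= Im (moebius i.2 (x +i* y))] /\
    (i.2 1 0 * i.1%:Z = uu t /\ i.2 1 1 * i.1%:Z = ww t).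
  have [ti|/negP nti] := boolP (t \in idx); last by exists (0%N, 1%:M).
  have [t0 tU tm tN tc] := idxP t ti.
  have u0 : 0 < uu t by rewrite ltz_nat muln_gt0 t0.
  have cu : (c%:Z %| uu t)%Z by rewrite dvdzE dvdn_mull.
  have wN : coprimez (ww t) N%:Z.
    have [K ->] : exists K, ww t = K * N%:Z + t.2.2%:Z.
      by eexists; rewrite /ww /w0 PoszD PoszM addrA -mulrDr mulrC.
    by rewrite coprimez_sym /coprimez gcdzMDl.
  have [d [Gd d0 d1 dR]] := pair_matrix uz u0 cu wN.
  have [g gE] : exists g : nat, gcdz (uu t) (ww t) = g%:Z by exists (gcdn `|uu t| `|ww t|).
  rewrite gE in d0 d1; have g0 : (0 < g)%N.
    by rewrite -ltz_nat -gE lt_def gcdz_eq0 (gt_eqF u0).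
  have gR : 0 < g%:R :> R by rewrite ltr0n.
  have d0R : (d 1 0)%:~R * g%:R = (t.1 * c)%N%:R :> R.
    by rewrite -[g%:R]/(g%:Z%:~R) -intrM d0.
  have d1R : (d 1 1)%:~R * g%:R = (w0 t.1)%:~R + (N%:R * t.2.1%:R + t.2.2%:R) :> R.
    by rewrite -[g%:R]/(g%:Z%:~R) -intrM d1 intrD -natrM -natrD.
  have hu : (t.1 * c)%N%:R * y * 2 <= rho.
    apply: le_trans U2; rewrite natrM; have : t.1%:R <= U%:R :> R by rewrite ler_nat.
    by move/(ler_wpM2r (ltW cy0)); apply: le_trans; apply: eq_ler; ring.
  have hw : 0 <= (t.1 * c)%N%:R * x + ((d 1 1)%:~R * g%:R) <= rho / 2.
    have /andP[h1 h2] := w0P t.1; rewrite d1R addrA.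
    have hN : N%:R * t.2.1%:R + t.2.2%:R <= m%:R * N%:R :> R.
      rewrite -!natrM -natrD ler_nat mulnC; apply: leq_trans (_ : t.2.1.+1 * N <= _)%N.
        by rewrite mulSn addnC leq_add2r ltnW.
      by rewrite leq_mul2r tm orbT.
    have hN0 : 0 <= N%:R * t.2.1%:R + t.2.2%:R :> R by rewrite addr_ge0// mulr_ge0.
    by move: m3 h1 h2 hN hN0; set a := _ * x; set b := (w0 _)%:~R => m3 h1 h2 hN hN0; apply/andP; split; [lra|lra].
  have uc0 : 0 <= (t.1 * c)%N%:R * y by rewrite mulr_ge0// ltW.
  have dd := Gamma0_SL2 Gd.
  have nE : nsq (autj d (x +i* y)) * g%:R ^+ 2 =
      ((t.1 * c)%N%:R * x + ((d 1 1)%:~R * g%:R)) ^+ 2 + ((t.1 * c)%N%:R * y) ^+ 2.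
    by rewrite nsq_autj -d0R; ring.
  have n0 : 0 < nsq (autj d (x +i* y)) by apply: nsq_gt0; exact: autj_neq0.
  have nle : nsq (autj d (x +i* y)) * g%:R ^+ 2 <= y / Y.
    rewrite nE -rho2; move: hw hu uc0 rho0; move: (_ + _) (_ * y) => a b /andP[a0 a1] b1 b0 r0; nra.
  exists (g, d) => _; split=> //; split=> //=.
  + have h2 : (g%:R * (2 * y)) ^+ 2 <= y / Y.
      rewrite -rho2; apply: lerXn2r; rewrite ?nnegrE; [by rewrite !mulr_ge0// ltW|exact: ltW|].
      apply: le_trans hu; rewrite mulrA mulrAC ler_pM2r// ler_pM2r// ler_nat.
      rewrite -(ltz_nat 0) in g0; have := dvdz_gcdl (uu t) (ww t); rewrite gE dvdzE /= => /dvdn_leq; apply.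
      by rewrite muln_gt0 t0.
    have h3 : g%:R ^+ 2 * (4 * y * Y) <= 1.
      move: h2; rewrite ler_pdivlMr// exprMn => h2; rewrite -(ler_pM2l y0) mulr1; apply: le_trans h2.
      by apply: eq_ler; ring.
    have yY : Y <= y by apply: le_trans hy1; rewrite -[leLHS]mul1r ler_wpM2r ?(ltW Y0)//; nra.
    rewrite -[leRHS]div1r ler_pdivlMr// -(@ler_pXn2r _ 2)// ?nnegrE ?mulr_ge0 ?(ltW Y0)// expr1n.
    apply: le_trans h3; rewrite exprMn ler_wpM2l ?sqr_ge0//; nra.
  + by rewrite Im_moebius// ler_pdivlMr//= mulrAC -ler_pdivlMr// mulrC.
have [ph hph] := choice key.
exists [seq ph t | t <- idx]; split.
- rewrite map_inj_in_uniq; last first.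
    move=> [u [j r]] [u' [j' r']] t1 t2 e; have [_ [e1 e2]] := hph _ t1; have [_ [e3 e4]] := hph _ t2.
    rewrite e e3 in e1; rewrite e e4 in e2; move: e1 e2; rewrite /uu /ww /= => -[/eqP].
    rewrite eqn_mul2r eqn0Ngt c0 /= => /eqP ->; move=> /addrI [].
    have [_ _ _ /= rN _] := idxP _ t1; have [_ _ _ /= rN' _] := idxP _ t2.
    move=> e5; have := congr1 (modn^~ N) e5; rewrite ![(N * _)%N]mulnC !modnMDl !modn_small// => er.
    by move: e5; rewrite er => /addIn /eqP; rewrite eqn_mul2l eqn0Ngt N0 /= => /eqP ->.
  apply: allpairs_uniq; rewrite ?iota_uniq//.
    by apply: allpairs_uniq; rewrite ?filter_uniq ?iota_uniq// => -[a b] [a' b'].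
  by move=> [a b] [a' b'].
- by move=> _ /seq.mapP[t ti ->]; have [] := hph t ti.
- rewrite size_map !size_allpairs !size_iota size_totatives !natrM.
  have tot0 : 0 <= (totient N)%:R :> R by [].
  have cR0 : 0 < c%:R :> R by lra.
  have NR0 : 0 < N%:R :> R by lra.
  apply: (@le_trans _ _ (rho / (2 * c%:R * y) / 2 * (rho / (2 * N%:R) / 4 * (totient N)%:R))).
    rewrite (_ : rho / (2 * c%:R * y) / 2 * (rho / (2 * N%:R) / 4 * (totient N)%:R) = rho ^+ 2 / (32 * N%:R * c%:R * y) * (totient N)%:R); last first.
      by field; rewrite !gt_eqF.
    rewrite rho2; apply: eq_ler; field; rewrite !gt_eqF//.
  apply: ler_pM => //.
  + by rewrite !divr_ge0// ltW.
  + by rewrite mulr_ge0// !divr_ge0// ltW.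
  + by rewrite ler_wpM2r.
Qed.
End OrbitCount.

Lemma mod_pos (N : nat) (a : int) : (0 < N)%N -> exists2 n : nat, (0 < n <= N)%N & (N%:Z %| n%:Z - a)%Z.
Proof.
move=> N0; exists (N - `|((- a) %% N%:Z)%Z|)%N.
  have h1 := ltz_pmod (- a) (N0 : (0 < N%:Z)%R); have h2 := modz_ge0 (- a) (lt0r_neq0 (N0 : (0 < N%:Z)%R)).
  by apply/andP; split; move: h1 h2; move: (- a %% N%:Z)%Z => r; lia.
have h1 := ltz_pmod (- a) (N0 : (0 < N%:Z)%R); have h2 := modz_ge0 (- a) (lt0r_neq0 (N0 : (0 < N%:Z)%R)).
have e := divz_eq (- a) N%:Z; apply/dvdzP; exists (1 + (- a %/ N%:Z)%Z).
have -> : (N - `|(- a %% N)%Z|)%N%:Z = N%:Z - (- a %% N%:Z)%Z by move: h1 h2; move: (- a %% N%:Z)%Z => r; lia.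
rewrite mulrDl mul1r; move: e; move: (- a %% N%:Z)%Z (- a %/ N%:Z)%Z => r s e.
by rewrite [X in X - a](_ : _ = N%:Z - (- a - s * N%:Z)) ?e; lia.
Qed.

(* The prime-to-d part t of c makes d + t N prime to c. *)
Lemma small_primitive (N : nat) (c d : int) : (0 < N)%N -> coprimez c d ->
  exists c' d' : nat, [/\ coprime c' d', (c' <= N)%N, (d' <= N + N ^ 2)%N &
    (N%:Z %| c'%:Z - c)%Z /\ (N%:Z %| d'%:Z - d)%Z].
Proof.
move=> N0 cop; have [c' /andP[c1 cN] hc] := mod_pos c N0; have [d1 /andP[d0 dN] hd] := mod_pos d N0.
pose t := (c'`_(\pi(d1)^'))%N.
have tle : (t <= c')%N by rewrite dvdn_leq// dvdn_part.
exists c', (d1 + t * N)%N; split=> //; last first.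
- split=> //; rewrite PoszD PoszM addrAC; apply: rpredD => //; exact: dvdz_mull.
- by apply: leq_add => //; rewrite expnS expn1 leq_mul2r (leq_trans tle) ?orbT.
have d'0 : (0 < d1 + t * N)%N by rewrite addn_gt0 d0.
rewrite /coprime -[_ == _]negbK; apply/negP => h.
have g1 : (1 < gcdn c' (d1 + t * N))%N by rewrite ltn_neqAle eq_sym h gcdn_gt0 c1.
have := pdiv_prime g1; have := pdiv_dvd (gcdn c' (d1 + t * N)); move: (pdiv _) => p.
rewrite dvdn_gcd => /andP[pc pd] pp.
have pi_part pi : (p %| c'`_pi)%N -> p \in pi.
  move=> h1; apply: (@pnatPpi pi c'`_pi); first exact: part_pnat.
  by rewrite mem_primes pp part_gt0.
have [pd1|npd1] := boolP (p %| d1)%N; last first.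
  case/negP: (npd1); rewrite -(dvdn_addl _ (_ : (p %| t * N)%N))//; apply: dvdn_mulr.
  move: pc; rewrite -(partnC \pi(d1) c1) Euclid_dvdM// => /orP[/pi_part|//].
  by rewrite inE /= mem_primes (negbTE npd1) !andbF.
have ptN : (p %| t * N)%N by rewrite -(dvdn_addr _ pd1).
have npt : ~~ (p %| t)%N.
  by apply/negP => /pi_part; rewrite !inE /= mem_primes pp d0 pd1.
have pN : (p %| N)%N by move: ptN; rewrite Euclid_dvdM// (negbTE npt).
have pz (m : nat) (e : int) : (N%:Z %| m%:Z - e)%Z -> (p %| m)%N -> (p%:Z %| e)%Z.
  move=> h1 h2; have -> : e = m%:Z - (m%:Z - e) by ring.
  by apply: rpredB => //; apply: dvdz_trans h1.
have : (p%:Z %| gcdz c d)%Z by rewrite dvdz_gcd (pz c' c)// (pz d1 d).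
by rewrite (eqP cop) dvdzE /= dvdn1 => /eqP p1; rewrite p1 in pp.
Qed.

Section Low.
Variables (R : realType) (N : nat).
Hypothesis N0 : (0 < N)%N.
Implicit Types (z : R[i]).
Local Notation A := (@fund_dom R (Gamma0 N)).

(** Some h in SL2(Z) brings z to a height between 1/2 and T0. By [small_primitive] there is k with
    entries of the bottom row O(N^2) such that k h lies in Gamma0(N); then k h z is not much lower
    than h z, and z is at least as high as k h z. *)
Lemma fund_low z (T0 : R) : 1 <= T0 -> A z -> (forall g, SL2Z g -> Im (moebius g z) < T0) ->
  1 / (20 * N%:R ^+ 4 * T0 ^+ 2) <= Im z.
Proof.
move=> T1 Az hT; have [uz _ hz] := Az.
have [g dg hg] := reduce_half uz.
have [n [hr hi]] := shift_strip (uhp_moebius dg uz).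
pose h := Tmat n *m g; have dh : SL2Z h by apply: SL2Z_mul => //; exact: SL2Z_T.
have hv : moebius h z = moebius g z + n%:~R by rewrite moebius_mul ?moebius_T//; exact: SL2Z_T.
have cop : coprimez (- h 1 0) (h 0 0).
  apply/coprimezP; exists (h 0 1, h 1 1) => /=; rewrite -(SL2Z_det dh); ring.
have [c [d [cd cN dN [hc hd]]]] := small_primitive N0 cop.
have [k [dk k0 k1]] : exists k, [/\ SL2Z k, k 1 0 = c%:Z & k 1 1 = d%:Z] by apply: complete_row.
have dkh := SL2Z_mul dk dh.
have Gkh : Gamma0 N (k *m h).
  split=> //; rewrite mulmx2E k0 k1.
  have -> : c%:Z * h 0 0 + d%:Z * h 1 0 = (c%:Z - - h 1 0) * h 0 0 + (d%:Z - h 0 0) * h 1 0 by ring.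
  by apply: rpredD; apply: dvdz_mulr.
have [+ _] := hz _ Gkh; apply: le_trans.
rewrite moebius_mul// Im_moebius// hv.
have uv : uhp (moebius h z) by exact: uhp_moebius.
have := hT h dh; rewrite hv; rewrite hv in uv; rewrite -hi in hg; move: hg hr uv.
move: (moebius g z + n%:~R) => -[x y] /= hy /andP[x0 x1] uv yT; have y0 : 0 < y := uv.
rewrite nsq_autj k0 k1 -[c%:Z%:~R]/(c%:R) -[d%:Z%:~R]/(d%:R).
have cR : c%:R <= N%:R :> R by rewrite ler_nat.
have dR : d%:R <= N%:R + N%:R ^+ 2 :> R by rewrite -natrX -natrD ler_nat.
have N1 : 1 <= N%:R :> R by rewrite ler1n.
have c0 : 0 <= c%:R :> R by [].
have d0 : 0 <= d%:R :> R by [].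
have N2 : N%:R <= N%:R ^+ 2 :> R by rewrite expr2; nra.
have a1 : (c%:R * x + d%:R) ^+ 2 <= 9 * N%:R ^+ 4.
  have b1 : c%:R * x + d%:R <= 3 * N%:R ^+ 2 by have : c%:R * x <= c%:R by [nra]; lra.
  have b0 : 0 <= c%:R * x + d%:R by rewrite addr_ge0// mulr_ge0.
  have -> : 9 * N%:R ^+ 4 = (3 * N%:R ^+ 2) ^+ 2 :> R by ring.
  by apply: lerXn2r => //; rewrite nnegrE//; exact: le_trans b1.
have a2 : (c%:R * y) ^+ 2 <= N%:R ^+ 2 * T0 ^+ 2.
  rewrite -exprMn; apply: lerXn2r; rewrite ?nnegrE ?mulr_ge0 ?(ltW y0)//; try lra.
  by apply: ler_pM => //; [exact: ltW|exact: ltW].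
have N4 : N%:R ^+ 2 <= N%:R ^+ 4 :> R by rewrite -!natrX ler_nat leq_pexp2l.
have T2 : 1 <= T0 ^+ 2 by rewrite expr_ge1// (le_trans _ T1).
have a3 : (c%:R * x + d%:R) ^+ 2 + (c%:R * y) ^+ 2 <= 10 * N%:R ^+ 4 * T0 ^+ 2.
  have h1 : N%:R ^+ 2 * T0 ^+ 2 <= N%:R ^+ 4 * T0 ^+ 2 by rewrite ler_wpM2r// sqr_ge0.
  have h2 : N%:R ^+ 4 <= N%:R ^+ 4 * T0 ^+ 2 by rewrite -[leLHS]mulr1 ler_wpM2l// exprn_ge0.
  by rewrite -mulrA; lra.
have q0 : 0 < (c%:R * x + d%:R) ^+ 2 + (c%:R * y) ^+ 2.
  rewrite -[c%:R]/(c%:Z%:~R) -[d%:R]/(d%:Z%:~R) -k0 -k1 -nsq_autj; apply: nsq_gt0; exact: autj_neq0.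
have NT : 0 < N%:R ^+ 4 * T0 ^+ 2 by rewrite mulr_gt0 ?exprn_gt0//; lra.
rewrite ler_pdivrMr; last by rewrite -mulrA mulr_gt0.
rewrite mulrC mulrA ler_pdivlMr// mul1r; apply: (le_trans a3).
rewrite -[10 * _ * _]mulrA -[20 * _ * _]mulrA; move: NT; move: (_ ^+ 4 * _) => e e0; nra.
Qed.
End Low.

(** * From the fundamental domain to strips *)

Section Good.
Variables (R : realType) (C : R) (k N M : nat) (f : R[i] -> R[i]) (chi : int -> R[i]).
Hypothesis N0 : (0 < N)%N.
Hypothesis C0 : 0 <= C.
Hypothesis gf : good_form C k N f.
Hypothesis dchi : dirichlet_char N chi.
Hypothesis neb : nebentypus N k chi f.
Hypothesis condM : is_conductor N chi M.
Variable a : nat -> R[i].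
Hypothesis eig : forall n, (0 < n)%N -> coprime n N -> forall z, uhp z -> hecke k chi n f z = a n * f z.
Implicit Types (z w : R[i]) (p : R * R).
Local Notation A := (@fund_dom R (Gamma0 N)).
Let c0 := half_level N.
Let N1 := (N %/ c0)%N.
Let q := excess N M.
Local Notation S := (sup_norm k f).
Local Notation mass := (mass k N f).
Local Notation fb := (fb k N f).

Let c0_gt0 : (0 < c0)%N. Proof. exact: half_level_gt0. Qed.
Let c0N : (c0 %| N)%N. Proof. exact: half_level_dvd. Qed.
Let N1_pos : (0 < N1)%N. Proof. by rewrite divn_gt0// dvdn_leq. Qed.

Lemma normc_chi_int (b : int) : coprimez b N%:Z -> normc (chi b) = 1.
Proof.
move=> cb; have r0 := modz_ge0 b (lt0r_neq0 (N0 : (0 < N%:Z)%R)).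
have e : (b = `|(b %% N)%Z|%:Z %[mod N%:Z])%Z by rewrite gez0_abs// modz_mod.
rewrite (chi_modz dchi e) (normc_chi N0 dchi)//.
rewrite -[coprime _ _]/(coprimez (`|(b %% N)%Z|)%:Z N%:Z) gez0_abs//.
by rewrite /coprimez gcdz_modl.
Qed.

Lemma height_Gamma0 h z : Gamma0 N h -> uhp z -> height k f (moebius h z) = height k f z.
Proof.
move=> Gh uz; have dh := Gamma0_SL2 Gh; rewrite -height_slash//.
rewrite /height; congr (_ * _); rewrite -[h]mulmx1 (slash_Gamma0 neb)//; last exact: SL2Z1.
rewrite normcM normc_chi_int ?mul1r; last first.
  rewrite coprimez_sym; have [_ cN] := Gh; apply/coprimezP; have [q' e] := dvdzP cN.
  exists (- (h 0 1 * q'), h 0 0) => /=; rewrite -(SL2Z_det dh) e; ring.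
by rewrite /slash autj1 expr1n invr1 mul1r moebius1.
Qed.

(** With e c the lower left entry of d, take b congruent to e d_00 modulo N / c. As d_00 d_11 is 1
    modulo c and N | c^2, the lower left entry of the product vanishes modulo N. *)
Lemma coset_gam d : Gamma0 c0 d -> exists b : 'I_N1, Gamma0 N (d *m gam N (- b%:Z)).
Proof.
move=> [dd /dvdzP[e he]]; have ad := SL2Z_det dd.
have b0 : (0 < N1%:Z)%R by [].
have bl : (`|((e * d 0%R 0%R) %% N1)%Z| < N1)%N.
  have := ltz_pmod (e * d 0 0) b0; have := modz_ge0 (e * d 0 0) (lt0r_neq0 b0); move: (_ %% _)%Z => r; lia.
exists (Ordinal bl) => /=; have r0 := modz_ge0 (e * d 0 0) (lt0r_neq0 b0).
split; first by apply: SL2Z_mul => //; exact: SL2Z_gam.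
rewrite mulmx2E !mat2E mulr1 gez0_abs// he -/c0.
have [t ht] := half_sqr_dvd N0; rewrite -/c0 in ht.
have hm := half_mul N0; rewrite -/c0 -/N1 in hm.
have e1 := divz_eq (e * d 0 0) N1; move: e1; move: (_ %/ _)%Z (_ %% _)%Z => s r e1.
have -> : e * c0%:Z + d 1 1 * (- r * c0%:Z) = - (e * d 0 1 * e) * (c0%:Z * c0%:Z) + d 1 1 * s * (c0%:Z * N1%:Z).
  have -> : r = e * d 0 0 - s * N1%:Z by rewrite e1; ring.
  transitivity (c0%:Z * e * (d 0 0 * d 1 1 - d 0 1 * d 1 0) - c0%:Z * e * d 0 0 * d 1 1 + d 1 1 * s * (c0%:Z * N1%:Z)).
    by rewrite ad mulr1; ring.
  by rewrite he; ring.
by rewrite ht hm; apply: rpredD; [rewrite mulrA|]; exact: dvdz_mull.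
Qed.

(* Group the translates by their coset in Gamma0 N \ Gamma0 c0. *)
Lemma coset_mass (s : seq 'M[int]_2) w : uhp w -> uniq s -> (forall d, d \in s -> Gamma0 c0 d) ->
  \sum_(d <- s) (`[< A (moebius d w) >])%:R * height k f (moebius d w) ^+ 2 <= 15 * mass (ofC w).
Proof.
move=> uw us ds.
have key d : exists b : 'I_N1, Gamma0 c0 d -> Gamma0 N (d *m gam N (- b%:Z)).
  have [Gd|nG] := pselect (Gamma0 c0 d); last by exists (Ordinal N1_pos).
  by have [b hb] := coset_gam Gd; exists b.
have [cl hcl] := choice key.
have gK b : gam N (- b) *m gam N b = 1%:M.
  by rewrite -gamD addNr /gam mul0r [RHS]mat2_eta !mxE.
have hE d : d \in s -> height k f (moebius d w) = height k (fb (cl d)%:Z) w.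
  move=> sd; have G := hcl d (ds d sd); have dg := @SL2Z_gam N (cl d)%:Z.
  rewrite {1}(_ : d = (d *m gam N (- (cl d)%:Z)) *m gam N (cl d)%:Z); last by rewrite -mulmxA gK mulmx1.
  rewrite moebius_mul//; last exact: Gamma0_SL2 G.
  by rewrite height_Gamma0//; [rewrite -height_slash|exact: uhp_moebius].
rewrite big_seq (eq_bigr (fun d => (`[< A (moebius d w) >])%:R * height k (fb (cl d)%:Z) w ^+ 2)); last first.
  by move=> d sd; rewrite hE.
rewrite -big_seq (partition_big cl xpredT)//= /mass mulr_sumr; apply: ler_sum => b _.
rewrite (eq_bigr (fun d => (`[< A (moebius d w) >])%:R * height k (fb b%:Z) w ^+ 2)); last first.
  by move=> d /eqP ->.
rewrite -mulr_suml ofCK ler_wpM2r ?sqr_ge0// -natr_sum ler_nat.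
have h := @fund_count R N unit (fun=> tt) [seq d <- s | cl d == b] w uw (filter_uniq _ us).
rewrite card_unit muln1 in h; apply: leq_trans (h _ _).
- rewrite -big_filter -sum1_count [X in (_ <= X)%N]big_mkcond /= leq_eqVlt; apply/orP; left; apply/eqP.
  by apply: eq_bigr => d _; case: asboolP.
- by move=> d; rewrite mem_filter => /andP[_ /ds]; exact: Gamma0_SL2.
- move=> d e; rewrite !mem_filter => /andP[/eqP cd sd] /andP[/eqP ce se] _.
  have Gd := hcl d (ds d sd); have Ge := hcl e (ds e se); rewrite cd in Gd; rewrite ce in Ge.
  have de := Gamma0_SL2 (ds e se).
  rewrite (_ : d *m inv2 e = (d *m gam N (- b%:Z)) *m inv2 (e *m gam N (- b%:Z))).
    by apply: Gamma0_mul => //; exact: Gamma0_inv.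
  have -> : inv2 (e *m gam N (- b%:Z)) = gam N b%:Z *m inv2 e.
    by rewrite [LHS]mat2_eta [RHS]mat2_eta /inv2 !mulmx2E /gam !mat2E; congr mat2; ring.
  by rewrite mulmxA -[_ *m gam _ _ *m gam _ _]mulmxA gK mulmx1.
Qed.

Definition fmass p : R := if 0 < p.2 then height k f (toC p) ^+ 2 else 0.

Lemma fmass_ge0 p : 0 <= fmass p. Proof. by rewrite /fmass; case: ifP => // _; exact: sqr_ge0. Qed.

Lemma measurable_fmass : mfunT (fmass : plane R -> R).
Proof.
rewrite (_ : fmass = (fun p : plane R => (if 0 < p.2 then height k f (toC p) else 0) ^+ 2)).
  by apply: measurable_funX; apply: measurable_height; case: gf.
by apply/funext => p; rewrite /fmass; case: ifP => // _; rewrite expr0n.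
Qed.

Local Open Scope ereal_scope.

Lemma hyp_sum (s : seq nat) (F : nat -> R * R -> \bar R) : (forall g, mfunT (F g)) ->
  (forall g p, 0 <= F g p) -> hyp (fun p => \sum_(g <- s) F g p) = \sum_(g <- s) hyp (F g).
Proof.
move=> mF F0; rewrite /hyp -ge0_integral_sum//.
- by apply: eq_integral => p _; rewrite ge0_sume_distrl.
- by move=> g; exact: measurable_hyp_integrand.
- by move=> g p _; rewrite mule_ge0// lee_fin hyp_weight_ge0.
Qed.

(** Y1 times the bound of [upper], independent of the strip. *)
Definition bracket (s : nat) (de K : R) (Z : nat) : R :=
  (2 * (size (smooths N (N ^ 3 * Z ^ 2)))%:R * ((K * (N ^ 3 * Z ^ 2)%:R `^ de * q%:R) `^ ((2 ^ s)%:R^-1) * (N1%:R * S ^+ 2 / q%:R))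
     + 2 * (8 + 4 * C ^+ 2) * (N1%:R * S ^+ 2) / N%:R)%R.

Definition goodw (t : R) p : R := (fdi N p * (~~ high t p)%:R * fmass p)%R.

Lemma goodw_ge0 t p : (0 <= goodw t p)%R.
Proof. by rewrite !mulr_ge0 ?fdi_ge0 ?fmass_ge0. Qed.

Lemma measurable_goodw t : mfunT (goodw t : plane R -> R).
Proof.
apply: measurable_funM; last exact: measurable_fmass.
apply: measurable_funM; first exact: measurable_fdi.
rewrite (_ : (fun p => _) = (fun p : plane R => 1 - (high t p)%:R : R)%R).
  by apply: measurable_funB => //; exact: measurable_high.
by apply/funext => p; case: high; rewrite ?subrr ?subr0.
Qed.

(** [orbit_count] provides at least X translates, in strips above g^2 Y with g the gcd; [coset_mass]
    bounds their multiplicity by 15 times the mass; [upper] bounds the mass of each strip by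
    [bracket] / (g^2 Y), and the sum over g costs a factor 2. With the 32 of [orbit_count] this
    makes 960. *)
Lemma good_le s de K (Z : nat) (T0 : R) : moment_ineq s de K -> (1 <= K)%R -> (0 < Z)%N -> (1 <= T0)%R ->
  (320 * N%:R ^+ 6 * T0 ^+ 2 <= Z%:R)%R -> (4 * c0%:R ^+ 2 * T0 <= Z%:R)%R ->
  hyp (fun p => (goodw T0 p)%:E) <= (960 * (N%:R * c0%:R / (totient N)%:R) * bracket s de K Z)%:E.
Proof.
move=> hK K1 Z0 T1 h1 h2.
have ZR : (0 < Z%:R :> R)%R by rewrite ltr0n.
have NR : (0 < N%:R :> R)%R by rewrite ltr0n.
have cR : (0 < c0%:R :> R)%R by rewrite ltr0n.
have tR : (0 < (totient N)%:R :> R)%R by rewrite ltr0n totient_gt0.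
(* The two hypotheses on Z are the two conditions of [orbit_count] for this Y: the lower bound on Im
   z comes from [fund_low], with 16 * 20 = 320, the upper one from Im z < T0. *)
pose Y : R := (Z%:R^-1)%R; have Y0 : (0 < Y)%R by rewrite invr_gt0.
pose X := ((totient N)%:R / (32 * N%:R * c0%:R * Y))%R.
have X0 : (0 < X)%R by rewrite divr_gt0// !mulr_gt0.
pose E2 p : R := (15 * \sum_(g <- iota 1 Z) (strip (g%:R ^+ 2 * Y) p)%:R * (if (0 < p.2) then mass p else 0))%R.
have m0 p : (0 <= if (0 < p.2) then mass p else 0)%R by case: ifP => // _; exact: mass_ge0.
have E20 p : (0 <= E2 p)%R by rewrite mulr_ge0// sumr_ge0// => g _; rewrite mulr_ge0.
have mterm g : mfunT (fun p : plane R => (strip (g%:R ^+ 2 * Y) p)%:R * (if (0 < p.2) then mass p else 0) : R)%R.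
  by apply: measurable_funM; [exact: measurable_strip|exact: (measurable_mass gf)].
have mE2 : mfunT (E2 : plane R -> R).
  by apply: measurable_funM => //; apply: measurable_sum.
have le1 : hyp (fun p => (X * goodw T0 p)%:E) <= hyp (fun p => (E2 p)%:E).
  apply: (@mass_transport _ (nat * 'M[int]_2)%type (fun i => [&& (0 < i.1)%N, (i.1 <= Z)%N & `[< Gamma0 c0 i.2 >]])
    (fun i => i.2) (fun i p => ((strip (i.1%:R ^+ 2 * Y) p)%:R)%:E) (fun p => (goodw T0 p)%:E)).
  - by move=> i /and3P[_ _ /asboolP /Gamma0_SL2].
  - by move=> i; apply/measurable_EFinP; exact: measurable_strip.
  - by move=> i p; rewrite lee_fin.
  - by apply/measurable_EFinP; exact: measurable_goodw.
  - by move=> p; rewrite lee_fin goodw_ge0.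
  - by apply/measurable_EFinP; apply: measurable_funM => //; exact: measurable_goodw.
  - by apply/measurable_EFinP.
  - by move=> p; rewrite lee_fin mulr_ge0 ?goodw_ge0// ltW.
  - by move=> p; rewrite lee_fin.
  - move=> z z0; have [h0|/eqP hn0] := eqVneq (goodw T0 z) 0%R.
      by exists [::]; split=> //; rewrite h0 mulr0 big_nil.
    have [Az hz] : A (toC z) /\ ~~ high T0 z.
      move: hn0; rewrite /goodw /fdi; case: asboolP => [Az|_]; last by rewrite !mul0r.
      by case: high => //; rewrite mulr0 mul0r.
    have hz' g : SL2Z g -> (Im (moebius g (toC z)) < T0)%R.
      move=> dg; rewrite ltNge; apply/negP => h; case/negP: hz; apply/asboolP; by exists g.
    have uz : uhp (toC z) := z0.
    have b1 := fund_low N0 T1 Az hz'.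
    have b2 : (Im (toC z) < T0)%R by rewrite -[toC z]moebius1; apply: hz'; exact: SL2Z1.
    have T00 : (0 < T0)%R by exact: lt_le_trans T1.
    have cond1 : (16 * N%:R ^+ 2 * Y <= Im (toC z))%R.
      apply: le_trans b1; rewrite ler_pdivlMr ?mulr_gt0 ?exprn_gt0// /Y mulrAC ler_pdivrMr// mul1r.
      by apply: le_trans h1; apply: eq_ler; ring.
    have cond2 : (4 * c0%:R ^+ 2 * Y * Im (toC z) <= 1)%R.
      rewrite /Y mulrAC ler_pdivrMr// mul1r; apply: le_trans h2.
      by rewrite ler_wpM2l ?mulr_ge0 ?exprn_ge0 ?ltW.
    have [t [ut ht st]] := @orbit_count R N c0 N0 c0_gt0 c0N (toC z) Y uz Y0 cond1 cond2.
    exists t; split=> //.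
        apply/allP => i /ht[i1 i2 Gi _ _]; rewrite i1 /=; apply/andP; split; last exact/asboolP.
        by rewrite -(ler_nat R) -[leRHS]invrK.
      rewrite big_seq (eq_bigr (fun=> (goodw T0 z)%:E)); last first.
        move=> i /ht[_ _ _ r1 r2]; rewrite /strip /mobp /ofC /=; move: r1 r2; rewrite /Y => -> ->.
        by rewrite mule1.
      rewrite -big_seq sumEFin lee_fin big_const_seq count_predT iter_addr_0 mulrC -mulr_natr.
      by rewrite ler_wpM2l ?goodw_ge0.
  - move=> w w0 t ut /allP ht.
    have uw : uhp (toC w) := w0.
    under eq_bigr => i _ do rewrite -EFinM.
    rewrite sumEFin lee_fin /E2 w0 mulr_sumr.
    have t1 i : i \in t -> i.1 \in iota 1 Z.
      by move=> /ht/and3P[i1 i2 _]; rewrite mem_iota i1 add1n ltnS.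
    pose F g (i : nat * 'M[int]_2) : R := ((strip (g%:R ^+ 2 * Y) w)%:R * goodw T0 (mobp (inv2 i.2) w))%R.
    rewrite big_seq (eq_bigr (fun i => \sum_(g <- iota 1 Z) (if g == i.1 then F g i else 0)))%R; last first.
      move=> i ti; rewrite (bigD1_seq i.1) ?iota_uniq//=; last exact: t1.
      by rewrite eqxx big1 ?addr0// => g /negbTE ->.
    rewrite -big_seq exchange_big /=; apply: ler_sum => g _.
    rewrite -big_mkcond -mulr_sumr mulrCA; apply: ler_wpM2l => //.
    pose u := [seq inv2 i.2 | i <- t & g == i.1].
    have uu : uniq u.
      rewrite map_inj_in_uniq ?filter_uniq// => -[g1 d1] [g2 d2]; rewrite !mem_filter /= => /andP[/eqP <- _] /andP[/eqP <- _] e.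
      by congr pair; exact: (can_inj inv2K).
    have du d : d \in u -> Gamma0 c0 d.
      by case/seq.mapP => i; rewrite mem_filter => /andP[_ /ht/and3P[_ _ /asboolP h]] ->; exact: Gamma0_inv.
    have := coset_mass uw uu du; rewrite toCK; apply: le_trans.
    rewrite /u big_map big_filter big_seq_cond [leRHS]big_seq_cond; apply: ler_sum => i /andP[it _].
    have /and3P[_ _ /asboolP Gi] := ht i it; have di := SL2Z_inv (Gamma0_SL2 Gi).
    rewrite /goodw /fdi /fmass mobp_gt0// {1 3}/mobp ofCK ler_wpM2r ?sqr_ge0//.
    by case: high; rewrite ?mulr0 ?mulr1.
have U0 : (0 <= bracket s de K Z)%R.
  have S2 : (0 <= N1%:R * S ^+ 2)%R by rewrite mulr_ge0// sqr_ge0.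
  rewrite /bracket; apply: addr_ge0; last by rewrite divr_ge0// mulr_ge0// mulr_ge0// addr_ge0// mulr_ge0// sqr_ge0.
  by apply: mulr_ge0; [rewrite mulr_ge0|rewrite mulr_ge0 ?powR_ge0// divr_ge0].
have le2 : hyp (fun p => (E2 p)%:E) <= (30 * bracket s de K Z / Y)%:E.
  rewrite (_ : (fun p => _) = (fun p => 15%:E * (\sum_(g <- iota 1 Z) ((strip (g%:R ^+ 2 * Y) p)%:R * (if (0 < p.2)%R then mass p else 0)%R)%:E))); last first.
    by apply/funext => p; rewrite /E2 sumEFin -EFinM.
  rewrite hyp_scale//; last 2 first.
  - by apply: emeasurable_sum => g; apply/measurable_EFinP; exact: mterm.
  - by move=> p; apply: sume_ge0 => g _; rewrite lee_fin mulr_ge0.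
  rewrite hyp_sum; last 2 first.
  - by move=> g; apply/measurable_EFinP; exact: mterm.
  - by move=> g p; rewrite lee_fin mulr_ge0.
  apply: (@le_trans _ _ (15%:E * (\sum_(g <- iota 1 Z) (bracket s de K Z / (g%:R ^+ 2 * Y))%:E))).
    apply: lee_wpmul2l; first by rewrite lee_fin.
    rewrite big_seq [leRHS]big_seq; apply: lee_sum => g; rewrite mem_iota => /andP[g1 _].
    have gR : (1 <= g%:R :> R)%R by rewrite ler1n.
    have hu : (Z%:R^-1 <= g%:R ^+ 2 * Y)%R by rewrite -[leLHS]mul1r ler_wpM2r ?invr_ge0// expr_ge1.
    apply: le_trans (upper N0 C0 gf dchi neb condM eig hK K1 Z0 hu).
    by apply: eq_ler; apply: eq_hyp => p p0; rewrite p0.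
  rewrite sumEFin -EFinM lee_fin.
  rewrite (eq_bigr (fun g => bracket s de K Z / Y * (g%:R ^+ 2)^-1)%R) => [|g _]; last first.
    by rewrite invfM mulrA mulrAC.
  rewrite -mulr_sumr; have := sum_inv_sqr R Z; set T := (\sum_(_ <- _) _)%R => hT.
  have P0 : (0 <= bracket s de K Z / Y)%R by rewrite divr_ge0// ltW.
  rewrite -[(30 * _ / _)%R]mulrA; have := ler_wpM2l P0 hT; move: (_ / _)%R => P; lra.
have := le_trans le1 le2; rewrite (_ : (fun p => _) = (fun p => X%:E * (goodw T0 p)%:E))//.
rewrite hyp_scale ?(ltW X0)//; last 2 first.
- by apply/measurable_EFinP; exact: measurable_goodw.
- by move=> p; rewrite lee_fin goodw_ge0.
rewrite -lee_pdivlMl// -EFinM => h; apply: (le_trans h); rewrite lee_fin le_eqVlt; apply/orP; left; apply/eqP.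
by rewrite /X; field; rewrite !gt_eqF.
Qed.
End Good.

Section Positive.
Variables (R : realType) (C : R) (k N : nat) (f : R[i] -> R[i]) (chi : int -> R[i]).
Hypothesis N0 : (0 < N)%N.
Hypothesis gf : good_form C k N f.
Hypothesis dchi : dirichlet_char N chi.
Hypothesis neb : nebentypus N k chi f.
Local Notation A := (@fund_dom R (Gamma0 N)).
Local Open Scope ereal_scope.

Let mf := measurable_fmass gf.

(* Weighting by +oo turns "the integral over the fundamental domain vanishes"
   into "the integral over the upper half-plane vanishes". *)
Lemma hyp_fmass_le : hyp (fun p => (fmass k f p)%:E) <= +oo * hyp (fun p => (fdi N p * fmass k f p)%:E).
Proof.
have mg : mfunT (fun p : plane R => fdi N p * fmass k f p : R)%R.
  by apply: measurable_funM => //; exact: measurable_fdi.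
have g0 p : (0 <= fdi N p * fmass k f p)%R by rewrite mulr_ge0 ?fdi_ge0 ?fmass_ge0.
have -> : +oo * hyp (fun p => (fdi N p * fmass k f p)%:E) = hyp (fun p => +oo * (fdi N p * fmass k f p)%:E) :> \bar R.
  rewrite /hyp -ge0_integralZl//.
  - by apply: eq_integral => p _; rewrite muleA.
  - by apply: measurable_hyp_integrand; exact/measurable_EFinP.
  - by move=> p _; rewrite mule_ge0// lee_fin ?hyp_weight_ge0.
apply: (@mass_transport _ 'M[int]_2 (fun g => `[< Gamma0 N g >]) id (fun _ p => (fdi N p)%:E) (fun p => (fmass k f p)%:E)).
- by move=> g /asboolP /Gamma0_SL2.
- by move=> _; apply/measurable_EFinP; exact: measurable_fdi.
- by move=> _ p; rewrite lee_fin fdi_ge0.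
- exact/measurable_EFinP.
- by move=> p; rewrite lee_fin fmass_ge0.
- exact/measurable_EFinP.
- by apply: emeasurable_funM; [exact: measurable_cst|exact/measurable_EFinP].
- by move=> p; rewrite lee_fin fmass_ge0.
- by move=> p; rewrite mule_ge0// lee_fin.
- move=> z z0; have [g Gg Ag] := fund_rep N (z0 : uhp (toC z)).
  exists [:: g]; split=> //=; first by rewrite andbT; exact/asboolP.
  by rewrite big_seq1 /fdi /mobp ofCK; case: asboolP => // _; rewrite mule1.
- move=> w w0 s us /allP hs; have [h0|hn] := eqVneq (fdi N w * fmass k f w)%R 0%R; last first.
    by rewrite gt0_mulye ?leey// lte_fin lt_def hn g0.
  rewrite h0 mule0 big_seq big1// => g /hs /asboolP Gg.
  have Gi := Gamma0_inv Gg; have di := Gamma0_SL2 Gi.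
  rewrite /fmass mobp_gt0// /mobp ofCK (height_Gamma0 N0 dchi neb Gi)//.
  by move: h0; rewrite /fmass w0 -EFinM => ->.
Qed.

Lemma fmass_box z : uhp z -> f z != 0%R -> exists e a b c d : R,
  [/\ (0 < e)%R, (a < b)%R, (0 < c)%R, (c < d)%R & forall p, (e * (rect a b c d p)%:R <= fmass k f p)%R].
Proof.
case: z => x y y0 fz; rewrite /uhp /= in y0.
have n0 : (0 < normc (f (x +i* y)))%R.
  by rewrite lt_def normc_ge0 andbT; apply: contra fz => /eqP /Normc.eq0_normc ->.
have cf : ccat f (x +i* y) by case: gf => + _ _ _; apply.
have [d d0 hd] := ccat_near cf (divr_gt0 n0 (ltr0Sn R 1)).
pose r : R := (Num.min (d / 2) (y / 2))%R.
have r0 : (0 < r)%R by rewrite lt_min !divr_gt0.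
have rd : (r < d)%R by apply: le_lt_trans (_ : d / 2 < d)%R; [rewrite ge_min lexx|lra].
have ry : (r <= y / 2)%R by rewrite ge_min lexx orbT.
exists ((y - r) ^+ k * (normc (f (x +i* y)) / 2) ^+ 2)%R, (x - r)%R, (x + r)%R, (y - r)%R, (y + r)%R.
have yr : (0 < y - r)%R by lra.
split; [|lra|by []|lra|].
  by rewrite mulr_gt0// exprn_gt0// divr_gt0.
move=> [u v]; rewrite /rect /fmass /=.
case: (boolP ((x - r <= u <= x + r) && (y - r <= v <= y + r)))%R => [/andP[/andP[u1 u2] /andP[v1 v2]]|_]; last first.
  by rewrite mulr0; case: ifP => // _; exact: sqr_ge0.
have v0 : (0 < v)%R by lra.
rewrite mulr1 v0 /toC /= height_sqr//; apply: ler_pM.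
- by rewrite exprn_ge0// ltW.
- exact: sqr_ge0.
- by apply: lerXn2r => //; rewrite nnegrE ltW.
apply: lerXn2r; rewrite ?nnegrE ?normc_ge0 ?divr_ge0 ?normc_ge0//.
have h1 : (normc (f (u +i* v) - f (x +i* y)) <= normc (f (x +i* y)) / 2)%R.
  by apply: hd; apply: le_lt_trans rd; rewrite ler_norml /=; apply/andP; split; lra.
have := normcD (f (u +i* v)) (- (f (u +i* v) - f (x +i* y)))%R.
rewrite (_ : (f (u +i* v) + - (f (u +i* v) - f (x +i* y)))%R = f (x +i* y)); last by ring.
by rewrite normcN; lra.
Qed.

(** If the integral over the domain vanished, so would the one over the half-plane, yet f is bounded
    away from 0 on a small rectangle. Positivity is needed because division by a zero norm would
    give 0. *)
Lemma hyp_fdi_fmass_gt0 z : uhp z -> f z != 0%R -> 0 < hyp (fun p => (fdi N p * fmass k f p)%:E).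
Proof.
move=> uz fz; have [e [a [b [c [d [e0 ab c0 cd he]]]]]] := fmass_box uz fz.
rewrite lt0e; apply/andP; split; last first.
  by apply: integral_ge0 => p _; rewrite mule_ge0// lee_fin ?hyp_weight_ge0// mulr_ge0 ?fdi_ge0 ?fmass_ge0.
apply/eqP => h0; have := hyp_fmass_le; rewrite h0 mule0; apply/negP; rewrite -ltNge.
apply: (@lt_le_trans _ _ (hyp (fun p => e%:E * ((rect a b c d p)%:R)%:E))); last first.
  apply: hyp_le.
  - by apply: emeasurable_funM => //; apply/measurable_EFinP; exact: measurable_rect.
  - exact/measurable_EFinP.
  - by move=> p; rewrite mule_ge0// lee_fin ltW.
  - by move=> p; rewrite lee_fin fmass_ge0.
  - by move=> p _; rewrite -EFinM lee_fin.
rewrite hyp_scale ?(ltW e0)//; last first.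
  by apply/measurable_EFinP; exact: measurable_rect.
apply: mule_gt0; first by rewrite lte_fin.
apply: lt_le_trans (hyp_rect (ltW ab) c0 (ltW cd)); rewrite lte_fin.
by rewrite divr_gt0 ?mulr_gt0 ?exprn_gt0 ?subr_gt0// (lt_trans c0).
Qed.
End Positive.

(** * Comparison of the norms *)

Section Quotient.
Variables (R : realType) (C : R) (k N M : nat) (f : R[i] -> R[i]) (chi : int -> R[i]).
Hypothesis N0 : (0 < N)%N.
Hypothesis C0 : 0 <= C.
Hypothesis gf : good_form C k N f.
Hypothesis dchi : dirichlet_char N chi.
Hypothesis neb : nebentypus N k chi f.
Hypothesis condM : is_conductor N chi M.
Variable a : nat -> R[i].
Hypothesis eig : forall n, (0 < n)%N -> coprime n N -> forall z, uhp z -> hecke k chi n f z = a n * f z.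
Local Notation A := (@fund_dom R (Gamma0 N)).
Local Notation S := (sup_norm k f).
Let c0 := half_level N.
Let N1 := (N %/ c0)%N.
Let q := excess N M.

Lemma quot_intE (h : R[i] -> R) (h' : R * R -> R) : (forall p, 0 < p.2 -> h (toC p) = h' p) ->
  quot_int (Gamma0 N) h = fine (hyp (fun p => (fdi N p * h' p)%:E)).
Proof.
move=> e; rewrite /quot_int /Rintegral /hyp; congr fine.
rewrite [LHS]integral_mkcond; apply: eq_integral => p _; rewrite patchE /fdi -/(toC p).
case: asboolP => Ap; last first.
  by rewrite ifF ?mul0r ?mul0e//; apply/negP; rewrite inE.
have p0 : 0 < p.2 by case: Ap.
rewrite ifT; last by rewrite inE.
by rewrite mul1r -EFinM -e// /hyp_weight /invpos p0 exprVn.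
Qed.

Let V := hyp (fun p : R * R => (fdi N p)%:E).
Let W := hyp (fun p : R * R => (fdi N p * fmass k f p)%:E).

Lemma quot_volE : quot_vol (Gamma0 N) = fine V.
Proof.
rewrite /quot_vol (quot_intE (h' := fun=> 1))//; congr fine; apply: eq_hyp => p _.
by rewrite mulr1.
Qed.

Lemma quot_heightE : quot_int (Gamma0 N) (fun z => height k f z ^+ 2) = fine W.
Proof. by apply: quot_intE => p p0; rewrite /fmass p0. Qed.

(** In the neighbourhoods of the cusps F is bounded by its supremum and the volume is small;
    [good_le] covers the rest. *)
Lemma hyp_split s de K Z (T0 : R) : moment_ineq s de K -> 1 <= K -> (0 < Z)%N -> 1 <= T0 ->
  320 * N%:R ^+ 6 * T0 ^+ 2 <= Z%:R -> 4 * c0%:R ^+ 2 * T0 <= Z%:R ->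
  (W <= (960 * (N%:R * c0%:R / (totient N)%:R) * bracket C k N M f s de K Z + S ^+ 2 * ((15 * N ^ 4)%:R / T0))%:E)%E.
Proof.
move=> hK K1 Z0 T1 h1 h2.
have T00 : 0 < T0 by exact: lt_le_trans T1.
have mf := @measurable_fdi R N; have mm := measurable_fmass gf; have mh := @measurable_high R T0.
have mfh : mfunT (fun p : plane R => fdi N p * (high T0 p)%:R : R).
  exact: measurable_funM.
have fh0 p : 0 <= fdi N p * (high T0 p)%:R :> R by rewrite mulr_ge0 ?fdi_ge0.
rewrite EFinD; apply: (@le_trans _ _ (hyp (fun p => (goodw k N f T0 p)%:E) + hyp (fun p => (S ^+ 2)%:E * (fdi N p * (high T0 p)%:R)%:E))%E); last first.
  apply: leeD; first exact: (good_le N0 C0 gf dchi neb condM eig hK K1).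
  rewrite hyp_scale ?sqr_ge0//; last exact/measurable_EFinP.
  by rewrite [leRHS]EFinM; apply: lee_wpmul2l; [rewrite lee_fin sqr_ge0|exact: fund_high].
have m1 : mfunT (fun p : R * R => (goodw k N f T0 p)%:E * (hyp_weight p.2)%:E)%E.
  by apply: measurable_hyp_integrand; apply/measurable_EFinP; exact: (measurable_goodw gf).
have m2 : mfunT (fun p : R * R => (S ^+ 2)%:E * (fdi N p * (high T0 p)%:R)%:E * (hyp_weight p.2)%:E)%E.
  by apply: measurable_hyp_integrand; apply: emeasurable_funM => //; exact/measurable_EFinP.
have p1 (p : R * R) : (0 <= (goodw k N f T0 p)%:E * (hyp_weight p.2)%:E)%E.
  by rewrite -EFinM lee_fin mulr_ge0 ?hyp_weight_ge0 ?goodw_ge0.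
have p2 (p : R * R) : (0 <= (S ^+ 2)%:E * (fdi N p * (high T0 p)%:R)%:E * (hyp_weight p.2)%:E)%E.
  by rewrite -!EFinM lee_fin mulr_ge0 ?hyp_weight_ge0// mulr_ge0// sqr_ge0.
rewrite /hyp -ge0_integralD//.
apply: ge0_le_integral => //.
- by move=> p _; rewrite mule_ge0 ?lee_fin ?hyp_weight_ge0// mulr_ge0 ?fdi_ge0 ?fmass_ge0.
- by apply: measurable_hyp_integrand; apply/measurable_EFinP; exact: measurable_funM.
- exact: emeasurable_funD.
- move=> p _; rewrite -!EFinM -EFinD lee_fin -mulrDl ler_wpM2r ?hyp_weight_ge0//.
  rewrite /goodw; case: high; rewrite /= ?mulr0 ?mul0r ?add0r ?mulr1 ?addr0//.
  rewrite mulrC ler_wpM2r ?fdi_ge0// /fmass; case: ifP => [p0|_]; last exact: sqr_ge0.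
  apply: lerXn2r; rewrite ?nnegrE ?(sup_norm_ge0 N0 C0 gf)//.
    by rewrite mulr_ge0 ?powR_ge0 ?normc_ge0.
  exact: (height_sup N0 C0 gf).
Qed.

Lemma quot_height_le s de K Z (T0 : R) : moment_ineq s de K -> 1 <= K -> (0 < Z)%N -> 1 <= T0 ->
  320 * N%:R ^+ 6 * T0 ^+ 2 <= Z%:R -> 4 * c0%:R ^+ 2 * T0 <= Z%:R ->
  (exists2 z, uhp z & f z != 0) ->
  [/\ 0 < fine W & fine W <= 960 * (N%:R * c0%:R / (totient N)%:R) * bracket C k N M f s de K Z + S ^+ 2 * ((15 * N ^ 4)%:R / T0)].
Proof.
move=> hK K1 Z0 T1 h1 h2 [z uz fz]; have := hyp_split hK K1 Z0 T1 h1 h2.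
have := hyp_fdi_fmass_gt0 N0 gf dchi neb uz fz; rewrite -/W.
by case: W => [w| |]//=; rewrite lte_fin lee_fin.
Qed.

Lemma quot_vol_ge : (4 * (size (box (Num.truncn ((1 + 2) / 1 * (1 + 1) + 1 + 2 + 1 : R)).+1)).+1%:R)^-1 * N%:R <= fine V.
Proof.
have := hyp_fdi_fin R N0; have := volume_ge R N0; rewrite -/V.
by case: V => [v| |]//=; rewrite lee_fin.
Qed.
End Quotient.

Section Final.
Variable R : realType.
Implicit Types (eps C : R) (k N M : nat) (chi : int -> R[i]) (f : R[i] -> R[i]).

Lemma inv_pow2_le (e : R) : 0 < e -> exists s, (2 ^ s)%:R^-1 <= e.
Proof.
move=> e0; exists (Num.truncn e^-1).+1; rewrite -[leRHS]invrK lef_pV2 ?posrE ?invr_gt0 ?ltr0n ?expn_gt0//.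
apply: (le_trans (ltW (truncnS_gt _))); rewrite ler_nat ltnW//; exact: ltn_expl.
Qed.

Lemma powR_ge1 (x e : R) : 1 <= x -> 0 <= e -> 1 <= x `^ e.
Proof. by move=> x1 e0; rewrite -[leLHS](powRr0 x) ler_powR. Qed.

(** The bookkeeping with E = N^eta. Since c N1 = N, the factor N c / phi(N) meets N1 / q as N^2 /
    (phi(N) q), which leaves N E / q and the power E^65. *)
Lemma collect_bounds (w q n t c n1 S sm X C C1 C2 K D E : R) :
  0 < q -> q <= n -> 0 < n -> 0 < t -> 0 < c -> c * n1 = n -> 1 <= E -> 0 <= sm -> 0 <= X ->
  sm <= C1 * (D * E ^+ 32) -> X <= K * D * E ^+ 32 -> n <= t * (C2 * E) ->
  w <= 960 * (n * c / t) * (2 * sm * (X * (n1 * S ^+ 2 / q)) + 2 * (8 + 4 * C ^+ 2) * (n1 * S ^+ 2) / n) + S ^+ 2 * 15 ->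
  w * q <= S ^+ 2 * n * (960 * C2 * (2 * C1 * D * (K * D) + 2 * (8 + 4 * C ^+ 2)) + 15) * E ^+ 65.
Proof.
move=> qR qN n0 tR cR f4 E1 sm0 X0 f1 f2 f3 wle; have C20 : 0 <= C ^+ 2 := sqr_ge0 C.
have nn := ltW n0; have qq := ltW qR; have tt := ltW tR.
have E32 m : 1 <= E ^+ m by exact: exprn_ege1.
set B := 960 * C2 * _ + 15.
apply: le_trans (ler_wpM2r (ltW qR) wle) _.
have -> : (960 * (n * c / t) * (2 * sm * (X * (n1 * S ^+ 2 / q)) + 2 * (8 + 4 * C ^+ 2) * (n1 * S ^+ 2) / n) + S ^+ 2 * 15) * q
   = S ^+ 2 * (960 * (n * (c * n1) / t) * (2 * (sm * X) + 2 * (8 + 4 * C ^+ 2) * (q / n)) + 15 * q).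
  by field; rewrite !gt_eqF.
rewrite f4; have -> : S ^+ 2 * n * B * E ^+ 65 = S ^+ 2 * (n * B * (E * E ^+ 64)) by rewrite exprS; ring.
apply: ler_wpM2l; first exact: sqr_ge0.
have g1 : n * n / t <= n * (C2 * E).
  by rewrite -mulrA ler_wpM2l// ler_pdivrMr// [_ * t]mulrC.
have g2 : sm * X <= C1 * (D * E ^+ 32) * (K * D * E ^+ 32) by exact: ler_pM.
have e64 : E ^+ 64 = E ^+ 32 * E ^+ 32 by rewrite -exprD.
have g3 : q / n <= E ^+ 64.
  by apply: le_trans (E32 64%N); rewrite ler_pdivrMr// mul1r.
have g0 : 0 <= q / n :> R by exact: divr_ge0.
have g7 : 0 <= n * n / t :> R by apply: divr_ge0 => //; apply: mulr_ge0.
have g5 : q <= n * (E * E ^+ 64) by rewrite -exprS; apply: le_trans qN _; exact: ler_peMr (ltW n0) (E32 65%N).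
rewrite e64 in g3 g5 *; move: g2 g3 g5; move: (E ^+ 32) => e g2 g3 g5.
have g4 : 2 * (sm * X) + 2 * (8 + 4 * C ^+ 2) * (q / n) <= (2 * C1 * D * (K * D) + 2 * (8 + 4 * C ^+ 2)) * (e * e).
  have c8 : 0 <= 2 * (8 + 4 * C ^+ 2) by lra.
  have := ler_wpM2l c8 g3; move: (_ / n) g2 => r g2; lra.
have g6 : 0 <= 2 * (sm * X) + 2 * (8 + 4 * C ^+ 2) * (q / n).
  have c8 : 0 <= 2 * (8 + 4 * C ^+ 2) by lra.
  have := mulr_ge0 c8 g0; have := mulr_ge0 sm0 X0; lra.
have := ler_pM g7 g6 g1 g4; rewrite /B; move: (_ / t) (_ / n) => r1 r2.
move: g5; lra.
Qed.

Lemma sup_ratio eps C : 0 < eps -> 0 <= C -> exists2 c : R, 0 < c &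
  forall k N M chi f, (0 < N)%N -> good_form C k N f -> dirichlet_char N chi -> nebentypus N k chi f ->
    hecke_eigenform N k chi f -> (exists2 z, uhp z & f z != 0) -> is_conductor N chi M ->
    c * N%:R `^ (- eps) * (excess N M)%:R `^ (1 / 2) <= sup_norm k f / l2_norm N k f.
Proof.
(* The losses are 32 powers of N^eta in the number of smooth frequencies, 32 in the moment bound and
   1 in N / phi(N). The estimate is for squares, which accounts for 2 eps. *)
move=> eps0 C0; pose eta := 2 * eps / 65.
have eta0 : 0 < eta by rewrite /eta divr_gt0// mulr_gt0.
have [s hs] := inv_pow2_le eta0.
have [K K1 hK] := moment_bound s eta0.
have [C1 C11 hC1] := smooth_count eta0.
have [C2 C21 hC2] := divisors_le eta0.
have [D DE] : exists D : R, D = (320 `^ eta) ^+ 2 by eexists.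
have D1 : 1 <= D by rewrite DE; apply: exprn_ege1; apply: powR_ge1; [rewrite ler1n|exact: ltW].
have [B BE] : exists B : R, B = 960 * C2 * (2 * C1 * D * (K * D) + 2 * (8 + 4 * C ^+ 2)) + 15 by eexists.
pose kap : R := (4 * (size (box (Num.truncn ((1 + 2) / 1 * (1 + 1) + 1 + 2 + 1 : R)).+1)).+1%:R)^-1.
have kap0 : 0 < kap by rewrite invr_gt0 mulr_gt0.
have C20 : 0 <= C ^+ 2 := sqr_ge0 C.
have K0 : 0 <= K by lra.
have D0 : 0 <= D by lra.
have C10 : 0 <= C1 by lra.
have C20' : 0 <= C2 by lra.
have B0 : 0 < B.
  have b1 : 0 <= 2 * C1 * D * (K * D) by rewrite !mulr_ge0.
  have b2 : 0 <= 2 * (8 + 4 * C ^+ 2) by lra.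
  have b3 : 0 <= 960 * C2 by lra.
  by have := mulr_ge0 b3 (addr_ge0 b1 b2); rewrite BE; lra.
exists (Num.sqrt (kap / B)); first by rewrite sqrtr_gt0 divr_gt0.
move=> k N M chi f N0 gf dchi neb hec fz condM.
have [a ha] : exists a : nat -> R[i], forall n, (0 < n)%N -> coprime n N -> forall z, uhp z -> hecke k chi n f z = a n * f z.
  have key n : exists b : R[i], (0 < n)%N -> coprime n N -> forall z, uhp z -> hecke k chi n f z = b * f z.
    have [n0|] := posnP n; first by exists 0; rewrite n0.
    move=> n0; have [nN|/negP h] := boolP (coprime n N); last by exists 0.
    by have [b hb] := hec n n0 nN; exists b.
  by have [a ha] := choice key; exists a.
have NR : 1 <= N%:R :> R by rewrite ler1n.
have NR0 : 0 < N%:R :> R by lra.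
(* N^4 makes the cuspidal volume 15 N^4 / T0 a constant; Z is then 320 N^6 T0^2, as [good_le]
   requires. *)
pose T0 : R := N%:R ^+ 4; have T01 : 1 <= T0 by rewrite expr_ge1// ltW.
pose Z := (320 * N ^ 14)%N.
have Z0 : (0 < Z)%N by rewrite muln_gt0 expn_gt0 N0.
have ZE : Z%:R = 320 * N%:R ^+ 14 :> R by rewrite natrM natrX.
pose c0 := half_level N; have c0N : (c0%:R <= N%:R :> R).
  by rewrite ler_nat dvdn_leq//; exact: half_level_dvd.
have h1 : 320 * N%:R ^+ 6 * T0 ^+ 2 <= Z%:R.
  by rewrite ZE /T0 -exprM -mulrA -exprD.
have h2 : 4 * c0%:R ^+ 2 * T0 <= Z%:R.
  have e1 : c0%:R ^+ 2 <= N%:R ^+ 2 :> R by apply: lerXn2r; rewrite ?nnegrE// ltW.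
  have e2 : N%:R ^+ 2 * T0 <= N%:R ^+ 14 by rewrite /T0 -exprD -!natrX ler_nat leq_pexp2l.
  have e3 : c0%:R ^+ 2 * T0 <= N%:R ^+ 2 * T0 by rewrite ler_wpM2r//; lra.
  have e4 : 0 <= c0%:R ^+ 2 * T0 by rewrite mulr_ge0 ?sqr_ge0//; lra.
  by rewrite ZE -mulrA; move: e2 e3 e4; move: (_ * T0) (_ * T0) (_ ^+ 14) => u v w; lra.
have [w0 wle] := quot_height_le N0 C0 gf dchi neb condM ha hK K1 Z0 T01 h1 h2 fz.
have vge := quot_vol_ge R N0; rewrite -/kap in vge.
rewrite /l2_norm quot_volE quot_heightE.
move: w0 wle vge; set w := fine (hyp (fun p => (fdi N p * _)%:E)); set v := fine _; set q := excess N M; set S := sup_norm k f.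
move=> w0 wle vge.
have v0 : 0 < v by apply: lt_le_trans vge; rewrite mulr_gt0.
have S0 : 0 <= S := sup_norm_ge0 N0 C0 gf.
have [MN _ _] := condM.
have q0 : (0 < q)%N by exact: (excess_gt0 N0 MN).
clearbody w v kap.
have qN : q%:R <= N%:R :> R.
  rewrite ler_nat dvdn_leq//; apply: dvdn_trans (excess_dvd N0 MN) _; apply: dvdn_div; exact: half_level_dvd.
have qR : 0 < q%:R :> R by rewrite ltr0n.
have [E EE0] : exists E : R, E = N%:R `^ eta by eexists.
have E1 : 1 <= E by rewrite EE0; apply: powR_ge1 => //; exact: ltW.
have E0 := le_trans ler01 E1.
pose J := (N ^ 3 * Z ^ 2)%N.
have J0 : (0 < J)%N by rewrite muln_gt0 !expn_gt0 N0 Z0.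
have JE : J = (320 ^ 2 * N ^ 31)%N by rewrite /J /Z expnMn -expnM mulnCA -expnD.
have JeE : J%:R `^ eta = D * E ^+ 31 by rewrite JE natrM (powRM _ (ler0n _ _) (ler0n _ _)) !powR_natX DE EE0.
have NJe : (N * J)%:R `^ eta = D * E ^+ 32 by rewrite natrM powRM// JeE -EE0 mulrCA -exprS.
have E32 n : 1 <= E ^+ n by exact: exprn_ege1.
have f1 := hC1 N J N0 J0; rewrite NJe in f1.
have f2 : (K * J%:R `^ eta * q%:R) `^ ((2 ^ s)%:R^-1) <= K * D * E ^+ 32.
  have t0 : 0 <= (2 ^ s)%:R^-1 :> R by rewrite invr_ge0.
  have t1 : (2 ^ s)%:R^-1 <= 1 :> R by rewrite invf_le1 ?ltr0n ?expn_gt0// ler1n expn_gt0.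
  have KJ1 : 1 <= K * J%:R `^ eta.
    by apply: mulr_ege1 => //; apply: powR_ge1; [rewrite ler1n|exact: ltW].
  have KJ0 := le_trans ler01 KJ1.
  rewrite powRM// exprS mulrCA mulrC; apply: ler_pM; rewrite ?powR_ge0//.
    apply: (@le_trans _ _ (N%:R `^ (2 ^ s)%:R^-1)); first by rewrite ge0_ler_powR ?nnegrE.
    by rewrite EE0 ler_powR.
  by rewrite -mulrA -JeE -[leRHS]powRr1// ler_powR.
have f3 : N%:R <= (totient N)%:R * (C2 * E) :> R.
  apply: (@le_trans _ _ ((totient N)%:R * (size (divisors N))%:R)).
    by rewrite -natrM ler_nat totient_divisors.
  by rewrite ler_wpM2l// EE0 hC2.
have f4 : c0%:R * (N %/ c0)%:R = N%:R :> R by rewrite -natrM mulnC divnK// half_level_dvd.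
have tR : 0 < (totient N)%:R :> R by rewrite ltr0n totient_gt0.
have cR : 0 < c0%:R :> R by rewrite ltr0n half_level_gt0.
have main : w * q%:R <= S ^+ 2 * N%:R * B * E ^+ 65.
  move: wle; rewrite /bracket -/c0 -/q -/S -/J /smooths.
  have -> : (15 * N ^ 4)%:R / T0 = 15 by rewrite natrM natrX mulfK// gt_eqF// (lt_le_trans _ T01).
  move: f1 f2; set sm := (size _)%:R; set X := (_ `^ (_^-1)) => f1 f2 wle.
  have sm0 : 0 <= sm by [].
  have X0 : 0 <= X by exact: powR_ge0.
  by rewrite BE; exact: (collect_bounds qR qN NR0 tR cR f4 E1 sm0 X0 f1 f2 f3 wle).
have EE : E ^+ 65 = (N%:R `^ eps) ^+ 2.
  rewrite EE0 -(powR_mulrn 65 (powR_ge0 _ _)) -(powR_mulrn 2 (powR_ge0 _ _)) -!powRrM; congr (_ `^ _).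
  by rewrite /eta; field.
rewrite ler_pdivlMr; last by rewrite sqrtr_gt0 mulr_gt0// invr_gt0.
rewrite -(@ler_pXn2r _ 2)// ?nnegrE ?mulr_ge0 ?powR_ge0 ?sqrtr_ge0//.
rewrite !exprMn !sqr_sqrtr; last 2 first.
- by rewrite mulr_ge0// ?invr_ge0 ltW.
- exact: divr_ge0 (ltW kap0) (ltW B0).
rewrite powRN div1r powR12_sqrt ?(ltW qR)// sqr_sqrtr ?(ltW qR)// exprVn -EE.
have E65 : 0 < E ^+ 65 := lt_le_trans ltr01 (E32 65%N).
move: E65 main {EE}; move: (E ^+ 65) => e e0 main.
have -> : kap / B * e^-1 * q%:R * (v^-1 * w) = kap * (w * q%:R) / (B * e * v).
  by field; rewrite !gt_eqF.
rewrite ler_pdivrMr; last by rewrite !mulr_gt0.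
apply: le_trans (ler_wpM2l (ltW kap0) main) _.
have P0 : 0 <= S ^+ 2 * (B * e) by rewrite mulr_ge0 ?sqr_ge0// mulr_ge0// ltW.
have := ler_wpM2l P0 vge; rewrite -!mulrA; apply: le_trans.
by apply: eq_ler; ring.
Qed.
End Final.

(** The space of cusp forms is left abstract: the holomorphic and the Maass case differ only in the
    proof of [good_form] and in the value of C. *)
Lemma newform_ratio (R : realType) (eps C : R) : 0 < eps -> 0 <= C -> exists2 c : R, 0 < c &
  forall (cusp : nat -> (R[i] -> R[i]) -> Prop) (k N M : nat) (chi : int -> R[i]) (f : R[i] -> R[i]),
    (0 < N)%N -> (cusp N f -> good_form C k N f) -> newform cusp N k chi f -> is_conductor N chi M ->
    c * N%:R `^ (- eps) * local_product R N M <= sup_norm k f / l2_norm N k f /\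
    ((exists r : nat, M = (r ^ 2)%N) -> (N ^ 2 %| M ^ 3)%N ->
     c * N%:R `^ (- eps) * (M%:R `^ (3 / 4) / N%:R `^ (1 / 2)) <= sup_norm k f / l2_norm N k f).
Proof.
move=> eps0 C0; have [c c0 H] := sup_ratio eps0 C0; exists c => // cusp k N M chi f N0 good.
move=> [cf nz [dchi neb] _ hec] condM; have [MN _ _] := condM.
have P : 0 <= c * N%:R `^ (- eps) by rewrite mulr_ge0 ?powR_ge0// ltW.
have h := H k N M chi f N0 (good cf) dchi neb hec nz condM.
split=> [|[r Mr] NM]; apply: le_trans h; apply: ler_wpM2l => //.
  exact: local_product_le.
exact: square_conductor_le Mr NM.
Qed.

Theorem theoremA (R : realType) :
  (forall (k : nat) (eps : R), (1 <= k)%N -> 0 < eps ->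
     exists2 c : R, 0 < c &
       forall (N M : nat) (chi : int -> R[i]) (f : R[i] -> R[i]),
         (1 <= N)%N -> hol_newform k N chi f -> is_conductor N chi M ->
         c * N%:R `^ (- eps) * local_product R N M
           <= sup_norm k f / l2_norm N k f /\
         ((exists r : nat, M = (r ^ 2)%N) -> (N ^ 2 %| M ^ 3)%N ->
          c * N%:R `^ (- eps) * (M%:R `^ (3 / 4) / N%:R `^ (1 / 2))
            <= sup_norm k f / l2_norm N k f)) /\
  (forall (lambda eps : R), 0 < eps ->
     exists2 c : R, 0 < c &
       forall (k N M : nat) (chi : int -> R[i]) (f : R[i] -> R[i]),
         (k = 0%N \/ k = 1%N) -> (1 <= N)%N ->
         maass_newform lambda k N chi f -> is_conductor N chi M ->
         c * N%:R `^ (- eps) * local_product R N M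
           <= sup_norm k f / l2_norm N k f /\
         ((exists r : nat, M = (r ^ 2)%N) -> (N ^ 2 %| M ^ 3)%N ->
          c * N%:R `^ (- eps) * (M%:R `^ (3 / 4) / N%:R `^ (1 / 2))
            <= sup_norm k f / l2_norm N k f)).
Proof.
split=> [k eps _ eps0|lambda eps eps0].
  have [c c0 H] := newform_ratio eps0 (ler0n R k).
  by exists c => // N M chi f N0; apply: H => //; exact: hol_good.
have C0 : 0 <= 6 + 2 * `|lambda| by rewrite addr_ge0// mulr_ge0.
have [c c0 H] := newform_ratio eps0 C0.
by exists c => // k N M chi f k01 N0; apply: H => //; exact: maass_good.
Qed.
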